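(* Let $X=(X_t)_{t\ge0}$ be a real-valued stable Lévy process with index $\alpha\in(1,2]$, that is, a Lévy process, not identically zero, such that for every $c>0$ the processes $(X_{ct})_{t\ge0}$ and $(c^{1/\alpha}X_t)_{t\ge0}$ have the same law. Let $\rho=P(X_1\ge0)$. For each $x>0$, the family of random variables $\{T_x^h\}_{h>0}$, where $T_x^h$ has law $P(T_x^h\in\cdot)=P(T_{[x,+\infty[}\in\cdot\mid K_x\le h)$, converges in law as $h\to0+$. The limit, denoted by $T_x^0$, has law given by $$P\left(T_x^0\le t\right)=\frac{\sin(\pi\rho)}{k\,\pi\rho}\,x^{-\alpha\rho}\,E\left[\frac{T_{[x,+\infty[}\,1_{\{T_{[x,+\infty[}\le t\}}}{\left(t-T_{[x,+\infty[}\right)^{1-\rho}}\right],\qquad t>0.$$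
   Context: $X$ has càdlàg paths and $X_0=0$. For $t\ge0$, $S_t=\sup_{0\le s\le t}X_s$. For $x>0$, $T_{[x,+\infty[}=\inf\{s>0:X_s\ge x\}$ and $K_x=X_{T_{[x,+\infty[}}-x$ (the overshoot). It is known that $\rho\in[1-1/\alpha,1/\alpha]\subset(0,1)$, and $k>0$ denotes the constant (known to exist) such that $P(S_1\le x)\sim k\,x^{\alpha\rho}$ as $x\to0+$. *)

(* Defs.v *)
From HB Require Import structures.
From mathcomp Require Import all_boot all_order all_algebra.
From mathcomp Require Import all_classical all_reals all_analysis.

Set Implicit Arguments.
Unset Strict Implicit.
Unset Printing Implicit Defensive.

Import Order.TTheory GRing.Theory Num.Theory.
Import numFieldNormedType.Exports.

Local Open Scope classical_set_scope.
Local Open Scope ring_scope.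

(* A process is a map X : R -> Omega -> R, time first. Time is [0, +oo[; the
   values of X at negative times are never constrained nor used. *)

Definition cadlag (R : realType) (f : R -> R) : Prop :=
  (forall t, 0 <= t -> f s @[s --> t^'+] --> f t) /\
  (forall t, 0 < t -> cvg (f s @[s --> t^'-])).

(* Taking some of the B i equal to setT gives the product rule for every
   subfamily of the increments, i.e., their mutual independence. *)
Definition independent_increments (R : realType) (d : measure_display)
    (Omega : measurableType d) (P : probability Omega R)
    (X : R -> Omega -> R) : Prop :=
  forall (n : nat) (t : nat -> R), 0 <= t 0%N -> {homo t : i j / (i <= j)%N >-> i <= j} ->
  forall B : 'I_n -> set R, (forall i, measurable (B i)) ->
  P (\bigcap_(i in [set: 'I_n]) [set w | B i (X (t i.+1) w - X (t i) w)]) =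
  (\prod_(i < n) P [set w | B i (X (t i.+1) w - X (t i) w)%R])%E.

Definition stationary_increments (R : realType) (d : measure_display)
    (Omega : measurableType d) (P : probability Omega R)
    (X : R -> Omega -> R) : Prop :=
  forall s t, 0 <= s -> 0 <= t -> forall B : set R, measurable B ->
  P [set w | B (X (s + t) w - X s w)] = P [set w | B (X t w)].

Record levy_process (R : realType) (d : measure_display)
    (Omega : measurableType d) (P : probability Omega R)
    (X : R -> Omega -> R) : Prop := LevyProcess {
  levy_measurable : forall t, 0 <= t -> measurable_fun [set: Omega] (X t) ;
  levy_start : forall w, X 0 w = 0 ;
  levy_cadlag : forall w, cadlag (X ^~ w) ;
  levy_independent : independent_increments P X ;
  levy_stationary : stationary_increments P X }.

(* The law of a process is its image measure on the space of paths, equipped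
   with the sigma-algebra generated by the evaluations at the times t >= 0. *)
Definition path_cylinders (R : realType) : set (set (R -> R)) :=
  [set C | exists t B, [/\ 0 <= t, measurable B & C = [set f : R -> R | B (f t)]]].

Definition same_process_law (R : realType) (d : measure_display)
    (Omega : measurableType d) (P : probability Omega R)
    (Y Z : R -> Omega -> R) : Prop :=
  forall A : set (R -> R), <<s @path_cylinders R >> A ->
  P [set w | A (Y ^~ w)] = P [set w | A (Z ^~ w)].

Definition stable_levy_process (R : realType) (d : measure_display)
    (Omega : measurableType d) (P : probability Omega R) (alpha : R)
    (X : R -> Omega -> R) : Prop :=
  [/\ levy_process P X,
      ~ {ae P, forall w, forall t, 0 <= t -> X t w = 0} &
      forall c, 0 < c ->
        same_process_law P (fun t => X (c * t)) (fun t w => c `^ alpha^-1 * X t w)].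

Definition running_sup (R : realType) (Omega : Type) (X : R -> Omega -> R)
    (t : R) (w : Omega) : R :=
  sup [set X s w | s in `[0, t]%classic].

(* Debut of the closed set [x, +oo[: for a cadlag X it is measurable with respect
   to the P-completion, but in general not with respect to the raw sigma-algebra
   generated by X, so it is to be used over a complete probability space. *)
Definition first_passage (R : realType) (Omega : Type) (X : R -> Omega -> R)
    (x : R) (w : Omega) : \bar R :=
  ereal_inf [set s%:E | s in [set s | 0 < s /\ x <= X s w]].

(* +oo when the level x is never reached, so that the event "overshoot <= h"
   is contained in "first_passage < +oo". *)
Definition overshoot (R : realType) (Omega : Type) (X : R -> Omega -> R)
    (x : R) (w : Omega) : \bar R :=
  if first_passage X x w is s%:E then (X s w - x)%:E else +oo%E.

Definition cond_prob (R : realType) (d : measure_display)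
    (Omega : measurableType d) (P : probability Omega R) (A B : set Omega) : R :=
  fine (P (A `&` B)) / fine (P B).

(* Weak convergence; R is a measurableType through its Borel sigma-algebra. *)
Definition cvg_in_law (R : realType) (I : Type) (F : set_system I)
    (mu : I -> probability R R) (mu0 : probability R R) : Prop :=
  forall f : R -> R, continuous f -> bounded_fun f ->
  (\int[mu i]_y (f y)%:E)%E @[i --> F] --> (\int[mu0]_y (f y)%:E)%E.

(* Main.v *)
(* Write T and K for the passage time over x and the overshoot. The asymptotics of P(S_1 <= y)
   give E min(tau_y, v) ~ c y^(alpha rho) v^(1 - rho) when y^alpha is small compared to v, so the
   Markov property at T and scaling determine the limits of
   E[(h - K)_+^(alpha rho)] / h and E[(h - K)_+^(alpha rho) (u - T)_+^(1 - rho)] / h as h -> 0.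
   A fractional integration in u replaces (u - T)_+^(1 - rho) by (v - T)_+, and a monotone density
   argument in h turns both limits into that of E[(v - T)_+ | K <= h], which is a constant times
   E[T (v - T)_+^rho]. This function of v is convex and its slope is the distribution function of
   the limit law; the means of T on {T < u} show that no mass escapes to infinity.

   The limit law has no atom at t_0: by the Markov property at a time t < t_0, the second
   differences of v |-> E[T (v - T)_+^rho] at t_0 are bounded by averages, over the level x - X_t, of
   those of the same function for another level. The latter come from the countably many atoms of
   the rescaled limit law, and X_t has no atoms. Hence E[T (v - T)_+^rho] is differentiable, its
   derivative is rho E[T (v - T)^(rho - 1); T < v], and the constant involves
   Gamma(rho) Gamma(1 - rho), evaluated by comparing Beta integrals with the integrals of
   cos^(2n) t cos(2 x t). *)
Require Import Defs.
From HB Require Import structures.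
From mathcomp Require Import all_boot all_order all_algebra.
From mathcomp Require Import all_classical all_reals all_analysis.
From mathcomp Require Import measurable_realfun lra ring zify.

Set Implicit Arguments.
Unset Strict Implicit.
Unset Printing Implicit Defensive.

Import Order.TTheory GRing.Theory Num.Theory.
Import numFieldNormedType.Exports.

Local Open Scope classical_set_scope.
Local Open Scope ring_scope.

(** * Expectations of bounded measurable functions *)

Section bounded_measurable.
Context d (T : measurableType d) (R : realType) (P : probability T R).
Implicit Types f g : T -> R.

(** The passage time [tau] is the debut of the open half-line ]x, +oo[, because fine dyadic grids
    see a right-continuous path that enters it: passage functionals become limits of functionals of
    random walks, and measurability, scaling and the Markov property all come from finitely many
    independent increments. The debut of [x, +oo[ is identified with [tau] almost surely afterwards.
    What shapes the analysis is that [tau] has infinite mean, its tail being of order s^(-rho), and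
    that no formula for the joint law of T and K is at hand. The quantities under control are the
    means E (u - tau_y)_+: they are continuous in level and time, and they scale. Their increment
    from x to x + h is computed in two ways: scaling gives its derivative in terms of E[T; T < u],
    which is where the factor T of the final formula comes from, while a restart at T gives E
    min(tau_(h - K), u - T), which is why moments of order alpha rho of h - K appear. Letting u tend
    to infinity gives such a moment exactly, (x + h)^(alpha rho) - x^(alpha rho), and alpha rho <= 1
    follows from it as well. *)

Definition bmf f := measurable_fun setT f /\ exists C, forall w, `|f w| <= C.

Definition Ex f : R := \int[P]_w f w.

Lemma bmf_integrable f : bmf f -> P.-integrable setT (EFin \o f).
Proof.
move=> [mf [C fC]].
apply: (@le_integrable _ _ _ _ _ measurableT _ (EFin \o cst C)).
- exact/measurable_EFinP.
- move=> x _ /=; rewrite lee_fin (le_trans (fC x))//; exact: ler_norm.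
- exact: finite_measure_integrable_cst.
Qed.

Lemma bmf_cst c : bmf (fun=> c).
Proof. by split; [exact: measurable_cst | exists `|c|]. Qed.

Lemma bmfD f g : bmf f -> bmf g -> bmf (fun w => f w + g w).
Proof.
move=> [mf [C fC]] [mg [D gD]]; split; first exact: measurable_funD.
by exists (C + D) => w; rewrite (le_trans (ler_normD _ _))// lerD.
Qed.

Lemma bmfM f g : bmf f -> bmf g -> bmf (fun w => f w * g w).
Proof.
move=> [mf [C fC]] [mg [D gD]]; split; first exact: measurable_funM.
by exists (C * D) => w; rewrite normrM ler_pM.
Qed.

Lemma bmfN f : bmf f -> bmf (fun w => - f w).
Proof.
move=> [mf [C fC]]; split; first exact: measurableT_comp.
by exists C => w; rewrite normrN.
Qed.

Lemma bmfB f g : bmf f -> bmf g -> bmf (fun w => f w - g w).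
Proof. by move=> bf bg; apply: bmfD => //; apply: bmfN. Qed.

Lemma bmfZ c f : bmf f -> bmf (fun w => c * f w).
Proof. by move=> bf; apply: bmfM => //; exact: bmf_cst. Qed.

Lemma bmf_indic A : measurable A -> bmf (\1_A : T -> R).
Proof.
move=> mA; split; first exact: measurable_indic.
by exists 1 => w; rewrite indicE ger0_norm// lern1 leq_b1.
Qed.

Lemma ExE f : bmf f -> (Ex f)%:E = (\int[P]_w (f w)%:E)%E.
Proof.
by move=> bf; rewrite /Ex /Rintegral fineK//; apply: integrable_fin_num => //; exact: bmf_integrable.
Qed.

Lemma Ex_eq f g : f =1 g -> Ex f = Ex g.
Proof. by move=> fg; congr Ex; apply/funext. Qed.

Lemma Ex_cst c : Ex (fun=> c) = c.
Proof. by rewrite /Ex Rintegral_cst//= [X in fine X](_ : _ = 1%E) ?mulr1// probability_setT. Qed.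

Lemma ExD f g : bmf f -> bmf g -> Ex (fun w => f w + g w) = Ex f + Ex g.
Proof. by move=> bf bg; apply: RintegralD => //; exact: bmf_integrable. Qed.

Lemma ExB f g : bmf f -> bmf g -> Ex (fun w => f w - g w) = Ex f - Ex g.
Proof. by move=> bf bg; apply: RintegralB => //; exact: bmf_integrable. Qed.

Lemma ExZ c f : bmf f -> Ex (fun w => c * f w) = c * Ex f.
Proof. by move=> bf; apply: RintegralZl => //; exact: bmf_integrable. Qed.

Lemma le_Ex f g : bmf f -> bmf g -> (forall w, f w <= g w) -> Ex f <= Ex g.
Proof.
by move=> bf bg fg; apply: le_Rintegral => //; exact: bmf_integrable.
Qed.

Lemma Ex_ge0 f : (forall w, 0 <= f w) -> 0 <= Ex f.
Proof. by move=> f0; apply: Rintegral_ge0. Qed.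

Lemma Ex_indic A : measurable A -> Ex \1_A = fine (P A).
Proof. by move=> mA; rewrite /Ex /Rintegral integral_indic// setIT. Qed.

Lemma Ex_norm f : bmf f -> `|Ex f| <= Ex (fun w => `|f w|).
Proof. by move=> bf; apply: le_normr_Rintegral => //; exact: bmf_integrable. Qed.

Lemma bmf_norm f : bmf f -> bmf (fun w => `|f w|).
Proof.
move=> [mf [C fC]]; split; first exact: measurableT_comp.
by exists C => w; rewrite normr_id.
Qed.

Lemma Ex_ae_eq f g : bmf f -> bmf g -> {ae P, forall w, f w = g w} -> Ex f = Ex g.
Proof.
move=> [mf _] [mg _] fg; congr fine; apply: ae_eq_integral => //.
- exact/measurable_EFinP.
- exact/measurable_EFinP.
- by apply: filterS fg => w fgw _ /=; rewrite fgw.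
Qed.

Lemma Ex_cvg (f_ : nat -> T -> R) f (C : R) :
  (forall n, measurable_fun setT (f_ n)) -> measurable_fun setT f ->
  (forall n w, `|f_ n w| <= C) ->
  {ae P, forall w, f_ n w @[n --> \oo] --> f w} ->
  Ex (f_ n) @[n --> \oo] --> Ex f.
Proof.
move=> mf_ mf fC cf; apply: fine_cvg.
have [] := @dominated_convergence _ _ _ P setT measurableT
   (fun n w => (f_ n w)%:E) (EFin \o f) (EFin \o cst C).
- by move=> n; apply/measurable_EFinP.
- exact/measurable_EFinP.
- by apply: filterS cf => w cw _; apply: cvg_EFin => //; apply: nearW.
- exact: finite_measure_integrable_cst.
- by apply: aeW => w n _ /=; rewrite lee_fin.
move=> i1 _ /=; rewrite fineK//.
exact: integrable_fin_num.
Qed.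

Lemma ae_norm_le_lim (f_ : nat -> T -> R) f (C : R) :
  (forall n w, `|f_ n w| <= C) -> (forall w, f_ n w @[n --> \oo] --> f w) ->
  forall w, `|f w| <= C.
Proof.
move=> fC cf w; have /cvg_norm c := cf w.
rewrite -(cvg_lim _ c)//; apply: limr_le; first by apply/cvg_ex; eexists; exact: c.
by apply: nearW => n.
Qed.

Lemma bmf_lim (f_ : nat -> T -> R) f (C : R) :
  (forall n, measurable_fun setT (f_ n)) -> (forall n w, `|f_ n w| <= C) ->
  (forall w, f_ n w @[n --> \oo] --> f w) -> bmf f.
Proof.
move=> mf_ fC cf; split; last by exists C; exact: ae_norm_le_lim fC cf.
exact: (measurable_fun_cvg (h := f_)).
Qed.

Lemma Ex_sum (I : Type) (s : seq I) (F : I -> T -> R) :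
  (forall i, bmf (F i)) -> Ex (fun w => \sum_(i <- s) F i w) = \sum_(i <- s) Ex (F i).
Proof.
move=> bF; elim: s => [|i s ih].
  by rewrite big_nil; under Ex_eq do rewrite big_nil; rewrite Ex_cst.
under Ex_eq do rewrite big_cons.
rewrite ExD ?ih ?big_cons//.
elim: s {ih} => [|j s ih]; first by under eq_fun do rewrite big_nil; exact: bmf_cst.
by under eq_fun do rewrite big_cons; exact: bmfD.
Qed.

Lemma bmf_sum (I : Type) (s : seq I) (F : I -> T -> R) :
  (forall i, bmf (F i)) -> bmf (fun w => \sum_(i <- s) F i w).
Proof.
move=> bF; elim: s => [|j s ih]; first by under eq_fun do rewrite big_nil; exact: bmf_cst.
by under eq_fun do rewrite big_cons; exact: bmfD.
Qed.

Lemma Ex_eq0 f : bmf f -> (forall w, 0 <= f w) -> Ex f = 0 ->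
  {ae P, forall w, f w = 0}.
Proof.
move=> bf f0 Ef; have := ExE bf; rewrite Ef => /esym.
under eq_integral => w _ do rewrite -[(f w)%:E]gee0_abs ?lee_fin//.
have mEf : measurable_fun setT (EFin \o f) by apply/measurable_EFinP/bf.1.
move/(proj1 (ae_eq_integral_abs P measurableT mEf)).
by apply: filterS => w /(_ I)[].
Qed.

End bounded_measurable.

(** * Image measures, independence and laws *)

Lemma bmf_comp d (T : measurableType d) d' (T' : measurableType d') (R : realType)
  (g : T -> T') (f : T' -> R) : measurable_fun setT g -> bmf f -> bmf (f \o g).
Proof.
move=> mg [mf [C fC]]; split; first exact: measurableT_comp.
by exists C => w; exact: fC.
Qed.

(** The pushforward is packed with the two facts used of it, its values on sets and the change of
    variables, so that later arguments never unfold it. *)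
Lemma image_measure d (T : measurableType d) d' (T' : measurableType d') (R : realType)
    (m : {measure set T -> \bar R}) (g : T -> T') : measurable_fun setT g ->
  exists nu : {measure set T' -> \bar R}, (forall A, nu A = m (g @^-1` A)) /\
    forall f : T' -> \bar R, measurable_fun setT f -> (forall y, 0 <= f y)%E ->
      (\int[nu]_y f y = \int[m]_x f (g x))%E.
Proof.
move=> mg; unshelve eexists (pushforward m g); first exact: mg.
by split=> // f mf f0; rewrite ge0_integral_pushforward//=.
Qed.

Section affine.
Context (R : realType).
Notation mu := (@lebesgue_measure R).

Lemma ge0_integral_affine (a b : R) (f : R -> \bar R) : 0 < b ->
  measurable_fun setT f -> (forall x, 0 <= f x)%E ->
  (\int[mu]_x f (a + b * x)%R = b^-1%:E * \int[mu]_x f x)%E.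
Proof.
move=> b0 mf f0.
pose g : measurableTypeR R -> measurableTypeR R := fun x => a + b * x.
have mg : measurable_fun setT g.
  by apply: measurable_funD => //; apply: measurable_funM.
have b0' : (0 <= b)%R by exact: ltW.
pose nb := NngNum b0'.
have [nu [nuE nuI]] := image_measure mu mg.
(* Lebesgue measure is characterised by its values on ]u, v]; there b times the image of [mu] under
   g agrees with it, the preimage having length (v - u) / b. *)
have mug X : measurable X -> mu X = mscale nb nu X.
  apply: lebesgue_measure_unique => _ [[u v] _ <-].
  rewrite -[RHS]/(b%:E * nu _)%E nuE.
  have -> : g @^-1` `]u, v]%classic = `](u - a) / b, (v - a) / b]%classic.
    apply/seteqP; split=> x /=; rewrite !in_itv/= ltr_pdivrMr// ler_pdivlMr//
      ltrBlDl lerBrDl [_ * b]mulrC//.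
  rewrite lebesgue_measure_itv/= [in RHS]lebesgue_measure_itv/= !lte_fin ltr_pM2r ?invr_gt0//.
  rewrite ltrD2r; case: ifPn => uv; last by rewrite mule0.
  rewrite -EFinM; congr EFin; field; exact: lt0r_neq0.
have -> : (\int[mu]_x f x = \int[mscale nb nu]_x f x)%E.
  by apply: eq_measure_integral => A mA _; exact: mug.
rewrite ge0_integral_mscale//= nuI//.
by rewrite muleA -EFinM mulVf ?mul1e// gt_eqF.
Qed.

End affine.

Lemma image_probability d (T : measurableType d) d' (T' : measurableType d') (R : realType)
    (P : probability T R) (g : T -> T') : measurable_fun setT g ->
  exists nu : probability T' R, (forall A, nu A = P (g @^-1` A)) /\
    forall f : T' -> \bar R, measurable_fun setT f -> (forall y, 0 <= f y)%E ->
      (\int[nu]_y f y = \int[P]_x f (g x))%E.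
Proof.
move=> mg.
pose mix := isMeasurableFun.Build _ _ _ _ _ mg.
pose X : {mfun T >-> T'} := HB.pack g mix.
exists (distribution P X); split=> // f mf f0.
exact: (@ge0_integral_distribution _ _ _ _ _ P X).
Qed.

Lemma bmf_Ex_section d (T : measurableType d) d1 (S : measurableType d1) (R : realType)
    (P : probability T R) (f : S * T -> R) :
  bmf f -> bmf (fun s => Ex P (fun w => f (s, w))).
Proof.
move=> bf; have [mf [C fC]] := bf.
have bw s : bmf (fun w => f (s, w)).
  by apply: (bmf_comp (g := fun w => (s, w)) _ bf); exact: measurable_fun_pair.
(* Adding the bound makes the integrand nonnegative, as Tonelli's theorem requires; C is subtracted
   again at the end. *)
pose F p := (f p + C)%:E.
have mF : measurable_fun setT F by apply/measurable_EFinP; apply: measurable_funD.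
have F0 p : (0 <= F p)%E.
  by rewrite lee_fin -lerBlDr sub0r; have := fC p; rewrite ler_norml => /andP[].
have inn s : (\int[P]_w F (s, w))%E = (Ex P (fun w => f (s, w)) + C)%:E.
  have -> : (\int[P]_w F (s, w))%E = (Ex P (fun w => f (s, w) + C))%:E.
    by rewrite ExE//; apply: bmfD => //; exact: bmf_cst.
  by rewrite ExD ?Ex_cst//; exact: bmf_cst.
split; last first.
  exists C => s; rewrite (le_trans (Ex_norm P (bw _)))//.
  by rewrite -[leRHS](Ex_cst P) le_Ex//; [exact: bmf_norm | exact: bmf_cst].
rewrite (_ : (fun s => _) = fun s => fine (\int[P]_w F (s, w))%E - C); last first.
  by apply/funext => s; rewrite inn /= addrK.
apply: measurable_funB => //; apply: measurableT_comp => //.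
exact: (measurable_fun_fubini_tonelli_F F).
Qed.

(* If (g1, g2) has independent components and g3 has the law of g2, then
   integrating over the pair amounts to integrating over g3 first. *)
Lemma Ex_independent d (T : measurableType d) d1 (S1 : measurableType d1)
    d2 (S2 : measurableType d2) (R : realType) (P : probability T R)
    (g1 : T -> S1) (g2 g3 : T -> S2) (f : S1 * S2 -> R) :
  measurable_fun setT g1 -> measurable_fun setT g2 -> measurable_fun setT g3 ->
  (forall A B, measurable A -> measurable B ->
     P (g1 @^-1` A `&` g2 @^-1` B) = (P (g1 @^-1` A) * P (g3 @^-1` B))%E) ->
  bmf f ->
  Ex P (fun w => f (g1 w, g2 w)) = Ex P (fun w => Ex P (fun w' => f (g1 w, g3 w')))
  /\ bmf (fun w => Ex P (fun w' => f (g1 w, g3 w'))).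
Proof.
move=> m1 m2 m3 indep bf.
have bP g : measurable_fun setT g -> bmf (fun w => f (g1 w, g w)).
  by move=> mg; apply: (bmf_comp (g := fun w => (g1 w, g w)) _ bf); exact: measurable_fun_pair.
have bw s : bmf (fun w' => f (s, g3 w')).
  apply: (bmf_comp (g := fun w => (s, g3 w)) _ bf); exact: measurable_fun_pair.
have [mf [C fC]] := bf.
have [n1 [n1E n1I]] := image_probability P m1.
have [n3 [n3E n3I]] := image_probability P m3.
have m12 : measurable_fun setT (fun w => (g1 w, g2 w)) by exact: measurable_fun_pair.
have [n12 [n12E n12I]] := image_probability P m12.
(* The joint law of (g1, g2) is the product of the laws of g1 and g3, since they agree on
   rectangles. *)
have prodE X : measurable X -> (n1 \x n3)%E X = n12 X.
  apply: product_measure_unique => A B mA mB.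
  transitivity (P (g1 @^-1` A `&` g2 @^-1` B)); first exact: n12E.
  by rewrite indep// -n1E -n3E.
pose F p := (f p + C)%:E.
have mF : measurable_fun setT F by apply/measurable_EFinP; apply: measurable_funD.
have F0 p : (0 <= F p)%E.
  by rewrite lee_fin -lerBlDr sub0r; have := fC p; rewrite ler_norml => /andP[].
have key : (\int[P]_w F (g1 w, g2 w) = \int[P]_w \int[P]_w' F (g1 w, g3 w'))%E.
  rewrite -(n12I F)//.
  under [RHS]eq_integral => w _.
    rewrite -(n3I (fun s => F (g1 w, s)))//; last first.
      by apply: measurableT_comp => //; exact: measurable_fun_pair.
    over.
  rewrite -(n1I (fun s => \int[n3]_y F (s, y))%E); last 2 first.
  - exact: (measurable_fun_fubini_tonelli_F F).
  - by move=> s; apply: integral_ge0.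
  rewrite -(fubini_tonelli1 F)//.
  by apply: eq_measure_integral => A mA _; exact/esym/prodE.
have inn w : (\int[P]_w' F (g1 w, g3 w'))%E = (Ex P (fun w' => f (g1 w, g3 w')) + C)%:E.
  have -> : (\int[P]_w' F (g1 w, g3 w'))%E = (Ex P (fun w' => f (g1 w, g3 w') + C))%:E.
    by rewrite ExE//; apply: bmfD => //; exact: bmf_cst.
  by rewrite ExD ?Ex_cst//; exact: bmf_cst.
have binn : bmf (fun w => Ex P (fun w' => f (g1 w, g3 w'))).
  apply: (bmf_comp (g := g1) (f := fun s => Ex P (fun w' => f (s, g3 w'))) m1).
  apply: (@bmf_Ex_section _ _ _ _ _ P (fun p => f (p.1, g3 p.2))).
  apply: (bmf_comp (g := fun p : S1 * T => (p.1, g3 p.2)) _ bf).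
  apply: measurable_fun_pair => //.
  exact: (measurableT_comp m3 measurable_snd).
split => //.
apply: (@addIr _ C).
move: key; under [in X in _ = X -> _]eq_integral do rewrite inn.
rewrite -[X in X = _ -> _]ExE; last by apply: bmfD; [exact: bP | exact: bmf_cst].
rewrite -[X in _ = X -> _]ExE; last by apply: bmfD; [by [] | exact: bmf_cst].
move=> [].
rewrite ExD; [|exact: bP|exact: bmf_cst].
by rewrite ExD; [|by []|exact: bmf_cst]; rewrite Ex_cst.
Qed.

(** * Sequences of independent identically distributed increments *)

Section sequences.
Context (R : realType).

(** The constraints bear on an initial segment of coordinates, so that two such sets meet in a third
    one with the larger length: a pi-system that generates the sigma-algebra of sequences. *)
Definition rects : set (set (nat -> R)) := [set C | exists N (B : nat -> set R),
  (forall i, measurable (B i)) /\ C = [set x | forall i, (i < N)%N -> B i (x i)]].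

Definition seqR := g_sigma_algebraType rects.

Lemma rects_setI : setI_closed rects.
Proof.
move=> _ _ [N [B [mB ->]]] [M [D [mD ->]]].
exists (maxn N M), (fun i => (if (i < N)%N then B i else setT) `&`
                             (if (i < M)%N then D i else setT)); split.
  by move=> i; apply: measurableI; case: ifP.
apply/seteqP; split => [x [/= xB xD] i iNM|x /= xBD].
  by split; case: ifPn => //; [exact: xB|exact: xD].
split=> i iN.
- by have := xBD i; rewrite leq_max iN /= => -[].
- by have := xBD i; rewrite leq_max iN orbT /= => -[].
Qed.

Lemma measurable_rects (C : set seqR) : rects C -> measurable C.
Proof. by move=> rC; apply: sub_sigma_algebra. Qed.

Lemma measurable_coord i : measurable_fun setT (fun x : seqR => x i).
Proof.
move=> _ B mB; rewrite setTI; apply: measurable_rects.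
exists i.+1, (fun j => if j == i then B else setT); split.
  by move=> j; case: ifP.
apply/seteqP; split => [x /= Bx j _|x /=]; first by case: eqP => // ->.
by move=> /(_ i (ltnSn _)); rewrite eqxx.
Qed.

Lemma measurable_to_seqR d (T : measurableType d) (xi : nat -> T -> R) :
  (forall i, measurable_fun setT (xi i)) ->
  measurable_fun setT (fun w => (fun i => xi i w) : seqR).
Proof.
move=> mxi; refine (@measurability _ _ T seqR setT _ rects erefl _).
move=> _ [_ [N [B [mB ->]]] <-]; rewrite setTI.
rewrite (_ : _ @^-1` _ = \bigcap_(i in [set i | (i < N)%N]) (xi i @^-1` B i)); last first.
  by apply/seteqP; split.
apply: bigcap_measurableType => // i _.
by rewrite -[X in measurable X]setTI; exact: mxi.
Qed.

Lemma measure_rects_unique (m1 m2 : {measure set seqR -> \bar R}) :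
  (m1 setT < +oo)%E -> (forall C, rects C -> m1 C = m2 C) ->
  forall C, measurable C -> m1 C = m2 C.
Proof.
move=> m1oo m12 C mC.
apply: (@measure_unique _ R seqR rects (fun=> setT)) => //.
- exact: rects_setI.
- by move=> _; exists 0%N, (fun=> setT); split => //; apply/seteqP; split.
- by rewrite bigcup_const//; exists 0%N.
Qed.

Section iid.
Context d (T : measurableType d) (P : probability T R) (xi : nat -> T -> R).
Hypothesis mxi : forall i, measurable_fun setT (xi i).
Hypothesis indep : forall N (B : nat -> set R), (forall i, measurable (B i)) ->
  P [set w | forall i, (i < N)%N -> B i (xi i w)] = (\prod_(i < N) P (xi i @^-1` B i))%E.
Hypothesis stat : forall i B, measurable B -> P (xi i @^-1` B) = P (xi 0%N @^-1` B).

(** Padding with 0 keeps the past in the same sequence space as the future; its partial sums are the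
    walk frozen at index i. *)
Definition past i w : seqR := fun j => if (j < i)%N then xi j w else 0.
Definition future i w : seqR := fun j => xi (i + j) w.
Definition whole w : seqR := fun j => xi j w.

Lemma measurable_past i : measurable_fun setT (past i).
Proof.
apply: (measurable_to_seqR (xi := fun j w => if (j < i)%N then xi j w else 0)) => j.
by case: (j < i)%N.
Qed.

Lemma measurable_future i : measurable_fun setT (future i).
Proof. exact: (measurable_to_seqR (xi := fun j => xi (i + j)%N)). Qed.

Lemma measurable_whole : measurable_fun setT whole.
Proof. by apply: measurable_to_seqR => j. Qed.

Let rects_indep i A C : rects A -> rects C ->
  P (past i @^-1` A `&` future i @^-1` C) = (P (past i @^-1` A) * P (whole @^-1` C))%E.
Proof.
move=> [N [B [mB ->]]] [M [D [mD ->]]].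
(* A rectangle that excludes 0 at a padded coordinate has an empty preimage; otherwise its
   constraints from i on are void. *)
have [h|h] := pselect (exists j, [/\ (i <= j)%N, (j < N)%N & ~ B j 0]).
  have -> : past i @^-1` [set x | forall j, (j < N)%N -> B j (x j)] = set0.
    apply/seteqP; split => // w /= H; have [j [ij jN nB]] := h.
    by apply: nB; have := H _ jN; rewrite /past ltnNge ij.
  by rewrite set0I measure0 mul0e.
have pastE w : (forall j, (j < N)%N -> B j (past i w j)) <->
    (forall j, (j < i)%N -> (if (j < N)%N then B j else setT) (xi j w)).
  split=> H j.
    by move=> ji; case: ifPn => // jN; have := H _ jN; rewrite /past ji.
  move=> jN; rewrite /past; case: ifPn => ji; first by have := H _ ji; rewrite jN.
  by apply: contrapT => nB; apply: h; exists j; rewrite leqNgt.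
pose B' j := if (j < N)%N then B j else setT.
have mB' j : measurable (B' j) by rewrite /B'; case: ifP.
pose E j := if (j < i)%N then B' j else D (j - i)%N.
have mE j : measurable (E j) by rewrite /E; case: ifP.
have -> : past i @^-1` [set x | forall j, (j < N)%N -> B j (x j)] =
    [set w | forall j, (j < i)%N -> B' j (xi j w)].
  by apply/seteqP; split => w /pastE.
have -> : [set w | forall j, (j < i)%N -> B' j (xi j w)] `&`
   future i @^-1` [set x | forall j, (j < M)%N -> D j (x j)] =
   [set w | forall j, (j < i + M)%N -> E j (xi j w)].
  apply/seteqP; split => [w [/= h1 h2] j jiM|w /= h1].
    rewrite /E; case: ifPn => ji; first exact: h1.
    move: ji; rewrite -leqNgt => ij.
    have jM : (j - i < M)%N by rewrite ltn_subLR.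
    by move: (h2 _ jM); rewrite /future subnKC.
  split=> j hj.
    have hjM : (j < i + M)%N by rewrite ltn_addr.
    by move: (h1 _ hjM); rewrite /E hj.
  have ijM : (i + j < i + M)%N by rewrite ltn_add2l.
  by move: (h1 _ ijM); rewrite /E ltnNge leq_addr/= addKn.
have -> : whole @^-1` [set x | forall j, (j < M)%N -> D j (x j)] =
  [set w | forall j, (j < M)%N -> D j (xi j w)] by [].
rewrite !indep// big_split_ord/=; congr (_ * _)%E.
  by apply: eq_bigr => -[j ji] _ /=; rewrite /E ji.
apply: eq_bigr => -[j jM] _ /=.
by rewrite /E ltnNge leq_addr/= addKn stat// [RHS]stat.
Qed.

(** Two uniqueness arguments on the pi-system of rectangles: both sides are finite measures in C
    when A is a rectangle, then in A for any measurable C. *)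
Lemma past_future_independent i A C : measurable A -> measurable C ->
  P (past i @^-1` A `&` future i @^-1` C) = (P (past i @^-1` A) * P (whole @^-1` C))%E.
Proof.
have mpre g (A0 : set seqR) : measurable_fun setT (g : T -> seqR) -> measurable A0 ->
    measurable (g @^-1` A0).
  by move=> mg mA0; rewrite -[X in measurable X]setTI; exact: mg.
have step1 A0 C0 : rects A0 -> measurable C0 ->
  P (past i @^-1` A0 `&` future i @^-1` C0) = (P (past i @^-1` A0) * P (whole @^-1` C0))%E.
  move=> rA mC.
  have mpA := mpre _ _ (measurable_past i) (measurable_rects rA).
  have [n1 [n1E _]] := image_measure (mrestr P mpA) (measurable_future i).
  have [n2 [n2E _]] := image_measure P measurable_whole.
  have c0 : 0 <= fine (P (past i @^-1` A0)) by rewrite fine_ge0.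
  have e C1 : mscale (NngNum c0) n2 C1 = (P (past i @^-1` A0) * P (whole @^-1` C1))%E.
    by rewrite -[LHS]/((fine (P (past i @^-1` A0)))%:E * n2 C1)%E n2E fineK// fin_num_measure.
  rewrite -e setIC -[LHS]/(mrestr P mpA _) -n1E.
  apply: measure_rects_unique => // [|C1 rC1].
    rewrite n1E preimage_setT -[X in (X < _)%E]/(P (setT `&` _)) setTI.
    by rewrite -ge0_fin_numE// fin_num_measure.
  apply: etrans (esym (e C1)); rewrite n1E.
  by rewrite -[LHS]/(P (_ `&` _)) setIC rects_indep.
move=> mA mC.
have mfC := mpre _ _ (measurable_future i) mC.
have [n1 [n1E _]] := image_measure (mrestr P mfC) (measurable_past i).
have [n2 [n2E _]] := image_measure P (measurable_past i).
have c0 : 0 <= fine (P (whole @^-1` C)) by rewrite fine_ge0.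
have mwC := mpre _ _ measurable_whole mC.
have e C1 : mscale (NngNum c0) n2 C1 = (P (past i @^-1` C1) * P (whole @^-1` C))%E.
  by rewrite -[LHS]/((fine (P (whole @^-1` C)))%:E * n2 C1)%E n2E fineK ?fin_num_measure// muleC.
rewrite -e -[LHS]/(mrestr P mfC _) -n1E.
apply: measure_rects_unique => // [|C1 rC1].
  rewrite n1E preimage_setT -[X in (X < _)%E]/(P (setT `&` _)) setTI.
  by rewrite -ge0_fin_numE// fin_num_measure.
apply: etrans (esym (e C1)); rewrite n1E.
by rewrite -[LHS]/(P (_ `&` _)) step1.
Qed.

Lemma Ex_markov i (f : seqR * seqR -> R) : bmf f ->
  Ex P (fun w => f (past i w, future i w)) =
  Ex P (fun w => Ex P (fun w' => f (past i w, whole w')))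
  /\ bmf (fun w => Ex P (fun w' => f (past i w, whole w'))).
Proof.
apply: Ex_independent => //.
- exact: measurable_past.
- exact: measurable_future.
- exact: measurable_whole.
- exact: past_future_independent.
Qed.

End iid.
End sequences.

(** * First passage along a dyadic grid *)

Section grid.
Context (R : realType).
Implicit Types (W : nat -> R) (f : R -> R -> R) (g : R -> R).

Definition fp W y k := (y < W k) && [forall j : 'I_k, W j <= y].

(** The passage index is summed over instead of being chosen: each term is measurable, at most one
    is nonzero, and the value is 0 when no passage occurs before n. *)
Definition grid n d f W y : R := \sum_(k < n) (fp W y k)%:R * f (k%:R * d) (W k - y).

Lemma fp_inj W y j k : fp W y j -> fp W y k -> j = k.
Proof.
move=> /andP[yj /forallP hj] /andP[yk /forallP hk].
case: (ltngtP j k) => // jk.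
- by have := hk (Ordinal jk); rewrite leNgt /= yj.
- by have := hj (Ordinal jk); rewrite leNgt /= yk.
Qed.

Lemma fp_exists W y k : y < W k -> exists2 j, fp W y j & (j <= k)%N.
Proof.
move=> yk; have ex : exists j, y < W j by exists k.
case: (ex_minnP ex) => j yj minj; exists j; last exact: minj.
apply/andP; split=> //; apply/forallP => -[i ij] /=.
by rewrite leNgt; apply/negP => /minj; rewrite leqNgt ij.
Qed.

Lemma sum_fp n W y k (F : nat -> R) : (k < n)%N -> fp W y k ->
  \sum_(j < n) (fp W y j)%:R * F j = F k.
Proof.
move=> kn fpk; rewrite (bigD1 (Ordinal kn))//= fpk mul1r big1 ?addr0// => -[j jn] /=.
rewrite -val_eqE/= => jk; case fpj: (fp W y j); last by rewrite mul0r.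
by move: jk; rewrite (fp_inj fpj fpk) eqxx.
Qed.

Lemma sum_nofp n W y (F : nat -> R) : (forall k, (k < n)%N -> ~~ fp W y k) ->
  \sum_(j < n) (fp W y j)%:R * F j = 0.
Proof.
move=> h; rewrite big1// => -[k kn] _ /=.
by rewrite (negbTE (h _ kn)) mul0r.
Qed.

Lemma sum_fp_bounded n W y (F : nat -> R) C : 0 <= C -> (forall k, `|F k| <= C) ->
  `|\sum_(j < n) (fp W y j)%:R * F j| <= C.
Proof.
move=> C0 FC.
have [[k [kn fpk]]|h] := pselect (exists k, (k < n)%N /\ fp W y k).
  by rewrite (sum_fp _ kn fpk).
rewrite sum_nofp ?normr0// => k kn; apply/negP => fpk; apply: h.
by exists k.
Qed.

Lemma fp_ext W W' y k : (forall j, (j <= k)%N -> W j = W' j) -> fp W y k = fp W' y k.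
Proof.
move=> WW'; rewrite /fp WW'//; congr (_ && _).
by apply: eq_forallb => -[j jk] /=; rewrite WW'// ltnW.
Qed.

Lemma grid_fp n d f W y k : (k < n)%N -> fp W y k ->
  grid n d f W y = f (k%:R * d) (W k - y).
Proof. exact: (sum_fp (fun k => f (k%:R * d) (W k - y))). Qed.

Lemma grid_nofp n d f W y : (forall k, (k < n)%N -> ~~ fp W y k) -> grid n d f W y = 0.
Proof. exact: (sum_nofp (fun k => f (k%:R * d) (W k - y))). Qed.

Lemma grid_bounded n d f W y C : (forall s z, `|f s z| <= C) -> `|grid n d f W y| <= C.
Proof.
move=> fC; have C0 : 0 <= C by apply: le_trans (fC 0 0).
exact: (sum_fp_bounded n W y C0 (fun k => fC (k%:R * d) (W k - y))).
Qed.

Definition rcont g := forall t, 0 <= t -> g s @[s --> t^'+] --> g t.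
(** The half-line is open: a right-continuous path that enters it stays there for a while, hence
    meets every fine enough grid. Time 0 is allowed, so that a path started at 0 passes a negative
    level at once. *)
Definition hit g y := [set s | 0 <= s /\ y < g s].
Definition fpt g y := inf (hit g y).
Definition Fp f g y := if `[< hit g y !=set0 >] then f (fpt g y) (g (fpt g y) - y) else 0.

Lemma Fp_hit f g y : hit g y !=set0 -> Fp f g y = f (fpt g y) (g (fpt g y) - y).
Proof. by move=> h; rewrite /Fp asboolT. Qed.

Lemma Fp_nohit f g y : ~ (hit g y !=set0) -> Fp f g y = 0.
Proof. by move=> h; rewrite /Fp asboolF. Qed.

Lemma Fp_bounded f g y C : (forall s z, `|f s z| <= C) -> `|Fp f g y| <= C.
Proof.
move=> fC; rewrite /Fp; case: ifP => // _; rewrite normr0.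
by apply: le_trans (fC 0 0).
Qed.

Lemma rcontP g t e : rcont g -> 0 <= t -> 0 < e ->
  exists2 d, 0 < d & forall r, t <= r < t + d -> `|g t - g r| < e.
Proof.
move=> rg t0 e0; have /cvgrPdist_lt /(_ _ e0) := rg _ t0.
move=> [d /= d0 H]; exists d => // r /andP[].
rewrite le_eqVlt => /predU1P[<-|tr] rtd; first by rewrite subrr normr0.
by apply: H => //=; rewrite ltr0_norm ?subr_lt0// opprB ltrBlDl.
Qed.

Lemma rcont_shift g t : rcont g -> 0 <= t -> rcont (fun s => g (t + s) - g t).
Proof.
move=> rg t0 s s0; apply/cvgrPdist_lt => e e0.
have [d d0 H] := rcontP rg (addr_ge0 t0 s0) e0.
exists d => //= r sr rs; rewrite [X in `|X|](_ : _ = g (t + s) - g (t + r)); last by ring.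
apply: H; rewrite lerD2l (ltW rs)/= -addrA ltrD2l.
by move: sr; rewrite /= ltr0_norm ?subr_lt0// opprB ltrBlDl.
Qed.

Lemma hit_open g y s : rcont g -> hit g y s ->
  exists2 e, 0 < e & forall r, s <= r < s + e -> hit g y r.
Proof.
move=> rg [s0 ys]; have e0 : 0 < g s - y by rewrite subr_gt0.
have [d d0 H] := rcontP rg s0 e0; exists d => // r /[dup] srd /H.
rewrite ltr_distlC => /andP[+ _]; rewrite opprB addrCA subrr addr0 => yr.
by split=> //; case/andP: srd => sr _; exact: le_trans s0 sr.
Qed.

Lemma hit_lb g y : has_lbound (hit g y).
Proof. by exists 0 => s []. Qed.

Lemma fpt_le g y s : hit g y s -> fpt g y <= s.
Proof. by move=> h; apply: ge_inf => //; exact: hit_lb. Qed.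

Lemma fpt_ge0 g y : 0 <= fpt g y.
Proof.
have [h|/set0P/negP/negPn/eqP h] := pselect (hit g y !=set0).
  by apply: lb_le_inf => // s [].
by rewrite /fpt h inf0.
Qed.

Lemma fpt_adherent g y e : hit g y !=set0 -> 0 < e ->
  exists2 s, hit g y s & s < fpt g y + e.
Proof.
move=> h e0; apply: inf_adherent => //; split=> //; exact: hit_lb.
Qed.

(* Right-continuity makes the strict and the non-strict debut values agree in
   the limit; at the debut itself only the weak inequality holds. *)
Lemma fpt_value g y : rcont g -> hit g y !=set0 -> y <= g (fpt g y).
Proof.
move=> rg h; rewrite leNgt; apply/negP => gy.
have e0 : 0 < y - g (fpt g y) by rewrite subr_gt0.
have [d d0 H] := rcontP rg (fpt_ge0 g y) e0.
have [s hs sd] := fpt_adherent h d0.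
have /H : fpt g y <= s < fpt g y + d by rewrite fpt_le.
rewrite ltr_distlC => /andP[_]; rewrite addrCA subrr addr0.
by case: hs => _ ys /lt_trans /(_ ys); rewrite ltxx.
Qed.

Lemma near_mesh (c e : R) : 0 < c -> 0 < e -> \forall m \near \oo, c / 2 ^+ m < e.
Proof.
move=> c0 e0; near=> m.
rewrite ltr_pdivrMr ?exprn_gt0// mulrC -ltr_pdivrMr//.
apply: (@le_lt_trans _ _ m%:R); first by near: m; exact: nbhs_infty_ger.
by rewrite -natrX ltr_nat ltn_expl.
Unshelve. all: by end_near. Qed.

Definition mesh (c : R) g m k := g (k%:R * (c / 2 ^+ m)).

(** Near the debut the path stays above y during some interval of length d, which contains a point
    of each grid of mesh less than d; conversely a grid passage never precedes the debut. With m 2^m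
    steps the grid reaches time m c, eventually beyond the debut. *)
Lemma grid_near g y c e : rcont g -> hit g y !=set0 -> 0 < c -> 0 < e ->
  \forall m \near \oo, exists k, [/\ (k < m * 2 ^ m)%N, fp (mesh c g m) y k &
    fpt g y <= k%:R * (c / 2 ^+ m) < fpt g y + e].
Proof.
move=> rg h c0 e0.
have e20 : 0 < e / 2 by rewrite divr_gt0.
have [s hs sf] := fpt_adherent h e20.
have [d d0 H] := hit_open rg hs.
near=> m.
have m0 : 0 < c / 2 ^+ m by rewrite divr_gt0 ?exprn_gt0.
have md : c / 2 ^+ m < d by near: m; exact: near_mesh.
have me : c / 2 ^+ m < e / 2 by near: m; exact: near_mesh.
have mf : (fpt g y + e) / c <= m%:R by near: m; exact: nbhs_infty_ger.
set D := c / 2 ^+ m in m0 md me *.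
have s0 : 0 <= s / D by rewrite divr_ge0 ?(ltW m0)//; case: hs.
have /andP[ks sk] := truncn_itv s0.
set k0 := (Num.truncn (s / D)).+1 in sk.
have sk0 : s < k0%:R * D by rewrite -ltr_pdivrMr.
have k0s : k0%:R * D <= s + D.
  by rewrite /k0 -natr1 mulrDl mul1r lerD2r -ler_pdivlMr.
have hk0 : hit g y (k0%:R * D).
  by apply: H; rewrite (ltW sk0)/= (le_lt_trans k0s)// ltrD2l.
have [k fpk kk0] := @fp_exists (mesh c g m) y k0 hk0.2.
have kle : k%:R * D < fpt g y + e.
  apply: (@le_lt_trans _ _ (s + D)); first by rewrite (le_trans _ k0s)// ler_pM2r// ler_nat.
  rewrite [e in ltRHS](splitr e) addrA; exact: ltrD.
exists k; split => //; last first.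
  rewrite kle andbT; apply: fpt_le; split; first by rewrite mulr_ge0// ltW.
  by case/andP: fpk.
rewrite -(@ltr_nat R) natrM natrX -(@ltr_pM2r _ D)//.
rewrite (lt_le_trans kle)// (_ : _ * D = m%:R * c).
  by rewrite -ler_pdivrMr.
by rewrite /D; field; rewrite lt0r_neq0// exprn_gt0.
Unshelve. all: by end_near. Qed.

Lemma continuous2P f s z e : continuous (fun p : R * R => f p.1 p.2) -> 0 < e ->
  exists2 d, 0 < d & forall s' z', `|s - s'| < d -> `|z - z'| < d -> `|f s z - f s' z'| < e.
Proof.
move=> cf e0; have /cvgrPdist_lt /(_ _ e0) := cf (s, z).
move=> /nbhs_ballP[d /= d0 H]; exists d => // s' z' ss' zz'.
by apply: (H (s', z')).
Qed.

Lemma grid_cvg g y c f : rcont g -> 0 < c -> continuous (fun p : R * R => f p.1 p.2) ->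
  grid (m * 2 ^ m) (c / 2 ^+ m) f (mesh c g m) y @[m --> \oo] --> Fp f g y.
Proof.
move=> rg c0 cf; have [h|h] := pselect (hit g y !=set0); last first.
  rewrite Fp_nohit//; apply: cvg_near_cst; apply: nearW => m.
  apply: grid_nofp => k _; apply/negP => /andP[yk _]; apply: h.
  by exists (k%:R * (c / 2 ^+ m)); split=> //; rewrite mulr_ge0// divr_ge0// ltW.
rewrite Fp_hit//; apply/cvgrPdist_lt => e e0.
have [d d0 H] := continuous2P (fpt g y) (g (fpt g y) - y) cf e0.
have [d' d'0 H'] := rcontP rg (fpt_ge0 g y) d0.
have dd0 : 0 < Num.min d d' by rewrite lt_min d0.
near=> m.
have [k [km fpk /andP[fk kf]]] : exists k, [/\ (k < m * 2 ^ m)%N, fp (mesh c g m) y k &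
    fpt g y <= k%:R * (c / 2 ^+ m) < fpt g y + Num.min d d'].
  by near: m; exact: grid_near.
rewrite (grid_fp _ _ km fpk); apply: H.
  rewrite distrC ger0_norm ?subr_ge0// ltrBlDl (lt_le_trans kf)// lerD2l.
  by rewrite ge_min lexx.
rewrite [X in `|X|](_ : _ = g (fpt g y) - mesh c g m k); last by ring.
apply: H'; rewrite fk (lt_le_trans kf)// lerD2l ge_min lexx orbT//.
Unshelve. all: by end_near. Qed.

End grid.

Section grid_measurable.
Context d (T : measurableType d) (R : realType).

Lemma measurable_le_set (f g : T -> R) : measurable_fun setT f -> measurable_fun setT g ->
  measurable [set t | f t <= g t].
Proof.
move=> mf mg; rewrite (_ : mkset _ = (fun t => g t - f t) @^-1` `[0, +oo[%classic).
  by rewrite -[X in measurable X]setTI; apply: measurable_funB.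
by apply/seteqP; split => t /=; rewrite in_itv/= andbT subr_ge0.
Qed.

Lemma measurable_lt_set (f g : T -> R) : measurable_fun setT f -> measurable_fun setT g ->
  measurable [set t | f t < g t].
Proof.
move=> mf mg; rewrite (_ : mkset _ = ~` [set t | g t <= f t]).
  by apply: measurableC; exact: measurable_le_set.
by apply/seteqP; split => t /=; rewrite real_ltNge ?num_real// => /negP.
Qed.

Lemma measurable_fp (W : T -> nat -> R) (y : T -> R) k :
  (forall k, measurable_fun setT (fun t => W t k)) -> measurable_fun setT y ->
  measurable [set t | fp (W t) (y t) k].
Proof.
move=> mW my.
rewrite (_ : mkset _ = [set t | y t < W t k] `&`
   \bigcap_(j in [set j | (j < k)%N]) [set t | W t j <= y t]); last first.
  apply/seteqP; split => [t /andP[? /forallP h]|t [? h]].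
    by split=> // j /= jk; exact: (h (Ordinal jk)).
  by apply/andP; split=> //; apply/forallP => -[j jk]; exact: h.
apply: measurableI; first exact: measurable_lt_set.
by apply: bigcap_measurableType => // j _; exact: measurable_le_set.
Qed.

Lemma bmf_fp (W : T -> nat -> R) (y : T -> R) k :
  (forall k, measurable_fun setT (fun t => W t k)) -> measurable_fun setT y ->
  bmf (fun t => (fp (W t) (y t) k)%:R : R).
Proof.
move=> mW my; rewrite (_ : (fun t => _) = \1_[set t | fp (W t) (y t) k]).
  by apply: bmf_indic; exact: measurable_fp.
by apply/funext => t; rewrite indicE; congr (nat_of_bool _)%:R; apply/idP/idP; rewrite inE.
Qed.

Lemma continuous2_r (f : R -> R -> R) s : continuous (fun p : R * R => f p.1 p.2) ->
  continuous (f s).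
Proof.
move=> cf z; apply: (@continuous_comp _ _ _ (fun z => (s, z)) (fun p : R * R => f p.1 p.2)).
  apply: (cvg_pair (F := nbhs z) (G := nbhs s) (H := nbhs z)); [exact: cvg_cst|exact: cvg_id].
exact: cf.
Qed.

Lemma bmf_grid n c (f : R -> R -> R) C (W : T -> nat -> R) (y : T -> R) :
  continuous (fun p : R * R => f p.1 p.2) -> (forall s z, `|f s z| <= C) ->
  (forall k, measurable_fun setT (fun t => W t k)) -> measurable_fun setT y ->
  bmf (fun t => grid n c f (W t) (y t)).
Proof.
move=> cf fC mW my; rewrite /grid; apply: bmf_sum => k.
apply: bmfM; first exact: bmf_fp.
split; last by exists C => t.
apply: (measurableT_comp (f := f (k%:R * c))).
  by apply: continuous_measurable_fun; exact: continuous2_r.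
exact: measurable_funB.
Qed.

End grid_measurable.

Opaque Ex grid Fp.

(** * The Markov property of a Lévy process at dyadic times *)

Section levy.
Context (R : realType) d (Omega : measurableType d) (P : probability Omega R)
  (X : R -> Omega -> R).
Hypothesis LX : levy_process P X.

Let X0 := levy_start LX.
Let Xm := levy_measurable LX.

Lemma levy_rcont w : rcont (X ^~ w).
Proof. exact: (levy_cadlag LX w).1. Qed.

Definition incr (D : R) (i : nat) (w : Omega) := X (i.+1%:R * D) w - X (i%:R * D) w.

Definition psum (x : seqR R) : seqR R := fun k => \sum_(i < k) x i.

Lemma measurable_psum : measurable_fun setT psum.
Proof.
apply: (measurable_to_seqR (xi := fun k (x : seqR R) => \sum_(i < k) x i)) => k.
by apply: measurable_sum => i; exact: measurable_coord.
Qed.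

Lemma measurable_psum_coord k : measurable_fun setT (fun x : seqR R => (psum x : nat -> R) k).
Proof. by apply: measurable_sum => i; exact: measurable_coord. Qed.

Section mesh.
Variables (D : R) (D0 : 0 < D).

Let grid_ge0 (i : nat) : 0 <= i%:R * D.
Proof. by rewrite mulr_ge0// ltW. Qed.

Lemma measurable_incr i : measurable_fun setT (incr D i).
Proof. by apply: measurable_funB; apply: Xm. Qed.

Lemma incr_indep N (B : nat -> set R) : (forall i, measurable (B i)) ->
  P [set w | forall i, (i < N)%N -> B i (incr D i w)] = (\prod_(i < N) P (incr D i @^-1` B i))%E.
Proof.
move=> mB.
have := levy_independent LX (n := N) (t := fun i => i%:R * D) (grid_ge0 0) _
  (B := fun i : 'I_N => B i) (fun i : 'I_N => mB i).
move=> <-; last by move=> i j ij; rewrite ler_pM2r// ler_nat.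
congr (P _); apply/seteqP; split => [w h [i iN] _|w h i iN]; first exact: h.
exact: (h (Ordinal iN) I).
Qed.

Lemma incr_stat i (B : set R) : measurable B -> P (incr D i @^-1` B) = P (incr D 0%N @^-1` B).
Proof.
move=> mB.
have st j : P (incr D j @^-1` B) = P [set w | B (X D w)].
  rewrite -(levy_stationary LX (grid_ge0 j) (ltW D0) mB); congr (P _).
  by apply/seteqP; split => w /=; rewrite /incr -natr1 mulrDl mul1r.
by rewrite !st.
Qed.

Lemma psum_whole w k : psum (whole (incr D) w) k = X (k%:R * D) w.
Proof.
rewrite /psum /whole /incr.
elim: k => [|k ih]; first by rewrite big_ord0 mul0r X0.
by rewrite big_ord_recr/= ih addrC subrK.
Qed.

Lemma psum_future i w k :
  psum (future (incr D) i w) k = X ((i + k)%:R * D) w - X (i%:R * D) w.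
Proof.
rewrite /psum /future /incr.
elim: k => [|k ih]; first by rewrite big_ord0 addn0 subrr.
by rewrite big_ord_recr/= ih addnS; ring.
Qed.

Lemma psum_past i w k : psum (past (incr D) i w) k = X ((minn k i)%:R * D) w.
Proof.
rewrite /psum /past /incr.
elim: k => [|k ih]; first by rewrite big_ord0 min0n mul0r X0.
rewrite big_ord_recr/= ih; case: ifPn => ki.
  by rewrite (minn_idPl (ltnW ki)) (minn_idPl ki) addrC subrK.
by rewrite -leqNgt in ki; rewrite addr0 (minn_idPr ki) (minn_idPr (leqW ki)).
Qed.

(** The weight A sees the walk frozen at step i, the grid functional sees the increments after it,
    for the level that remains to be climbed; [Ex_markov] replaces the latter by an independent
    copy. *)
Lemma grid_markov n i (A : seqR R -> R) (f : R -> R -> R) (C c : R) :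
  bmf A -> continuous (fun p : R * R => f p.1 p.2) -> (forall s z, `|f s z| <= C) ->
  Ex P (fun w => A (fun j => X ((minn j i)%:R * D) w) *
     grid n D f (fun j => X ((i + j)%:R * D) w - X (i%:R * D) w) (c - X (i%:R * D) w)) =
  Ex P (fun w => A (fun j => X ((minn j i)%:R * D) w) *
     Ex P (fun w' => grid n D f (fun j => X (j%:R * D) w') (c - X (i%:R * D) w))).
Proof.
move=> bA cf fC.
pose F (p : seqR R * seqR R) := A (psum p.1) * grid n D f (psum p.2) (c - psum p.1 i).
have ps1 : measurable_fun setT (fun p : seqR R * seqR R => psum p.1).
  by apply: measurableT_comp; [exact: measurable_psum|exact: measurable_fst].
have ps2 : measurable_fun setT (fun p : seqR R * seqR R => psum p.2).
  by apply: measurableT_comp; [exact: measurable_psum|exact: measurable_snd].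
have bF : bmf F.
  apply: bmfM; first exact: (bmf_comp ps1 bA).
  have mk k : measurable_fun setT (fun p : seqR R * seqR R => (psum p.2 : nat -> R) k).
    exact: (measurableT_comp (measurable_psum_coord k) (@measurable_snd _ _ (seqR R) (seqR R))).
  have mc : measurable_fun setT (fun p : seqR R * seqR R => c - (psum p.1 : nat -> R) i).
    apply: measurable_funB => //.
    exact: (measurableT_comp (measurable_psum_coord i) (@measurable_fst _ _ (seqR R) (seqR R))).
  exact: (bmf_grid n D cf fC mk mc).
have [h _] := Ex_markov measurable_incr incr_indep incr_stat i bF.
have eqseq (s s' : seqR R) : s =1 s' -> s = s' by move=> ss; apply/funext.
have pE w : psum (past (incr D) i w) = (fun j => X ((minn j i)%:R * D) w).
  by apply: eqseq => j; rewrite psum_past.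
have fE w : psum (future (incr D) i w) = (fun j => X ((i + j)%:R * D) w - X (i%:R * D) w).
  by apply: eqseq => j; rewrite psum_future.
have wE w : psum (whole (incr D) w) = (fun j => X (j%:R * D) w).
  by apply: eqseq => j; rewrite psum_whole.
rewrite -[LHS](_ : Ex P (fun w => F (past (incr D) i w, future (incr D) i w)) = _); last first.
  by apply: Ex_eq => w; rewrite /F /= pE fE minnn.
rewrite h; apply: Ex_eq => w; rewrite /F /= pE minnn.
rewrite ExZ; last first.
  have mk k : measurable_fun setT (fun w' => (psum (whole (incr D) w') : nat -> R) k).
    by apply: eq_measurable_fun (Xm (grid_ge0 k)) => w' _; rewrite psum_whole.
  exact: (bmf_grid n D cf fC mk (measurable_cst _)).
by congr (_ * _); apply: Ex_eq => w'; rewrite wE.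
Qed.

End mesh.

Lemma bmf_meshgrid n D (f : R -> R -> R) (C y : R) : 0 < D ->
  continuous (fun p : R * R => f p.1 p.2) -> (forall s z, `|f s z| <= C) ->
  bmf (fun w => grid n D f (fun j => X (j%:R * D) w) y).
Proof.
move=> D0 cf fC.
have mk k : measurable_fun setT (fun w => (fun j => X (j%:R * D) w) k).
  by apply: Xm; rewrite mulr_ge0// ltW.
exact: (bmf_grid n D cf fC mk (measurable_cst _)).
Qed.

Definition EFp (f : R -> R -> R) y := Ex P (fun w => Fp f (X ^~ w) y).

Lemma EFpE f y : EFp f y = Ex P (fun w => Fp f (X ^~ w) y).
Proof. by []. Qed.

(** As a limit of grid functionals it is measurable for the given sigma-algebra, without any
    completion. *)
Lemma bmf_Fp (f : R -> R -> R) (C : R) t c : 0 <= t ->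
  continuous (fun p : R * R => f p.1 p.2) -> (forall s z, `|f s z| <= C) ->
  bmf (fun w => Fp f (fun s => X (t + s) w - X t w) (c - X t w)).
Proof.
move=> t0 cf fC.
have rc w : rcont (fun s => X (t + s) w - X t w).
  exact: (rcont_shift (@levy_rcont w) t0).
apply: (@bmf_lim _ _ _ (fun m w => grid (m * 2 ^ m) (1 / 2 ^+ m) f
  (mesh 1 (fun s => X (t + s) w - X t w) m) (c - X t w)) _ C).
- move=> m.
  have mk k : measurable_fun setT (fun w => mesh 1 (fun s => X (t + s) w - X t w) m k).
    by rewrite /mesh; apply: measurable_funB; apply: Xm; rewrite ?addr_ge0// mulr_ge0// divr_ge0// exprn_ge0.
  have mc : measurable_fun setT (fun w => c - X t w).
    by apply: measurable_funB => //; apply: Xm.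
  exact: (bmf_grid (m * 2 ^ m) (1 / 2 ^+ m) cf fC mk mc).1.
- by move=> m w; exact: grid_bounded.
- by move=> w; apply: grid_cvg.
Qed.

(** The mesh size c is left free because scaling compares the grids built on c and on 1. *)
Lemma grid_EFp (f : R -> R -> R) (C c y : R) : 0 < c ->
  continuous (fun p : R * R => f p.1 p.2) -> (forall s z, `|f s z| <= C) ->
  Ex P (fun w => grid (m * 2 ^ m) (c / 2 ^+ m) f (mesh c (X ^~ w) m) y) @[m --> \oo] --> EFp f y.
Proof.
move=> c0 cf fC; apply: (Ex_cvg (C := C)).
- by move=> m; apply: (bmf_meshgrid _ _ _ cf fC).1; rewrite divr_gt0// exprn_gt0.
- have /= := bmf_Fp y (lexx 0) cf fC.
  rewrite (_ : (fun w => _) = (fun w => Fp f (X ^~ w) y)); first by case.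
  apply/funext => w; rewrite X0 subr0; congr Fp.
  by apply/funext => s; rewrite add0r subr0.
- by move=> m w; exact: grid_bounded.
- by apply: aeW => w; apply: grid_cvg => //; exact: levy_rcont.
Qed.

(* The event or weight a may depend on the path up to the dyadic time t through
   a limit of functions of finer and finer dyadic samples. *)
Lemma path_markov i0 n0 (A : nat -> seqR R -> R) (a : Omega -> R) (f : R -> R -> R) (C c : R) :
  let t := i0%:R * (1 / 2 ^+ n0) in
  (forall m, measurable_fun setT (A m)) -> (forall m s, `|A m s| <= 1) ->
  (forall w, A m (fun j => X ((minn j (i0 * 2 ^ m))%:R * (1 / 2 ^+ (n0 + m))) w) @[m --> \oo] --> a w) ->
  continuous (fun p : R * R => f p.1 p.2) -> (forall s z, `|f s z| <= C) ->
  Ex P (fun w => a w * Fp f (fun s => X (t + s) w - X t w) (c - X t w)) =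
  Ex P (fun w => a w * EFp f (c - X t w)) /\ bmf (fun w => EFp f (c - X t w)) /\ bmf a.
Proof.
move=> t mA A1 Aa cf fC.
have t0 : 0 <= t by rewrite mulr_ge0// divr_ge0// exprn_ge0.
have C0 : 0 <= C by apply: le_trans (fC 0 0).
(* Grids of mesh 2^-(n0 + m) all contain t, at index i0 2^m. *)
pose D m : R := 1 / 2 ^+ (n0 + m).
have D0 m : 0 < D m by rewrite divr_gt0// exprn_gt0.
have tE m : (i0 * 2 ^ m)%:R * D m = t.
  rewrite /t /D exprD natrM natrX; field.
  by rewrite !expf_neq0// pnatr_eq0.
pose N m := ((n0 + m) * 2 ^ (n0 + m))%N.
have key m := grid_markov (D0 m) (N m) (i0 * 2 ^ m) c (conj (mA m) (ex_intro _ 1 (A1 m)) : bmf (A m)) cf fC.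
have rc w : rcont (fun s => X (t + s) w - X t w).
  exact: (rcont_shift (@levy_rcont w) t0).
have shiftn (u : nat -> R) (l : R) : u n @[n --> \oo] --> l -> u (n0 + m)%N @[m --> \oo] --> l.
  by move=> ul; apply: (cvg_comp (addn n0) u) ul; exact: cvg_addnl.
have mAw m : measurable_fun setT
    (fun w => A m (fun j => X ((minn j (i0 * 2 ^ m))%:R * D m) w)).
  apply: (measurableT_comp (mA m)).
  apply: (measurable_to_seqR (xi := fun j w => X ((minn j (i0 * 2 ^ m))%:R * D m) w)) => j.
  by apply: Xm; rewrite mulr_ge0// ltW.
have ba : bmf a.
  by apply: (bmf_lim (C := 1) mAw) => [m w|//]; exact: A1.
have mg m : measurable_fun setT (fun w => Ex P (fun w' => grid (N m) (D m) f
    (fun j => X (j%:R * D m) w') (c - X t w))).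
  pose F (p : R * Omega) := grid (N m) (D m) f (fun j => X (j%:R * D m) p.2) (c - p.1).
  have mk k : measurable_fun setT (fun p : R * Omega => (fun j => X (j%:R * D m) p.2) k).
    apply: (measurableT_comp (f := X (k%:R * D m)) (g := snd)) => //.
    by apply: Xm; rewrite mulr_ge0// ltW.
  have mc : measurable_fun setT (fun p : R * Omega => c - p.1) by exact: measurable_funB.
  have bF : bmf F by exact: (bmf_grid (N m) (D m) cf fC mk mc).
  exact: (measurableT_comp (bmf_Ex_section P bF).1 (Xm t0)).
have bg m w : `|Ex P (fun w' => grid (N m) (D m) f (fun j => X (j%:R * D m) w') (c - X t w))| <= C.
  have b1 := bmf_meshgrid (N m) (c - X t w) (D0 m) cf fC.
  rewrite (le_trans (Ex_norm P b1))// -[leRHS](Ex_cst P) le_Ex//; [exact: bmf_norm | exact: bmf_cst|].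
  by move=> w'; exact: grid_bounded.
have cg w : Ex P (fun w' => grid (N m) (D m) f (fun j => X (j%:R * D m) w') (c - X t w))
    @[m --> \oo] --> EFp f (c - X t w).
  have h := grid_EFp (y := c - X t w) (@ltr01 R) cf fC.
  pose u m := Ex P (fun w' => grid (m * 2 ^ m) (1 / 2 ^+ m) f (mesh 1 (X ^~ w') m) (c - X t w)).
  have := shiftn u _ h.
  by apply: cvg_trans; apply: near_eq_cvg; apply: nearW.
have bE : bmf (fun w => EFp f (c - X t w)) by exact: (bmf_lim mg bg cg).
split; last by split.
pose L m w := A m (fun j => X ((minn j (i0 * 2 ^ m))%:R * D m) w) *
  grid (N m) (D m) f (fun j => X ((i0 * 2 ^ m + j)%:R * D m) w - X ((i0 * 2 ^ m)%:R * D m) w)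
     (c - X ((i0 * 2 ^ m)%:R * D m) w).
have bL m w : `|L m w| <= C.
  rewrite /L normrM -[leRHS]mul1r.
  by apply: ler_pM; [exact: normr_ge0|exact: normr_ge0|exact: A1|exact: grid_bounded].
have h1 : Ex P (L m) @[m --> \oo] -->
    Ex P (fun w => a w * Fp f (fun s => X (t + s) w - X t w) (c - X t w)).
  apply: (Ex_cvg (C := C)) => //.
  - move=> m; apply: measurable_funM; first exact: mAw.
    have mk k : measurable_fun setT (fun w => (fun j => X ((i0 * 2 ^ m + j)%:R * D m) w -
        X ((i0 * 2 ^ m)%:R * D m) w) k).
      by apply: measurable_funB; apply: Xm; rewrite mulr_ge0// ltW.
    have mc : measurable_fun setT (fun w => c - X ((i0 * 2 ^ m)%:R * D m) w).
      by apply: measurable_funB => //; apply: Xm; rewrite mulr_ge0// ltW.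
    exact: (bmf_grid (N m) (D m) cf fC mk mc).1.
  - by apply: (bmfM ba _).1; exact: bmf_Fp.
  - apply: aeW => w; apply: cvgM; first exact: Aa.
    have h := grid_cvg (y := c - X t w) (rc w) (@ltr01 R) cf.
    pose u m := grid (m * 2 ^ m) (1 / 2 ^+ m) f (mesh 1 (fun s => X (t + s) w - X t w) m) (c - X t w).
    have := shiftn u _ h.
    apply: cvg_trans; apply: near_eq_cvg; apply: nearW => m.
    rewrite tE; congr grid; apply/funext => j.
    by rewrite /mesh natrD mulrDl tE.
have h2 : Ex P (L m) @[m --> \oo] --> Ex P (fun w => a w * EFp f (c - X t w)).
  under eq_fun do rewrite /L key.
  apply: (Ex_cvg (C := C)).
  - move=> m; apply: measurable_funM; first exact: mAw.
    by rewrite tE; exact: mg.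
  - exact: (bmfM ba bE).1.
  - move=> m w; rewrite normrM -[leRHS]mul1r tE.
    by apply: ler_pM; [exact: normr_ge0|exact: normr_ge0|exact: A1|exact: bg].
  - apply: aeW => w.
    rewrite (_ : (fun m => _) = (fun m => A m (fun j => X ((minn j (i0 * 2 ^ m))%:R * D m) w) *
      Ex P (fun w' => grid (N m) (D m) f (fun j => X (j%:R * D m) w') (c - X t w)))).
      by apply: cvgM; [exact: Aa|exact: cg].
    by apply/funext => m; rewrite tE.
exact: (cvg_unique _ h1 h2).
Qed.

End levy.

Opaque EFp.

(** * Powers of positive parts and continuity *)

Section real_tools.
Context (R : realType).

(** Dominated convergence runs along sequences; this turns its conclusions into continuity. *)
Lemma continuous_seq (f : R -> R) (p : R) :
  (forall u : nat -> R, u n @[n --> \oo] --> p -> f (u n) @[n --> \oo] --> f p) ->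
  {for p, continuous f}.
Proof.
by move=> h; apply/continuous_withinNx/cvgr_dnbhsP => u [_]; exact: h.
Qed.

Lemma powR_continuous_gt0 (r y : R) : 0 < y -> {for y, continuous (fun a : R => a `^ r)}.
Proof.
move=> y0; apply: differentiable_continuous; apply/derivable1_diffP.
by apply: derivable_powR; rewrite in_itv/= y0.
Qed.

(* The power of the positive part; since 0 `^ 0 = 1, powp 0 is the constant 1. *)
Definition powp (r y : R) : R := (Num.max y 0) `^ r.

Lemma powp_gt0 r y : 0 < y -> powp r y = y `^ r.
Proof. by move=> y0; rewrite /powp max_l// ltW. Qed.

Lemma powp_le0 r y : r != 0 -> y <= 0 -> powp r y = 0.
Proof. by move=> r0 y0; rewrite /powp max_r// powR0. Qed.

Lemma powp_ge0 r y : 0 <= powp r y.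
Proof. exact: powR_ge0. Qed.

Lemma powp_homo r : 0 <= r -> {homo powp r : x y / x <= y}.
Proof.
move=> r0 x y xy.
have xy' : Num.max x 0 <= Num.max y 0 by rewrite ge_max !le_max xy lexx orbT.
by rewrite /powp; apply: ge0_ler_powR => //; rewrite nnegrE le_max lexx orbT.
Qed.

Lemma powp_continuous r : 0 < r -> continuous (powp r).
Proof.
move=> r0 y; have [y0|y0|->] := ltgtP y 0.
- have : (cst 0 : R -> R) x @[x --> y] --> powp r y.
    by rewrite powp_le0 ?gt_eqF// ?ltW//; exact: cvg_cst.
  apply: cvg_trans; apply: near_eq_cvg; near=> x.
  by rewrite /= powp_le0 ?gt_eqF//; apply: ltW; near: x; exact: lt_nbhsl.
- have : x `^ r @[x --> y] --> powp r y by rewrite powp_gt0//; exact: powR_continuous_gt0.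
  apply: cvg_trans; apply: near_eq_cvg; near=> x.
  by rewrite /= powp_gt0//; near: x; exact: lt_nbhsr.
- apply/cvgrPdist_lt => e e0; near=> x.
  rewrite powp_le0 ?gt_eqF// sub0r normrN ger0_norm ?powp_ge0//.
  have [x0|x0] := leP x 0; first by rewrite powp_le0 ?gt_eqF.
  rewrite powp_gt0//.
  have -> : e = (e `^ r^-1) `^ r by rewrite -powRrM mulVf ?gt_eqF// powRr1// ltW.
  rewrite gt0_ltr_powR// ?nnegrE ?powR_ge0 ?ltW//.
  near: x; apply: lt_nbhsl; exact: powR_gt0.
Unshelve. all: by end_near. Qed.

Lemma max0_homo (a b : R) : a <= b -> Num.max a 0 <= Num.max b 0.
Proof. by move=> ab; rewrite ge_max !le_max ab lexx orbT. Qed.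

Lemma max0_sub_le (v a : R) : 0 <= a -> Num.max (v - a) 0 <= Num.max v 0.
Proof. by move=> a0; apply: max0_homo; rewrite gerBl. Qed.

Lemma max0_ge0 (v : R) : 0 <= Num.max v 0.
Proof. by rewrite le_max lexx orbT. Qed.

Lemma norm_max0_sub_le (v a : R) : 0 <= a -> `|Num.max (v - a) 0| <= Num.max v 0.
Proof. by move=> a0; rewrite ger0_norm ?max0_ge0// max0_sub_le. Qed.

Lemma max0_le0 (v : R) : v <= 0 -> Num.max v 0 = 0.
Proof. by move=> v0; rewrite max_r. Qed.

Lemma near_dist (y e : R) : 0 < e -> \forall z \near y, `|y - z| < e.
Proof. by move=> e0; exists e. Qed.

Lemma max0_lip (a b : R) : `|Num.max a 0 - Num.max b 0| <= `|a - b|.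
Proof.
have h1 := ler_norm (a - b); have h2 := ler_norm (- (a - b)).
rewrite normrN in h2; rewrite ler_norml.
have [a0|a0] := leP a 0; have [b0|b0] := leP b 0; apply/andP; split; lra.
Qed.

Lemma continuous_fst_comp (f : R -> R) : continuous f ->
  continuous (fun p : R * R => f p.1).
Proof.
by move=> cf [a b]; apply: (cvg_comp fst f); [exact: cvg_fst|exact: cf].
Qed.

Lemma continuous_snd_comp (f : R -> R) : continuous f ->
  continuous (fun p : R * R => f p.2).
Proof.
by move=> cf [a b]; apply: (cvg_comp snd f); [exact: cvg_snd|exact: cf].
Qed.

Lemma continuous_maxr (T : topologicalType) (f g : T -> R) : continuous f -> continuous g ->
  continuous (fun x => Num.max (f x) (g x)).
Proof. by move=> cf cg x; apply: continuous_max; [exact: cf|exact: cg]. Qed.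

Lemma continuous_minr (T : topologicalType) (f g : T -> R) : continuous f -> continuous g ->
  continuous (fun x => Num.min (f x) (g x)).
Proof. by move=> cf cg x; apply: continuous_min; [exact: cf|exact: cg]. Qed.

Lemma continuous_pair (T : topologicalType) (f g : T -> R) : continuous f -> continuous g ->
  continuous (fun x => (f x, g x)).
Proof. by move=> cf cg x; exact: (cvg_pair (cf x) (cg x)). Qed.

Lemma continuous_subl (T : topologicalType) (c : R) (f : T -> R) : continuous f ->
  continuous (fun x => c - f x).
Proof. by move=> cf x; apply: cvgB; [exact: cvg_cst|exact: cf]. Qed.

Lemma continuous_max0 : continuous (fun s : R => Num.max s 0).
Proof. by apply: continuous_maxr; [move=> ?; exact: cvg_id|exact: cst_continuous]. Qed.

End real_tools.

(* The negative part of s is cut so that remf u is bounded; passage times are nonnegative. *)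
Definition remf (R : realType) (u s z : R) := Num.max (u - Num.max s 0) 0.

(** * Scaling of the passage time and of the overshoot *)

Section stable.
Context (R : realType) d (Omega : measurableType d) (P : probability Omega R)
  (X : R -> Omega -> R) (alpha : R).
Hypothesis alpha_gt1 : 1 < alpha.
Hypothesis SX : stable_levy_process P alpha X.

Let LX : levy_process P X. Proof. by case: SX. Qed.
Let X0 := levy_start LX.
Let Xm := levy_measurable LX.

Lemma scale_fp c m k y : 0 < c ->
  P [set w | fp (mesh c (X ^~ w) m) (c `^ alpha^-1 * y) k] =
  P [set w | fp (mesh 1 (X ^~ w) m) y k].
Proof.
move=> c0; have ca0 : 0 < c `^ alpha^-1 by exact: powR_gt0.
pose T := g_sigma_algebraType (@path_cylinders R).
pose W (f : T) : nat -> R := fun j => (f : R -> R) (j%:R * (1 / 2 ^+ m)).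
have mW j : measurable_fun setT (fun f => W f j).
  move=> _ B mB; rewrite setTI; apply: sub_sigma_algebra.
  have t0 : 0 <= j%:R * (1 / 2 ^+ m) :> R by rewrite mulr_ge0// divr_ge0// exprn_ge0.
  by exists (j%:R * (1 / 2 ^+ m)), B; split.
have mA : measurable [set f : T | fp (W f) (c `^ alpha^-1 * y) k].
  exact: measurable_fp.
have [_ _ /(_ c c0 _ mA)] := SX.
rewrite (_ : [set w | _] = [set w | fp (mesh c (X ^~ w) m) (c `^ alpha^-1 * y) k]); last first.
  apply/seteqP; split=> w /=; rewrite /W /mesh;
    rewrite (_ : (fun j : nat => X (c * _) w) = (fun j : nat => X (j%:R * (c / 2 ^+ m)) w))//;
    by apply/funext => j; congr (X _ w); ring.
move=> ->; congr (P _).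
have sc (W' : nat -> R) : fp (fun j => c `^ alpha^-1 * W' j) (c `^ alpha^-1 * y) k = fp W' y k.
  rewrite /fp ltr_pM2l//; congr (_ && _).
  by apply: eq_forallb => j; rewrite ler_pM2l.
by apply/seteqP; split=> w /=; rewrite /W sc.
Qed.

(** The passage index over c^(1/alpha) y on the grid of mesh c / 2^m has the law of the passage
    index over y on the grid of mesh 1 / 2^m, while the grid times are multiplied by c. The
    overshoot, which would scale by c^(1/alpha), does not enter [phi]. *)
Lemma scale_EFp (phi : R -> R) C c y : 0 < c -> continuous phi ->
  (forall s, `|phi s| <= C) ->
  EFp P X (fun s _ => phi s) (c `^ alpha^-1 * y) = EFp P X (fun s _ => phi (c * s)) y.
Proof.
move=> c0 cphi phiC.
have c1 := continuous_fst_comp cphi.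
have cphi' : continuous (fun s => phi (c * s)).
  move=> s; apply: continuous_comp; last exact: cphi.
  by apply: cvgMr; exact: cvg_id.
have c2 := continuous_fst_comp cphi'.
have h1 := grid_EFp (f := fun s _ => phi s) (y := c `^ alpha^-1 * y) LX c0 c1 (fun s _ => phiC s).
have h2 := grid_EFp (f := fun s _ => phi (c * s)) (y := y) LX ltr01 c2 (fun s _ => phiC (c * s)).
suff e : forall m, Ex P (fun w => grid (m * 2 ^ m) (c / 2 ^+ m) (fun s _ => phi s)
     (mesh c (X ^~ w) m) (c `^ alpha^-1 * y)) =
   Ex P (fun w => grid (m * 2 ^ m) (1 / 2 ^+ m) (fun s _ => phi (c * s))
     (mesh 1 (X ^~ w) m) y).
  move: h1; under eq_fun do rewrite e; move=> h1.
  exact: (cvg_unique _ h1 h2).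
move=> m.
have mfp e z k : 0 < e -> measurable [set w | fp (mesh e (X ^~ w) m) z k].
  move=> e0; apply: measurable_fp => // j; apply: Xm.
  by rewrite mulr_ge0// divr_ge0// ?exprn_ge0// ltW.
have fpE e z k w : (fp (mesh e (X ^~ w) m) z k)%:R =
    \1_[set w | fp (mesh e (X ^~ w) m) z k] w :> R.
  by rewrite indicE; congr (nat_of_bool _)%:R; apply/idP/idP; rewrite inE.
have sumE e z (psi : R -> R) : 0 < e ->
  Ex P (fun w => grid (m * 2 ^ m) (e / 2 ^+ m) (fun s _ => psi s) (mesh e (X ^~ w) m) z) =
  \sum_(k < m * 2 ^ m) psi (k%:R * (e / 2 ^+ m)) * fine (P [set w | fp (mesh e (X ^~ w) m) z k]).
  move=> e0; have mf k := mfp e z k e0.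
  rewrite -[LHS](_ : Ex P (fun w => \sum_(k < m * 2 ^ m) psi (k%:R * (e / 2 ^+ m)) *
     \1_[set w | fp (mesh e (X ^~ w) m) z k] w) = _); last first.
    by apply: Ex_eq => w; apply: eq_bigr => k _; rewrite fpE mulrC.
  rewrite Ex_sum; last by move=> k; apply: bmfZ; exact: bmf_indic.
  by apply: eq_bigr => k _; rewrite ExZ ?Ex_indic//; exact: bmf_indic.
rewrite !sumE//; apply: eq_bigr => k _; rewrite scale_fp//; congr (phi _ * _).
by rewrite mul1r; ring.
Qed.

(** On paths that never pass y both this infimum of the empty set and [ovs] take the value 0; those
    paths form a null set wherever [ae_hit] is assumed and y > 0. *)
Definition tau y w := fpt (X ^~ w) y.
Definition ovs y w := Fp (fun _ z => z) (X ^~ w) y.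

Let rc w : rcont (X ^~ w). Proof. exact: (levy_rcont LX). Qed.

Let bmf_Fp0 (f : R -> R -> R) (C : R) y :
  continuous (fun p : R * R => f p.1 p.2) -> (forall s z, `|f s z| <= C) ->
  bmf (fun w => Fp f (X ^~ w) y).
Proof.
move=> cf fC; have := bmf_Fp LX y (lexx 0) cf fC.
rewrite (_ : (fun w => _) = (fun w => Fp f (X ^~ w) y))//.
apply/funext => w; rewrite X0 subr0; congr Fp.
by apply/funext => s; rewrite add0r subr0.
Qed.

Lemma tau_ge0 y w : 0 <= tau y w.
Proof. exact: fpt_ge0. Qed.

Lemma ovs_ge0 y w : 0 <= ovs y w.
Proof.
rewrite /ovs; have [h|h] := pselect (hit (X ^~ w) y !=set0).
  by rewrite Fp_hit// subr_ge0; exact: (fpt_value (rc (w := w)) h).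
by rewrite Fp_nohit.
Qed.

Let clamp (n : nat) (s : R) := Num.min s n%:R.

Let clamp_cvg (s : R) : clamp n s @[n --> \oo] --> s.
Proof.
apply: cvg_near_cst; near=> n; rewrite /clamp min_l//.
by near: n; exact: nbhs_infty_ger.
Unshelve. all: by end_near. Qed.

Let max0c : continuous (fun s : R => Num.max s 0).
Proof. by apply: continuous_maxr; [move=> ?; exact: cvg_id|exact: cst_continuous]. Qed.

Let clampc n : continuous (clamp n).
Proof. by apply: continuous_minr; [move=> ?; exact: cvg_id|exact: cst_continuous]. Qed.

Lemma measurable_tau y : measurable_fun setT (tau y).
Proof.
pose f n (s z : R) := Num.max (clamp n s) 0.
have cf n : continuous (fun p : R * R => f n p.1 p.2).
  apply: (continuous_fst_comp (f := fun s => Num.max (clamp n s) 0)).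
  by apply: continuous_maxr; [exact: clampc|exact: cst_continuous].
have fC n s z : `|f n s z| <= n%:R.
  by rewrite /f ger0_norm ?le_max ?lexx ?orbT// ge_max ge_min lexx orbT ler0n.
apply: (measurable_fun_cvg (h := fun n w => Fp (f n) (X ^~ w) y)).
  by move=> n; exact: (bmf_Fp0 y (cf n) (fC n)).1.
move=> w _; have [h|h] := pselect (hit (X ^~ w) y !=set0).
  under eq_fun do rewrite Fp_hit//.
  have e : Num.max (tau y w) 0 = tau y w by rewrite max_l//; exact: tau_ge0.
  rewrite -e.
  apply: (cvg_comp (fun n => clamp n (tau y w)) (fun s => Num.max s 0) (@clamp_cvg (tau y w))).
  exact: max0c.
rewrite /tau /fpt (_ : hit _ _ = set0) ?inf0; last first.
  by apply/eqP/negPn/negP => /set0P.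
by under eq_fun do rewrite Fp_nohit//; exact: cvg_cst.
Qed.

Lemma measurable_ovs y : measurable_fun setT (ovs y).
Proof.
pose f n (s z : R) := Num.max (clamp n z) 0.
have cf n : continuous (fun p : R * R => f n p.1 p.2).
  apply: (continuous_snd_comp (f := fun s => Num.max (clamp n s) 0)).
  by apply: continuous_maxr; [exact: clampc|exact: cst_continuous].
have fC n s z : `|f n s z| <= n%:R.
  by rewrite /f ger0_norm ?le_max ?lexx ?orbT// ge_max ge_min lexx orbT ler0n.
apply: (measurable_fun_cvg (h := fun n w => Fp (f n) (X ^~ w) y)).
  by move=> n; exact: (bmf_Fp0 y (cf n) (fC n)).1.
move=> w _; have [h|h] := pselect (hit (X ^~ w) y !=set0).
  under eq_fun do rewrite Fp_hit//.
  have k0 := ovs_ge0 y w; rewrite /ovs Fp_hit// in k0 *.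
  set K := (X in 0 <= X) in k0 *.
  have e : Num.max K 0 = K by rewrite max_l.
  suff : Num.max (clamp n K) 0 @[n --> \oo] --> Num.max K 0 by rewrite e.
  apply: (cvg_comp (fun n => clamp n K) (fun s => Num.max s 0) (@clamp_cvg K)).
  exact: max0c.
rewrite /ovs Fp_nohit//.
by under eq_fun do rewrite Fp_nohit//; exact: cvg_cst.
Qed.

Lemma measurable_hit y : measurable [set w | hit (X ^~ w) y !=set0].
Proof.
have n1 : `|1 : R| <= 1 by rewrite normr1.
have [+ _] := bmf_Fp0 (f := fun _ _ => 1) (C := 1) y (@cst_continuous _ _ _) (fun _ _ => n1).
move=> /(_ measurableT _ (measurable_set1 1)); rewrite setTI.
congr measurable; apply/seteqP; split=> w /=; have [h|h] := pselect (hit (X ^~ w) y !=set0).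
- by [].
- by rewrite Fp_nohit// => /esym/eqP; rewrite oner_eq0.
- by rewrite Fp_hit.
- by [].
Qed.

Lemma tau_nohit y w : ~ (hit (X ^~ w) y !=set0) -> tau y w = 0 /\ ovs y w = 0.
Proof.
move=> h; split; last by rewrite /ovs Fp_nohit.
rewrite /tau /fpt (_ : hit _ _ = set0) ?inf0//.
by apply/eqP/negPn/negP => /set0P.
Qed.

Lemma bmf_tau (f : R -> R -> R) C y :
  continuous (fun p : R * R => f p.1 p.2) -> (forall s z, `|f s z| <= C) ->
  bmf (fun w => f (tau y w) (ovs y w)).
Proof.
move=> cf fC.
rewrite (_ : (fun w => _) = (fun w => Fp f (X ^~ w) y +
    f 0 0 * \1_(~` [set w | hit (X ^~ w) y !=set0]) w)).
  apply: bmfD; first exact: bmf_Fp0 cf fC.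
  by apply: bmfZ; apply: bmf_indic; apply: measurableC; exact: measurable_hit.
apply/funext => w; rewrite indicE.
have [h|h] := pselect (hit (X ^~ w) y !=set0).
  by rewrite memNset ?mulr0 ?addr0 /ovs ?Fp_hit//; apply.
by rewrite mem_set// mulr1 Fp_nohit// add0r; have [-> ->] := tau_nohit h.
Qed.

Lemma EFp_tau (f : R -> R -> R) C y : {ae P, forall w, hit (X ^~ w) y !=set0} ->
  continuous (fun p : R * R => f p.1 p.2) -> (forall s z, `|f s z| <= C) ->
  EFp P X f y = Ex P (fun w => f (tau y w) (ovs y w)).
Proof.
move=> ah cf fC.
rewrite EFpE; apply: Ex_ae_eq; [exact: bmf_Fp0 cf fC|exact: bmf_tau cf fC|].
by apply: filterS ah => w h; rewrite /ovs !Fp_hit.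
Qed.

Lemma scale_hit y : 0 < y -> P [set w | hit (X ^~ w) y !=set0] = P [set w | hit (X ^~ w) 1 !=set0].
Proof.
move=> y0.
have E z : EFp P X (fun _ _ => 1) z = fine (P [set w | hit (X ^~ w) z !=set0]).
  rewrite -Ex_indic; last exact: measurable_hit.
  rewrite EFpE; apply: Ex_eq => w; rewrite indicE.
  have [h|h] := pselect (hit (X ^~ w) z !=set0).
    by rewrite Fp_hit// mem_set.
  by rewrite Fp_nohit// memNset.
have ya0 : 0 < y `^ alpha by exact: powR_gt0.
have := scale_EFp (phi := fun=> 1) (C := 1) 1 ya0 (@cst_continuous _ _ _).
rewrite mulr1 -powRrM divff ?powRr1 ?(ltW y0)//; last by rewrite gt_eqF// (lt_trans ltr01).
rewrite !E normr1 => /(_ (fun=> lexx 1)) h.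
rewrite -[LHS]fineK; last by rewrite fin_num_measure//; exact: measurable_hit.
by rewrite h fineK// fin_num_measure//; exact: measurable_hit.
Qed.

Let Y := tau 1.

Section hitting.
Hypothesis ae_hit : forall y, 0 < y -> {ae P, forall w, hit (X ^~ w) y !=set0}.

Lemma scale_tau (phi : R -> R) C y : 0 < y -> continuous phi -> (forall s, `|phi s| <= C) ->
  Ex P (fun w => phi (tau y w)) = Ex P (fun w => phi (y `^ alpha * Y w)).
Proof.
move=> y0 cphi phiC.
have ya0 : 0 < y `^ alpha by exact: powR_gt0.
have cphi' : continuous (fun s => phi (y `^ alpha * s)).
  move=> s; apply: continuous_comp; last exact: cphi.
  by apply: cvgMr; exact: cvg_id.
have := scale_EFp 1 ya0 cphi phiC.
rewrite mulr1 -powRrM divff ?powRr1 ?(ltW y0)//; last by rewrite gt_eqF// (lt_trans ltr01).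
rewrite (EFp_tau (ae_hit y0) (continuous_fst_comp cphi) (fun s _ => phiC s)) => ->.
by rewrite (EFp_tau (ae_hit ltr01) (continuous_fst_comp cphi') (fun s _ => phiC _)).
Qed.

(* By scaling this is E (v - tau y)_+ for y > 0; it is v_+ for y <= 0, which makes
   it continuous in the level. *)
Definition residual (y v : R) := Ex P (fun w => Num.max (v - powp alpha y * Y w) 0).

Let residual_bmf y v : bmf (fun w => Num.max (v - powp alpha y * Y w) 0).
Proof.
split.
  apply: measurable_funTS; apply: measurable_maxr => //; apply: measurable_funB => //.
  by apply: measurable_funM => //; exact: measurable_tau.
exists (Num.max v 0) => w; apply: norm_max0_sub_le.
by rewrite mulr_ge0 ?powp_ge0 ?tau_ge0.
Qed.

Lemma residual_ge0 y v : 0 <= residual y v.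
Proof. by apply: Ex_ge0 => w; exact: max0_ge0. Qed.

Lemma residual_le y v : residual y v <= Num.max v 0.
Proof.
rewrite -[leRHS](Ex_cst P); apply: le_Ex; [exact: residual_bmf|exact: bmf_cst|move=> w].
by apply: max0_sub_le; rewrite mulr_ge0 ?powp_ge0 ?tau_ge0.
Qed.

Lemma residual_le0 y v : v <= 0 -> residual y v = 0.
Proof.
move=> v0; apply/eqP; rewrite eq_le residual_ge0 andbT.
by rewrite -(max0_le0 v0) residual_le.
Qed.

Lemma residual_lipr y v v' : `|residual y v - residual y v'| <= `|v - v'|.
Proof.
rewrite /residual -ExB; [|exact: residual_bmf|exact: residual_bmf].
have b : bmf (fun w => Num.max (v - powp alpha y * Y w) 0 - Num.max (v' - powp alpha y * Y w) 0).
  by apply: bmfB; exact: residual_bmf.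
apply: le_trans (Ex_norm P b) _.
rewrite -[leRHS](Ex_cst P); apply: le_Ex; [exact: bmf_norm|exact: bmf_cst|move=> w].
apply: le_trans (max0_lip _ _) _.
by rewrite opprB addrA subrK.
Qed.

Lemma alpha_gt0 : 0 < alpha. Proof. exact: lt_trans alpha_gt1. Qed.

Lemma residual_continuousl v : continuous (residual ^~ v).
Proof.
move=> y; apply: continuous_seq => u uy.
apply: (Ex_cvg (C := Num.max v 0)).
- by move=> n; exact: (residual_bmf _ _).1.
- exact: (residual_bmf _ _).1.
- by move=> n w; apply: norm_max0_sub_le; rewrite mulr_ge0 ?powp_ge0 ?tau_ge0.
- apply: aeW => w.
  have c : continuous (fun y => Num.max (v - powp alpha y * Y w) 0).
    apply: continuous_maxr; last exact: cst_continuous.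
    move=> z; apply: cvgB; first exact: cvg_cst.
    by apply: cvgMl; exact: (powp_continuous alpha_gt0).
  exact: (cvg_comp u (fun y => Num.max (v - powp alpha y * Y w) 0) uy (c y)).
Qed.

Lemma residual_continuous : continuous (fun p : R * R => residual p.1 p.2).
Proof.
move=> [y v]; apply/cvgrPdist_lt => e e0.
have e20 : 0 < e / 2 by rewrite divr_gt0.
have /cvgrPdist_lt /(_ _ e20) /nbhs_ballP[d1 /= d10 H1] := @residual_continuousl v y.
near=> y' v' => /=.
have yy' : `|y - y'| < d1 by near: y'; exact: near_dist.
have vv' : `|v - v'| < e / 2 by near: v'; exact: near_dist.
apply: le_lt_trans (ler_distD (residual y' v) _ _) _.
rewrite [e in ltRHS]splitr; apply: ltrD.
  exact: H1.
exact: le_lt_trans (residual_lipr _ _ _) vv'.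
Unshelve. all: by end_near. Qed.

Let cmax (u : R) : continuous (fun s : R => Num.max (u - Num.max s 0) 0).
Proof.
apply: continuous_maxr; last exact: cst_continuous.
move=> s; apply: cvgB; first exact: cvg_cst.
by apply: continuous_maxr; [move=> ?; exact: cvg_id|exact: cst_continuous].
Qed.

Let cmaxC (u : R) s : `|Num.max (u - Num.max s 0) 0| <= Num.max u 0.
Proof.
exact/norm_max0_sub_le/max0_ge0.
Qed.

(** For y > 0 this is scaling. For y <= 0 it says that the path passes y at once: the passage over y
    does not come after the passage over any z > 0, and [residual z u] tends to [Num.max u 0] as z
    decreases to 0. *)
Lemma EFp_residual u y : EFp P X (remf u) y = residual y u.
Proof.
have pos z : 0 < z -> EFp P X (remf u) z = residual z u.
  move=> z0; rewrite (EFp_tau (ae_hit z0) (continuous_fst_comp (@cmax u)) (fun s _ => cmaxC u s)).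
  rewrite (scale_tau z0 (@cmax u) (cmaxC u)) /residual powp_gt0//.
  apply: Ex_eq => w; congr (Num.max (u - _) 0).
  by rewrite max_l// mulr_ge0 ?powR_ge0 ?tau_ge0.
have [y0|y0] := ltP 0 y; first exact: pos.
have remE z : z <= 0 -> residual z u = Num.max u 0.
  move=> z0; rewrite /residual powp_le0//; last by rewrite gt_eqF// alpha_gt0.
  by rewrite -[RHS](Ex_cst P); apply: Ex_eq => w; rewrite mul0r subr0.
have bR z := bmf_Fp0 z (continuous_fst_comp (@cmax u)) (fun s _ => cmaxC u s).
have EE z : EFp P X (remf u) z = Ex P (fun w => Fp (remf u) (X ^~ w) z) by exact: EFpE.
apply/eqP; rewrite eq_le; apply/andP; split.
  rewrite remE// -[leRHS](Ex_cst P) EE; apply: le_Ex; [exact: bR|exact: bmf_cst|move=> w].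
  by apply: le_trans (ler_norm _) _; apply: Fp_bounded => s z; exact: cmaxC.
have mono z : 0 < z -> residual z u <= EFp P X (remf u) y.
  move=> z0; rewrite -pos// !EE; apply: le_Ex; [exact: bR|exact: bR|move=> w].
  have [h|h] := pselect (hit (X ^~ w) z !=set0); last first.
    rewrite Fp_nohit//; have [h'|h'] := pselect (hit (X ^~ w) y !=set0).
      by rewrite Fp_hit// /remf le_max lexx orbT.
    by rewrite Fp_nohit.
  have sub : hit (X ^~ w) z `<=` hit (X ^~ w) y.
    by move=> s [s0 zs]; split=> //; rewrite (le_lt_trans y0)// (lt_trans z0).
  have h' : hit (X ^~ w) y !=set0 by case: h => s /sub ?; exists s.
  rewrite !Fp_hit//; apply: max0_homo; rewrite lerD2l lerN2; apply: max0_homo.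
  by apply: lb_le_inf => // s /sub; exact: fpt_le.
have c : residual z u @[z --> 0^'+] --> residual 0 u.
  by apply: cvg_at_right_filter; exact: residual_continuousl.
rewrite (remE y)// -(remE 0)// -(cvg_lim _ c)//.
apply: limr_le; first by apply/cvg_ex; eexists; exact: c.
near=> z; apply: mono; near: z; exact: nbhs_right_gt.
Unshelve. all: by end_near. Qed.

End hitting.

End stable.

(** * The Markov property at a passage time and at a fixed time *)

Section restart.
Context (R : realType).
Implicit Types (g : R -> R).

Lemma remf_cont (u : R) : continuous (fun p : R * R => remf u p.1 p.2).
Proof.
apply: (continuous_fst_comp (f := fun s => Num.max (u - Num.max s 0) 0)).
apply: continuous_maxr; last exact: cst_continuous.
move=> s; apply: cvgB; first exact: cvg_cst.
by apply: continuous_maxr; [move=> ?; exact: cvg_id|exact: cst_continuous].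
Qed.

Lemma remf_bound (u s z : R) : `|remf u s z| <= Num.max u 0.
Proof. exact/norm_max0_sub_le/max0_ge0. Qed.

(** The time left before u at the passage over x + h, when this passage is sought only from the
    first grid time at which x is exceeded. Each term involves a fixed time, to which the Markov
    property at dyadic times applies. *)
Definition restart n x h u g : R :=
  \sum_(k < n * 2 ^ n) (fp (mesh 1 g n) x k)%:R *
    Fp (remf (u - k%:R * (1 / 2 ^+ n))) (fun s => g (k%:R * (1 / 2 ^+ n) + s) - g (k%:R * (1 / 2 ^+ n)))
       (x + h - g (k%:R * (1 / 2 ^+ n))).

Lemma restart_bound n x h u g : `|restart n x h u g| <= Num.max u 0.
Proof.
pose F k := Fp (remf (u - k%:R * (1 / 2 ^+ n)))
  (fun s => g (k%:R * (1 / 2 ^+ n) + s) - g (k%:R * (1 / 2 ^+ n))) (x + h - g (k%:R * (1 / 2 ^+ n))).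
apply: (@sum_fp_bounded _ _ _ _ F) => [|k]; first exact: max0_ge0.
apply: Fp_bounded => s z; apply: le_trans (remf_bound _ _ _) _.
by apply: max0_homo; rewrite gerBl mulr_ge0// divr_ge0// exprn_ge0.
Qed.

Lemma restart_cvg x h u g : rcont g -> 0 <= h ->
  restart n x h u g @[n --> \oo] --> Fp (remf u) g (x + h).
Proof.
move=> rg h0.
have [hh|hh] := pselect (hit g (x + h) !=set0); last first.
  rewrite Fp_nohit//; apply: cvg_near_cst; apply: nearW => n.
  rewrite /restart big1// => k _; set t := _ * (1 / _).
  have t0 : 0 <= t by rewrite mulr_ge0// divr_ge0// exprn_ge0.
  rewrite Fp_nohit ?mulr0// => -[s [s0 /= hs]]; apply: hh; exists (t + s).
  by split; [rewrite addr_ge0|move: hs; rewrite ltrD2r].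
rewrite Fp_hit//; apply/cvgrPdist_lt => e e0.
set s' := fpt g (x + h).
have [s1 hs1 s1e] := fpt_adherent hh e0.
have [d d0 Hd] := hit_open rg hs1.
(* A point above x + h, close to the debut of that level and strictly later than the debut of x,
   even when a single jump passes both. Once the grid notices the passage over x before s, the
   restarted passage lies between s' and s. *)
pose s := s1 + Num.min d (s' + e - s1) / 2.
have mn0 : 0 < Num.min d (s' + e - s1) by rewrite lt_min d0 subr_gt0.
have ss1 : s1 < s by rewrite ltrDl divr_gt0.
have se : s < s' + e.
  rewrite -ltrBrDl; apply: (@lt_le_trans _ _ (Num.min d (s' + e - s1))).
    by rewrite ltr_pdivrMr// mulr_natr mulr2n ltrDl.
  by rewrite ge_min lexx orbT.
have hs : hit g (x + h) s.
  apply: Hd; rewrite (ltW ss1)/= ltrD2l; apply: (@lt_le_trans _ _ (Num.min d (s' + e - s1))).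
    by rewrite ltr_pdivrMr// mulr_natr mulr2n ltrDl.
  by rewrite ge_min lexx.
have sub : hit g (x + h) `<=` hit g x.
  by move=> r [r0 rr]; split => //; apply: le_lt_trans rr; rewrite lerDl.
have hx : hit g x !=set0 by exists s; exact: sub.
have es0 : 0 < s - fpt g x.
  by rewrite subr_gt0; apply: le_lt_trans ss1; apply: fpt_le; exact: sub.
near=> n.
have [k [kn fpk /andP[tk ks]]] : exists k, [/\ (k < n * 2 ^ n)%N, fp (mesh 1 g n) x k &
    fpt g x <= k%:R * (1 / 2 ^+ n) < fpt g x + (s - fpt g x)].
  by near: n; exact: grid_near.
rewrite /restart (sum_fp (fun k => Fp (remf (u - k%:R * (1 / 2 ^+ n)))
  (fun s => g (k%:R * (1 / 2 ^+ n) + s) - g (k%:R * (1 / 2 ^+ n))) (x + h - g (k%:R * (1 / 2 ^+ n)))) kn fpk).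
rewrite addrC subrK in ks; set t := k%:R * (1 / 2 ^+ n) in tk ks *.
have t0 : 0 <= t by rewrite mulr_ge0// divr_ge0// exprn_ge0.
set gs := fun s => g (t + s) - g t.
have hss : hit gs (x + h - g t) (s - t).
  split; first by rewrite subr_ge0 ltW.
  by rewrite /gs ltrD2r [t + _]addrC subrK; case: hs.
have hss' : hit gs (x + h - g t) !=set0 by exists (s - t).
rewrite Fp_hit//; set s'' := fpt gs _.
have s''0 : 0 <= s'' by exact: fpt_ge0.
have s'0 : 0 <= s' by exact: fpt_ge0.
have up : t + s'' <= s by rewrite addrC -lerBrDr; exact: fpt_le.
have lo : s' <= t + s''.
  rewrite -lerBlDl; apply: lb_le_inf => // r [r0 rr].
  rewrite lerBlDl; apply: fpt_le; split; first by rewrite addr_ge0.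
  by move: rr; rewrite /gs ltrD2r.
have e1 : Num.max s' 0 = s' by rewrite max_l.
have e2 : Num.max s'' 0 = s'' by rewrite max_l.
rewrite /remf e1 e2; apply: le_lt_trans (max0_lip _ _) _.
rewrite (_ : _ - _ = t + s'' - s'); last by ring.
by rewrite ger0_norm ?subr_ge0// ltrBlDl (le_lt_trans up).
Unshelve. all: by end_near. Qed.

Lemma Fp_shift (f : R -> R -> R) g t x : 0 <= t -> (forall s, 0 <= s <= t -> g s <= x) ->
  Fp f (fun s => g (t + s) - g t) (x - g t) = Fp (fun s z => f (s - t) z) g x.
Proof.
move=> t0 gx; set gs := fun s => _.
have hE s : hit gs (x - g t) s <-> 0 <= s /\ hit g x (t + s).
  split=> [[s0 hs]|[s0 [_ hs]]]; last by split=> //; rewrite ltrD2r.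
  by split=> //; split; [rewrite addr_ge0|move: hs; rewrite ltrD2r].
have gt_t s : hit g x s -> t < s.
  move=> [s0 hs]; rewrite ltNge; apply/negP => st.
  by have := gx s; rewrite s0 st => /(_ isT); rewrite leNgt hs.
have [h|h] := pselect (hit g x !=set0); last first.
  rewrite [RHS]Fp_nohit// Fp_nohit// => -[s /hE[_ hs]]; apply: h.
  by exists (t + s).
have h' : hit gs (x - g t) !=set0.
  have [s hs] := h; exists (s - t); apply/hE; rewrite [t + _]addrC subrK.
  by rewrite subr_ge0 ltW ?gt_t.
have e : fpt gs (x - g t) = fpt g x - t.
  apply/eqP; rewrite eq_le; apply/andP; split.
    rewrite lerBrDr; apply: lb_le_inf => // s hs; rewrite -lerBrDr.
    by apply: fpt_le; apply/hE; rewrite [t + _]addrC subrK subr_ge0 ltW ?gt_t.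
  apply: lb_le_inf => // s /hE[s0 hs]; rewrite lerBlDl; exact: fpt_le.
rewrite !Fp_hit// e /gs [t + _]addrC subrK; congr (f _ _); ring.
Qed.

End restart.

Section markov.
Context (R : realType) d (Omega : measurableType d) (P : probability Omega R)
  (X : R -> Omega -> R) (alpha : R).
Hypothesis alpha_gt1 : 1 < alpha.
Hypothesis SX : stable_levy_process P alpha X.
Hypothesis ae_hit : forall y, 0 < y -> {ae P, forall w, hit (X ^~ w) y !=set0}.

Let LX : levy_process P X. Proof. by case: SX. Qed.
Let X0 := levy_start LX.
Let Xm := levy_measurable LX.
Notation tau := (tau X).
Notation ovs := (ovs X).
Notation residual := (residual P X alpha).

(** At the passage over x the level still to be climbed is h - K and the time left is u - T; when K
    > h, [residual] at a negative level is the whole time left, in accordance with a jump over both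
    levels. Continuity of [residual] in both arguments lets the grid identity pass to the limit. *)
Lemma strong_markov x h u : 0 < x -> 0 <= h ->
  residual (x + h) u = Ex P (fun w => residual (h - ovs x w) (u - tau x w)).
Proof.
move=> x0 h0.
pose f (s z : R) := residual (h - z) (u - Num.max s 0).
have cf : continuous (fun p : R * R => f p.1 p.2).
  move=> [s z].
  apply: (@continuous_comp _ _ _ (fun p : R * R => (h - p.2, u - Num.max p.1 0))
    (fun p : R * R => residual p.1 p.2)); last exact: residual_continuous.
  apply: continuous_pair.
    apply: (continuous_snd_comp (f := fun z => h - z)).
    by apply: (continuous_subl (f := id)) => ?; exact: cvg_id.
  apply: (continuous_fst_comp (f := fun s => u - Num.max s 0)).
  by apply: continuous_subl; exact: continuous_max0.
have fC s z : `|f s z| <= Num.max u 0.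
  rewrite ger0_norm ?residual_ge0//; apply: le_trans (residual_le SX _ _) _.
  by apply: max0_sub_le; exact: max0_ge0.
have t0 k n : 0 <= k%:R * (1 / 2 ^+ n) :> R by rewrite mulr_ge0// divr_ge0// exprn_ge0.
have key n k : Ex P (fun w => (fp (mesh 1 (X ^~ w) n) x k)%:R *
    Fp (remf (u - k%:R * (1 / 2 ^+ n))) (fun s => X (k%:R * (1 / 2 ^+ n) + s) w - X (k%:R * (1 / 2 ^+ n)) w)
       (x + h - X (k%:R * (1 / 2 ^+ n)) w)) =
    Ex P (fun w => (fp (mesh 1 (X ^~ w) n) x k)%:R * f (k%:R * (1 / 2 ^+ n)) (mesh 1 (X ^~ w) n k - x))
  /\ bmf (fun w => f (k%:R * (1 / 2 ^+ n)) (mesh 1 (X ^~ w) n k - x)).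
  pose A (m : nat) (s : seqR R) : R := (fp (fun j => s (j * 2 ^ m)%N) x k)%:R.
  have mA m : measurable_fun setT (A m).
    have mk j : measurable_fun setT (fun s : seqR R => (fun j => s (j * 2 ^ m)%N) j).
      exact: (@measurable_coord R (j * 2 ^ m)%N).
    exact: (bmf_fp k mk (measurable_cst x)).1.
  have A1 m s : `|A m s| <= 1 by rewrite /A ger0_norm// lern1 leq_b1.
  have Aa w : A m (fun j => X ((minn j (k * 2 ^ m))%:R * (1 / 2 ^+ (n + m))) w) @[m --> \oo]
     --> ((fp (mesh 1 (X ^~ w) n) x k)%:R : R).
    apply: cvg_near_cst; apply: nearW => m; rewrite /A; congr (nat_of_bool _)%:R.
    apply: fp_ext => j jk; rewrite /mesh (minn_idPl _) ?leq_pmul2r ?expn_gt0//.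
    congr (X _ w); rewrite natrM natrX exprD; field.
    by rewrite !expf_neq0// pnatr_eq0.
  have [e1 [b1 b2]] := path_markov LX (x + h) mA A1 Aa
    (@remf_cont _ (u - k%:R * (1 / 2 ^+ n))) (@remf_bound _ (u - k%:R * (1 / 2 ^+ n))).
  have fE w : EFp P X (remf (u - k%:R * (1 / 2 ^+ n))) (x + h - X (k%:R * (1 / 2 ^+ n)) w) =
      f (k%:R * (1 / 2 ^+ n)) (mesh 1 (X ^~ w) n k - x).
    rewrite (EFp_residual alpha_gt1 SX ae_hit) /f /mesh max_l; last exact: t0.
    set b := X _ w; have -> : h - (b - x) = x + h - b by rewrite opprB addrA [h + x]addrC.
    exact: erefl.
  split; last by move: b1; under eq_fun do rewrite fE.
  by rewrite e1; apply: Ex_eq => w; rewrite fE.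
have bfp n k : bmf (fun w => (fp (mesh 1 (X ^~ w) n) x k)%:R : R).
  by apply: bmf_fp => // j; exact: Xm.
have bFp n k : bmf (fun w => Fp (remf (u - k%:R * (1 / 2 ^+ n)))
       (fun s => X (k%:R * (1 / 2 ^+ n) + s) w - X (k%:R * (1 / 2 ^+ n)) w)
       (x + h - X (k%:R * (1 / 2 ^+ n)) w)).
  apply: (bmf_Fp LX _ (t0 k n)); [exact: remf_cont|exact: remf_bound].
have eqn n : Ex P (fun w => restart n x h u (X ^~ w)) =
    Ex P (fun w => grid (n * 2 ^ n) (1 / 2 ^+ n) f (mesh 1 (X ^~ w) n) x).
  rewrite /restart Ex_sum; last by move=> k; exact: bmfM.
  Transparent grid. rewrite /grid. Opaque grid.
  rewrite [RHS]Ex_sum; last by move=> k; apply: bmfM => //; exact: (key n k).2.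
  by apply: eq_bigr => k _; exact: (key n k).1.
have l1 : Ex P (fun w => restart n x h u (X ^~ w)) @[n --> \oo] --> residual (x + h) u.
  rewrite -(EFp_residual alpha_gt1 SX ae_hit) EFpE; apply: (Ex_cvg (C := Num.max u 0)).
  - move=> n; rewrite /restart; apply: (bmf_sum _ _).1 => k; exact: bmfM.
  - have := bmf_Fp LX (x + h) (lexx 0) (@remf_cont _ u) (@remf_bound _ u).
    move=> [+ _]; apply: eq_measurable_fun => w _; rewrite X0 subr0; congr Fp.
    by apply/funext => s; rewrite add0r subr0.
  - by move=> n w; exact: restart_bound.
  - by apply: aeW => w; apply: restart_cvg => //; exact: (levy_rcont LX).
have l2 := grid_EFp (y := x) LX (@ltr01 R) cf fC.
move: l1; under eq_fun do rewrite eqn; move=> l1.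
rewrite (cvg_unique _ l1 l2)// (EFp_tau SX (ae_hit x0) cf fC).
by apply: Ex_eq => w; rewrite /f max_l// tau_ge0.
Qed.

(** The weight [a] is the indicator that the path stays at or below x during [0, t]; it is hidden
    behind the properties used later. On that event the passage over x after t is the passage over x
    - X t of the restarted path. *)
Lemma fixed_time_markov x i0 n0 : let t : R := i0%:R * (1 / 2 ^+ n0) in
  exists a : Omega -> R, [/\ bmf a, forall w, 0 <= a w <= 1,
    forall w, a w != 0 -> X t w <= x,
    forall w, hit (X ^~ w) x !=set0 -> t < tau x w -> a w = 1 &
    forall f C, continuous (fun p : R * R => f p.1 p.2) -> (forall s z, `|f s z| <= C) ->
      0 < x ->
      Ex P (fun w => a w * f (tau x w - t) (ovs x w)) = Ex P (fun w => a w * EFp P X f (x - X t w))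
      /\ bmf (fun w => EFp P X f (x - X t w))].
Proof.
move=> t; have t0 : 0 <= t by rewrite mulr_ge0// divr_ge0// exprn_ge0.
pose below w := forall s, 0 <= s <= t -> X s w <= x.
pose a w : R := if `[< below w >] then 1 else 0.
pose A (m : nat) (s : seqR R) : R := [forall j : 'I_(i0 * 2 ^ m).+1, s j <= x]%:R.
have mA m : measurable_fun setT (A m).
  rewrite /A (_ : (fun s => _) = \1_(\bigcap_(j in [set j | (j < (i0 * 2 ^ m).+1)%N]) [set s : seqR R | s j <= x])).
    have mB : measurable (\bigcap_(j in [set j | (j < (i0 * 2 ^ m).+1)%N]) [set s : seqR R | s j <= x]).
      apply: bigcap_measurableType => // j _.
      by apply: measurable_le_set; [exact: measurable_coord|exact: measurable_cst].
    exact: measurable_indic.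
  apply/funext => s; rewrite indicE; congr (nat_of_bool _)%:R.
  apply/forallP/idP => [h|]; first by rewrite inE => j /= jm; exact: (h (Ordinal jm)).
  by rewrite inE => h -[j jm]; exact: h.
have A1 m s : `|A m s| <= 1 by rewrite /A ger0_norm// lern1 leq_b1.
have tE m : (i0 * 2 ^ m)%:R * (1 / 2 ^+ (n0 + m)) = t :> R.
  rewrite /t exprD natrM natrX; field.
  by rewrite !expf_neq0// pnatr_eq0.
have Aa w : A m (fun j => X ((minn j (i0 * 2 ^ m))%:R * (1 / 2 ^+ (n0 + m))) w) @[m --> \oo] --> a w.
  rewrite /a; case: asboolP => [h|h].
    apply: cvg_near_cst; apply: nearW => m; rewrite /A (_ : [forall j, _])//.
    apply/forallP => -[j jm] /=; rewrite (minn_idPl _)//; apply: h.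
    by rewrite mulr_ge0 ?divr_ge0 ?exprn_ge0//= -(tE m) ler_pM2r ?divr_gt0 ?exprn_gt0// ler_nat.
  have [s [s0 st sx]] : exists s, [/\ 0 <= s, s <= t & x < X s w].
    apply: contrapT => h'; apply: h => s /andP[s0 st]; rewrite leNgt; apply/negP => xs.
    by apply: h'; exists s.
  (* An excess at time t itself is seen by every grid, t being a grid point; an earlier one is seen
     by fine grids. *)
  have [st'|st'] := eqVneq s t.
    apply: cvg_near_cst; apply: nearW => m; rewrite /A (_ : [forall j, _] = false)//.
    apply/negP => /forallP /(_ ord_max) /=.
    by rewrite minnn tE -st' leNgt sx.
  have hx : hit (X ^~ w) x s by [].
  have hx' : hit (X ^~ w) x !=set0 by exists s.
  have e0 : 0 < t - tau x w.
    by rewrite subr_gt0 (le_lt_trans (fpt_le hx))// lt_neqAle st'.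
  have rc : rcont (X ^~ w) by exact: (levy_rcont LX).
  have /= near_k := grid_near rc hx' (@ltr01 R) e0.
  apply: cvg_near_cst; near=> m; rewrite /A (_ : [forall j, _] = false)//.
  have [k [_ fpk /andP[_ kt]]] : exists k, [/\ (k < (n0 + m) * 2 ^ (n0 + m))%N,
      fp (mesh 1 (X ^~ w) (n0 + m)) x k &
      fpt (X ^~ w) x <= k%:R * (1 / 2 ^+ (n0 + m)) < fpt (X ^~ w) x + (t - tau x w)].
    near: m; exact: (@cvg_addnl n0 _ near_k).
  have kt' : (k < i0 * 2 ^ m)%N.
    rewrite -(@ltr_nat R) -(@ltr_pM2r _ (1 / 2 ^+ (n0 + m))) ?divr_gt0 ?exprn_gt0//.
    by rewrite tE (lt_le_trans kt)// addrC subrK.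
  apply/negP => /forallP /(_ (Ordinal (ltnW kt' : (k < (i0 * 2 ^ m).+1)%N))) /=.
  by rewrite (minn_idPl (ltnW kt')) leNgt; case/andP: fpk => ->.
exists a; split.
- by have [_ []] := path_markov LX 0 mA A1 Aa
    (@remf_cont _ 0) (@remf_bound _ 0).
- by move=> w; rewrite /a; case: ifP; rewrite lexx ler01.
- move=> w; rewrite /a; case: asboolP => [h _|]; last by rewrite eqxx.
  by apply: h; rewrite t0 lexx.
- move=> w h tt; rewrite /a asboolT// => s /andP[s0 st].
  rewrite leNgt; apply/negP => xs.
  by have := @fpt_le _ (X ^~ w) x s (conj s0 xs); rewrite leNgt (le_lt_trans st).
move=> f C cf fC x0.
have [e [b _]] := path_markov LX x mA A1 Aa cf fC.
split=> //; rewrite -e.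
have cf' : continuous (fun p : R * R => f (p.1 - t) p.2).
  move=> [s z]; apply: (@continuous_comp _ _ _ (fun p : R * R => (p.1 - t, p.2))
    (fun p : R * R => f p.1 p.2)); last exact: cf.
  apply: continuous_pair; last by apply: (continuous_snd_comp (f := id)) => ?; exact: cvg_id.
  apply: (continuous_fst_comp (f := fun s => s - t)) => ?.
  by apply: cvgB; [exact: cvg_id|exact: cvg_cst].
have ba : bmf a.
  by have [_ []] := path_markov LX 0 mA A1 Aa
    (@remf_cont _ 0) (@remf_bound _ 0).
apply: Ex_ae_eq.
- apply: bmfM => //.
  exact: (bmf_tau (f := fun s z => f (s - t) z) SX x cf' (fun s z => fC _ _)).
- by apply: bmfM => //; exact: (bmf_Fp LX _ t0 cf fC).
apply: filterS (ae_hit x0) => w h.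
rewrite /a; case: asboolP => bw; last by rewrite !mul0r.
rewrite mul1r [RHS]mul1r; transitivity (Fp (fun s z => f (s - t) z) (X ^~ w) x).
  by rewrite /ovs !Fp_hit.
by rewrite -(Fp_shift f t0 bw).
Unshelve. all: by end_near. Qed.

End markov.

(** Without an upper bound [sup] would be a default value. The times up to which g is bounded reach
    their supremum thanks to the left limit there, and go beyond it, unless it is 1, by
    right-continuity. *)
Lemma cadlag_bounded (R : realType) (g : R -> R) : cadlag g ->
  exists M, forall s, 0 <= s <= 1 -> g s <= M.
Proof.
move=> [rg lg].
pose S := [set t : R | 0 <= t <= 1 /\ exists M, forall s, 0 <= s <= t -> g s <= M].
have S0 : S 0.
  split; first by rewrite lexx ler01.
  by exists (g 0) => s /andP[s0 s1]; have -> : s = 0 by apply/eqP; rewrite eq_le s0 s1.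
have supS : has_sup S by split; [exists 0|exists 1 => t [/andP[]]].
set t := sup S.
have t0 : 0 <= t by apply: ub_le_sup => //; exact: supS.2.
have t1 : t <= 1 by apply: ge_sup; [exists 0|move=> r [/andP[]]].
have [t' [M [M1 [t'0 t't gM gM1]]]] : exists t' M M1, [/\ 0 <= t', t' <= t,
   forall s, 0 <= s <= t' -> g s <= M & forall s, t' < s < t -> g s <= M1].
  have [tE|tn0] := eqVneq t 0.
    exists 0, (g 0), 0; rewrite tE; split => // s.
      by move=> /andP[s0 s1]; have -> : s = 0 by apply/eqP; rewrite eq_le s0 s1.
    by move=> /andP[s0 s1]; have := lt_trans s0 s1; rewrite ltxx.
  have tgt0 : 0 < t by rewrite lt_neqAle eq_sym tn0.
  have /cvg_ex[l /cvgrPdist_lt/(_ _ ltr01)[d /= d0 H]] := lg _ tgt0.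
  have [r Sr rt] := sup_adherent d0 supS.
  have [/andP[r0 r1] [M rM]] := Sr.
  exists r, M, (l + 1); split => //.
    by apply: ub_le_sup => //; exact: supS.2.
  move=> s /andP[rs st]; have := H s; rewrite /= gtr0_norm ?subr_gt0// ltrBlDr -ltrBlDl.
  move=> /(_ (lt_trans rt rs) st); rewrite ltr_distlC => /andP[_ /ltW].
  by rewrite addrC.
have /cvgrPdist_lt/(_ _ ltr01)[d /= d0 H] := rg _ t0.
pose e := d / 2; have e0 : 0 < e by rewrite divr_gt0.
have ed : e < d by rewrite /e ltr_pdivrMr// mulr_natr mulr2n ltrDl.
pose N := Num.max M (Num.max M1 (g t + 1)).
have bN s : 0 <= s <= t + e -> g s <= N.
  move=> /andP[s0 st]; rewrite /N !le_max.
  have [st'|st'] := leP s t'; first by rewrite gM// s0.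
  have [stt|stt] := ltP s t; first by rewrite gM1 ?orbT// st'.
  move: stt; rewrite le_eqVlt => /predU1P[<-|stt]; first by rewrite lerDl ler01 !orbT.
  have := H s; rewrite /= ltr0_norm ?subr_lt0// opprB ltrBlDl.
  move=> /(_ (le_lt_trans st _) stt); rewrite ltrD2l => /(_ ed).
  by rewrite ltr_distlC => /andP[_ /ltW ->]; rewrite !orbT.
have Sm : S (Num.min (t + e) 1).
  split; first by rewrite le_min ler01 addr_ge0 ?(ltW e0)//= ge_min lexx orbT.
  exists N => s /andP[s0 sm]; apply: bN; rewrite s0 (le_trans sm)//.
  by rewrite ge_min lexx.
have : Num.min (t + e) 1 <= t by apply: ub_le_sup => //; exact: supS.2.
rewrite ge_min => /orP[|t1']; first by rewrite gerDl leNgt e0.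
by exists N => s /andP[s0 s1]; apply: bN; rewrite s0 (le_trans s1)// (le_trans t1')// lerDl ltW.
Qed.

(** * The running supremum and the debut of a closed half-line *)

Section supremum.
Context (R : realType) d (Omega : measurableType d) (P : probability Omega R)
  (X : R -> Omega -> R) (alpha : R).
Hypothesis alpha_gt1 : 1 < alpha.
Hypothesis SX : stable_levy_process P alpha X.

Let LX : levy_process P X. Proof. by case: SX. Qed.
Let X0 := levy_start LX.
Let Xm := levy_measurable LX.
Notation tau := (tau X).
Notation ovs := (ovs X).
Notation residual := (residual P X alpha).

Lemma running_supP y w : (running_sup X 1 w <= y) <-> forall s, 0 <= s <= 1 -> X s w <= y.
Proof.
split=> [h s s01|h].
  apply: le_trans h; apply: ub_le_sup; last by exists s => //=; rewrite in_itv.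
  have [M HM] := cadlag_bounded (levy_cadlag LX w).
  by exists M => _ [r /= + <-]; rewrite in_itv/=; exact: HM.
apply: ge_sup; first by exists (X 0 w), 0 => //=; rewrite in_itv/= lexx ler01.
by move=> _ [r /= + <-]; rewrite in_itv/=; exact: h.
Qed.

Lemma measurable_running_sup y : measurable [set w | running_sup X 1 w <= y].
Proof.
rewrite (_ : mkset _ = \bigcap_m \bigcap_(k in [set k | (k <= 2 ^ m)%N])
    [set w | X (k%:R * (1 / 2 ^+ m)) w <= y]).
  apply: bigcap_measurableType => // m _; apply: bigcap_measurableType => // k _.
  apply: measurable_le_set; last exact: measurable_cst.
  by apply: Xm; rewrite mulr_ge0// divr_ge0// exprn_ge0.
apply/seteqP; split => w /=.
  move=> /running_supP h m _ k /= km; apply: h.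
  rewrite mulr_ge0 ?divr_ge0 ?exprn_ge0//= mulrA mulr1 ler_pdivrMr ?exprn_gt0// mul1r.
  by rewrite -natrX ler_nat.
move=> h; apply/running_supP => s /andP[s0 s1]; rewrite leNgt; apply/negP => ys.
have hy : hit (X ^~ w) y s by [].
have [s1'|s1'] := eqVneq s 1.
  by have := h 0%N I 1%N (leqnn _); rewrite /= expr0 divr1 mulr1 -s1' leNgt ys.
have e0 : 0 < 1 - tau y w.
  by rewrite subr_gt0 (le_lt_trans (fpt_le hy))// lt_neqAle s1'.
have hy' : hit (X ^~ w) y !=set0 by exists s.
have rc : rcont (X ^~ w) by exact: (levy_rcont LX).
have [m0 _ /(_ _ (leqnn m0))] := grid_near rc hy' (@ltr01 R) e0.
move=> /= [k [_ /andP[fpk _] /andP[_ kt]]].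
have km : (k <= 2 ^ m0)%N.
  rewrite -(@ler_nat R) natrX -(@ler_pM2r _ (1 / 2 ^+ m0)) ?divr_gt0 ?exprn_gt0//.
  rewrite mul1r mulfV ?lt0r_neq0 ?exprn_gt0// -[X in X <= _]mul1r -[X in X * _]/(1%R).
  by move: kt; rewrite [fpt _ _ + _]addrC subrK mul1r mul1r => /ltW.
by have /= := h m0 I k km; rewrite leNgt; move: fpk; rewrite /mesh => ->.
Qed.

Definition Fsup y : R := fine (P [set w | running_sup X 1 w <= y]).

(** By scaling the probability that y is never passed does not depend on y; it is at most [Fsup y],
    which vanishes as y tends to 0. *)
Lemma ae_hit_of_Fsup : Fsup y @[y --> 0^'+] --> (0 : R) ->
  forall y, 0 < y -> {ae P, forall w, hit (X ^~ w) y !=set0}.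
Proof.
move=> F0 y y0.
have mh z := measurable_hit SX z.
have e z : 0 < z -> fine (P (~` [set w | hit (X ^~ w) z !=set0])) =
    1 - fine (P [set w | hit (X ^~ w) 1 !=set0]).
  move=> z0; rewrite probability_setC// (scale_hit alpha_gt1 SX z0) fineB//.
  by rewrite fin_num_measure.
have le z : 0 < z -> 1 - fine (P [set w | hit (X ^~ w) 1 !=set0]) <= Fsup z.
  move=> z0; rewrite -(e _ z0); apply: fine_le.
  - by rewrite fin_num_measure//; exact: measurableC.
  - by rewrite fin_num_measure//; exact: measurable_running_sup.
  apply: le_measure; rewrite ?inE//; [exact: measurableC|exact: measurable_running_sup|].
  move=> w /= nh; apply/running_supP => s /andP[s0 _]; rewrite leNgt; apply/negP => zs.
  by apply: nh; exists s.
have le0 : 1 - fine (P [set w | hit (X ^~ w) 1 !=set0]) <= 0.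
  rewrite -(cvg_lim _ F0)//; apply: limr_ge; first by apply/cvg_ex; exists 0.
  by near=> z; apply: le; near: z; exact: nbhs_right_gt.
exists (~` [set w | hit (X ^~ w) y !=set0]); split => //; first exact: measurableC.
have p0 : fine (P (~` [set w | hit (X ^~ w) y !=set0])) = 0.
  by apply/eqP; rewrite eq_le fine_ge0// andbT e.
by rewrite -[LHS]fineK ?p0// fin_num_measure//; exact: measurableC.
Unshelve. all: by end_near. Qed.

Section hitting.
Hypothesis ae_hit : forall y, 0 < y -> {ae P, forall w, hit (X ^~ w) y !=set0}.

Let Y := tau 1.

Let mtau y : measurable_fun setT (tau y). Proof. exact: (measurable_tau SX). Qed.

(** Scaling in law is available for continuous functions; as j grows these tend to the indicator of
    [1, +oo[ for b = 1 and of ]1, +oo[ for b = 0. *)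
Let ramp (b : R) (j : nat) (s : R) : R := Num.min (Num.max (b + j%:R * (s - 1)) 0) 1.

Let ramp_cont b j : continuous (ramp b j).
Proof.
apply: continuous_minr; last exact: cst_continuous.
apply: continuous_maxr; last exact: cst_continuous.
move=> s; apply: cvgD; first exact: cvg_cst.
by apply: cvgMr; apply: cvgB; [exact: cvg_id|exact: cvg_cst].
Qed.

Let ramp_bound b j s : `|ramp b j s| <= 1.
Proof.
rewrite ger0_norm ?ge_min ?lexx ?orbT//.
by rewrite /ramp le_min ler01 andbT le_max lexx orbT.
Qed.

Let ramp1 s : ramp 1 j s @[j --> \oo] --> ((1 <= s)%R%:R : R).
Proof.
have [s1|s1] := leP 1 s.
  apply: cvg_near_cst; apply: nearW => j; rewrite /ramp min_r// le_max lerDl.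
  by rewrite mulr_ge0// subr_ge0.
apply: cvg_near_cst; near=> j; rewrite /ramp max_r ?min_l//.
rewrite -lerBrDl sub0r -(opprB 1 s) mulrN lerN2 -ler_pdivrMr ?subr_gt0//.
by near: j; exact: nbhs_infty_ger.
Unshelve. all: by end_near. Qed.

Let ramp0 s : ramp 0 j s @[j --> \oo] --> ((1 < s)%R%:R : R).
Proof.
have [s1|s1] := leP s 1.
  apply: cvg_near_cst; apply: nearW => j; rewrite /ramp max_r ?min_l//.
  by rewrite add0r mulr_ge0_le0// subr_le0.
apply: cvg_near_cst; near=> j; rewrite /ramp min_r// le_max add0r.
rewrite -ler_pdivrMr ?subr_gt0//; apply/orP; left.
by near: j; exact: nbhs_infty_ger.
Unshelve. all: by end_near. Qed.

Let scale_set b (A : set R) y : (forall s, ramp b j s @[j --> \oo] --> (\1_A s : R)) -> measurable A ->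
  0 < y -> P (tau y @^-1` A) = P [set w | A (y `^ alpha * Y w)].
Proof.
move=> rA mA y0.
have mYy : measurable_fun setT (fun w => y `^ alpha * Y w).
  by apply: measurable_funM => //; exact: mtau.
have mpre (f : Omega -> R) : measurable_fun setT f -> measurable (f @^-1` A).
  by move=> mf; rewrite -[X in measurable X]setTI; exact: mf.
have lim (f : Omega -> R) : measurable_fun setT f ->
    Ex P (fun w => ramp b j (f w)) @[j --> \oo] --> fine (P (f @^-1` A)).
  move=> mf; rewrite -Ex_indic; last exact: mpre.
  apply: (Ex_cvg (C := 1)).
  - move=> j; apply: (measurableT_comp (f := ramp b j)) => //.
    by apply: continuous_measurable_fun; exact: ramp_cont.
  - by apply: measurable_indic; exact: mpre.
  - by move=> j w; exact: ramp_bound.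
  - by apply: aeW => w; exact: rA.
have h1 := lim _ (mtau y).
have h2 := lim _ mYy.
move: h1; under eq_fun do rewrite (scale_tau alpha_gt1 SX ae_hit y0 (@ramp_cont b _) (ramp_bound b _)).
move=> h1.
rewrite -[LHS]fineK ?fin_num_measure//; last exact: mpre.
rewrite (cvg_unique _ h1 h2)// fineK// fin_num_measure//; exact: mpre.
Qed.

Lemma scale_ge y : 0 < y -> P [set w | 1 <= tau y w] = P [set w | 1 <= y `^ alpha * Y w].
Proof.
move=> y0; apply: (@scale_set 1 [set s | 1 <= s]) => //.
  move=> s; have := @ramp1 s; rewrite indicE; congr (_ --> _).
  by congr (nat_of_bool _)%:R; apply/idP/idP; rewrite inE.
by rewrite (_ : mkset _ = `[1, +oo[%classic)//; apply/seteqP; split=> s /=; rewrite in_itv/= andbT.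
Qed.

Lemma scale_gt y : 0 < y -> P [set w | 1 < tau y w] = P [set w | 1 < y `^ alpha * Y w].
Proof.
move=> y0; apply: (@scale_set 0 [set s | 1 < s]) => //.
  move=> s; have := @ramp0 s; rewrite indicE; congr (_ --> _).
  by congr (nat_of_bool _)%:R; apply/idP/idP; rewrite inE.
by rewrite (_ : mkset _ = `]1, +oo[%classic)//; apply/seteqP; split=> s /=; rewrite in_itv/= andbT.
Qed.

Let mge f c : measurable_fun setT f -> measurable [set w : Omega | c <= (f w : R)].
Proof. by move=> mf; apply: measurable_le_set => //; exact: measurable_cst. Qed.
Let mgt f c : measurable_fun setT f -> measurable [set w : Omega | c < (f w : R)].
Proof. by move=> mf; apply: measurable_lt_set => //; exact: measurable_cst. Qed.

(** With y = s^(-1/alpha), the event S_1 <= y lies almost surely between tau_y > 1 and tau_y >= 1,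
    and tau_y has the law of Y / s. The weak inequality here and the strict one in [Fsup_ge] differ
    by a possible atom, which does not affect the asymptotics. *)
Lemma Fsup_le s : 0 < s -> Fsup (s `^ (- alpha^-1)) <= fine (P [set w | s <= Y w]).
Proof.
move=> s0; set y := s `^ _; have y0 : 0 < y by exact: powR_gt0.
have a0 := alpha_gt0 alpha_gt1.
have ya : y `^ alpha = s^-1.
  by rewrite /y -powRrM mulNr mulVf ?gt_eqF// powRN powRr1// ltW.
have -> : [set w | s <= Y w] = [set w | 1 <= y `^ alpha * Y w].
  by apply/seteqP; split => w /=; rewrite ya [_ * Y w]mulrC ler_pdivlMr// mul1r.
rewrite -scale_ge//; apply: fine_le.
- by rewrite fin_num_measure//; exact: measurable_running_sup.
- by rewrite fin_num_measure//; exact: mge.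
have [N [mN N0 hN]] := ae_hit y0.
rewrite -[leRHS]adde0 -N0.
apply: le_trans (measureU2 _ _ _) => //; last exact: mge.
apply: le_measure; rewrite ?inE//; first exact: measurable_running_sup.
  by apply: measurableU => //; exact: mge.
move=> w /= /running_supP h; have [nh|h'] := pselect (N w); first by right.
have hw : hit (X ^~ w) y !=set0 by apply: contrapT => nh; apply: h'; exact: hN.
left; apply: lb_le_inf => // r [r0 yr]; rewrite leNgt; apply/negP => r1.
by have := h r; rewrite r0 (ltW r1) => /(_ isT); rewrite leNgt yr.
Qed.

Lemma Fsup_ge s : 0 < s -> fine (P [set w | s < Y w]) <= Fsup (s `^ (- alpha^-1)).
Proof.
move=> s0; set y := s `^ _; have y0 : 0 < y by exact: powR_gt0.
have a0 := alpha_gt0 alpha_gt1.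
have ya : y `^ alpha = s^-1.
  by rewrite /y -powRrM mulNr mulVf ?gt_eqF// powRN powRr1// ltW.
have -> : [set w | s < Y w] = [set w | 1 < y `^ alpha * Y w].
  by apply/seteqP; split => w /=; rewrite ya [_ * Y w]mulrC ltr_pdivlMr// mul1r.
rewrite -scale_gt//; apply: fine_le.
- by rewrite fin_num_measure//; exact: mgt.
- by rewrite fin_num_measure//; exact: measurable_running_sup.
apply: le_measure; rewrite ?inE//; [exact: mgt|exact: measurable_running_sup|].
move=> w /= h; apply/running_supP => r /andP[r0 r1]; rewrite leNgt; apply/negP => yr.
by have := @fpt_le _ (X ^~ w) y r (conj r0 yr); rewrite leNgt (le_lt_trans r1 h).
Qed.

(* The debut of the closed half-line lies between the debuts of the open
   half-lines ]y, +oo[ for y < x and ]x, +oo[, whose laws depend continuously on the level. *)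
Lemma first_passageE x : 0 < x -> {ae P, forall w, first_passage X x w = (tau x w)%:E}.
Proof.
move=> x0.
pose H w := [set s : R | 0 < s /\ x <= X s w].
have subH w : hit (X ^~ w) x `<=` H w.
  move=> s [s0 xs]; split; last exact: ltW.
  rewrite lt_neqAle s0 andbT eq_sym; apply/negP => /eqP sE.
  by move: xs; rewrite sE X0 ltNge (ltW x0).
have subH' y w : y < x -> H w `<=` hit (X ^~ w) y.
  by move=> yx s [s0 xs]; split; [exact: ltW|exact: lt_le_trans xs].
have fpE w : hit (X ^~ w) x !=set0 -> first_passage X x w = (inf (H w))%:E.
  move=> [s hs]; rewrite /first_passage; apply: ereal_inf_EFin.
    by exists 0 => r [/ltW].
  by exists s; exact: subH.
pose y_ n : R := x - x / n.+2%:R.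
have y_x n : y_ n < x by rewrite /y_ gtrBl divr_gt0.
have y_0 n : 0 < y_ n by rewrite /y_ subr_gt0 ltr_pdivrMr// ltr_pMr// ltr1n.
have cy : y_ n @[n --> \oo] --> x.
  rewrite -[X in _ --> X]subr0; apply: cvgB; first exact: cvg_cst.
  rewrite -[X in _ --> X](mulr0 x); apply: cvgMr.
  exact: (cvg_comp (addn 1) (fun n => n.+1%:R^-1)) (@cvg_addnl 1) (@cvg_harmonic R).
(* Truncation at u keeps the difference of the two passage times bounded; its mean tends to 0 by
   continuity of [residual] in the level. *)
pose D (u : nat) n w := Num.max (u%:R - tau (y_ n) w) 0 - Num.max (u%:R - tau x w) 0.
have mD u n : measurable_fun setT (D u n).
  by apply: measurable_funB; apply: measurable_maxr => //; apply: measurable_funB => //; exact: mtau.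
have bmax u y : bmf (fun w => Num.max (u%:R - tau y w) 0).
  split; first by apply: measurable_maxr => //; apply: measurable_funB => //; exact: mtau.
  by exists (Num.max u%:R 0) => w; apply: norm_max0_sub_le; exact: tau_ge0.
have resE u y : 0 < y -> Ex P (fun w => Num.max (u%:R - tau y w) 0) = residual y u%:R.
  move=> y0; rewrite -(EFp_residual alpha_gt1 SX ae_hit).
  rewrite (EFp_tau SX (ae_hit y0) (@remf_cont _ _) (@remf_bound _ _)).
  by apply: Ex_eq => w; rewrite /remf [Num.max (tau y w) 0]max_l//; exact: tau_ge0.
have ED u : Ex P (D u n) @[n --> \oo] --> (0 : R).
  have -> : (fun n => Ex P (D u n)) = (fun n => residual (y_ n) u%:R - residual x u%:R).
    by apply/funext => n; rewrite ExB// !resE.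
  rewrite -[X in _ --> X](subrr (residual x u%:R)); apply: cvgB; last exact: cvg_cst.
  apply: (cvg_comp y_ (residual ^~ u%:R) cy).
  exact: (residual_continuousl alpha_gt1 SX).
have D0 u n w : hit (X ^~ w) x !=set0 -> 0 <= D u n w.
  move=> h; rewrite subr_ge0; apply: max0_homo; rewrite lerD2l lerN2.
  by apply: lb_le_inf => // s /subH /subH' hs; apply: fpt_le; exact: hs.
have bad u j : P.-negligible [set w | forall n, j.+1%:R^-1 <= D u n w].
  pose A := [set w | forall n, j.+1%:R^-1 <= D u n w].
  have mA : measurable A.
    rewrite /A (_ : mkset _ = \bigcap_n [set w | j.+1%:R^-1 <= D u n w]).
      by apply: bigcap_measurableType => // n _; apply: measurable_le_set => //; exact: measurable_cst.
    by apply/seteqP; split => w h n; [move=> _|]; exact: h.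
  exists A; split => //.
  have le n : j.+1%:R^-1 * fine (P A) <= Ex P (D u n).
    rewrite -Ex_indic// -ExZ; last exact: bmf_indic.
    apply: (@le_trans _ _ (Ex P (fun w => `|D u n w|))).
      apply: le_Ex; first by apply: bmfZ; exact: bmf_indic.
        by apply: bmf_norm; apply: bmfB.
      move=> w; rewrite indicE; case: (boolP (w \in A)) => wA; last by rewrite mulr0.
      by rewrite mulr1 (le_trans _ (ler_norm _))//; move: wA; rewrite inE; exact.
    rewrite (@Ex_ae_eq _ _ _ P (fun w => `|D u n w|) (D u n))//.
    - by apply: bmf_norm; apply: bmfB.
    - exact: bmfB.
    - by apply: filterS (ae_hit x0) => w h; rewrite ger0_norm// D0.
  have le0 : j.+1%:R^-1 * fine (P A) <= 0.
    rewrite -(cvg_lim _ (ED u))//; apply: limr_ge; first by apply/cvg_ex; exists 0.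
    by apply: nearW => n; exact: le.
  have p0 : fine (P A) = 0.
    apply/eqP; rewrite eq_le fine_ge0// andbT.
    by move: le0; rewrite pmulr_rle0// invr_gt0.
  by rewrite -[LHS]fineK ?p0// fin_num_measure.
have : P.-negligible (~` [set w | hit (X ^~ w) x !=set0] `|`
    \bigcup_u \bigcup_j [set w | forall n, j.+1%:R^-1 <= D u n w]).
  apply: negligibleU; first exact: (ae_hit x0).
  by apply: negligible_bigcup => u; apply: negligible_bigcup => j; exact: bad.
apply: negligibleS => w /= nE.
have [h|h] := pselect (hit (X ^~ w) x !=set0); last by left.
right; apply: contrapT => nbad; apply: nE; rewrite fpE//; congr EFin.
have lbH : has_lbound (H w) by exists 0 => r [/ltW].
have Hne : H w !=set0 by case: h => s /subH; exists s.
have infle : inf (H w) <= tau x w.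
  by apply: lb_le_inf => // s /subH hs; exact: ge_inf.
apply/eqP; rewrite eq_le infle andTb leNgt; apply/negP => lt.
pose u := (Num.truncn (tau x w)).+1.
have tu : tau x w < u%:R by have /andP[] := truncn_itv (tau_ge0 X x w).
pose j := Num.truncn (tau x w - inf (H w))^-1.
have dl0 : 0 < tau x w - inf (H w) by rewrite subr_gt0.
have jd : j.+1%:R^-1 <= tau x w - inf (H w).
  rewrite -[leRHS]invrK lef_pV2 ?posrE ?invr_gt0//.
  have i0 : 0 <= (tau x w - inf (H w))^-1 by rewrite invr_ge0 ltW.
  by apply: ltW; have /andP[] := truncn_itv i0.
apply: nbad; exists u => //; exists j => // n /=.
rewrite /D [X in _ - X]max_l ?subr_ge0 ?(ltW tu)// max_l; last first.
  by rewrite subr_ge0 (le_trans _ (ltW tu))// (le_trans _ infle)//; apply: lb_le_inf => // s /subH' hs; exact/fpt_le/hs.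
apply: (le_trans jd); rewrite [leRHS](_ : _ = tau x w - tau (y_ n) w); last by ring.
rewrite lerD2l lerN2; apply: lb_le_inf => // s /subH' hs; exact/fpt_le/hs.
Qed.

End hitting.
End supremum.

Transparent Ex grid Fp EFp.

Lemma Ex_law d (T : measurableType d) d' (S : measurableType d') (R : realType)
    (P : probability T R) (g h : T -> S) (f : S -> R) :
  measurable_fun setT g -> measurable_fun setT h ->
  (forall B, measurable B -> P (g @^-1` B) = P (h @^-1` B)) -> bmf f ->
  Ex P (fun w => f (g w)) = Ex P (fun w => f (h w)).
Proof.
move=> mg mh gh bf.
have [n1 [n1E n1I]] := image_probability P mg.
have [n2 [n2E n2I]] := image_probability P mh.
have [mf [C fC]] := bf.
have bg : bmf (fun w => f (g w)) by exact: (bmf_comp mg bf).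
have bh : bmf (fun w => f (h w)) by exact: (bmf_comp mh bf).
pose F s := (f s + C)%:E.
have mF : measurable_fun setT F by apply/measurable_EFinP; apply: measurable_funD.
have F0 s : (0 <= F s)%E.
  by rewrite lee_fin -lerBlDr sub0r; have := fC s; rewrite ler_norml => /andP[].
have : (\int[n1]_s F s = \int[n2]_s F s)%E.
  have n12 A : measurable A -> n1 A = n2 A.
    by move=> mA; apply: etrans (n1E A) _; apply: etrans (gh A mA) _; exact/esym/n2E.
  by apply: eq_measure_integral => A mA _; first [exact: n12|exact/esym/n12|have := n12 _ mA => -> ].
rewrite n1I// n2I// -[LHS]ExE; last by apply: bmfD => //; exact: bmf_cst.
rewrite -[RHS]ExE; last by apply: bmfD => //; exact: bmf_cst.
move=> [].
by rewrite !ExD//; try exact: bmf_cst; move=> /addIr.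
Qed.

Lemma ae_of_fine0 d (T : measurableType d) (R : realType) (P : probability T R) (A : set T) :
  measurable A -> fine (P A) = 0 -> {ae P, forall w, ~ A w}.
Proof.
move=> mA pA; exists A; split => //; last by move=> w /= /contrapT.
by rewrite -[LHS]fineK ?pA// fin_num_measure.
Qed.

Lemma fine0_of_ae d (T : measurableType d) (R : realType) (P : probability T R) (A : set T) :
  measurable A -> {ae P, forall w, ~ A w} -> fine (P A) = 0.
Proof.
move=> mA [N [mN N0 AN]].
have : (P A <= P N)%E by apply: le_measure; rewrite ?inE// => w Aw; apply: AN.
by rewrite N0 => pA; have -> : P A = 0%E by apply/eqP; rewrite eq_le pA measure_ge0.
Qed.

Lemma fine_probability_le1 d (T : measurableType d) (R : realType) (P : probability T R) (A : set T) :
  measurable A -> fine (P A) <= 1.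
Proof. by move=> mA; rewrite -lee_fin fineK ?fin_num_measure//; exact: probability_le1. Qed.

Lemma fine_probability_mono d (T : measurableType d) (R : realType) (P : probability T R) (A B : set T) :
  measurable A -> measurable B -> A `<=` B -> fine (P A) <= fine (P B).
Proof.
move=> mA mB AB; rewrite -lee_fin !fineK ?fin_num_measure//.
by apply: le_measure; rewrite ?inE.
Qed.

Opaque Ex.

(** * The law of X 1: no atoms, mass on both sides of 0 *)

Section nondegenerate.
Context (R : realType) d (Omega : measurableType d) (P : probability Omega R)
  (X : R -> Omega -> R) (alpha : R).
Hypothesis alpha_gt1 : 1 < alpha.
Hypothesis SX : stable_levy_process P alpha X.

Let LX : levy_process P X. Proof. by case: SX. Qed.
Let X0 := levy_start LX.
Let Xm := levy_measurable LX.

Let mX1 : measurable_fun setT (X 1). Proof. exact: Xm. Qed.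
Let mX21 : measurable_fun setT (fun w => X 2 w - X 1 w).
Proof. by apply: measurable_funB; apply: Xm. Qed.

Lemma indep_X12 (f : R * R -> R) : bmf f ->
  Ex P (fun w => f (X 1 w, X 2 w - X 1 w)) = Ex P (fun w => Ex P (fun w' => f (X 1 w, X 1 w'))).
Proof.
move=> bf; apply: (Ex_independent mX1 mX21 mX1 _ bf).1 => A B mA mB.
have xi0 : incr X 1 0 = X 1 by apply/funext => w; rewrite /incr !mulr1 mulr0n X0 subr0.
have xi1 : incr X 1 1 = (fun w => X 2 w - X 1 w).
  by apply/funext => w; rewrite /incr !mulr1.
have := @incr_indep _ _ _ _ _ LX 1 (@ltr01 R) 2 (fun i => if i == 0%N then A else B) _.
rewrite !big_ord_recl big_ord0/= mule1 /bump/= !addn0 (incr_stat LX (@ltr01 R) 1)// xi0.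
move=> <-; last by move=> i; case: ifP.
congr (P _); apply/seteqP; split=> [w [/= Aw Bw] [|[|//]] _ /=|w /= h].
- by rewrite xi0.
- by rewrite xi1.
- by split; [have := h 0%N isT; rewrite /= xi0|have := h 1%N isT; rewrite /= xi1].
Qed.

Lemma law_X t (B : set R) : 0 < t -> measurable B ->
  P (X t @^-1` B) = P ((fun w => t `^ alpha^-1 * X 1 w) @^-1` B).
Proof.
move=> t0 mB; have [_ _ /(_ t t0 [set f | B (f 1)]) h] := SX.
have := h; rewrite /= mulr1; apply.
by apply: sub_sigma_algebra; exists 1, B; split.
Qed.

Lemma Ex_X t (f : R -> R) : 0 < t -> bmf f ->
  Ex P (fun w => f (X t w)) = Ex P (fun w => f (t `^ alpha^-1 * X 1 w)).
Proof.
move=> t0 bf; apply: Ex_law => //; first by apply: Xm; exact: ltW.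
  by apply: measurable_funM.
by move=> B mB; exact: law_X.
Qed.

(** If X 1 vanished almost surely, so would X t for every t by scaling, then all dyadic times at
    once, then the whole path by right-continuity, which the definition of a stable process
    excludes. *)
Lemma nontrivial_X1 : ~ {ae P, forall w, X 1 w = 0}.
Proof.
move=> h; have [_ + _] := SX; apply.
have ht t : 0 <= t -> {ae P, forall w, X t w = 0}.
  rewrite le_eqVlt => /predU1P[<-|t0]; first by apply: aeW => w; exact: X0.
  have mN : measurable (~` [set (0 : R)]) by exact: measurableC.
  have m1 : measurable ((fun w => t `^ alpha^-1 * X 1 w) @^-1` (~` [set 0])).
    by rewrite -[X in measurable X]setTI; apply: measurable_funM.
  have m2 : measurable (X t @^-1` (~` [set 0])).
    by rewrite -[X in measurable X]setTI; apply: Xm => //; exact: ltW.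
  have : fine (P (X t @^-1` (~` [set 0]))) = 0.
    rewrite law_X//; apply: fine0_of_ae => //.
    by apply: filterS h => w Xw /=; rewrite Xw mulr0.
  by move/(ae_of_fine0 m2); apply: filterS => w /= /contrapT.
have : {ae P, forall w, forall m k : nat, X (k%:R * (1 / 2 ^+ m)) w = 0}.
  apply/ae_foralln => m; apply/ae_foralln => k; apply: ht.
  by rewrite mulr_ge0// divr_ge0// exprn_ge0.
apply: filterS => w h0 t t0; apply/eqP/negPn/negP => Xt0.
have n0 : 0 < `|X t w| by rewrite normr_gt0.
have [dl dl0 H] := rcontP (@levy_rcont _ _ _ _ _ LX w) t0 n0.
have [m _ /(_ m (leqnn m)) /= md] := near_mesh (@ltr01 R) dl0.
set D := 1 / 2 ^+ m in md; have D0 : 0 < D by rewrite divr_gt0// exprn_gt0.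
have /andP[k1 k2] := truncn_itv (divr_ge0 t0 (ltW D0)).
set k := (Num.truncn (t / D)).+1 in k2.
suff /H : t <= k%:R * D < t + dl by rewrite h0 subr0 ltxx.
rewrite -ler_pdivrMr// (ltW k2)/= /k -natr1 mulrDl mul1r.
by apply: ler_ltD => //; rewrite -ler_pdivlMr.
Qed.

(** The factor 2^(1/alpha) carries the law of X 1 to that of X 2. It is less than 2, the factor of a
    deterministic linear motion, because alpha > 1. *)
Let two_root : 1 < (2 : R) `^ alpha^-1 < 2.
Proof.
have a0 : 0 < alpha^-1 by rewrite invr_gt0 (lt_trans ltr01).
have a1 : alpha^-1 < 1 by rewrite invf_lt1 // (lt_trans ltr01).
have l2 : 0 < ln (2 : R) by rewrite ln_gt0// ltr1n.
have two0 : (2 : R) != 0 by rewrite pnatr_eq0.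
rewrite /powR (negPf two0); apply/andP; split.
  by rewrite -[ltLHS]expR0 ltr_expR mulr_gt0.
by rewrite -[ltRHS](@lnK _ 2) ?posrE// ltr_expR gtr_pMl.
Qed.

(* With Z = exp(-|X_1|), stability and independence give E Z^theta = (E Z)^2 for
   theta = 2^(1/alpha) < 2, whereas E Z^theta >= E Z^2 >= (E Z)^2 and Z is in ]0, 1]. *)
Lemma one_sided (e : R) : e = 1 \/ e = -1 -> ~ {ae P, forall w, 0 <= e * X 1 w}.
Proof.
move=> e1 hpos; apply: nontrivial_X1.
have /andP[th1 th2] := two_root; set th := _ `^ _ in th1 th2.
pose f (x : R) := expR (- Num.max (e * x) 0).
have mf : measurable_fun setT f.
  apply: measurableT_comp => //; apply: measurable_funN => //.
  by apply: measurable_maxr => //; exact: measurable_funM.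
have f1 x : f x <= 1 by rewrite /f -expR0 ler_expR oppr_le0 max0_ge0.
have bf : bmf f by split => //; exists 1 => x; rewrite ger0_norm ?expR_ge0.
pose Z w := f (X 1 w).
have bZ : bmf Z by exact: (bmf_comp mX1 bf).
pose a := Ex P Z.
have e2 : {ae P, forall w, 0 <= e * (X 2 w - X 1 w)}.
  pose g (p : R * R) : R := \1_[set x : R | e * x < 0] p.2.
  have mA : measurable [set x : R | e * x < 0].
    by apply: measurable_lt_set => //; exact: measurable_funM.
  have bg : bmf g.
    by apply: (bmf_comp (g := snd) (f := \1_[set x : R | e * x < 0])) => //; exact: bmf_indic.
  have := indep_X12 bg; rewrite /g /=.
  have mpre (h : Omega -> R) : measurable_fun setT h -> measurable (h @^-1` [set x | e * x < 0]).
    by move=> mh; rewrite -[X in measurable X]setTI; exact: mh.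
  rewrite -[X in X = _](_ : Ex P \1_((fun w => X 2 w - X 1 w) @^-1` [set x | e * x < 0]) = _); last first.
    by apply: Ex_eq => w.
  rewrite Ex_indic; last exact: mpre.
  have in0 : Ex P (fun w => \1_[set x : R | e * x < 0] (X 1 w)) = 0.
    rewrite [LHS](_ : _ = Ex P \1_(X 1 @^-1` [set x | e * x < 0])); last by apply: Ex_eq.
    rewrite Ex_indic; last exact: mpre.
    apply: fine0_of_ae; first exact: mpre.
    by apply: filterS hpos => w' h /=; rewrite ltNge h.
  rewrite in0 Ex_cst => /(ae_of_fine0 (mpre _ mX21)).
  by apply: filterS => w /= /negP; rewrite -leNgt.
have h2 : Ex P (fun w => f (X 2 w)) = a ^+ 2.
  pose g (p : R * R) := f p.1 * f p.2.
  have bg : bmf g.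
    apply: bmfM; first exact: (bmf_comp (@measurable_fst _ _ R R) bf).
    exact: (bmf_comp (@measurable_snd _ _ R R) bf).
  transitivity (Ex P (fun w => g (X 1 w, X 2 w - X 1 w))).
    apply: Ex_ae_eq.
    - by apply: (bmf_comp _ bf); exact: Xm.
    - by apply: (bmf_comp _ bg); exact: measurable_fun_pair.
    - apply: filterS2 hpos e2 => w h h'.
      rewrite /g /f /= -expRD -opprD [Num.max (e * X 1 w) 0]max_l// [Num.max (e * (_ - _)) 0]max_l//.
      rewrite -mulrDr addrC subrK max_l//.
      by rewrite -(subrK (X 1 w) (X 2 w)) mulrDr addr_ge0.
  rewrite indep_X12// /g /=.
  under Ex_eq => w do rewrite ExZ// mulrC.
  by rewrite ExZ// expr2.
have h3 : Ex P (fun w => f (X 2 w)) = Ex P (fun w => Z w `^ th).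
  rewrite (Ex_X (ltr0n R 2) bf); apply: Ex_eq => w.
  rewrite /Z /f -/th -expRM; congr expR; rewrite mulNr; congr (- _).
  rewrite mulrCA; have [h|h] := leP 0 (e * X 1 w).
    rewrite max_l; first by rewrite mulrC.
    by rewrite mulr_ge0// powR_ge0.
  rewrite mul0r max_r//.
  by rewrite mulr_ge0_le0 ?powR_ge0 ?(ltW h).
have bZth : bmf (fun w => Z w `^ th).
  split; first by apply: (measurableT_comp (@measurable_powR R th)) => //; exact: bZ.1.
  have p1 : 1 `^ th = 1 by rewrite powR1.
  exists 1 => w; rewrite ger0_norm ?powR_ge0// -[leRHS]p1.
  by apply: ge0_ler_powR; rewrite ?nnegrE ?expR_ge0 ?f1// ltW// (lt_trans ltr01).
have bZ2 : bmf (fun w => Z w * Z w) by exact: bmfM.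
have var : a ^+ 2 <= Ex P (fun w => Z w * Z w).
  have : 0 <= Ex P (fun w => Z w * Z w - 2 * a * Z w + a ^+ 2).
    by apply: Ex_ge0 => w; rewrite [leRHS](_ : _ = (Z w - a) ^+ 2) ?sqr_ge0//; ring.
  rewrite ExD ?ExB ?ExZ ?Ex_cst//; try by [exact: bmf_cst|exact: bmfZ].
    by rewrite -/a; lra.
  by apply: bmfB => //; exact: bmfZ.
have ZZ w : Z w * Z w <= Z w `^ th.
  rewrite -expr2 -powR_mulrn ?expR_ge0//; apply: ger_powR; last exact: ltW.
  by rewrite expR_gt0 f1.
have b0 : bmf (fun w => Z w `^ th - Z w * Z w) by exact: bmfB.
have E0 : Ex P (fun w => Z w `^ th - Z w * Z w) = 0.
  apply/eqP; rewrite eq_le Ex_ge0 ?andbT => [|w]; last by rewrite subr_ge0.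
  by rewrite ExB// -h3 h2 subr_le0.
have d0 w : 0 <= Z w `^ th - Z w * Z w by rewrite subr_ge0.
apply: filterS2 hpos (Ex_eq0 b0 d0 E0) => w h /eqP.
rewrite subr_eq0 -expRM -expRD => /eqP/expR_inj; rewrite max_l// => e0.
have : e * X 1 w = 0 by nra.
by move=> /eqP; rewrite mulf_eq0; case: e1 => ->; rewrite ?oppr_eq0 oner_eq0 => /eqP.
Qed.

(** If e X_1 exceeds c with positive probability, so do e times two independent increments at once,
    and e X_2 then exceeds 2 c; by scaling e X_1 exceeds 2 c / th with positive probability, where
    th < 2. Iterating makes the level grow geometrically. *)
Lemma unbounded_X1 C : ~ {ae P, forall w, `|X 1 w| <= C}.
Proof.
move=> hC.
have /andP[th1 th2] := two_root; set th := _ `^ _ in th1 th2.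
have mgt (f : Omega -> R) c : measurable_fun setT f -> measurable [set w | c < f w].
  by move=> mf; apply: measurable_lt_set.
have step (e c : R) : 0 < fine (P [set w | c < e * X 1 w]) ->
    0 < fine (P [set w | 2 / th * c < e * X 1 w]).
  move=> h.
  have m1 (f : Omega -> R) : measurable_fun setT f -> measurable_fun setT (fun w => e * f w).
    by move=> mf; exact: measurable_funM.
  pose g (p : R * R) : R := \1_[set x : R | c < e * x] p.1 * \1_[set x : R | c < e * x] p.2.
  have mA : measurable [set x : R | c < e * x].
    by apply: measurable_lt_set => //; exact: measurable_funM.
  have bg : bmf g.
    apply: bmfM.
      by apply: (bmf_comp (g := fst) (f := \1_[set x : R | c < e * x])) => //; exact: bmf_indic.
    by apply: (bmf_comp (g := snd) (f := \1_[set x : R | c < e * x])) => //; exact: bmf_indic.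
  have i1 : bmf (fun w => \1_[set x : R | c < e * x] (X 1 w) : R).
    by apply: (bmf_comp mX1); exact: bmf_indic.
  have E1 : Ex P (fun w => \1_[set x : R | c < e * x] (X 1 w)) = fine (P [set w | c < e * X 1 w]).
    rewrite -Ex_indic; last exact: mgt (m1 _ mX1).
    exact: Ex_eq.
  have := indep_X12 bg; rewrite /g /=.
  under [X in _ = X -> _]Ex_eq => w do rewrite ExZ// mulrC.
  rewrite ExZ// E1 => e12.
  have le : fine (P [set w | c < e * X 1 w]) * fine (P [set w | c < e * X 1 w]) <=
      fine (P [set w | 2 * c < e * X 2 w]).
    rewrite -e12 -Ex_indic; last by apply/mgt/m1; exact: Xm.
    apply: le_Ex.
    - by apply: (bmf_comp (g := fun w => (X 1 w, X 2 w - X 1 w)) _ bg); exact: measurable_fun_pair.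
    - by apply: bmf_indic; apply/mgt/m1; exact: Xm.
    move=> w; rewrite !indicE.
    case: (boolP (X 1 w \in _)) => w1; last by rewrite mul0r.
    case: (boolP (_ - _ \in _)) => w2; last by rewrite mulr0.
    rewrite mem_set ?mulr1//=; move: w1 w2; rewrite !inE /= => w1 w2.
    by rewrite (_ : e * X 2 w = e * X 1 w + e * (X 2 w - X 1 w)); [lra|ring].
  have : 0 < fine (P [set w | 2 * c < e * X 2 w]) by apply: lt_le_trans le; rewrite mulr_gt0.
  congr (0 < fine _).
  transitivity (P (X 2 @^-1` [set x | 2 * c < e * x])); first by [].
  rewrite law_X//; last by apply: measurable_lt_set => //; exact: measurable_funM.
  congr (P _); apply/seteqP; split=> w /=; rewrite -/th mulrCA;
    by rewrite [_ / _ * c]mulrAC ltr_pdivrMr ?(lt_trans ltr01)// [th * _]mulrC.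
have big (e c : R) : e = 1 \/ e = -1 -> 0 < c -> fine (P [set w | c < e * X 1 w]) = 0.
  move=> ee c0; apply/eqP; rewrite eq_le fine_ge0// andbT leNgt; apply/negP => p0.
  have it n : 0 < fine (P [set w | (2 / th) ^+ n * c < e * X 1 w]).
    elim: n => [|n ih]; first by rewrite expr0 mul1r.
    by rewrite exprS -mulrA; exact: step.
  have lam : 1 < 2 / th by rewrite ltr_pdivlMr ?mul1r// (lt_trans ltr01).
  have [n nC] : exists n, C < (2 / th) ^+ n * c.
    exists ((Num.truncn `|C / c / (2 / th - 1)|).+1).
    have lam0 : 0 < 2 / th - 1 by rewrite subr_gt0.
    rewrite -ltr_pdivrMr//; set n := (Num.truncn _).+1.
    have nb : C / c / (2 / th - 1) < n%:R.
      apply: le_lt_trans (ler_norm _) _.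
      by have /andP[] := truncn_itv (normr_ge0 (C / c / (2 / th - 1))).
    rewrite ltr_pdivrMr// in nb; apply: lt_le_trans nb _.
    have pw m : m%:R * (2 / th - 1) + 1 <= (2 / th) ^+ m.
      elim: m => [|m ih]; first by rewrite mul0r add0r expr0.
      rewrite exprS -natr1.
      have m0 : 0 <= m%:R :> R by exact: ler0n.
      by set q := 2 / th in lam lam0 ih *; have := ler_wpM2l (ltW (lt_trans ltr01 lam)) ih;
        have := mulr_ge0 m0 (sqr_ge0 (q - 1)); rewrite expr2; lra.
    by apply: le_trans (pw n); rewrite lerDl.
  have := it n; rewrite fine0_of_ae ?ltxx//; first by apply: mgt; exact: measurable_funM.
  apply: filterS hC => w Xw /= h; have := lt_trans nC h.
  apply/negP; rewrite -leNgt; apply: le_trans Xw.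
  by case: ee => ->; rewrite ?mul1r ?mulN1r ?ler_norm// -normrN ler_norm.
apply: nontrivial_X1.
have q e : e = 1 \/ e = -1 -> {ae P, forall w, e * X 1 w <= 0}.
  move=> ee.
  have : {ae P, forall w, forall n : nat, ~ (n.+1%:R^-1 < e * X 1 w)}.
    apply/ae_foralln => n; apply: (@ae_of_fine0 _ _ _ _ [set w | n.+1%:R^-1 < e * X 1 w]).
      by apply: mgt; exact: measurable_funM.
    by apply: big => //; rewrite invr_gt0.
  apply: filterS => w h; rewrite leNgt; apply/negP => p.
  apply: (h (Num.truncn (e * X 1 w)^-1)).
  rewrite -[ltRHS]invrK ltf_pV2 ?posrE ?invr_gt0//.
  have i0 : 0 <= (e * X 1 w)^-1 by rewrite invr_ge0 ltW.
  by have /andP[] := truncn_itv i0.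
apply: filterS2 (q 1 (or_introl erefl)) (q (-1) (or_intror erefl)) => w.
by rewrite mul1r mulN1r oppr_le0 => h1 h2; apply/eqP; rewrite eq_le h1 h2.
Qed.

(** Let M be the supremum of the masses p of points, assumed positive. By scaling X_2 has a point b
    of mass close to M, and this mass is the mean of p (b - X_1), so p (b - X_1) is mostly close to
    M. But p is below M / 2 far from 0, where b - X_1 falls with positive probability since X_1 is
    unbounded. *)
Lemma atomless_X1 a : fine (P [set w | X 1 w = a]) = 0.
Proof.
have mE (f : Omega -> R) b : measurable_fun setT f -> measurable [set w | f w = b].
  by move=> mf; rewrite -[X in measurable X]setTI; exact: (mf measurableT [set b]).
pose p b := fine (P [set w | X 1 w = b]).
have p0 b : 0 <= p b by exact: fine_ge0.
have p1 b : p b <= 1.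
  by apply: fine_probability_le1; exact: mE.
have hs : has_sup (range p).
  by split; [exists (p 0), 0|exists 1 => _ [b _ <-]].
set M := sup (range p).
have pM b : p b <= M by apply: ub_le_sup; [exact: hs.2|exists b].
apply/eqP; rewrite -/(p a) eq_le p0 andbT leNgt; apply/negP => pa.
have M0 : 0 < M by exact: lt_le_trans (pM a).
have M1 : M <= 1 by apply: ge_sup; [exists (p 0), 0|move=> _ [b _ <-]].
have mgt c : measurable [set w | c < `|X 1 w|].
  by apply: measurable_lt_set => //; exact: measurableT_comp.
have [L0 PL0] : exists n : nat, fine (P [set w | n%:R < `|X 1 w|]) < M / 2.
  have : Ex P \1_[set w | n%:R < `|X 1 w|] @[n --> \oo] --> Ex P (fun=> 0).
    apply: (Ex_cvg (C := 1)) => [n||n w|]; [exact: measurable_indic (mgt _)|by []| |apply: aeW => w].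
      by rewrite indicE; case: (_ \in _); rewrite ?normr1 ?normr0.
    apply: cvg_near_cst; near=> n; rewrite indicE memNset//=.
    apply/negP; rewrite -leNgt; near: n; exact: nbhs_infty_ger.
  rewrite Ex_cst => /cvgr_lt /(_ (M / 2)).
  rewrite divr_gt0// => /(_ isT) [n _ /(_ n (leqnn n))] /=.
  by rewrite Ex_indic// => h; exists n.
set L : R := L0%:R in PL0.
have L00 : 0 <= L by exact: ler0n.
have small c : L < `|c| -> p c < M / 2.
  move=> Lc; apply: le_lt_trans PL0; by apply: fine_probability_mono => //; [exact: mE|move=> w /= ->].
have /andP[th1 th2] := two_root; set th := _ `^ _ in th1 th2.
have th0 : 0 < th by apply: lt_trans th1.
pose G b w := Ex P (fun w' => \1_[set q : R * R | q.1 + q.2 = b] (X 1 w, X 1 w') : R).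
have mD b : measurable [set q : R * R | q.1 + q.2 = b].
  have m : measurable_fun setT (fun q : R * R => q.1 + q.2).
    by apply: measurable_funD; [exact: measurable_fst|exact: measurable_snd].
  by rewrite -[X in measurable X]setTI; exact: (m measurableT [set b]).
have bG b : bmf (G b).
  pose f (q : R * Omega) : R := \1_[set q : R * R | q.1 + q.2 = b] (q.1, X 1 q.2).
  have bf : bmf f.
    apply: (bmf_comp (g := fun q : R * Omega => (q.1, X 1 q.2)) (f := \1_[set q : R * R | q.1 + q.2 = b])).
      apply: measurable_fun_pair; first exact: measurable_fst.
      by apply: measurableT_comp => //; exact: measurable_snd.
    exact: bmf_indic.
  exact: (bmf_comp mX1 (bmf_Ex_section P bf)).
have GE b w : G b w = p (b - X 1 w).
  rewrite /G /p -Ex_indic; last exact: mE.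
  apply: Ex_eq => w'; rewrite !indicE; congr (_%:R); congr (nat_of_bool _).
  apply/idP/idP; rewrite !inE /= => h; first by rewrite -h addrC addKr.
  by rewrite h addrC subrK.
have ExG b : Ex P (G b) = p (b / th).
  rewrite -indep_X12; last exact: bmf_indic.
  transitivity (fine (P (X 2 @^-1` [set b]))).
    rewrite -Ex_indic; last exact: (mE _ b (Xm (ler0n R 2))).
    apply: Ex_eq => w; rewrite !indicE; congr (_%:R); congr (nat_of_bool _).
    by apply/idP/idP; rewrite !inE /= addrC subrK.
  rewrite law_X// /p; congr (fine (P _)); apply/seteqP; split=> w /= h.
    by rewrite -h -/th mulrAC mulfV ?mul1r// gt_eqF.
  by rewrite h -/th mulrC divfK// gt_eqF.
have key e : 0 < e -> e < M / 4 -> M / 2 * fine (P [set w | 3 * L < `|X 1 w|]) <= e.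
  move=> e0 eM.
  have [_ [b0 _ <-] hb] : exists2 c, range p c & M - e < c.
    by apply: sup_adherent.
  pose b := b0 * th.
  have hE : Ex P (fun w => M - G b w) <= e.
    rewrite ExB ?Ex_cst//; last exact: bmf_cst.
    by rewrite ExG /b mulfK ?gt_eqF//; lra.
  have bMG : bmf (fun w => M - G b w) by apply: bmfB => //; exact: bmf_cst.
  have MG w : 0 <= M - G b w by rewrite GE subr_ge0.
  (* Otherwise b - X_1 is beyond L with probability at least 1 / 2, a loss of at least M / 4 in the
     mean of p (b - X_1), more than e. *)
  have b2L : `|b| <= 2 * L.
    rewrite leNgt; apply/negP => Lb.
    have : M / 2 * (1 - fine (P [set w | L < `|X 1 w|])) <= e.
      apply: le_trans hE; rewrite -Ex_indic// -[X in X - _](Ex_cst P) -ExB; [|exact: bmf_cst|exact: bmf_indic].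
      rewrite -ExZ; last by apply: bmfB; [exact: bmf_cst|exact: bmf_indic].
      apply: le_Ex => // [|w]; first by apply: bmfZ; apply: bmfB; [exact: bmf_cst|exact: bmf_indic].
      rewrite indicE; case: (boolP (w \in _)) => [_|]; first by rewrite subrr mulr0.
      rewrite notin_setE /= => /negP; rewrite -leNgt => wL.
      have : L < `|b - X 1 w| by have := lerB_normD b (- X 1 w); rewrite normrN; lra.
      by move/small; rewrite -GE; lra.
    by move: PL0 M0 M1; set q := fine _; nra.
  apply: le_trans hE; rewrite -Ex_indic// -ExZ; last exact: bmf_indic.
  apply: le_Ex => // [|w]; first by apply: bmfZ; exact: bmf_indic.
  rewrite indicE; case: (boolP (w \in _)) => [|_]; last by rewrite mulr0.
  rewrite inE /= => wL.
  have : L < `|b - X 1 w| by have := lerB_normD (X 1 w) (- b); rewrite normrN distrC; lra.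
  by move/small; rewrite -GE; lra.
have q0 : fine (P [set w | 3 * L < `|X 1 w|]) = 0.
  apply/eqP; rewrite eq_le fine_ge0// andbT leNgt; apply/negP => q0.
  have e0 : 0 < Num.min (M / 8) (M / 4 * fine (P [set w | 3 * L < `|X 1 w|])).
    by rewrite lt_min divr_gt0//= mulr_gt0// divr_gt0.
  have eM : Num.min (M / 8) (M / 4 * fine (P [set w | 3 * L < `|X 1 w|])) < M / 4.
    by rewrite gt_min; apply/orP; left; lra.
  have := key _ e0 eM; rewrite le_min => /andP[_].
  by move: q0; set q := fine _; nra.
apply: (@unbounded_X1 (3 * L)).
by apply: filterS (ae_of_fine0 (mgt _) q0) => w /= /negP; rewrite -leNgt.
Unshelve. all: by end_near. Qed.

Lemma atomless_X t a : 0 < t -> fine (P [set w | X t w = a]) = 0.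
Proof.
move=> t0; have t1 : t `^ alpha^-1 != 0 by rewrite gt_eqF// powR_gt0.
rewrite -[RHS](atomless_X1 (a / t `^ alpha^-1)); congr fine.
transitivity (P (X t @^-1` [set a])); first by [].
rewrite law_X//; congr (P _); apply/seteqP; split=> w /= h.
  by rewrite -h mulrAC mulfV ?mul1r.
by rewrite h mulrC divfK.
Qed.

Lemma positivity_parameter : 0 < fine (P [set w | 0 <= X 1 w]) < 1.
Proof.
have mA : measurable [set w | 0 <= X 1 w] by apply: measurable_le_set.
have mC : measurable [set w | ~ (0 <= X 1 w)] by exact: measurableC.
apply/andP; split; rewrite lt_neqAle.
  rewrite fine_ge0// andbT eq_sym; apply/negP => /eqP /(ae_of_fine0 mA) h.
  apply: (@one_sided (-1)); first by right.
  by apply: filterS h => w /= /negP; rewrite -ltNge mulN1r oppr_ge0 => /ltW.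
apply/andP; split.
  apply/negP => /eqP h; apply: (@one_sided 1); first by left.
  have : fine (P [set w | ~ (0 <= X 1 w)]) = 0.
    rewrite [X in P X](_ : _ = ~` [set w | 0 <= X 1 w])// probability_setC//.
    by rewrite -(fineK (fin_num_measure P _ mA)) h subee.
  by move/(ae_of_fine0 mC); apply: filterS => w /= /contrapT; rewrite mul1r.
exact: fine_probability_le1.
Qed.

End nondegenerate.

Opaque Ex grid Fp EFp tau ovs residual.

(** * Fractional integrals and truncated passage times *)

Section integrals.
Context (R : realType).
Notation mu := (@lebesgue_measure R).

Lemma measurable_powp r : measurable_fun setT (powp r : R -> R).
Proof.
apply: (measurableT_comp (@measurable_powR R r)).
by apply: measurable_maxr => //; exact: measurable_cst.
Qed.

Lemma ler_powRl (r a b : R) : 0 <= r -> 0 <= a -> a <= b -> a `^ r <= b `^ r.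
Proof.
move=> r0 a0 ab; apply: ge0_ler_powR => //; rewrite nnegrE//.
exact: le_trans ab.
Qed.

Lemma ler_powRN (r a b : R) : 0 < r -> 0 < a -> a <= b -> b `^ (- r) <= a `^ (- r).
Proof.
move=> r0 a0 ab; have b0 := lt_le_trans a0 ab.
rewrite !powRN lef_pV2 ?posrE ?powR_gt0//.
by apply: ler_powRl => //; exact: ltW.
Qed.

(** The integrand may blow up at 0, so the fundamental theorem of calculus is applied on
    [v / (n + 2), v], and the intervals increase to ]0, v]. *)
Lemma integral_powR r v : 0 < r -> 0 < v ->
  (\int[mu]_(s in `]0%R, v]) (s `^ (r - 1))%:E)%E = (v `^ r / r)%:E.
Proof.
move=> r0 v0.
pose a (n : nat) : R := v / n.+2%:R.
have a0 n : 0 < a n by rewrite divr_gt0.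
have av n : a n < v by rewrite ltr_pdivrMr// ltr_pMr// ltr1n.
pose F n : set R := `[a n, v]%classic.
have aS n : a n.+1 <= a n.
  by rewrite ler_pM2l// lef_pV2 ?posrE// ler_nat.
have ndF : nondecreasing_seq F.
  apply/nondecreasing_seqP => n; apply/subsetPset => s; rewrite /F /= !in_itv/= => /andP[h ->].
  by rewrite (le_trans (aS n)).
have -> : `]0%R, v]%classic = \bigcup_n F n.
  apply/seteqP; split=> s /=.
    rewrite in_itv/= => /andP[s0 sv].
    exists (Num.truncn (v / s)) => //; rewrite /F /= in_itv/= sv andbT.
    have vs0 : 0 <= v / s by rewrite divr_ge0// ltW.
    have /andP[_ h] := truncn_itv vs0.
    rewrite /a ler_pdivrMr// -ler_pdivrMl// mulrC; apply: le_trans (ltW h) _.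
    by rewrite ler_nat.
  by move=> [n _]; rewrite /F /= !in_itv/= => /andP[h ->]; rewrite andbT (lt_le_trans (a0 n)).
have := @ge0_nondecreasing_set_cvg_integral _ (measurableTypeR R) R F (fun s => (s `^ (r - 1))%:E) (@lebesgue_measure R) ndF.
have mpow : measurable_fun setT (fun s : R => (s `^ (r - 1))%:E).
  by apply/measurable_EFinP; exact: measurable_powR.
move=> /(_ _ _ _)/cvg_lim => <- //.
- apply/cvg_lim => //.
  have E n : (\int[mu]_(x in F n) (x `^ (r - 1))%:E)%E = (v `^ r / r - (a n) `^ r / r)%:E.
    rewrite EFinB; apply: (@continuous_FTC2 _ (fun s => s `^ (r - 1)) (fun s => s `^ r / r)) => //.
    - apply: continuous_in_subspaceT => s; rewrite inE /= in_itv/= => /andP[h _].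
      by apply: powR_continuous_gt0; exact: lt_le_trans h.
    - have cF y : 0 < y -> {for y, continuous (fun s : R => s `^ r / r)}.
        by move=> y0; apply: cvgMl; exact: powR_continuous_gt0.
      split.
      + move=> s; rewrite in_itv/= => /andP[h _]; apply: derivableM => //.
        by apply: derivable_powR; rewrite in_itv/= andbT (lt_trans (a0 n)).
      + by apply: cvg_at_right_filter; exact: cF.
      + by apply: cvg_at_left_filter; exact: cF.
    - move=> s; rewrite in_itv/= => /andP[h _].
      have s0 := lt_trans (a0 n) h.
      rewrite derive1Mr; last by apply: derivable_powR; rewrite in_itv/= andbT.
      by rewrite powR_derive1 ?in_itv/= ?andbT// mulrAC mulfV ?mul1r// gt_eqF.
  under eq_fun do rewrite E.
  apply: cvg_EFin; first by apply: nearW.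
  rewrite -[X in _ --> X]subr0; apply: cvgB; first exact: cvg_cst.
  rewrite -[X in _ --> X](mul0r r^-1); apply: cvgMl.
  have := powR_cvg0 r0 => /cvg_at_rightP; apply; split => //.
  rewrite -(mulr0 v); apply: cvgMr.
  have := @cvg_harmonic R; rewrite -(cvg_shiftS); apply: cvg_trans.
  by apply: near_eq_cvg; apply: nearW => n.
- by move=> n; exact: measurable_itv.
- by move=> n; exact: measurable_funTS.
- by move=> n s _; rewrite lee_fin powR_ge0.
Qed.

End integrals.

Lemma tonelli_Ex d (T : measurableType d) (R : realType) (P : probability T R)
    (D : set R) (F : T -> R -> R) : measurable D ->
  measurable_fun setT (fun q : T * R => F q.1 q.2) -> (forall w s, 0 <= F w s) ->
  (forall s, bmf (F ^~ s)) ->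
  (\int[P]_w \int[@lebesgue_measure R]_(s in D) (F w s)%:E =
   \int[@lebesgue_measure R]_(s in D) (Ex P (F ^~ s))%:E)%E.
Proof.
move=> mD mF F0 bF.
have mF2 : measurable_fun setT (fun q : T * R => (F q.1 q.2 * \1_D q.2)%:E).
  apply/measurable_EFinP; apply: measurable_funM => //.
  by apply: (measurableT_comp (f := \1_D : R -> R)) => //; exact: measurable_indic.
have ind w s : (F w s * \1_D s)%:E = ((EFin \o F w) \_ D) s.
  rewrite /patch indicE /=; case: ifP => _; rewrite ?mulr1 ?mulr0//.
have := @fubini_tonelli _ _ _ _ R P (@lebesgue_measure R) (fun q => (F q.1 q.2 * \1_D q.2)%:E) mF2.
move=> /(_ _) fub.
transitivity (\int[P]_w \int[@lebesgue_measure R]_s (F w s * \1_D s)%:E)%E.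
  by apply: eq_integral => w _; rewrite integral_mkcond; apply: eq_integral => s _; rewrite ind.
rewrite fub/=; last by move=> q; rewrite lee_fin mulr_ge0// indicE ler0n.
rewrite [RHS]integral_mkcond; apply: eq_integral => s _.
rewrite -ExE; last first.
  under eq_fun do rewrite mulrC.
  exact: bmfZ.
rewrite /patch; case: ifPn => sD.
  by congr EFin; apply: Ex_eq => w; rewrite indicE sD mulr1.
by rewrite -[RHS]/(0%:E) -(Ex_cst P 0); congr EFin; apply: Ex_eq => w; rewrite indicE (negPf sD) mulr0.
Qed.

(** * Tail and truncated mean of the passage time over 1 *)

Section tail.
Context (R : realType) d (Omega : measurableType d) (P : probability Omega R)
  (X : R -> Omega -> R) (alpha rho k : R).
Hypothesis alpha_gt1 : 1 < alpha.
Hypothesis SX : stable_levy_process P alpha X.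
Hypothesis ae_hit : forall y, 0 < y -> {ae P, forall w, hit (X ^~ w) y !=set0}.
Hypothesis k_gt0 : 0 < k.
Hypothesis rho01 : 0 < rho < 1.
Hypothesis FsupP : forall e, 0 < e -> \forall y \near 0^'+,
  `|Fsup P X y - k * y `^ (alpha * rho)| <= e * (k * y `^ (alpha * rho)).

Notation mu := (@lebesgue_measure R).
Let a0 : 0 < alpha := alpha_gt0 alpha_gt1.
Let rho0 : 0 < rho. Proof. by case/andP: rho01. Qed.
Let p := 1 - rho.
Let p0 : 0 < p. Proof. by rewrite subr_gt0; case/andP: rho01. Qed.
Let Y := tau X 1.
Let mY : measurable_fun setT Y. Proof. exact: (measurable_tau SX). Qed.
Let Y0 w : 0 <= Y w. Proof. exact: tau_ge0. Qed.
Let mge s : measurable [set w | s <= Y w].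
Proof. by apply: measurable_le_set. Qed.
Let mgt s : measurable [set w | s < Y w].
Proof. by apply: measurable_lt_set. Qed.

(** The substitution y = s^(-1/alpha) turns y^(alpha rho) with y small into s^(-rho) with s
    large. *)
Lemma tail_bounds e : 0 < e -> exists2 s0, 0 < s0 & forall s, s0 <= s ->
  fine (P [set w | s < Y w]) <= (1 + e) * k * s `^ (- rho) /\
  (1 - e) * k * s `^ (- rho) <= fine (P [set w | s <= Y w]).
Proof.
move=> e0; have [eta /= eta0 H] := FsupP e0.
have h0 : 0 < eta / 2 by rewrite divr_gt0.
exists ((eta / 2) `^ (- alpha)); first exact: powR_gt0.
move=> s hs; have s0 : 0 < s by apply: lt_le_trans hs; exact: powR_gt0.
have ya : s `^ (- alpha^-1) <= eta / 2.
  have -> : eta / 2 = ((eta / 2) `^ (- alpha)) `^ (- alpha^-1).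
    by rewrite -powRrM mulrNN mulfV ?gt_eqF// powRr1// ltW.
  by apply: ler_powRN => //; [rewrite invr_gt0|exact: powR_gt0].
have y0 : 0 < s `^ (- alpha^-1) by exact: powR_gt0.
have := H (s `^ (- alpha^-1)); rewrite /= sub0r normrN gtr0_norm// => /(_ _ y0).
have -> : (s `^ (- alpha^-1)) `^ (alpha * rho) = s `^ (- rho).
  by rewrite -powRrM mulNr mulrA mulVf ?mul1r// gt_eqF.
move=> h; have : s `^ (- alpha^-1) < eta.
  by apply: le_lt_trans ya _; rewrite ltr_pdivrMr// ltr_pMr// ltr1n.
move=> {}/h; rewrite ler_norml => /andP[h1 h2].
have := Fsup_le alpha_gt1 SX ae_hit s0; have := Fsup_ge alpha_gt1 SX ae_hit s0.
rewrite -/Y; set F := Fsup _ _ _ in h1 h2 *; set K := k * _ in h1 h2.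
by move=> q1 q2; rewrite -!mulrA -/K; split; lra.
Qed.

(** Truncated, because Y has a tail of order s^(-rho) with rho < 1 and so no finite mean; [m1 u]
    grows like (k / p) u^p. *)
Definition m1 u := Ex P (fun w => Num.min (Y w) u).

Let bm1 u : 0 <= u -> bmf (fun w => Num.min (Y w) u).
Proof.
move=> u0; split; first by apply: measurable_minr.
by exists u => w; rewrite ger0_norm ?ge_min ?lexx ?orbT// le_min Y0.
Qed.

(** One boolean covers the strict and the weak inequality: both give the same integral, and the
    upper tail bound is stated for the first, the lower one for the second. *)
Let lq (b : bool) (s y : R) := if b then s < y else s <= y.

Let lq01 b s y : `|(lq b s y)%:R : R| <= 1.
Proof. by case: (lq b s y); rewrite ?normr1 ?normr0. Qed.

Let mlq b s : measurable [set w | lq b s (Y w)].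
Proof. by case: b; [exact: mgt|exact: mge]. Qed.

Let mkernel b : measurable_fun setT (fun q : Omega * R => (lq b q.2 (Y q.1))%:R : R).
Proof.
have m1 : measurable_fun setT (fun q : Omega * R => Y q.1).
  by apply: (measurableT_comp mY); exact: measurable_fst.
have m2 : measurable_fun setT (snd : Omega * R -> R) by exact: measurable_snd.
rewrite (_ : (fun _ => _) = \1_[set q : Omega * R | lq b q.2 (Y q.1)]); last first.
  by apply/funext => q; rewrite indicE mem_setE.
by apply: measurable_indic; case: b; [exact: measurable_lt_set|exact: measurable_le_set].
Qed.

Let Ex_lq b s : Ex P (fun w => (lq b s (Y w))%:R) = fine (P [set w | lq b s (Y w)]).
Proof.
rewrite -Ex_indic; last exact: mlq.
by apply: Ex_eq => w; rewrite indicE mem_setE.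
Qed.

Lemma layer_cake b u : 0 < u ->
  (\int[mu]_(s in `]0%R, u]) (fine (P [set w | lq b s (Y w)]))%:E = (m1 u)%:E)%E.
Proof.
move=> u0.
have inner w : (\int[mu]_(s in `]0%R, u]) ((lq b s (Y w))%:R : R)%:E = (Num.min (Y w) u)%:E)%E.
  pose D := [set` Interval (BRight 0) (if b && (Y w <= u) then BLeft (Y w) else BRight (Num.min (Y w) u))].
  transitivity (\int[mu]_(s in `]0%R, u]) (\1_D s)%:E)%E.
    apply: eq_integral => s; rewrite inE /= in_itv/= => /andP[s0 su].
    rewrite indicE mem_setE /D /lq; case: (b).
      have [Yu|Yu] := leP (Y w) u; rewrite /= in_itv/= s0//=.
      by rewrite su (le_lt_trans su).
    by rewrite /= in_itv/= s0/= le_min su andbT.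
  rewrite integral_indic//; last exact: measurable_itv.
  have -> : D `&` `]0%R, u]%classic = D.
    apply/seteqP; split=> s; [by case|move=> h; split => //; move: h].
    rewrite /D /=; case: ifP => [/andP[_ Yu]|_]; rewrite !in_itv/= => /andP[-> /=].
      by move=> /ltW /le_trans; apply.
    by rewrite le_min => /andP[].
  apply: etrans (lebesgue_measure_itv _) _ => /=.
  have [Yu|Yu] := leP (Y w) u.
    have [Y00|Y00] := leP (Y w) 0.
      have -> : Y w = 0 by apply/eqP; rewrite eq_le Y00 Y0.
      by case: (b); rewrite /= lte_fin ltxx.
    by case: (b); rewrite /= lte_fin Y00 -EFinB subr0.
  by rewrite andbF /= lte_fin u0 -EFinB subr0.
transitivity (\int[mu]_(s in `]0%R, u]) (Ex P (fun w => (lq b s (Y w))%:R))%:E)%E.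
  by apply: eq_integral => s _; rewrite Ex_lq.
rewrite -tonelli_Ex//.
- under eq_integral do rewrite inner.
  by rewrite /m1 ExE//; apply: bm1; exact: ltW.
- move=> s; split; last by exists 1.
  apply: (measurableT_comp (mkernel b) (g := fun w => (w, s))).
  exact: measurable_fun_pair.
Qed.

Let mQ b (D : set R) : measurable D ->
  measurable_fun D (fun s => (fine (P [set w | lq b s (Y w)]))%:E).
Proof.
move=> mD; apply/measurable_EFinP; apply: measurable_funTS.
have bk : bmf (fun q : R * Omega => (lq b q.1 (Y q.2))%:R : R).
  split; last by exists 1.
  apply: (measurableT_comp (mkernel b) (g := fun q : R * Omega => (q.2, q.1))).
  by apply: measurable_fun_pair; [exact: measurable_snd|exact: measurable_fst].
have [+ _] := bmf_Ex_section P bk; rewrite (_ : (fun s => Ex _ _) = fun s => fine (P [set w | lq b s (Y w)]))//.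
by apply/funext => s /=; rewrite Ex_lq.
Qed.

Let mpow (c r : R) (D : set R) : measurable D -> measurable_fun D (fun s : R => (c * s `^ r)%:E).
Proof.
move=> mD; apply/measurable_EFinP/measurable_funTS; by apply: measurable_funM.
Qed.

Let ipow c u : 0 <= c -> 0 < u ->
  (\int[mu]_(s in `]0%R, u]) (c * s `^ (- rho))%:E = (c * (u `^ p / p))%:E)%E.
Proof.
move=> c0 u0; under eq_integral do rewrite EFinM.
rewrite ge0_integralZl//=; first last.
- by move=> s _; rewrite lee_fin powR_ge0.
- by apply/measurable_EFinP/measurable_funTS; exact: measurable_powR.
by rewrite (_ : - rho = p - 1) ?integral_powR//; rewrite /p; ring.
Qed.

Lemma m1_le : exists2 C, 0 < C & forall u, 0 < u -> m1 u <= C * u `^ p.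
Proof.
have [s0 s00 H] := tail_bounds (@ltr01 R).
pose C := Num.max (s0 `^ rho) (2 * k).
have C0 : 0 < C by rewrite lt_max powR_gt0.
exists (C / p); first by rewrite divr_gt0.
move=> u u0; rewrite -lee_fin -(layer_cake true u0) mulrAC -mulrA -ipow ?(ltW C0)//.
apply: ge0_le_integral => //.
- by move=> s _; rewrite lee_fin fine_ge0.
- exact: (mQ true).
- exact: mpow.
move=> s; rewrite /= in_itv/= => /andP[s1 _]; rewrite lee_fin.
have [ss|ss] := leP s0 s.
  apply: le_trans (H s ss).1 _; rewrite ler_pM2r ?powR_gt0//.
  by rewrite /C le_max; apply/orP; right; lra.
apply: (@le_trans _ _ 1); first exact: fine_probability_le1.
rewrite powRN -ler_pdivrMr ?invr_gt0 ?powR_gt0// invrK mul1r /C le_max.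
by rewrite ge0_ler_powR ?nnegrE// ltW.
Qed.

Lemma m1_bounds e : 0 < e < 1 -> exists2 A, 0 < A & forall u, A <= u ->
  (1 - e) * (k / p) * u `^ p <= m1 u <= (1 + e) * (k / p) * u `^ p.
Proof.
case/andP=> e0 e1; have e20 : 0 < e / 2 by rewrite divr_gt0.
have [s0 s00 H] := tail_bounds e20.
have [A0 A00 small] : exists2 A, 0 < A & forall u, A <= u ->
    s0 <= (e / 2) * (k / p) * u `^ p /\ k * (s0 `^ p / p) <= (e / 2) * (k / p) * u `^ p.
  pose M := Num.max s0 (k * (s0 `^ p / p)) / ((e / 2) * (k / p)).
  have c0 : 0 < (e / 2) * (k / p) by rewrite mulr_gt0// divr_gt0.
  have M0 : 0 < M by rewrite divr_gt0// lt_max s00.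
  exists (M `^ p^-1); first exact: powR_gt0.
  move=> u Mu; have : M <= u `^ p.
    rewrite -[leLHS]powRr1 ?(ltW M0)// -(mulVf (lt0r_neq0 p0)) powRrM.
    by apply: ler_powRl; rewrite ?powR_ge0// ltW.
  by rewrite /M ler_pdivrMr// [X in _ <= X]mulrC ge_max => /andP[].
exists (Num.max s0 A0); first by rewrite lt_max s00.
move=> u; rewrite ge_max => /andP[su Au]; have u0 : 0 < u by exact: lt_le_trans su.
have [sm1 sm2] := small u Au.
have up0 : 0 < u `^ p by exact: powR_gt0.
have mind : measurable_fun setT (\1_(`]0%R, s0]%classic) : R -> R).
  by apply: measurable_indic; exact: measurable_itv.
have split_int (f g : R -> R) : measurable_fun setT f -> measurable_fun setT g ->
    (forall s, 0 <= f s) -> (forall s, 0 <= g s) ->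
    (\int[mu]_(s in `]0%R, u]) (f s + \1_(`]0%R, s0]%classic) s * g s)%:E =
     \int[mu]_(s in `]0%R, u]) (f s)%:E + \int[mu]_(s in `]0%R, s0]) (g s)%:E)%E.
  move=> mf mg f0 g0; under eq_integral do rewrite EFinD.
  rewrite ge0_integralD//=; last 4 first.
  - by move=> s _; rewrite lee_fin.
  - by apply/measurable_EFinP/measurable_funTS.
  - by move=> s _; rewrite lee_fin mulr_ge0// indicE ler0n.
  - by apply/measurable_EFinP/measurable_funTS; exact: measurable_funM.
  congr (_ + _)%E; rewrite [LHS]integral_mkcond [RHS]integral_mkcond; apply: eq_integral => s _.
  rewrite /patch !mem_setE indicE mem_setE !in_itv/=; case: (ltP 0 s) => //= s1.
  have [h|h] := leP s s0; last by rewrite mul0r; case: ifP.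
  by rewrite mul1r (le_trans h su).
have mp c : measurable_fun setT (fun s : R => c * s `^ (- rho)).
  by apply: measurable_funM => //; exact: measurable_powR.
apply/andP; split; last first.
  have : ((m1 u)%:E <= ((1 + e / 2) * k * (u `^ p / p))%:E + s0%:E)%E.
    rewrite -(layer_cake true u0) -ipow//; last by rewrite mulr_ge0// ?ltW// addr_gt0.
    have <- : (\int[mu]_(s in `]0%R, s0]) (cst 1 s)%:E = s0%:E)%E.
      rewrite (@integral_cst _ _ _ mu _ _ 1%E); last exact: measurable_itv.
      by rewrite mul1e; apply: etrans (lebesgue_measure_itv _) _; rewrite /= lte_fin s00 -EFinB subr0.
    have c0 s : 0 <= (1 + e / 2) * k * s `^ (- rho).
      by rewrite mulr_ge0 ?powR_ge0// mulr_ge0// ltW// addr_gt0.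
    rewrite -split_int//; apply: ge0_le_integral => //.
    - by move=> s _; rewrite lee_fin fine_ge0.
    - exact: (mQ true).
    - apply/measurable_EFinP/measurable_funTS/measurable_funD; first exact: mp.
      exact: measurable_funM.
    move=> s; rewrite /= in_itv/= => /andP[s1 _]; rewrite lee_fin.
    have [ss|ss] := leP s0 s.
      by apply: le_trans (H s ss).1 _; rewrite lerDl mulr1 indicE ler0n.
    apply: (@le_trans _ _ 1); first exact: fine_probability_le1.
    by rewrite indicE mem_setE in_itv/= s1 (ltW ss)/= mulr1 lerDr.
  rewrite -EFinD lee_fin => /le_trans; apply.
  rewrite (_ : (1 + e) * (k / p) * u `^ p =
    (1 + e / 2) * k * (u `^ p / p) + e / 2 * (k / p) * u `^ p) ?lerD2l//.
  by field; rewrite gt_eqF.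
have : (((1 - e / 2) * k * (u `^ p / p))%:E <= (m1 u)%:E + (k * (s0 `^ p / p))%:E)%E.
  rewrite -(layer_cake false u0) -!ipow//; [|exact: ltW|by rewrite mulr_ge0// ?ltW// subr_gt0; lra].
  have c0 s : 0 <= k * s `^ (- rho) by rewrite mulr_ge0 ?powR_ge0// ltW.
  have c1 s : 0 <= (1 - e / 2) * k * s `^ (- rho).
    by rewrite mulr_ge0 ?powR_ge0// mulr_ge0// ?ltW//; lra.
  rewrite -split_int//; first last.
  - by move=> s; exact: fine_ge0.
  - by apply/measurable_EFinP; exact: (mQ false).
  apply: ge0_le_integral => //.
  - by move=> s _; rewrite lee_fin.
  - exact: mpow.
  - apply/measurable_EFinP/measurable_funTS/measurable_funD => //.
      by apply/measurable_EFinP; exact: (mQ false).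
    by apply: (measurable_funM mind); exact: mp.
  move=> s; rewrite /= in_itv/= => /andP[s1 _]; rewrite lee_fin.
  have [ss|ss] := leP s0 s.
    by apply: le_trans (H s ss).2 _; rewrite lerDl mulr_ge0// indicE ler0n.
  rewrite indicE mem_setE in_itv/= s1 (ltW ss)/= mul1r -[leLHS]add0r lerD ?fine_ge0//.
  by rewrite ler_wpM2r ?powR_ge0// ler_piMl// ?ltW//; lra.
rewrite -EFinD lee_fin => h.
have : (1 - e) * (k / p) * u `^ p + e / 2 * (k / p) * u `^ p <= m1 u + k * (s0 `^ p / p).
  by apply: le_trans h; rewrite le_eqVlt; apply/orP; left; apply/eqP; field; rewrite gt_eqF.
lra.
Qed.

End tail.

(** * Beta integrals *)

Section beta.
Context (R : realType).
Notation mu := (@lebesgue_measure R).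
Implicit Types a b p t u v : R.

Lemma ge0_integral_oppr (f : R -> \bar R) :
  measurable_fun setT f -> (forall x, 0 <= f x)%E ->
  (\int[mu]_x f (- x)%R = \int[mu]_x f x)%E.
Proof.
move=> mf f0.
pose g : measurableTypeR R -> measurableTypeR R := fun x => - x.
have mg : measurable_fun setT g by exact: measurable_funN.
have [nu [nuE nuI]] := image_measure mu mg.
have mug A : measurable A -> mu A = nu A.
  apply: lebesgue_measure_unique => _ [[u v] _ <-].
  apply/esym; apply: etrans (nuE _) _.
  have -> : g @^-1` `]u, v]%classic = `[- v, - u[%classic.
    by apply/seteqP; split=> x /=; rewrite /g !in_itv/= lerNl ltrNr andbC.
  apply: etrans (lebesgue_measure_itv _) _; apply/esym; apply: etrans (lebesgue_measure_itv _) _.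
  by rewrite /= !lte_fin ltrN2 -!EFinB opprK addrC.
rewrite -[LHS]nuI//.
by apply: eq_measure_integral => A mA _; exact/esym/mug.
Qed.

Lemma ge0_integral_reflect v (f : R -> \bar R) :
  measurable_fun setT f -> (forall x, 0 <= f x)%E ->
  (\int[mu]_x f (v - x)%R = \int[mu]_x f x)%E.
Proof.
move=> mf f0.
have mf' : measurable_fun setT (fun x : R => f (v + 1 * x)%R).
  by apply: (measurableT_comp mf); apply: measurable_funD => //; exact: measurable_funM.
rewrite -[RHS](mul1e) -[in RHS](invr1 R) -(ge0_integral_affine v ltr01 mf f0).
rewrite -(ge0_integral_oppr mf')//.
by apply: eq_integral => x _; rewrite mul1r.
Qed.

(* The Beta function at (b + 1, a + 1). *)
Definition betaI a b := (\int[mu]_u (powp a (1 - u) * powp b u)%:E)%E.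

Lemma powRDp (c r s : R) : 0 < c -> c `^ (r + s) = c `^ r * c `^ s.
Proof. by move=> c0; rewrite powRD// (gt_eqF c0) implybT. Qed.

Lemma mbeta a b v t : measurable_fun setT (fun u : R => (powp a (v - u) * powp b (u - t))%:E).
Proof.
apply/measurable_EFinP; apply: measurable_funM.
  by apply: (measurableT_comp (measurable_powp a)); exact: measurable_funB.
by apply: (measurableT_comp (measurable_powp b)); exact: measurable_funB.
Qed.

Lemma integral_beta a b v t : t < v ->
  (\int[mu]_u (powp a (v - u) * powp b (u - t))%:E = ((v - t) `^ (a + b + 1))%:E * betaI a b)%E.
Proof.
move=> tv; have vt : 0 < v - t by rewrite subr_gt0.
have f0 (u : R) : (0 <= (powp a (v - u) * powp b (u - t))%:E)%E.
  by rewrite lee_fin mulr_ge0// powp_ge0.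
have := ge0_integral_affine t vt (mbeta a b v t) f0.
have E u : powp a (v - (t + (v - t) * u)) * powp b (t + (v - t) * u - t) =
    (v - t) `^ (a + b) * (powp a (1 - u) * powp b u).
  have -> : v - (t + (v - t) * u) = (v - t) * (1 - u) by ring.
  have -> : t + (v - t) * u - t = (v - t) * u by ring.
  have pw r c : powp r ((v - t) * c) = (v - t) `^ r * powp r c.
    rewrite /powp -powRM ?(ltW vt)//; last exact: max0_ge0.
    by rewrite maxr_pMr ?mulr0// ltW.
  by rewrite !pw powRDp//; ring.
have mb : measurable_fun setT (fun u : R => (powp a (1 - u) * powp b u)%:E).
  by have := mbeta a b 1 0; under eq_fun do rewrite subr0.
have b0 (u : R) : setT u -> (0 <= (powp a (1 - u) * powp b u)%:E)%E.
  by rewrite lee_fin mulr_ge0// powp_ge0.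
have -> : (\int[mu]_u (powp a (v - (t + (v - t) * u)) * powp b (t + (v - t) * u - t))%:E =
    ((v - t) `^ (a + b))%:E * betaI a b)%E.
  rewrite /betaI -(ge0_integralZl_EFin mu measurableT b0 mb (powR_ge0 _ _)).
  by apply: eq_integral => u _; rewrite E EFinM.
move: (\int[mu]_u _)%E (betaI a b) => I J h.
have -> : I = ((v - t)%:E * ((v - t)^-1%:E * I))%E by rewrite muleA -EFinM mulfV ?gt_eqF// mul1e.
rewrite -h muleA -EFinM [in RHS]powRDp// powRr1 ?(ltW vt)//.
by rewrite [(_ - _) * _]mulrC.
Qed.

Lemma integral_beta0 a b v t : a != 0 -> b != 0 -> v <= t ->
  (\int[mu]_u (powp a (v - u) * powp b (u - t))%:E = 0)%E.
Proof.
move=> a0 b0 vt; apply: integral0_eq => u _; congr EFin.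
have [uv|uv] := leP v u.
  by rewrite powp_le0 ?mul0r// subr_le0.
by rewrite [powp b _]powp_le0 ?mulr0// subr_le0 (le_trans (ltW uv)).
Qed.

Lemma measurable_gt_nat t : measurable_fun setT (fun u : R => (t < u)%R%:R : R).
Proof.
rewrite (_ : (fun _ => _) = \1_[set u : R | t < u]).
  by apply: measurable_indic; apply: measurable_lt_set.
by apply/funext => u; rewrite indicE mem_setE.
Qed.

(** The indicator stands for (u - t)^0 on u > t; [powp 0] would not vanish for u <= t, because 0^0 =
    1. *)
Lemma integral_powp v t a : -1 < a -> a != 0 -> t <= v ->
  (\int[mu]_u (powp a (v - u) * (t < u)%R%:R)%:E = ((v - t) `^ (a + 1) / (a + 1))%:E)%E.
Proof.
move=> a1 na tv; have a10 : 0 < a + 1 by rewrite -ltrBlDr sub0r.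
pose D := `]0, v - t[%classic : set R.
pose f (x : R) := (powp a x * \1_D x)%:E.
have mf : measurable_fun setT f.
  apply/measurable_EFinP; apply: measurable_funM; first exact: measurable_powp.
  by apply: measurable_indic; exact: measurable_itv.
have f0 x : (0 <= f x)%E by rewrite lee_fin mulr_ge0 ?powp_ge0// indicE ler0n.
transitivity (\int[mu]_(u in setT) f (v - u)%R)%E.
  apply: eq_integral => u _; rewrite /f indicE mem_setE in_itv/= ltrD2l ltrN2.
  have [h|h] := ltP 0 (v - u) => //=.
  by rewrite powp_le0// !mul0r.
rewrite ge0_integral_reflect//.
transitivity (\int[mu]_(x in D) (x `^ (a + 1 - 1))%:E)%E.
  rewrite [RHS]integral_mkcond; apply: eq_integral => x _; rewrite /f /patch indicE.
  case: ifPn => [|_]; last by rewrite mulr0.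
  by rewrite inE /D /= in_itv/= => /andP[x0 _]; rewrite mulr1 powp_gt0// addrK.
rewrite integral_itv_bndo_bndc; last first.
  by apply/measurable_EFinP/measurable_funTS; exact: measurable_powR.
move: tv; rewrite le_eqVlt => /predU1P[->|tv]; last by rewrite integral_powR ?subr_gt0.
by rewrite subrr set_itv_ge ?bnd_simp ?ltxx// integral_set0 powR0 ?gt_eqF// mul0r.
Qed.

Lemma integral_powpN v t p : 0 < p < 1 -> t <= v ->
  (\int[mu]_u (powp (- p) (v - u) * (t < u)%R%:R)%:E = ((v - t) `^ (1 - p) / (1 - p))%:E)%E.
Proof.
case/andP=> p0 p1 tv; have := @integral_powp v t (- p).
by rewrite [- p + 1]addrC ltrN2 oppr_eq0 gt_eqF// => ->.
Qed.

(** From above, u^q <= 1 leaves an integrable singularity at 1; from below, the part over ]0, 1/2]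
    is at least the integral of u^q. *)
Lemma betaI_fin p q : 0 < p < 1 -> 0 < q -> exists2 B : R, 0 < B & betaI (- p) q = B%:E.
Proof.
case/andP=> p0 p1 q0; have qn : q != 0 by rewrite gt_eqF.
have np : - p != 0 by rewrite oppr_eq0 gt_eqF.
have f0 (u : R) : (0 <= (powp (- p) (1 - u) * powp q u)%:E)%E.
  by rewrite lee_fin mulr_ge0// powp_ge0.
have mb : measurable_fun setT (fun u : R => (powp (- p) (1 - u) * powp q u)%:E).
  by have := mbeta (- p) q 1 0; under eq_fun do rewrite subr0.
have up : (betaI (- p) q <= (1 / (1 - p))%:E)%E.
  have := integral_powpN (introT andP (conj p0 p1)) ler01; rewrite subr0 powR1 => <-.
  apply: ge0_le_integral => //.
    apply/measurable_EFinP; apply: measurable_funM; last exact: measurable_gt_nat.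
    by apply: (measurableT_comp (measurable_powp (- p))); exact: measurable_funB.
  move=> u _; rewrite lee_fin.
  have [u0|u0] := ltP 0 u; last by rewrite (powp_le0 qn u0) !mulr0.
  have [u1|u1] := leP 1 u; first by rewrite (powp_le0 np) ?subr_le0// !mul0r.
  rewrite mulr1 ler_piMr ?powp_ge0// powp_gt0//.
  by rewrite -[leRHS](powRr0 u) ger_powR// ?u0 ltW.
have h2 : 0 < 2^-1 :> R by rewrite invr_gt0.
have lo : ((2^-1 `^ (q + 1) / (q + 1))%:E <= betaI (- p) q)%E.
  rewrite -integral_powR//; last by rewrite addr_gt0.
  rewrite integral_mkcond; apply: ge0_le_integral => //.
  - by move=> u _; apply: erestrict_ge0 => {}u _; rewrite lee_fin powR_ge0.
  - apply/(measurable_restrictT _ _).1 => //.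
    by apply/measurable_EFinP/measurable_funTS; exact: measurable_powR.
  move=> u _; rewrite /patch; case: ifPn => [|_]; last exact: f0.
  rewrite inE /= in_itv/= => /andP[u0 uh]; rewrite lee_fin addrK powp_gt0//; last lra.
  have u1 : 0 < 1 - u by lra.
  rewrite powp_gt0// ler_peMl ?powR_ge0// powRN invf_ge1 ?powR_gt0//.
  by rewrite -[leRHS](powRr0 (1 - u)) ger_powR ?u1 ?(ltW p0)//=; lra.
have fb : betaI (- p) q \is a fin_num.
  rewrite ge0_fin_numE; first exact: le_lt_trans up (ltry _).
  by apply: integral_ge0.
exists (fine (betaI (- p) q)); last by rewrite fineK.
rewrite -lte_fin fineK//; apply: lt_le_trans lo.
by rewrite lte_fin divr_gt0// ?powR_gt0// addr_gt0.
Qed.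

End beta.

(** * Fractional integration under an expectation *)

Section fractional.
Context (R : realType) d (Omega : measurableType d) (P : probability Omega R).
Notation mu := (@lebesgue_measure R).
Variables (S Z : Omega -> R).
Hypothesis mS : measurable_fun setT S.
Hypothesis S0 : forall w, 0 <= S w.
Hypothesis bZ : bmf Z.
Hypothesis Z0 : forall w, 0 <= Z w.

Let mker p : measurable_fun setT (fun q : Omega * R => powp p (q.2 - S q.1)).
Proof.
apply: (measurableT_comp (measurable_powp p)); apply: measurable_funB; first exact: measurable_snd.
by apply: (measurableT_comp mS); exact: measurable_fst.
Qed.

Let mker2 p v : measurable_fun setT (fun q : Omega * R => powp p (v - q.2)).
Proof.
apply: (measurableT_comp (measurable_powp p)); exact: measurable_funB.
Qed.

Let mZ : measurable_fun setT (fun q : Omega * R => Z q.1).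
Proof. by apply: (measurableT_comp bZ.1); exact: measurable_fst. Qed.

Lemma bmf_powp p u : 0 <= p -> bmf (fun w => powp p (u - S w)).
Proof.
move=> p0; split.
  by apply: (measurableT_comp (measurable_powp p)); exact: measurable_funB.
exists (powp p u) => w; rewrite ger0_norm ?powp_ge0//.
by apply: powp_homo => //; rewrite gerBl.
Qed.

(** Abel's kernel: for S < v the integral over u of (v - u)^(-p) (u - S)_+^p is B (v - S), the
    exponent being - p + p + 1, and Tonelli's theorem brings it under the expectation. *)
Lemma fractional_integral p B v : 0 < p < 1 -> 0 <= B -> betaI (- p) p = B%:E ->
  (\int[mu]_u (powp (- p) (v - u) * Ex P (fun w => Z w * powp p (u - S w)))%:E =
   (B * Ex P (fun w => Z w * Num.max (v - S w) 0))%:E)%E.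
Proof.
move=> p01 B0 BE; have /andP[p0 p1] := p01.
have pn : p != 0 by rewrite gt_eqF.
have np : - p != 0 by rewrite oppr_eq0.
have bpow u : bmf (fun w => Z w * powp p (u - S w)).
  by apply: bmfM => //; apply: bmf_powp; exact: ltW.
have bmx : bmf (fun w => Z w * Num.max (v - S w) 0).
  apply: bmfM => //; have := bmf_powp v ler01.
  by under eq_fun do rewrite /powp powRr1 ?max0_ge0//.
pose F w u := Z w * (powp (- p) (v - u) * powp p (u - S w)).
have := @tonelli_Ex _ _ _ P setT F measurableT.
move=> /(_ _ _ _) ton.
transitivity (\int[mu]_u (Ex P (F ^~ u))%:E)%E.
  apply: eq_integral => u _; rewrite -ExZ//; congr EFin; apply: Ex_eq => w.
  by rewrite /F mulrCA.
rewrite -ton; first last.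
- move=> u; rewrite /F.
  have := bmfZ (powp (- p) (v - u)) (bpow u).
  by under eq_fun do rewrite mulrCA.
- by move=> w u; rewrite mulr_ge0// mulr_ge0// powp_ge0.
- by apply: (measurable_funM mZ); apply: measurable_funM; [exact: mker2|exact: mker].
rewrite EFinM ExE//.
have Z0' w : setT w -> (0 <= (Z w * Num.max (v - S w) 0)%:E)%E.
  by rewrite lee_fin mulr_ge0// max0_ge0.
rewrite -(ge0_integralZl_EFin P measurableT Z0' _ B0); last by apply/measurable_EFinP; exact: bmx.1.
apply: eq_integral => w _; rewrite /F.
under eq_integral do rewrite EFinM.
rewrite (ge0_integralZl_EFin mu measurableT _ (mbeta (- p) p v (S w)) (Z0 w)); last first.
  by move=> u _; rewrite lee_fin mulr_ge0 ?powp_ge0.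
have [Sv|Sv] := leP v (S w).
  by rewrite integral_beta0// max0_le0 ?subr_le0// !mulr0 !mule0.
rewrite integral_beta// addNr add0r powRr1 ?subr_ge0 ?(ltW Sv)// BE.
rewrite max_l ?subr_ge0 ?(ltW Sv)// -!EFinM; congr EFin; ring.
Qed.

(** The same kernel against the indicator of S < u produces the power 1 - p, which is rho where this
    is used. *)
Lemma fractional_step p v : 0 < p < 1 ->
  (\int[mu]_u (powp (- p) (v - u) * Ex P (fun w => Z w * (S w < u)%R%:R))%:E =
   (Ex P (fun w => Z w * powp (1 - p) (v - S w)) / (1 - p))%:E)%E.
Proof.
move=> p01; have /andP[p0 p1] := p01.
have p10 : 0 < 1 - p by rewrite subr_gt0.
have np : - p != 0 by rewrite oppr_eq0 gt_eqF.
have mk : measurable_fun setT (fun q : Omega * R => (S q.1 < q.2)%R%:R : R).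
  rewrite (_ : (fun _ => _) = \1_[set q : Omega * R | S q.1 < q.2]).
    apply: measurable_indic; apply: measurable_lt_set; last exact: measurable_snd.
    by apply: (measurableT_comp mS); exact: measurable_fst.
  by apply/funext => u; rewrite indicE mem_setE.
have bst u : bmf (fun w => Z w * (S w < u)%R%:R).
  apply: bmfM => //; split.
    by apply: (measurableT_comp mk (g := fun w => (w, u))); exact: measurable_fun_pair.
  by exists 1 => w; case: (S w < u); rewrite ?normr1 ?normr0.
have bmx : bmf (fun w => Z w * powp (1 - p) (v - S w)).
  by apply: bmfM => //; apply: bmf_powp; exact: ltW.
pose F w u := Z w * (powp (- p) (v - u) * (S w < u)%R%:R).
have := @tonelli_Ex _ _ _ P setT F measurableT.
move=> /(_ _ _ _) ton.
transitivity (\int[mu]_u (Ex P (F ^~ u))%:E)%E.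
  apply: eq_integral => u _; rewrite -ExZ//; congr EFin; apply: Ex_eq => w.
  by rewrite /F mulrCA.
rewrite -ton; first last.
- move=> u; rewrite /F.
  have := bmfZ (powp (- p) (v - u)) (bst u).
  by under eq_fun do rewrite mulrCA.
- by move=> w u; rewrite mulr_ge0// mulr_ge0// powp_ge0.
- by apply: (measurable_funM mZ); apply: (measurable_funM _ mk); exact: mker2.
rewrite mulrC EFinM ExE//.
have Z0' w : setT w -> (0 <= (Z w * powp (1 - p) (v - S w))%:E)%E.
  by rewrite lee_fin mulr_ge0// powp_ge0.
rewrite -(ge0_integralZl_EFin P measurableT Z0'); [|by apply/measurable_EFinP; exact: bmx.1|by rewrite invr_ge0 ltW].
apply: eq_integral => w _; rewrite /F.
under eq_integral do rewrite EFinM.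
have mk1 : measurable_fun setT (fun u : R => (powp (- p) (v - u) * (S w < u)%R%:R)%:E).
  apply/measurable_EFinP; apply: measurable_funM; last exact: measurable_gt_nat.
  by apply: (measurableT_comp (measurable_powp (- p))); exact: measurable_funB.
rewrite (ge0_integralZl_EFin mu measurableT _ mk1 (Z0 w)); last first.
  by move=> u _; rewrite lee_fin mulr_ge0 ?powp_ge0.
have [Sv|Sv] := leP v (S w); last first.
  by rewrite integral_powpN ?(ltW Sv)// powp_gt0 ?subr_gt0// -!EFinM; congr EFin; ring.
rewrite powp_le0 ?subr_le0 ?gt_eqF// !mulr0 mule0 integral0_eq ?mule0// => u _; congr EFin.
have [uS|uS] := leP u (S w); first by rewrite mulr0.
by rewrite powp_le0 ?mul0r// subr_le0 (le_trans Sv)// ltW.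
Qed.

End fractional.

Lemma cvg_ext (T : Type) (U : nbhsType) (F : set_system T) (f g : T -> U) (l l' : U) :
  f x @[x --> F] --> l -> f =1 g -> l = l' -> g x @[x --> F] --> l'.
Proof. by move=> fl /funext <- <-. Qed.

Lemma powR_quotient (R : realType) (r x : R) : 0 < x ->
  h^-1 * ((x + h) `^ r - x `^ r) @[h --> 0^'+] --> r * x `^ (r - 1).
Proof.
move=> x0; have [df dE] := is_derive1_powR r x0.
have : h^-1 *: ((fun y : R => y `^ r) (h *: 1 + x) - x `^ r) @[h --> 0^'] --> r * x `^ (r - 1).
  by rewrite -dE; exact: df.
move=> /cvg_dnbhs_at_right; apply: cvg_trans; apply: near_eq_cvg; apply: nearW => h.
by rewrite /= /GRing.scale /= mulr1 [h + x]addrC.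
Qed.

Transparent residual.
Lemma residualE (R : realType) d (Omega : measurableType d) (P : probability Omega R)
    (X : R -> Omega -> R) (alpha y v : R) :
  residual P X alpha y v = Ex P (fun w => Num.max (v - powp alpha y * tau X 1 w) 0).
Proof. by []. Qed.
Opaque residual.

(** * Small overshoots: moments of order alpha rho *)

Section limits.
Context (R : realType) d (Omega : measurableType d) (P : probability Omega R)
  (X : R -> Omega -> R) (alpha rho k : R).
Hypothesis alpha_gt1 : 1 < alpha.
Hypothesis SX : stable_levy_process P alpha X.
Hypothesis ae_hit : forall y, 0 < y -> {ae P, forall w, hit (X ^~ w) y !=set0}.
Hypothesis k_gt0 : 0 < k.
Hypothesis rho01 : 0 < rho < 1.
Hypothesis FsupP : forall e, 0 < e -> \forall y \near 0^'+,
  `|Fsup P X y - k * y `^ (alpha * rho)| <= e * (k * y `^ (alpha * rho)).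

Let a0 : 0 < alpha := alpha_gt0 alpha_gt1.
Let rho0 : 0 < rho. Proof. by case/andP: rho01. Qed.
Let p := 1 - rho.
Let p0 : 0 < p. Proof. by rewrite subr_gt0; case/andP: rho01. Qed.
Let beta := alpha * rho.
Let b0 : 0 < beta. Proof. exact: mulr_gt0. Qed.
Let c1 := k / p.
Let c10 : 0 < c1. Proof. exact: divr_gt0. Qed.
Let Y := tau X 1.
Let mY : measurable_fun setT Y. Proof. exact: (measurable_tau SX). Qed.
Let Y0 w : 0 <= Y w. Proof. exact: tau_ge0. Qed.
Notation residual := (residual P X alpha).

(** For y and v positive this is E min(tau_y, v); in this form it extends by 0 to the other levels
    and times. *)
Definition mfun y v := Num.max v 0 - residual y v.

Lemma mfun_ge0 y v : 0 <= mfun y v.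
Proof. by rewrite subr_ge0; exact: (residual_le SX). Qed.

Lemma mfun_le0 y v : v <= 0 -> mfun y v = 0.
Proof. by move=> v0; rewrite /mfun (residual_le0 SX)// max0_le0// subrr. Qed.

Lemma residual_Nlevel y v : y <= 0 -> residual y v = Num.max v 0.
Proof.
move=> y0; rewrite residualE -[RHS](Ex_cst P).
by apply: Ex_eq => w; rewrite powp_le0 ?gt_eqF// mul0r subr0.
Qed.

Lemma mfun_Nlevel y v : y <= 0 -> mfun y v = 0.
Proof. by move=> y0; rewrite /mfun residual_Nlevel// subrr. Qed.

Lemma mfunE y v : 0 < y -> 0 < v -> mfun y v = y `^ alpha * m1 P X (v * y `^ (- alpha)).
Proof.
move=> y0 v0; have ya : 0 < y `^ alpha by exact: powR_gt0.
have va : 0 <= v * y `^ (- alpha) by rewrite mulr_ge0 ?powR_ge0// ltW.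
have bm : bmf (fun w => Num.min (Y w) (v * y `^ (- alpha))).
  split; first by apply: measurable_minr.
  by exists (v * y `^ (- alpha)) => w; rewrite ger0_norm ?ge_min ?lexx ?orbT// le_min Y0.
rewrite /mfun max_l ?ltW// (_ : residual y v = v - y `^ alpha * m1 P X (v * y `^ (- alpha))) ?subKr//.
rewrite residualE -[X in X - _](Ex_cst P v) /m1 -ExZ// -ExB; [|exact: bmf_cst|exact: bmfZ].
apply: Ex_eq => w; rewrite powp_gt0// minr_pMr ?ltW// mulrCA powRN mulfV ?gt_eqF// mulr1.
rewrite -/Y; set z := _ * Y w; have [h|h] := leP z v.
  by rewrite max_l// subr_ge0.
by rewrite subrr max_r// subr_le0 ltW.
Qed.

Let expo y v : 0 < y -> 0 < v ->
  y `^ alpha * (v * y `^ (- alpha)) `^ p = y `^ beta * v `^ p.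
Proof.
move=> y0 v0; rewrite powRM ?powR_ge0 ?(ltW v0)// mulrCA [RHS]mulrC; congr (_ * _).
rewrite -powRrM -powRDp//; congr (_ `^ _).
by rewrite /beta /p; ring.
Qed.

Lemma mfun_le : exists2 C, 0 < C & forall y v, mfun y v <= C * (powp beta y * powp p v).
Proof.
have [C C0 HC] := m1_le alpha_gt1 SX ae_hit rho01 FsupP.
exists C => // y v.
have [y0|y0] := ltP 0 y; last by rewrite mfun_Nlevel// mulr_ge0 ?(ltW C0)// mulr_ge0// powp_ge0.
have [v0|v0] := ltP 0 v; last by rewrite mfun_le0// mulr_ge0 ?(ltW C0)// mulr_ge0// powp_ge0.
rewrite mfunE// !powp_gt0// -expo// [leRHS]mulrCA ler_pM2l ?powR_gt0//.
by apply: HC; rewrite mulr_gt0 ?powR_gt0.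
Qed.

Lemma mfun_near e : 0 < e -> exists2 A, 0 < A & forall y v, 0 < y -> 0 < v ->
  A * y `^ alpha <= v -> `|mfun y v - c1 * (y `^ beta * v `^ p)| <= e * (y `^ beta * v `^ p).
Proof.
(* The absolute error e becomes a relative error e / c1, kept below 1 as [m1_bounds] requires. *)
move=> e0; pose e' := Num.min (e / c1) (1 / 2).
have e'01 : 0 < e' < 1 by rewrite lt_min divr_gt0//= gt_min; apply/andP; split; [lra|apply/orP; right; lra].
have [A A0 HA] := m1_bounds alpha_gt1 SX ae_hit k_gt0 rho01 FsupP e'01.
exists A => // y v y0 v0 Av.
have : A <= v * y `^ (- alpha) by rewrite powRN ler_pdivlMr ?powR_gt0.
move=> /HA; rewrite -/p -/c1 => /andP[h1 h2].
have ec : e' * c1 <= e by rewrite -ler_pdivlMr// /e' ge_min lexx.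
have ya : 0 < y `^ alpha by exact: powR_gt0.
have M0 : 0 < (v * y `^ (- alpha)) `^ p by rewrite powR_gt0// mulr_gt0// powR_gt0.
rewrite mfunE// -expo//.
set M := _ `^ p in h1 h2 M0 *; set m := m1 _ _ _ in h1 h2 *.
rewrite (_ : _ - _ = y `^ alpha * (m - c1 * M)); last by ring.
rewrite normrM gtr0_norm// mulrCA ler_pM2l// ler_norml.
have ecM := ler_wpM2r (ltW M0) ec.
apply/andP; split; lra.
Qed.

(** The asymptotics of [mfun] hold when y^alpha is small compared to v, whereas v will be u - T,
    possibly close to 0. Below eta both terms are at most a constant times eta^p y^beta, which makes
    the estimate uniform in v <= u. *)
Lemma mfun_small u e : 0 < u -> 0 < e -> exists2 h0, 0 < h0 & forall y v, y <= h0 -> v <= u ->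
  `|mfun y v - c1 * (powp beta y * powp p v)| <= e * powp beta y.
Proof.
move=> u0 e0; have [C C0 HC] := mfun_le.
pose eta := (e / (C + c1)) `^ p^-1.
have Cc : 0 < C + c1 by exact: addr_gt0.
have eta0 : 0 < eta by rewrite powR_gt0// divr_gt0.
have etap : (C + c1) * eta `^ p = e.
  by rewrite /eta -powRrM mulVf ?gt_eqF// powRr1 ?(ltW (divr_gt0 _ _))// mulrC divfK// gt_eqF.
have up : 0 < u `^ p by exact: powR_gt0.
have [A A0 HA] := mfun_near (divr_gt0 e0 up).
exists ((eta / A) `^ alpha^-1); first by rewrite powR_gt0// divr_gt0.
move=> y v yh vu.
have [y0|y0] := ltP 0 y; last by rewrite mfun_Nlevel// powp_le0 ?gt_eqF// mul0r !mulr0 subrr normr0.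
rewrite powp_gt0//; have yb : 0 < y `^ beta by exact: powR_gt0.
have [v0|v0] := ltP 0 v; last first.
  by rewrite mfun_le0// powp_le0 ?gt_eqF// !mulr0 subrr normr0 mulr_ge0 ?(ltW e0)// ltW.
rewrite powp_gt0//.
have [ve|ve] := leP eta v.
  apply: le_trans (HA y v y0 v0 _) _.
    apply: le_trans ve; rewrite mulrC -ler_pdivlMr//.
    rewrite -[leRHS]powRr1 ?divr_ge0 ?(ltW eta0) ?(ltW A0)// -(mulVf (lt0r_neq0 a0)) powRrM.
    by apply: ler_powRl; rewrite ?(ltW a0) ?(ltW y0).
  rewrite mulrCA [leRHS]mulrC ler_pM2l// mulrAC ler_pdivrMr// ler_pM2l//.
  by apply: ler_powRl; rewrite ?(ltW p0) ?(ltW v0).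
have vp : v `^ p <= eta `^ p by apply: ler_powRl; rewrite ?(ltW p0) ?(ltW v0) ?(ltW ve).
have vp0 : 0 <= v `^ p by exact: powR_ge0.
have m0 := mfun_ge0 y v; have := HC y v; rewrite !powp_gt0// => mC.
rewrite -etap.
have q1 : y `^ beta * v `^ p <= y `^ beta * eta `^ p by rewrite ler_pM2l.
have q0 : 0 <= y `^ beta * v `^ p by rewrite mulr_ge0// ltW.
have q2 := ler_wpM2l (ltW C0) q1; have q3 := ler_wpM2l (ltW c10) q1.
have q4 : 0 <= c1 * (y `^ beta * v `^ p) by rewrite mulr_ge0// ltW.
have q5 : 0 <= C * (y `^ beta * eta `^ p) by rewrite mulr_ge0 ?(ltW C0)// (le_trans q0).
rewrite (_ : (C + c1) * _ * _ = C * (y `^ beta * eta `^ p) + c1 * (y `^ beta * eta `^ p)); last by ring.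
rewrite ler_norml; apply/andP; split; lra.
Qed.

Section level.
Variable x : R.
Hypothesis x0 : 0 < x.
Let T := tau X x.
Let K := ovs X x.
Let mT : measurable_fun setT T. Proof. exact: (measurable_tau SX). Qed.
Let mK : measurable_fun setT K. Proof. exact: (measurable_ovs SX). Qed.
Let T0 w : 0 <= T w. Proof. exact: tau_ge0. Qed.
Let K0 w : 0 <= K w. Proof. exact: (ovs_ge0 SX). Qed.

Lemma residual_time u : residual x u = Ex P (fun w => Num.max (u - T w) 0).
Proof.
have := strong_markov alpha_gt1 SX ae_hit u x0 (lexx 0); rewrite addr0 => ->.
by apply: Ex_eq => w; rewrite residual_Nlevel// sub0r oppr_le0.
Qed.

Lemma bmf_pos_part u : bmf (fun w => Num.max (u - T w) 0).
Proof.
have := bmf_powp mT T0 u ler01.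
by under eq_fun do rewrite /powp powRr1 ?max0_ge0//.
Qed.

Lemma bmf_residual h u : bmf (fun w => residual (h - K w) (u - T w)).
Proof.
pose f s z := residual (h - z) (u - Num.max s 0).
have cf : continuous (fun q : R * R => f q.1 q.2).
  have cp : continuous (fun q : R * R => (h - q.2, u - Num.max q.1 0)).
    apply: continuous_pair.
      by apply: continuous_subl => q; exact: cvg_snd.
    apply: continuous_subl; apply: (continuous_fst_comp (f := fun s => Num.max s 0)).
    exact: continuous_max0.
  move=> q; apply: (@continuous_comp _ _ _ (fun q : R * R => (h - q.2, u - Num.max q.1 0))
    (fun q => residual q.1 q.2)); first exact: cp.
  exact: (residual_continuous alpha_gt1 SX).
have fC s z : `|f s z| <= Num.max u 0.
  rewrite ger0_norm ?(residual_ge0)//.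
  by apply: le_trans (residual_le SX _ _) _; exact/max0_sub_le/max0_ge0.
have := bmf_tau SX x cf fC; congr bmf; apply/funext => w.
by rewrite /f [Num.max (tau X x w) 0]max_l.
Qed.

Lemma bmf_mfun h u : bmf (fun w => mfun (h - K w) (u - T w)).
Proof. by apply: bmfB; [exact: bmf_pos_part|exact: bmf_residual]. Qed.

(** The left side is the mean time spent before u between the passages over x and x + h; a restart
    at the first one computes it. *)
Lemma residual_gap h u : 0 <= h ->
  residual x u - residual (x + h) u = Ex P (fun w => mfun (h - K w) (u - T w)).
Proof.
move=> h0; rewrite residual_time (strong_markov alpha_gt1 SX ae_hit u x0 h0) -ExB//.
  exact: bmf_pos_part.
exact: bmf_residual.
Qed.

Let inv_pow n : (n.+1%:R^-1 : R) `^ p = n.+1%:R `^ (- p).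
Proof. by rewrite -powR_inv1// -powRrM mulN1r. Qed.

Let inv_pow_cvg : (n.+1%:R : R) `^ (- p) @[n --> \oo] --> (0 : R).
Proof.
under eq_fun do rewrite -inv_pow.
have /cvg_at_rightP := powR_cvg0 p0; apply; split => [n|]; first by rewrite invr_gt0.
exact: cvg_harmonic.
Qed.

Let mfun_asymp y : mfun y n.+1%:R * n.+1%:R `^ (- p) @[n --> \oo] --> c1 * powp beta y.
Proof.
have [y0|y0] := ltP 0 y; last first.
  rewrite powp_le0 ?gt_eqF// mulr0; apply: cvg_near_cst; apply: nearW => n.
  by rewrite mfun_Nlevel// mul0r.
have yb : 0 < y `^ beta by exact: powR_gt0.
apply/cvgrPdist_le => e e0.
have [A A0 HA] := mfun_near (divr_gt0 e0 yb).
near=> n; have n0 : 0 < n.+1%:R :> R by [].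
have np : 0 < n.+1%:R `^ p :> R by exact: powR_gt0.
have := HA y n.+1%:R y0 n0 _; rewrite powp_gt0// powRN => /(_ _) h.
rewrite distrC -(ler_pM2r np) -[X in _ * X <= _](gtr0_norm np) -normrM mulrBl.
rewrite divfK ?gt_eqF// -mulrA; apply: le_trans (h _) _.
  near: n; apply: filterS (nbhs_infty_ger (A * y `^ alpha)) => n h'.
  by apply: le_trans h' _; rewrite ler_nat.
by rewrite mulrA divfK// gt_eqF.
Unshelve. all: by end_near. Qed.

Let mfun_shift y t u : `|mfun y (u - t) - mfun y u| <= 2 * `|t|.
Proof.
rewrite (_ : mfun y (u - t) - mfun y u =
  (Num.max (u - t) 0 - Num.max u 0) - (residual y (u - t) - residual y u)); last by rewrite /mfun; ring.
apply: le_trans (ler_normB _ _) _.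
have h1 := max0_lip (u - t) u; have h2 := residual_lipr SX y (u - t) u.
have ut : `|u - t - u| = `|t| by rewrite addrAC subrr add0r normrN.
by rewrite ut in h1 h2; lra.
Qed.

(** Divide [residual_gap] by u^p and let u tend to infinity: the left side tends to c1 ((x + h)^beta
    - x^beta), the right side to c1 times the moment. *)
Lemma overshoot_moment h : 0 <= h ->
  Ex P (fun w => powp beta (h - K w)) = (x + h) `^ beta - x `^ beta.
Proof.
move=> h0; have xh : 0 < x + h by exact: ltr_wpDr.
have [C C0 HC] := mfun_le.
have bpow := bmf_powp mK K0 h (ltW b0).
have lim1 : (residual x n.+1%:R - residual (x + h) n.+1%:R) * n.+1%:R `^ (- p) @[n --> \oo] -->
    c1 * ((x + h) `^ beta - x `^ beta).
  have -> : c1 * ((x + h) `^ beta - x `^ beta) = c1 * powp beta (x + h) - c1 * powp beta x.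
    by rewrite !powp_gt0// mulrBr.
  apply: (cvg_ext (cvgB (@mfun_asymp (x + h)) (@mfun_asymp x))) => // n.
  transitivity (mfun (x + h) n.+1%:R * n.+1%:R `^ (- p) - mfun x n.+1%:R * n.+1%:R `^ (- p)); first by [].
  rewrite -mulrBl; congr (_ * _); rewrite /mfun.
  by move: (Num.max _ _) (residual (x + h) _) (residual x _) => a b c; ring.
have lim2 : (residual x n.+1%:R - residual (x + h) n.+1%:R) * n.+1%:R `^ (- p) @[n --> \oo] -->
    c1 * Ex P (fun w => powp beta (h - K w)).
  rewrite -ExZ//.
  have E n : (residual x n.+1%:R - residual (x + h) n.+1%:R) * n.+1%:R `^ (- p) =
      Ex P (fun w => n.+1%:R `^ (- p) * mfun (h - K w) (n.+1%:R - T w)).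
    by rewrite residual_gap// mulrC ExZ//; exact: bmf_mfun.
  under eq_fun do rewrite E.
  apply: (Ex_cvg (C := C * h `^ beta)).
  - by move=> n; have [] := bmfZ (n.+1%:R `^ (- p)) (bmf_mfun h n.+1%:R).
  - by have [] := bmfZ c1 bpow.
  - move=> n w; rewrite ger0_norm ?mulr_ge0 ?powR_ge0 ?mfun_ge0//.
    rewrite powRN mulrC ler_pdivrMr ?powR_gt0//; apply: le_trans (HC _ _) _.
    rewrite -mulrA ler_pM2l//; apply: ler_pM; rewrite ?powp_ge0//.
      have -> : h `^ beta = powp beta h by rewrite /powp max_l.
      by apply: powp_homo; rewrite ?(ltW b0)// gerBl.
    rewrite -powp_gt0//; apply: powp_homo; rewrite ?(ltW p0)// gerBl//.
  - apply: aeW => w.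
    have -> : c1 * powp beta (h - K w) = 0 + c1 * powp beta (h - K w) by rewrite add0r.
    (* Replacing the time u - T by u costs at most 2 T by Lipschitz continuity, negligible after
       division by u^p. *)
    have z : n.+1%:R `^ (- p) * (mfun (h - K w) (n.+1%:R - T w) - mfun (h - K w) n.+1%:R) @[n --> \oo] --> (0 : R).
      apply/cvgrPdist_le => e e0.
      have t20 : 0 < 2 * T w + 1 by have := T0 w; lra.
      have /cvgrPdist_le /(_ _ (divr_gt0 e0 t20)) := inv_pow_cvg; apply: filterS => n.
      rewrite !sub0r !normrN normrM => h1.
      apply: (@le_trans _ _ (e / (2 * T w + 1) * (2 * `|T w|))).
        by apply: ler_pM => //; exact: mfun_shift.
      rewrite ger0_norm//  mulrAC ler_pdivrMr// ler_pM2l//; lra.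
    apply: (cvg_ext (cvgD z (@mfun_asymp (h - K w)))) => // n.
    by rewrite /= mulrBr [_ * n.+1%:R `^ _]mulrC subrK.
apply: (mulfI (lt0r_neq0 c10)); exact: (cvg_unique (@Rhausdorff R) lim2 lim1).
Qed.

Lemma overshoot_moment_quotient :
  h^-1 * Ex P (fun w => powp beta (h - K w)) @[h --> 0^'+] --> beta * x `^ (beta - 1).
Proof.
have := @powR_quotient R beta x x0; apply: cvg_trans; apply: near_eq_cvg.
near=> h; rewrite overshoot_moment//.
Unshelve. all: by end_near. Qed.

(** By scaling tau_(x + h) has the law of g T with g = ((x + h) / x)^alpha, so the derivative in the
    level becomes that of (u - g T)_+ at g = 1 from the right, which is - T if T < u and 0
    otherwise; alpha / x is the derivative of g in h at 0. *)
Lemma residual_gap_quotient u : 0 < u ->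
  h^-1 * (residual x u - residual (x + h) u) @[h --> 0^'+] -->
  alpha / x * Ex P (fun w => T w * (T w < u)%R%:R).
Proof.
move=> u0; apply/cvg_at_rightP => v [v0 vc].
pose g n := ((x + v n) / x) `^ alpha.
have xv n : x < x + v n by rewrite ltrDl.
have xv0 n : 0 < x + v n by exact: lt_trans (xv n).
have xa : 0 < x `^ alpha by exact: powR_gt0.
have g1 n : 1 < g n.
  rewrite -[ltLHS](_ : 1 `^ alpha = 1); last by rewrite powR1.
  by apply: gt0_ltr_powR; rewrite ?nnegrE ?ler01 ?divr_ge0 ?(ltW x0) ?(ltW (xv0 n))// ltr_pdivlMr// mul1r.
have gx n : g n * x `^ alpha = (x + v n) `^ alpha.
  by rewrite /g -powRM ?divr_ge0 ?(ltW x0) ?(ltW (xv0 n))// divfK// gt_eqF.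
have gq : (v n)^-1 * (g n - 1) @[n --> \oo] --> alpha / x.
  have /cvg_at_rightP := @powR_quotient R alpha x x0 => /(_ v (conj v0 vc)) h.
  have -> : alpha / x = alpha * x `^ (alpha - 1) * (x `^ alpha)^-1.
    by rewrite -mulrA; congr (_ * _); rewrite -powRN -powRDp// -powR_inv1 ?(ltW x0)//; congr (_ `^ _); ring.
  apply: (cvg_ext (cvgM h (cvg_cst (x `^ alpha)^-1))) => // n /=.
  by rewrite -gx -mulrA; congr (_ * _); rewrite mulrBl mulfK ?gt_eqF// mulfV ?gt_eqF.
have gc : g n @[n --> \oo] --> (1 : R).
  have -> : 1 = 1 + alpha / x * 0 :> R by rewrite mulr0 addr0.
  apply: (cvg_ext (cvgD (cvg_cst (1 : R)) (cvgM gq vc))) => // n /=.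
  by rewrite mulrC mulrA mulfV ?gt_eqF// mul1r addrC subrK.
have resE n : residual (x + v n) u = Ex P (fun w => Num.max (u - g n * T w) 0).
  have gn0 : 0 <= g n by exact: powR_ge0.
  have cphi : continuous (fun s : R => Num.max (u - g n * Num.max s 0) 0).
    apply: continuous_maxr; last exact: cst_continuous.
    by apply: continuous_subl => s; apply: cvgMr; exact: continuous_max0.
  have phiC s : `|Num.max (u - g n * Num.max s 0) 0| <= Num.max u 0.
    by apply: norm_max0_sub_le; rewrite mulr_ge0// max0_ge0.
  have := scale_tau alpha_gt1 SX ae_hit x0 cphi phiC.
  under eq_fun do rewrite [Num.max (tau _ _ _) 0]max_l ?T0//.
  move=> ->; rewrite residualE; apply: Ex_eq => w.
  by rewrite [Num.max (_ * _) 0]max_l ?mulr_ge0 ?powR_ge0// mulrA gx powp_gt0.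
pose r n w := (Num.max (u - T w) 0 - Num.max (u - g n * T w) 0) / (g n - 1).
have br n : bmf (fun w => Num.max (u - T w) 0 - Num.max (u - g n * T w) 0).
  apply: bmfB; first exact: bmf_pos_part.
  split; first by apply: measurable_maxr => //; apply: measurable_funB => //; exact: measurable_funM.
  exists (Num.max u 0) => w; apply: norm_max0_sub_le; rewrite mulr_ge0 ?powR_ge0//.
have gE n : (v n)^-1 * (residual x u - residual (x + v n) u) = (v n)^-1 * (g n - 1) * Ex P (r n).
  rewrite residual_time resE -ExB; [|exact: bmf_pos_part|]; last first.
    have := bmfB (bmf_pos_part u) (br n); under eq_fun do rewrite subKr; exact.
  rewrite -mulrA; congr (_ * _); rewrite /r.
  under [in RHS]eq_fun do rewrite mulrC.
  by rewrite ExZ// mulrA mulfV ?mul1r// subr_eq0 gt_eqF.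
under eq_fun do rewrite gE.
apply: cvgM => //.
have rle n w : 0 <= r n w <= u.
  have gn : 0 < g n - 1 by rewrite subr_gt0.
  have gT : T w <= g n * T w by rewrite ler_peMl// ltW.
  rewrite /r divr_ge0 ?(ltW gn)//=; last by rewrite subr_ge0; apply: max0_homo; lra.
  rewrite ler_pdivrMr//.
  have [uT|uT] := leP u (T w).
    rewrite max0_le0 ?subr_le0// max0_le0; last by rewrite subr_le0 (le_trans uT).
    by rewrite subrr mulr_ge0// ltW.
  rewrite max_l; last by rewrite subr_ge0 ltW.
  have h1 : u - g n * T w <= Num.max (u - g n * T w) 0 by rewrite le_max lexx.
  have : (g n - 1) * T w <= (g n - 1) * u by rewrite ler_pM2l// ltW.
  by lra.
apply: (Ex_cvg (C := u)).
- by move=> n; have [mb _] := br n; apply: measurable_funM => //.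
- apply: measurable_funM => //.
  rewrite (_ : (fun _ => _) = \1_[set w | T w < u]).
    by apply: measurable_indic; exact: measurable_lt_set.
  by apply/funext => w; rewrite indicE mem_setE.
- by move=> n w; have /andP[r0 ru] := rle n w; rewrite ger0_norm.
apply: aeW => w; apply: cvg_near_cst.
have [uT|uT] := leP u (T w).
  apply: nearW => n; have gT : T w <= g n * T w by rewrite ler_peMl// ltW.
  rewrite /r max0_le0 ?subr_le0// max0_le0; last by rewrite subr_le0 (le_trans uT).
  by rewrite subrr mul0r mulr0.
have Tg : g n * T w @[n --> \oo] --> T w.
  by rewrite -[X in _ --> X]mul1r; apply: cvgMl.
near=> n; have gTu : g n * T w < u by near: n; exact: (cvgr_lt (T w)).
rewrite /r !max_l ?subr_ge0 ?(ltW gTu) ?(ltW uT)// mulr1.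
have -> : u - T w - (u - g n * T w) = (g n - 1) * T w by ring.
by rewrite mulrAC mulfV ?mul1r// subr_eq0 gt_eqF.
Unshelve. all: by end_near. Qed.

(** Up to the factor c1, the quotient of [residual_gap] and the one sought differ by at most a small
    multiple of the moment quotient, which stays bounded. *)
Lemma joint_quotient u : 0 < u ->
  h^-1 * Ex P (fun w => powp beta (h - K w) * powp p (u - T w)) @[h --> 0^'+] -->
  alpha / (c1 * x) * Ex P (fun w => T w * (T w < u)%R%:R).
Proof.
move=> u0; set E := Ex P _.
have bT := bmf_powp mT T0 u (ltW p0).
have bK h := bmf_powp mK K0 h (ltW b0).
have -> : alpha / (c1 * x) * E = c1^-1 * (alpha / x * E) by field; rewrite !gt_eqF.
suff : c1 * (h^-1 * Ex P (fun w => powp beta (h - K w) * powp p (u - T w))) @[h --> 0^'+] --> alpha / x * E.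
  move=> H; apply: (cvg_ext (cvgM (cvg_cst c1^-1) H)) => // h /=.
  by rewrite mulrA mulVf ?mul1r// gt_eqF.
apply/cvgrPdist_le => e e0.
pose B := beta * x `^ (beta - 1) + 1.
have B0 : 0 < B by rewrite ltr_wpDl// mulr_ge0 ?powR_ge0// ltW.
have e20 : 0 < e / 2 by rewrite divr_gt0.
have [h0 h00 Hh0] := mfun_small u0 (divr_gt0 e20 B0).
have /cvgrPdist_le /(_ _ e20) Hgap := residual_gap_quotient u0.
have /cvgrPdist_le /(_ _ (@ltr01 R)) Hmom := overshoot_moment_quotient.
near=> h.
have hp : 0 < h by near: h; exact: nbhs_right_gt.
have hh0 : h <= h0 by near: h; exact: nbhs_right_le.
have gap : `|alpha / x * E - h^-1 * (residual x u - residual (x + h) u)| <= e / 2.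
  by near: h; exact: Hgap.
have mom : `|beta * x `^ (beta - 1) - h^-1 * Ex P (fun w => powp beta (h - K w))| <= 1.
  by near: h; exact: Hmom.
have bKT : bmf (fun w => powp beta (h - K w) * powp p (u - T w)) by exact: bmfM.
have cmp : `|h^-1 * (residual x u - residual (x + h) u) -
    c1 * (h^-1 * Ex P (fun w => powp beta (h - K w) * powp p (u - T w)))| <=
    e / 2 / B * (h^-1 * Ex P (fun w => powp beta (h - K w))).
  rewrite [X in _ <= X]mulrCA [X in _ - X]mulrCA -mulrBr normrM gtr0_norm ?invr_gt0// ler_pM2l ?invr_gt0//.
  rewrite residual_gap ?(ltW hp)// -ExZ// -ExB; [|exact: bmf_mfun|exact: bmfZ].
  have bd : bmf (fun w => mfun (h - K w) (u - T w) - c1 * (powp beta (h - K w) * powp p (u - T w))).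
    by apply: bmfB; [exact: bmf_mfun|exact: bmfZ].
  apply: le_trans (Ex_norm P bd) _; rewrite -ExZ//.
  apply: le_Ex; [exact: bmf_norm|exact: bmfZ|move=> w].
  apply: Hh0; first by apply: le_trans hh0; rewrite gerBl.
  by rewrite gerBl.
have mB : h^-1 * Ex P (fun w => powp beta (h - K w)) <= B.
  by move: mom; rewrite ler_norml /B => /andP[]; lra.
apply: le_trans (ler_distD (h^-1 * (residual x u - residual (x + h) u)) _ _) _.
rewrite [e]splitr; apply: lerD => //; apply: le_trans cmp _.
by rewrite mulrAC ler_pdivrMr// ler_pM2l.
Unshelve. all: by end_near. Qed.

End level.

End limits.

(** * From moments of the overshoot to conditioning on small overshoots *)

Lemma cvg_ext_near (T : Type) (U : nbhsType) (F : set_system T) (f g : T -> U) (l l' : U) :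
  Filter F -> f x @[x --> F] --> l -> (\forall x \near F, f x = g x) -> l = l' ->
  g x @[x --> F] --> l'.
Proof. by move=> FF fl fg <-; apply: cvg_trans fl; exact: near_eq_cvg. Qed.

(** In the hypothesis G acts as a nondecreasing derivative of N, without any differentiation. G h is
    squeezed between bounds given by the slopes of N over [h / lam, h] and [h, lam h]; after
    normalisation their limits are close to r l once lam = 1 + d is close to 1. *)
Lemma monotone_density (R : realType) (N G : R -> R) (r l : R) :
  (forall a b, 0 < a -> a < b -> (b - a) * G a <= N b - N a <= (b - a) * G b) ->
  N h * h `^ (- r) @[h --> 0^'+] --> l -> G h * h `^ (1 - r) @[h --> 0^'+] --> r * l.
Proof.
move=> NG Nl; apply/cvg_at_rightP => v [v0 vc]; apply/cvgrPdist_le => e e0.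
pose n h := N h * h `^ (- r).
have nseq lam : 0 < lam -> n (lam * v m) @[m --> \oo] --> l.
  move=> lam0; have /cvg_at_rightP := Nl; apply; split=> [m|]; first exact: mulr_gt0.
  by rewrite -(mulr0 lam); apply: cvgMr.
pose phi d : R := d^-1 * ((1 + d) `^ r - 1).
have phir : phi d @[d --> 0^'+] --> r.
  by apply: (cvg_ext (@powR_quotient R r 1 ltr01)) => [d|]; rewrite powR1 ?mulr1.
have phir2 : (1 + d) `^ (1 - r) * phi d @[d --> 0^'+] --> r.
  rewrite -[X in _ --> X]mul1r; apply: cvgM => //.
  have h1 : (1 + d : R) @[d --> 0^'+] --> (1 : R).
    rewrite -[X in _ --> X]addr0; apply: cvgD; first exact: cvg_cst.
    by apply: cvg_at_right_filter; exact: cvg_id.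
  rewrite -[X in _ --> X](_ : 1 `^ (1 - r) = 1); last by rewrite powR1.
  have hc := @powR_continuous_gt0 R (1 - r) 1 ltr01.
  exact: (@cvg_comp _ _ _ (fun d : R => 1 + d) (fun y : R => y `^ (1 - r)) _ _ _ h1 hc).
have e20 : 0 < e / 2 / (`|l| + 1) by rewrite !divr_gt0// ltr_wpDl.
have /cvgrPdist_le /(_ _ e20) H1 := phir.
have /cvgrPdist_le /(_ _ e20) H2 := phir2.
near (0 : R)^'+ => d.
have d0 : 0 < d by near: d; exact: nbhs_right_gt.
have p1 : `|r - phi d| <= e / 2 / (`|l| + 1) by near: d; exact: H1.
have p2 : `|r - (1 + d) `^ (1 - r) * phi d| <= e / 2 / (`|l| + 1) by near: d; exact: H2.
have small q : `|r - q| <= e / 2 / (`|l| + 1) -> `|r * l - q * l| <= e / 2.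
  move=> h; rewrite -mulrBl normrM; apply: (@le_trans _ _ (e / 2 / (`|l| + 1) * `|l|)).
    by rewrite ler_wpM2r.
  by rewrite mulrAC ler_pdivrMr ?ltr_wpDl// ler_pM2l ?divr_gt0// lerDl.
have {}p1 := small _ p1; have {}p2 := small _ p2.
pose lam : R := 1 + d; have lam0 : 0 < lam by rewrite addr_gt0.
have lam1 : 1 < lam by rewrite ltrDl.
have U : d^-1 * (lam `^ r * n (lam * v m) - n (1 * v m)) @[m --> \oo] --> phi d * l.
  apply: (cvg_ext (cvgM (cvg_cst d^-1) (cvgB (cvgM (cvg_cst (lam `^ r)) (nseq lam lam0)) (nseq 1 ltr01)))) => //.
  by rewrite /phi -/lam; ring.
have L : lam * d^-1 * (n (1 * v m) - lam `^ (- r) * n (lam^-1 * v m)) @[m --> \oo] --> (1 + d) `^ (1 - r) * phi d * l.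
  have li0 : 0 < lam^-1 by rewrite invr_gt0.
  apply: (cvg_ext (cvgM (cvg_cst (lam * d^-1)) (cvgB (nseq 1 ltr01) (cvgM (cvg_cst (lam `^ (- r))) (nseq lam^-1 li0))))) => //.
  have -> : (1 + d) `^ (1 - r) = lam * lam `^ (- r) by rewrite -/lam powRDp// powRr1// ltW.
  have lr : lam `^ (- r) * lam `^ r = 1 by rewrite -powRDp// addNr powRr0.
  transitivity (lam / d * (lam `^ (- r) * lam `^ r * l - lam `^ (- r) * l)); first by rewrite lr mul1r.
  rewrite /phi -/lam.
  by move: (lam `^ (- r)) (lam `^ r) => p q; ring.
have /cvgrPdist_le /(_ _ (divr_gt0 e0 (ltr0n R 2))) HU := U.
have /cvgrPdist_le /(_ _ (divr_gt0 e0 (ltr0n R 2))) HL := L.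
near=> m.
have u1 : `|phi d * l - d^-1 * (lam `^ r * n (lam * v m) - n (1 * v m))| <= e / 2 by near: m; exact: HU.
have u2 : `|(1 + d) `^ (1 - r) * phi d * l - lam * d^-1 * (n (1 * v m) - lam `^ (- r) * n (lam^-1 * v m))| <= e / 2.
  by near: m; exact: HL.
have hm := v0 m; move: u1 u2; set h := v m in hm * => u1 u2.
have hr : 0 < h `^ (- r) by exact: powR_gt0.
have hp : h `^ (1 - r) = h * h `^ (- r) by rewrite powRDp// powRr1// ltW.
have n1 : n (1 * h) = N h * h `^ (- r) by rewrite mul1r.
have n2 : lam `^ r * n (lam * h) = N (lam * h) * h `^ (- r).
  rewrite /n powRM ?(ltW lam0) ?(ltW hm)// mulrCA; congr (_ * _).
  by rewrite mulrA -powRDp// subrr powRr0 mul1r.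
have n3 : lam `^ (- r) * n (lam^-1 * h) = N (lam^-1 * h) * h `^ (- r).
  rewrite /n powRM ?invr_ge0 ?(ltW lam0) ?(ltW hm)// mulrCA; congr (_ * _).
  rewrite mulrA -powR_inv1 ?(ltW lam0)// -powRrM -powRDp//.
  by rewrite mulN1r opprK addNr powRr0 mul1r.
have up : G h * h `^ (1 - r) <= d^-1 * (lam `^ r * n (lam * h) - n (1 * h)).
  rewrite n1 n2 -mulrBl hp !mulrA ler_pM2r// mulrC -ler_pdivlMl// mulrC -mulrA.
  have hl : h < lam * h by rewrite ltr_pMl.
  have /andP[+ _] := NG _ _ hm hl.
  rewrite -ler_pdivlMl ?subr_gt0// => /le_trans; apply.
  have -> : lam * h - h = d * h by rewrite /lam; ring.
  by rewrite le_eqVlt; apply/orP; left; apply/eqP; field; rewrite !gt_eqF.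
have lo : lam * d^-1 * (n (1 * h) - lam `^ (- r) * n (lam^-1 * h)) <= G h * h `^ (1 - r).
  rewrite n1 n3 -mulrBl hp !mulrA ler_pM2r//.
  have hl : lam^-1 * h < h by rewrite gtr_pMl// invf_lt1.
  have lh : 0 < lam^-1 * h by rewrite mulr_gt0// invr_gt0.
  have /andP[_ +] := NG _ _ lh hl.
  have dp : 0 < lam * d^-1 by rewrite divr_gt0.
  move=> /(ler_wpM2l (ltW dp)) /le_trans; apply.
  by rewrite le_eqVlt; apply/orP; left; apply/eqP; rewrite /lam; field; rewrite !gt_eqF// addr_gt0.
move: u1 u2 p1 p2; rewrite !ler_norml => /andP[u1 _] /andP[_ u2] /andP[p1 p1'] /andP[p2 p2'].
by apply/andP; split; lra.
Unshelve. all: by end_near. Qed.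

Section space.
Context (R : realType) d (Omega : measurableType d) (P : probability Omega R).
Variables (K : Omega -> R) (beta : R).
Hypothesis mK : measurable_fun setT K.
Hypothesis K0 : forall w, 0 <= K w.
Hypothesis beta01 : 0 < beta <= 1.
Notation mu := (@lebesgue_measure R).

Let b0 : 0 < beta. Proof. by case/andP: beta01. Qed.

Lemma bmf_indicator_le (f : Omega -> R) h : measurable_fun setT f ->
  bmf (fun w => (f w <= h)%R%:R : R).
Proof.
move=> mf; rewrite (_ : (fun _ => _) = \1_[set w | f w <= h]).
  by apply: bmf_indic; exact: measurable_le_set.
by apply/funext => u; rewrite indicE mem_setE.
Qed.

Let bpos h : bmf (fun w => Num.max (h - K w) 0).
Proof.
have := bmf_powp mK K0 h ler01.
by under eq_fun do rewrite /powp powRr1 ?max0_ge0//.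
Qed.

Lemma measurable_convolution Z : bmf Z -> (forall w, 0 <= Z w) ->
  measurable_fun setT (fun u : R => Ex P (fun w => Z w * powp beta (u - K w))).
Proof.
move=> bZ Z0; apply: nondecreasing_measurable; first exact: measurableT.
move=> u v uv.
have bk h : bmf (fun w => powp beta (h - K w)) by exact: (bmf_powp mK K0 h (ltW b0)).
apply: le_Ex => [||w]; [exact: bmfM|exact: bmfM|].
by apply: ler_wpM2l => //; apply: powp_homo; rewrite ?(ltW b0)// lerD2r.
Qed.

(** A fractional integration in h against (v - h)^(-beta) turns (h - K)_+^beta into B (v - K)_+ and
    the behaviour a h into J a v^(2 - beta). The constant A is chosen before Z because it has to
    cancel between the numerator and the denominator of a conditional expectation. *)
Lemma integrated_limit : exists2 A, 0 < A & forall Z (a : R), bmf Z -> (forall w, 0 <= Z w) ->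
  h^-1 * Ex P (fun w => Z w * powp beta (h - K w)) @[h --> 0^'+] --> a ->
  Ex P (fun w => Z w * Num.max (h - K w) 0) * h `^ (- (2 - beta)) @[h --> 0^'+] --> A * a.
Proof.
have [b1|b1] := ltP beta 1; last first.
  (* For beta = 1 the hypothesis is already the conclusion with A = 1; the kernel would not be
     integrable. *)
  have -> : beta = 1 by apply/eqP; rewrite eq_le b1; case/andP: beta01 => _ ->.
  exists 1 => // Z a bZ Z0 H; rewrite mul1r.
  move: H; apply: cvg_trans; apply: near_eq_cvg; near=> h.
  have h0 : 0 < h by near: h; exact: nbhs_right_gt.
  rewrite mulrC (_ : - (2 - 1) = -1 :> R); last by ring.
  rewrite powR_inv1 ?(ltW h0)//; congr (_ * _); apply: Ex_eq => w.
  by rewrite /powp powRr1// max0_ge0.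
have b01 : 0 < beta < 1 by rewrite b0.
have [J J0 JE] := betaI_fin b01 ltr01.
have [B B0 BE] := betaI_fin b01 b0.
exists (J / B); first exact: divr_gt0.
move=> Z a bZ Z0 H; apply/cvgrPdist_le => e e0.
pose F u := Ex P (fun w => Z w * powp beta (u - K w)).
have F0 u : 0 <= F u by apply: Ex_ge0 => w; rewrite mulr_ge0// powp_ge0.
have mF : measurable_fun setT F by exact: measurable_convolution.
have FB v := fractional_integral P mK K0 bZ Z0 v b01 (ltW B0) BE.
have a0 : 0 <= a.
  apply: (ler_cvg_to (cvg_cst 0) H); near=> h; rewrite mulr_ge0// ?F0// invr_ge0 ltW//.
have e10 : 0 < e * B / J by rewrite divr_gt0// mulr_gt0.
set e1 := e * B / J in e10.
have /cvgrPdist_le /(_ _ e10) [dl /= dl0 Hd] := H.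
have Fb u : 0 < u -> u < dl -> (a - e1) * u <= F u <= (a + e1) * u.
  move=> u0 ud; have := Hd u; rewrite /= sub0r normrN gtr0_norm// => /(_ ud u0).
  rewrite -/(F u) ler_norml => /andP[h1 h2].
  have uF : u * (u^-1 * F u) = F u by rewrite mulrA mulfV ?mul1r// gt_eqF.
  by rewrite -uF; set q := u^-1 * _ in h1 h2 *; apply/andP; split; nra.
near=> v; have v0 : 0 < v by near: v; exact: nbhs_right_gt.
have vd : v < dl by near: v; exact: nbhs_right_lt.
set r := 2 - beta; have vr : 0 < v `^ r by exact: powR_gt0.
have mk : measurable_fun setT (fun u : R => powp (- beta) (v - u)).
  by apply: (measurableT_comp (measurable_powp (- beta))); exact: measurable_funB.
have mk1 : measurable_fun setT (fun u : R => powp (- beta) (v - u) * powp 1 u).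
  by apply: measurable_funM => //; exact: measurable_powp.
have k0 u : 0 <= powp (- beta) (v - u) * powp 1 u by rewrite mulr_ge0// powp_ge0.
have JI c : 0 <= c -> (\int[mu]_u (c * (powp (- beta) (v - u) * powp 1 u))%:E = (c * (v `^ r * J))%:E)%E.
  move=> c0; under eq_integral do rewrite EFinM.
  have k0' (u : R) : setT u -> (0 <= (powp (- beta) (v - u) * powp 1 u)%:E)%E by rewrite lee_fin.
  rewrite (ge0_integralZl_EFin mu measurableT k0' _ c0); last exact/measurable_EFinP.
  have := integral_beta (- beta) 1 v0; rewrite subr0.
  rewrite (_ : \int[mu]_u _ = \int[mu]_u (powp (- beta) (v - u) * powp 1 u)%:E)%E; last first.
    by apply: eq_integral => u _; rewrite subr0.
  by move=> ->; rewrite JE -!EFinM (_ : - beta + 1 + 1 = r)// /r; ring.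
have FN := FB v; rewrite -[in X in X = _](eq_integral _ _ (fun u _ => erefl)) in FN.
set N := Ex P (fun w => Z w * Num.max (v - K w) 0) in FN *.
have FZ u : u <= 0 -> F u = 0.
  move=> u0; rewrite /F -[RHS](Ex_cst P); apply: Ex_eq => w.
  by rewrite powp_le0 ?mulr0 ?gt_eqF// subr_le0 (le_trans u0).
have P1 u : 0 < u -> powp 1 u = u by move=> u0; rewrite powp_gt0// powRr1// ltW.
have P10 u : u <= 0 -> powp 1 u = 0 by move=> u0; rewrite powp_le0// oner_neq0.
have Pv u : v <= u -> powp (- beta) (v - u) = 0.
  by move=> uv; rewrite powp_le0 ?subr_le0// oppr_eq0 gt_eqF.
have up : B * N <= (a + e1) * (v `^ r * J).
  rewrite -lee_fin -FN -JI; last by rewrite addr_ge0// ltW.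
  apply: ge0_le_integral => //.
  - by move=> u _; rewrite lee_fin mulr_ge0 ?powp_ge0// F0.
  - by apply/measurable_EFinP; exact: measurable_funM.
  - by apply/measurable_EFinP; exact: measurable_funM.
  move=> u _; rewrite lee_fin [leRHS]mulrCA -/(F u).
  have [uv|uv] := leP v u; first by rewrite Pv// !mul0r.
  apply: ler_wpM2l; first exact: powp_ge0.
  have [u0|u0] := leP u 0; first by rewrite FZ// P10// mulr0.
  by rewrite P1//; have /andP[] := Fb u u0 (lt_trans uv vd).
have lo : a * (v `^ r * J) <= B * N + e1 * (v `^ r * J).
  rewrite -lee_fin EFinD -FN -!JI ?(ltW e10)// -ge0_integralD//; first last.
  - by apply/measurable_EFinP; exact: measurable_funM.
  - by move=> u _; rewrite lee_fin mulr_ge0 ?(ltW e10).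
  - by apply/measurable_EFinP; exact: measurable_funM.
  - by move=> u _; rewrite lee_fin mulr_ge0 ?powp_ge0// F0.
  apply: ge0_le_integral => //.
  - by move=> u _; rewrite lee_fin mulr_ge0.
  - by apply/measurable_EFinP; exact: measurable_funM.
  - by apply: emeasurable_funD; apply/measurable_EFinP; exact: measurable_funM.
  move=> u _; rewrite -EFinD lee_fin -/(F u).
  have [u0|u0] := leP u 0; first by rewrite FZ// P10// !mulr0 addr0.
  have [uv|uv] := leP v u; first by rewrite Pv// !mul0r !mulr0 addr0.
  have /andP[h _] := Fb u u0 (lt_trans uv vd); rewrite P1//.
  have := powp_ge0 (- beta) (v - u); set q := powp _ _ => q0.
  have := ler_wpM2l q0 h; lra.
have E : J / B * a - N * v `^ (- r) = (a * (v `^ r * J) - B * N) * (v `^ (- r) / B).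
  have vv : v `^ r * v `^ (- r) = 1 by rewrite -powRDp// subrr powRr0.
  rewrite -[J in LHS]mul1r -vv; field; exact: lt0r_neq0.
rewrite E normrM [X in _ * X]ger0_norm; last by rewrite divr_ge0 ?powR_ge0// ltW.
rewrite powRN -invfM ler_pdivrMr ?mulr_gt0//.
have -> : e * (v `^ r * B) = e1 * (v `^ r * J) by rewrite /e1; field; exact: lt0r_neq0.
by rewrite ler_norml; apply/andP; split; lra.
Unshelve. all: by end_near. Qed.

(** E[Z; K <= h] acts as the derivative in h of E Z (h - K)_+, hence by monotone density behaves
    like (2 - beta) A a h^(1 - beta). With Z = 1 this gives the denominator, and the powers of h
    cancel. *)
Lemma conditional_limit Z (a b : R) : bmf Z -> (forall w, 0 <= Z w) -> b != 0 ->
  h^-1 * Ex P (fun w => powp beta (h - K w)) @[h --> 0^'+] --> b ->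
  h^-1 * Ex P (fun w => Z w * powp beta (h - K w)) @[h --> 0^'+] --> a ->
  Ex P (fun w => Z w * (K w <= h)%R%:R) / Ex P (fun w => (K w <= h)%R%:R) @[h --> 0^'+] --> a / b.
Proof.
move=> bZ Z0 bn0 Hb Ha.
have [A A0 HA] := integrated_limit.
have dens Z' c : bmf Z' -> (forall w, 0 <= Z' w) ->
    h^-1 * Ex P (fun w => Z' w * powp beta (h - K w)) @[h --> 0^'+] --> c ->
    Ex P (fun w => Z' w * (K w <= h)%R%:R) * h `^ (1 - (2 - beta)) @[h --> 0^'+] --> (2 - beta) * (A * c).
  move=> bZ' Z0' Hc; apply: (monotone_density (N := fun h => Ex P (fun w => Z' w * Num.max (h - K w) 0))).
    move=> x y x0 xy.
    have bZK h : bmf (fun w => Z' w * (K w <= h)%R%:R) by apply: bmfM => //; exact: bmf_indicator_le.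
    have bZm h : bmf (fun w => Z' w * Num.max (h - K w) 0) by apply: bmfM.
    have bD : bmf (fun w => Z' w * Num.max (y - K w) 0 - Z' w * Num.max (x - K w) 0) by apply: bmfB.
    rewrite -ExB// -!ExZ//; apply/andP; split; apply: le_Ex => //; try exact: bmfZ; move=> w.
      have := Z0' w; have [h|h] := leP (K w) x; last first.
        by move=> z; rewrite !mulr0 -mulrBr mulr_ge0// subr_ge0; apply: max0_homo; lra.
      by rewrite !max_l ?subr_ge0 ?(le_trans h (ltW xy))// mulr1 => z; nra.
    have := Z0' w; have [h|h] := leP (K w) y; last first.
      by move=> z; rewrite !max0_le0 ?mulr0 ?subrr// subr_le0 ltW// (lt_trans xy).
    rewrite mulr1 -mulrBr mulrC => z; apply: ler_wpM2r => //.
    rewrite [X in X - _]max_l ?subr_ge0//.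
    have : x - K w <= Num.max (x - K w) 0 by rewrite le_max lexx.
    by lra.
  exact: HA.
have den : Ex P (fun w => (K w <= h)%R%:R) * h `^ (1 - (2 - beta)) @[h --> 0^'+] --> (2 - beta) * (A * b).
  have H1 : h^-1 * Ex P (fun w => 1 * powp beta (h - K w)) @[h --> 0^'+] --> b.
    by apply: (cvg_ext Hb) => // h; congr (_ * _); apply: Ex_eq => w; rewrite mul1r.
  apply: (cvg_ext (dens (fun=> 1) b (bmf_cst _ 1) (fun=> ler01) H1)) => // h.
  by congr (_ * _); apply: Ex_eq => w; rewrite mul1r.
have num := dens Z a bZ Z0 Ha.
have b20 : 0 < 2 - beta by case/andP: beta01; lra.
have db : (2 - beta) * (A * b) != 0 by rewrite !mulf_neq0// gt_eqF.
apply: (cvg_ext_near _ (cvgM num (cvgV db den))); last by field; rewrite bn0 !gt_eqF.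
near=> h.
have h0 : 0 < h by near: h; exact: nbhs_right_gt.
have hp : h `^ (1 - (2 - beta)) != 0 by rewrite gt_eqF// powR_gt0.
by rewrite /= invfM [X in _ * X]mulrC mulrA mulfK.
Unshelve. all: by end_near. Qed.

End space.

(** * Fractional integration in the time variable *)

Section time.
Context (R : realType) d (Omega : measurableType d) (P : probability Omega R).
Variables (T K : Omega -> R) (beta rho b c B : R).
Hypothesis mT : measurable_fun setT T.
Hypothesis T0 : forall w, 0 <= T w.
Hypothesis mK : measurable_fun setT K.
Hypothesis K0 : forall w, 0 <= K w.
Hypothesis beta0 : 0 < beta.
Hypothesis rho01 : 0 < rho < 1.
Let p := 1 - rho.
Hypothesis B0 : 0 < B.
Hypothesis BE : betaI (- p) p = B%:E.
Hypothesis c0 : 0 <= c.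
Hypothesis Hmom : h^-1 * Ex P (fun w => powp beta (h - K w)) @[h --> 0^'+] --> b.
Hypothesis Hjoint : forall u, 0 < u ->
  h^-1 * Ex P (fun w => powp beta (h - K w) * powp p (u - T w)) @[h --> 0^'+] -->
  c * Ex P (fun w => T w * (T w < u)%R%:R).
Notation mu := (@lebesgue_measure R).

Let p01 : 0 < p < 1.
Proof. by rewrite /p; case/andP: rho01 => r0 r1; apply/andP; split; lra. Qed.

Lemma bmf_truncated_time u (g : Omega -> R) C : measurable_fun setT g -> (forall w, 0 <= g w <= C) ->
  bmf (fun w => T w * (T w < u)%R%:R * g w).
Proof.
move=> mg gC; split.
  apply: measurable_funM => //; apply: measurable_funM => //.
  rewrite (_ : (fun _ => _) = \1_[set w | T w < u]).
    by apply: measurable_indic; exact: measurable_lt_set.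
  by apply/funext => w; rewrite indicE mem_setE.
exists (`|u| * C) => w; have /andP[g0 gc] := gC w.
rewrite !normrM ler_pM//; last by rewrite ger0_norm.
case: ltP => [Tu|_]; last by rewrite normr0 mulr0.
by rewrite normr1 mulr1 !ger0_norm ?(ltW Tu)// ltW// (le_lt_trans (T0 w)).
Qed.

(** T is unbounded, but only its values below v matter against the kernel, which vanishes for u >=
    v. *)
Let Zv v w := T w * (T w < v)%R%:R.

Let bZv v : bmf (Zv v).
Proof.
have h (w : Omega) : 0 <= (1 : R) <= 1 by rewrite ler01 lexx.
have := bmf_truncated_time v (@measurable_cst _ _ _ _ setT (1 : R)) h; congr bmf.
by apply/funext => w; rewrite mulr1.
Qed.

Let Zv0 v w : 0 <= Zv v w. Proof. by rewrite mulr_ge0// ler0n. Qed.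

(** Both sides of [Hjoint] are integrated in u against (v - u)^(-p): (u - T)_+^p becomes B (v -
    T)_+, and the right side becomes c E[T (v - T)_+^rho] / rho. The limit passes under the integral
    by domination, the moment quotients being bounded. *)
Lemma time_quotient v :
  h^-1 * Ex P (fun w => Num.max (v - T w) 0 * powp beta (h - K w)) @[h --> 0^'+] -->
  c / (rho * B) * Ex P (fun w => T w * powp rho (v - T w)).
Proof.
have /andP[p0 p1] := p01; have /andP[r0 r1] := rho01.
have [v0|v0] := leP v 0.
  have vT w : v - T w <= 0 by rewrite subr_le0 (le_trans v0).
  have E0 : Ex P (fun w => T w * powp rho (v - T w)) = 0.
    by rewrite -[RHS](Ex_cst P); apply: Ex_eq => w; rewrite powp_le0 ?mulr0// gt_eqF.
  rewrite E0 mulr0; apply: cvg_near_cst; apply: nearW => h.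
  rewrite -[RHS](mulr0 h^-1); congr (_ * _); rewrite -[RHS](Ex_cst P); apply: Ex_eq => w.
  by rewrite max0_le0// mul0r.
apply/cvg_at_rightP => h [h0 hc].
pose Z n w := (h n)^-1 * powp beta (h n - K w).
have bZ n : bmf (Z n) by apply: bmfZ; exact: (bmf_powp mK K0 (h n) (ltW beta0)).
have Z0 n w : 0 <= Z n w by rewrite mulr_ge0 ?powp_ge0// invr_ge0 ltW.
have EZ : Ex P (Z n) @[n --> \oo] --> b.
  have /cvg_at_rightP := Hmom => /(_ h (conj h0 hc)) H.
  by apply: (cvg_ext H) => // n; rewrite -ExZ//; exact: (bmf_powp mK K0 (h n) (ltW beta0)).
have [C C0 ZC] : exists2 C, 0 <= C & forall n, Ex P (Z n) <= C.
  have /cvg_seq_bounded [M [_ HM]] := cvgP _ EZ.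
  exists (`|M| + 1); first by rewrite addr_ge0.
  move=> n; apply: le_trans (ler_norm _) _; apply: (HM (`|M| + 1)) => //.
  by rewrite (le_lt_trans (ler_norm _))// ltrDl.
pose k u := powp (- p) (v - u).
have mk : measurable_fun setT (fun u : R => k u).
  by apply: (measurableT_comp (measurable_powp (- p))); exact: measurable_funB.
have k0 u : 0 <= k u by exact: powp_ge0.
pose F n u := Ex P (fun w => Z n w * powp p (u - T w)).
have p01' : 0 < p <= 1 by rewrite p0 ltW.
have mF n : measurable_fun setT (F n : R -> R).
  exact: (measurable_convolution P mT T0 p01' (bZ n) (Z0 n)).
have F0 n u : 0 <= F n u by apply: Ex_ge0 => w; rewrite mulr_ge0// powp_ge0.
pose L u := c * Ex P (fun w => Zv v w * (T w < u)%R%:R).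
have bZu u : bmf (fun w => Zv v w * (T w < u)%R%:R).
  apply: bmfM => //; rewrite (_ : (fun _ => _) = \1_[set w | T w < u]).
    by apply: bmf_indic; exact: measurable_lt_set.
  by apply/funext => w; rewrite indicE mem_setE.
have mL1 : measurable_fun setT (fun u : R => Ex P (fun w => Zv v w * (T w < u)%R%:R)).
  apply: nondecreasing_measurable; first exact: measurableT.
  move=> s t st; apply: le_Ex => // w; apply: ler_wpM2l => //.
  by rewrite ler_nat; case: (ltP (T w) s) => //= h1; rewrite (lt_le_trans h1 st).
have mL : measurable_fun setT (L : R -> R) by apply: measurable_funM.
have ZvE u w : u < v -> Zv v w * (T w < u)%R%:R = T w * (T w < u)%R%:R.
  by move=> uv; rewrite /Zv; case: (ltP (T w) u) => h1; rewrite ?mulr0// (lt_trans h1 uv) !mulr1.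
have FL u : k u * F n u @[n --> \oo] --> k u * L u.
  have [u0|u0] := leP u 0.
    have uT w : u - T w <= 0 by rewrite subr_le0 (le_trans u0).
    apply: cvg_near_cst; apply: nearW => n; congr (_ * _).
    have -> : F n u = 0.
      by rewrite -[RHS](Ex_cst P); apply: Ex_eq => w; rewrite powp_le0 ?mulr0// gt_eqF.
    rewrite /L -[LHS](mulr0 c); congr (_ * _); rewrite -[LHS](Ex_cst P); apply: Ex_eq => w.
    by rewrite ltNge (le_trans u0)// mulr0.
  have [uv|uv] := leP v u.
    by rewrite /k powp_le0 ?subr_le0 ?oppr_eq0 ?gt_eqF//; apply: cvg_near_cst; apply: nearW => n; rewrite !mul0r.
  apply: cvgM; first exact: cvg_cst.
  have /cvg_at_rightP := Hjoint u0 => /(_ h (conj h0 hc)) H; apply: (cvg_ext H) => [n|].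
    rewrite -ExZ; first by apply: Ex_eq => w; rewrite /Z mulrA.
    by apply: bmfM; [exact: (bmf_powp mK K0 (h n) (ltW beta0))|exact: (bmf_powp mT T0 u (ltW p0))].
  by rewrite /L; congr (_ * _); apply: Ex_eq => w; rewrite ZvE.
pose g u := k u * (0 < u)%R%:R * (powp p v * C).
have ig : mu.-integrable setT (fun u => (g u)%:E).
  have mg : measurable_fun setT (fun u : R => k u * (0 < u)%R%:R).
    by apply: measurable_funM => //; exact: measurable_gt_nat.
  have -> : (fun u => (g u)%:E) = (fun u => (powp p v * C)%:E * (k u * (0 < u)%R%:R)%:E)%E.
    by apply/funext => u; rewrite -EFinM mulrC.
  apply: integrableZl => //.
  apply/integrableP; split; first exact/measurable_EFinP.
  under eq_integral => u _ do rewrite gee0_abs ?lee_fin ?mulr_ge0//.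
  by rewrite (integral_powpN p01 (ltW v0)) ltry.
have Fg n u : k u * F n u <= g u.
  rewrite /g -mulrA.
  have [uv|uv] := leP v u; first by rewrite /k powp_le0 ?subr_le0 ?oppr_eq0 ?gt_eqF// !mul0r.
  apply: ler_wpM2l => //.
  have [u0|u0] := leP u 0.
    rewrite mul0r le_eqVlt; apply/orP; left; apply/eqP; rewrite -[RHS](Ex_cst P); apply: Ex_eq => w.
    by rewrite powp_le0 ?mulr0 ?gt_eqF// subr_le0 (le_trans u0).
  rewrite mul1r; apply: (@le_trans _ _ (powp p v * Ex P (Z n))); last first.
    by apply: ler_wpM2l => //; exact: powp_ge0.
  rewrite -ExZ//; apply: le_Ex => [||w]; [|exact: bmfZ|].
    by apply: bmfM => //; exact: (bmf_powp mT T0 u (ltW p0)).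
  rewrite mulrC; apply: ler_wpM2r => //; apply: powp_homo; rewrite ?(ltW p0)//.
  by have := T0 w; lra.
have [] := @dominated_convergence _ _ _ mu setT measurableT
  (fun n u => (k u * F n u)%:E) (fun u => (k u * L u)%:E) (fun u => (g u)%:E).
- by move=> n; apply/measurable_EFinP; apply: (measurable_funM mk); exact: mF.
- by apply/measurable_EFinP; apply: (measurable_funM mk); exact: mL.
- by apply: aeW => u _; apply: cvg_EFin; [exact: nearW|exact: FL].
- exact: ig.
- by apply: aeW => u n _; rewrite /= lee_fin ger0_norm ?mulr_ge0//; exact: Fg.
move=> _ _ /=.
have -> : (fun n => \int[mu]_u (k u * F n u)%:E)%E =
    fun n => (B * Ex P (fun w => Z n w * Num.max (v - T w) 0))%:E.
  by apply/funext => n; exact: (fractional_integral P mT T0 (bZ n) (Z0 n) v p01 (ltW B0) BE).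
have -> : (\int[mu]_u (k u * L u)%:E = (c * (Ex P (fun w => Zv v w * powp (1 - p) (v - T w)) / (1 - p)))%:E)%E.
  have kL u : (k u * L u)%:E = (c%:E * (k u * Ex P (fun w => Zv v w * (T w < u)%R%:R))%:E)%E.
    by rewrite -EFinM /L mulrCA.
  under eq_integral do rewrite kL.
  rewrite [RHS]EFinM -(fractional_step P mT T0 (bZv v) (Zv0 v) v p01).
  rewrite ge0_integralZl//.
  - by apply/measurable_EFinP; exact: measurable_funM.
  - move=> u _; rewrite lee_fin mulr_ge0//; apply: Ex_ge0 => w.
    by rewrite mulr_ge0// ler0n.
move=> /fine_cvg /= H.
apply: (cvg_ext (cvgM (cvg_cst B^-1) H)) => [n|].
  rewrite mulrA mulVf ?gt_eqF// mul1r -ExZ; last first.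
    apply: bmfM; last exact: (bmf_powp mK K0 (h n) (ltW beta0)).
    by have := bmf_powp mT T0 v ler01; under eq_fun do rewrite /powp powRr1 ?max0_ge0//.
  by apply: Ex_eq => w; rewrite /Z; ring.
have -> : 1 - p = rho by rewrite /p; ring.
have -> : Ex P (fun w => Zv v w * powp rho (v - T w)) = Ex P (fun w => T w * powp rho (v - T w)).
  apply: Ex_eq => w; rewrite /Zv; case: (ltP (T w) v) => h1; first by rewrite mulr1.
  by rewrite powp_le0 ?mulr0// ?gt_eqF// subr_le0.
by field; rewrite !gt_eqF.
Qed.

End time.

Lemma cdf_probability (R : realType) (M : R -> R) :
  {homo M : s t / s <= t} -> (forall t, M s @[s --> t^'+] --> M t) ->
  M s @[s --> -oo%R] --> (0 : R) -> M s @[s --> +oo%R] --> (1 : R) ->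
  exists mu0 : probability R R, forall t, mu0 `]-oo, t]%classic = (M t)%:E.
Proof.
move=> Mh Mr M0 M1.
pose f : cumulativeBounded (0 : R) (1 : R) :=
  HB.pack M (isCumulative.Build R _ R M Mh Mr) (isCumulativeBounded.Build R 0 1 M M0 M1).
pose lsf : probability (measurableTypeR R) R := lebesgue_stieltjes_measure f.
(* The identity transports the Stieltjes measure to the measurable structure of the statement. *)
have mid : measurable_fun setT ((fun x => x) : measurableTypeR R -> R).
  by move=> _ A mA; rewrite setTI.
have [nu [nuE _]] := image_probability lsf mid.
exists nu => t; rewrite nuE.
by have := cdf_lebesgue_stieltjes_id f t; rewrite /cdf /distribution /= /pushforward preimage_id.
Qed.

(** * Convergence of distribution functions *)

Section steps.
Context (R : realType).

(** An entry (c, a, b) with a <= b stands for c times the indicator of ]a, b]; as a difference of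
    indicators of half-lines, its mean is read off the distribution function. *)
Definition step (L : seq (R * R * R)) (y : R) : R :=
  \sum_(q <- L) q.1.1 * ((y <= q.2)%R%:R - (y <= q.1.2)%R%:R).

(** Continuity at the supremum of the right ends reached by approximations extends an approximation
    beyond it, unless it is b. *)
Lemma step_approx (f : R -> R) a b e : continuous f -> 0 < e -> a <= b -> exists L, forall y,
  [/\ a < y -> y <= b -> `|f y - step L y| <= e, y <= a -> step L y = 0 & b < y -> step L y = 0].
Proof.
move=> cf e0 ab.
pose Q c := exists L, forall y,
  [/\ a < y -> y <= c -> `|f y - step L y| <= e, y <= a -> step L y = 0 & c < y -> step L y = 0].
have e20 : 0 < e / 2 by rewrite divr_gt0.
have ext c c' z : a <= c -> c <= c' -> Q c -> (forall y, c < y <= c' -> `|f z - f y| <= e) -> Q c'.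
  move=> ac cc' [L HL] Hz; exists ((f z, c, c') :: L) => y; have [h1 h2 h3] := HL y.
  rewrite /step big_cons -/(step L y) /=; split.
  - move=> ay yc'; rewrite yc'; have [yc|yc] := leP y c; first by rewrite subrr mulr0 add0r; exact: h1.
    by rewrite subr0 mulr1 h3// addr0 distrC; apply: Hz; rewrite yc.
  - by move=> ya; rewrite (le_trans ya ac) (le_trans ya (le_trans ac cc')) subrr mulr0 add0r h2.
  - by move=> cy; rewrite h3 ?(le_lt_trans cc')// !leNgt cy (le_lt_trans cc' cy) subrr mulr0 add0r.
have Qa : Q a.
  exists [::] => y; rewrite /step big_nil; split => // ay ya.
  by have := lt_le_trans ay ya; rewrite ltxx.
pose S := [set c | a <= c <= b /\ Q c].
have hS : has_sup S.
  by split; [exists a; split; rewrite ?lexx|exists b => c [/andP[]]].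
pose z := sup S.
have az : a <= z by apply: ub_le_sup; [exact: hS.2|split; rewrite ?lexx].
have zb : z <= b by apply: ge_sup; [exact: hS.1|move=> c [/andP[]]].
have /cvgrPdist_le /(_ _ e0) [dl /= dl0 Hd] := cf z.
have [c [/andP[ac cb] Qc] cz] := sup_adherent dl0 hS; rewrite -/z in cz.
have cz' : c <= z by apply: ub_le_sup; [exact: hS.2|split; rewrite ?ac].
pose c' := Num.min (z + dl / 2) b.
have cc' : c <= c' by rewrite le_min cb andbT; apply: le_trans cz' _; rewrite lerDl divr_ge0// ltW.
have Qc' : Q c'.
  apply: (ext c c' z) => // y /andP[cy]; rewrite le_min => /andP[yz _]; apply: Hd => /=.
  by rewrite ltr_norml; apply/andP; split; lra.
have c'b : c' <= b by rewrite ge_min lexx orbT.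
have c'z : c' <= z by apply: ub_le_sup; [exact: hS.2|split => //; rewrite c'b (le_trans ac)].
suff -> : b = c' by [].
move: c'z; rewrite /c' ge_min => /orP[|bz]; first by rewrite gerDl leNgt divr_gt0.
by rewrite min_r//; apply: le_trans bz _; rewrite lerDl divr_ge0// ltW.
Qed.

End steps.

Section cdf_limit.
Context (R : realType) (nu : R -> probability R R) (mu0 : probability R R).
Hypothesis cdf_cvg : forall t, fine (nu h `]-oo, t]%classic) @[h --> 0^'+] --> fine (mu0 `]-oo, t]%classic).

Let ble c : bmf (fun y : R => (y <= c)%R%:R : R).
Proof. by apply: bmf_indicator_le. Qed.

Let bstep (L : seq (R * R * R)) : bmf (step L).
Proof.
apply: bmf_sum => q; apply: bmfZ; exact: bmfB.
Qed.

Let Ex_cdf (P : probability R R) c : Ex P (fun y => (y <= c)%R%:R) = fine (P `]-oo, c]%classic).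
Proof.
rewrite -Ex_indic; last exact: measurable_itv.
by apply: Ex_eq => y; rewrite indicE mem_setE in_itv.
Qed.

Let step_cvg L : Ex (nu h) (step L) @[h --> 0^'+] --> Ex mu0 (step L).
Proof.
elim: L => [|q L ih].
  have E (P : probability R R) : Ex P (step [::]) = 0.
    by rewrite -[RHS](Ex_cst P); apply: Ex_eq => y; rewrite /step big_nil.
  by rewrite E; under eq_fun do rewrite E; exact: cvg_cst.
have E (P : probability R R) : Ex P (step (q :: L)) =
    q.1.1 * (fine (P `]-oo, q.2]%classic) - fine (P `]-oo, q.1.2]%classic)) + Ex P (step L).
  rewrite -!Ex_cdf -ExB// -ExZ; last exact: bmfB.
  rewrite -ExD//; last by apply: bmfZ; exact: bmfB.
  by apply: Ex_eq => y; rewrite /step big_cons.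
rewrite E; under eq_fun do rewrite E.
by apply: cvgD => //; apply: cvgM; [exact: cvg_cst|apply: cvgB; exact: cdf_cvg].
Qed.

Lemma cdf_tails e : 0 < e -> exists2 N, 0 <= N &
  fine (mu0 `]-oo, - N]%classic) < e /\ 1 - e < fine (mu0 `]-oo, N]%classic).
Proof.
move=> e0.
have H1 : Ex mu0 (fun y => (y <= - n%:R)%R%:R) @[n --> \oo] --> Ex mu0 (fun=> 0).
  apply: (Ex_cvg (C := 1)) => [n||n w|]; [by have [] := ble (- n%:R)|by []| |].
    by rewrite ger0_norm// lern1 leq_b1.
  apply: aeW => y; apply: cvg_near_cst; near=> n.
  rewrite leNgt (_ : - n%:R < y)//= ltrNl; near: n; exact: nbhs_infty_gtr.
have H2 : Ex mu0 (fun y => (y <= n%:R)%R%:R) @[n --> \oo] --> Ex mu0 (fun=> 1).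
  apply: (Ex_cvg (C := 1)) => [n||n w|]; [by have [] := ble n%:R|by []| |].
    by rewrite ger0_norm// lern1 leq_b1.
  apply: aeW => y; apply: cvg_near_cst; near=> n.
  rewrite (_ : y <= n%:R)//; near: n; exact: nbhs_infty_ger.
rewrite !Ex_cst in H1 H2.
have /cvgr_lt /(_ _ e0) K1 := H1.
have /cvgr_gt /(_ (1 - e)) K2 := H2.
near \oo => n; exists n%:R => //; rewrite -!Ex_cdf; split.
  by near: n; exact: K1.
by near: n; apply: K2; rewrite ltrBlDl ltrDr.
Unshelve. all: by end_near. Qed.

Lemma cvg_in_law_cdf : cvg_in_law (0^'+) nu mu0.
Proof.
move=> f cf [M [_ HM]].
pose C := `|M| + 1; have C0 : 0 < C by rewrite ltr_wpDl.
have fC y : `|f y| <= C by apply: HM; rewrite // /C (le_lt_trans (ler_norm _))// ltrDl.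
have bf : bmf f by split; [exact: continuous_measurable_fun|exists C].
rewrite -ExE//; under eq_fun do rewrite -ExE//.
apply: cvg_EFin; first exact: nearW.
apply/cvgrPdist_le => e e0.
(* The total error is at most 3 n + 4 C n: n for each of the three comparisons and 2 C n for the
   tails of each of the two laws. *)
pose n := e / (6 * C + 3).
have n0 : 0 < n by rewrite divr_gt0// addr_gt0// mulr_gt0.
have [N N0 [t1 t2]] := cdf_tails n0.
have NN : - N <= N by lra.
have [L HL] := step_approx cf n0 NN.
have err (P : probability R R) : `|Ex P f - Ex P (step L)| <=
    n + C * (fine (P `]-oo, - N]%classic) + (1 - fine (P `]-oo, N]%classic))).
  rewrite -ExB//; apply: le_trans (Ex_norm P (bmfB bf (bstep L))) _.
  rewrite -!Ex_cdf -[X in X + C * _](Ex_cst P) -[X in _ + (X - _)](Ex_cst P).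
  have b1 : bmf (fun=> 1 : R) := bmf_cst _ 1.
  rewrite -ExB// -ExD//; last exact: bmfB.
  have b2 : bmf (fun y : R => (y <= - N)%R%:R + (1 - (y <= N)%R%:R) : R) by apply: bmfD => //; exact: bmfB.
  rewrite -ExZ// -ExD; [|exact: bmf_cst|exact: bmfZ].
  apply: le_Ex => [||y]; [by apply/bmf_norm/bmfB|by apply: bmfD; [exact: bmf_cst|exact: bmfZ]|].
  have [h1 h2 h3] := HL y.
  have [yN|yN] := leP y (- N).
    by rewrite h2// subr0 (le_trans yN (le_trans _ N0)) ?oppr_le0//= subrr addr0 mulr1 (le_trans (fC y))// lerDr ltW.
  have [yN'|yN'] := leP y N; first by rewrite subrr addr0 mulr0 addr0 h1.
  by rewrite h3// subr0 add0r subr0 mulr1 (le_trans (fC y))// lerDr ltW.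
have K1 := cdf_cvg (t := - N); have K2 := cdf_cvg (t := N).
have /cvgr_lt /(_ _ t1) {}K1 := K1.
have /cvgr_gt /(_ _ t2) {}K2 := K2.
have /cvgrPdist_le /(_ _ n0) K3 := @step_cvg L.
near=> h.
have k1 : fine (nu h `]-oo, - N]%classic) < n by near: h; exact: K1.
have k2 : 1 - n < fine (nu h `]-oo, N]%classic) by near: h; exact: K2.
have k3 : `|Ex mu0 (step L) - Ex (nu h) (step L)| <= n by near: h; exact: K3.
have E1 := err mu0; have E2 := err (nu h).
have D1 : fine (mu0 `]-oo, - N]%classic) + (1 - fine (mu0 `]-oo, N]%classic)) <= 2 * n by lra.
have D2 : fine (nu h `]-oo, - N]%classic) + (1 - fine (nu h `]-oo, N]%classic)) <= 2 * n by lra.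
have C1 := ler_wpM2l (ltW C0) D1; have C2 := ler_wpM2l (ltW C0) D2.
have en : e = n * (6 * C + 3) by rewrite /n divfK// gt_eqF// addr_gt0// mulr_gt0.
have nC : 0 < n * C by exact: mulr_gt0.
change (`|Ex mu0 f - Ex (nu h) f| <= e); rewrite en.
move: E1 E2 k3; rewrite !ler_norml => /andP[a1 a2] /andP[a3 a4] /andP[a5 a6].
by apply/andP; split; lra.
Unshelve. all: by end_near. Qed.

End cdf_limit.

(** * Convex limits of integrated distribution functions *)

Section limit_law.
Context (R : realType) (nu : R -> probability R R) (Theta : R -> R).
Let ramp (v y : R) := Num.max (v - Num.max y 0) 0.
Hypothesis ThetaP : forall v, Ex (nu h) (ramp v) @[h --> 0^'+] --> Theta v.
Hypothesis nu_neg : forall h t, 0 < h -> t < 0 -> nu h `]-oo, t]%classic = 0%E.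
Hypothesis tight : forall e, 0 < e -> exists2 u, 0 < u & forall v, u <= v -> (1 - e) * (v - u) <= Theta v.

Let bramp v : bmf (ramp v).
Proof.
split; first by apply: measurable_maxr => //; apply: measurable_funB => //; exact: measurable_maxr.
by exists (Num.max v 0) => y; apply: norm_max0_sub_le; exact: max0_ge0.
Qed.

Lemma Theta_diff a b : Ex (nu h) (fun y => ramp b y - ramp a y) @[h --> 0^'+] --> Theta b - Theta a.
Proof.
by apply: (cvg_ext (cvgB (ThetaP (v := b)) (ThetaP (v := a)))) => // h; rewrite ExB.
Qed.

(** Convexity as a comparison of increments, free of quotients: it survives expectation and the
    limit that defines [Theta]. *)
Lemma ramp_slopes a b c d y : a <= b -> b <= c -> c <= d ->
  (d - c) * (ramp b y - ramp a y) <= (b - a) * (ramp d y - ramp c y).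
Proof.
move=> ab bc cd; rewrite /ramp; set z := Num.max y 0.
have l (v : R) : v <= z -> Num.max (v - z) 0 = 0 by move=> vz; rewrite max_r// subr_le0.
have g (v : R) : z <= v -> Num.max (v - z) 0 = v - z by move=> vz; rewrite max_l// subr_ge0.
have m (v w : R) : v <= w -> Num.max (v - z) 0 <= Num.max (w - z) 0.
  by move=> vw; apply: max0_homo; rewrite lerD2r.
have [bz|zb] := leP b z.
  rewrite (l b)// (l a) ?(le_trans ab)// subrr mulr0 mulr_ge0 ?subr_ge0//; exact: m.
rewrite (g d) ?(g c) ?(le_trans (ltW zb))// ?(le_trans bc)// (g b) ?(ltW zb)//.
rewrite [leRHS](_ : _ = (d - c) * (b - a)); last by ring.
apply: ler_wpM2l; first by rewrite subr_ge0.
by have : a - z <= Num.max (a - z) 0; [rewrite le_max lexx|lra].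
Qed.

Lemma Theta_convex a b c d : a <= b -> b <= c -> c <= d ->
  (d - c) * (Theta b - Theta a) <= (b - a) * (Theta d - Theta c).
Proof.
move=> ab bc cd.
have H1 : (d - c) * Ex (nu h) (fun y => ramp b y - ramp a y) @[h --> 0^'+] --> (d - c) * (Theta b - Theta a).
  by apply: cvgM; [exact: cvg_cst|exact: Theta_diff].
have H2 : (b - a) * Ex (nu h) (fun y => ramp d y - ramp c y) @[h --> 0^'+] --> (b - a) * (Theta d - Theta c).
  by apply: cvgM; [exact: cvg_cst|exact: Theta_diff].
apply: (ler_cvg_to H1 H2); apply: nearW => h /=.
have bd v v' : bmf (fun y => ramp v y - ramp v' y) by exact: bmfB.
rewrite -!ExZ//; apply: le_Ex => [||y]; [exact: bmfZ|exact: bmfZ|exact: ramp_slopes].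
Qed.

Lemma Theta_lip a b : a <= b -> 0 <= Theta b - Theta a <= b - a.
Proof.
move=> ab; have H := @Theta_diff a b; apply/andP; split.
  apply: (ler_cvg_to (cvg_cst 0) H); apply: nearW => h; apply: Ex_ge0 => y.
  by rewrite subr_ge0; apply: max0_homo; lra.
apply: (ler_cvg_to H (cvg_cst (b - a))); apply: nearW => h; rewrite -[leRHS](Ex_cst (nu h)).
apply: le_Ex => [||y]; [exact: bmfB|exact: bmf_cst|].
have := max0_lip (b - Num.max y 0) (a - Num.max y 0).
rewrite (_ : b - _ - (a - _) = b - a); last by ring.
by rewrite [`|b - a|]ger0_norm ?subr_ge0// => /(le_trans (ler_norm _)).
Qed.

Lemma Theta_neg v : v <= 0 -> Theta v = 0.
Proof.
move=> v0; apply: (cvg_unique (@Rhausdorff R) (ThetaP (v := v))).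
apply: cvg_near_cst; apply: nearW => h.
rewrite -[RHS](Ex_cst (nu h)); apply: Ex_eq => y.
have z0 : 0 <= Num.max y 0 := max0_ge0 y.
by rewrite /ramp max_r//; move: z0; set z := Num.max y 0; lra.
Qed.

(** For the convex function [Theta] this infimum is the right derivative; no limit has to be shown
    to exist. *)
Definition right_slope t := inf [set (Theta (t + dl) - Theta t) / dl | dl in [set dl | 0 < dl]].

Let slope_lb t e : 0 < e ->
  lbound [set (Theta (t + dl) - Theta t) / dl | dl in [set dl | 0 < dl]] ((Theta t - Theta (t - e)) / e).
Proof.
move=> e0 _ [dl /= dl0 <-].
rewrite ler_pdivrMr// mulrAC ler_pdivlMr//.
have := @Theta_convex (t - e) t t (t + dl).
rewrite gerBl (ltW e0) lexx lerDl (ltW dl0) => /(_ isT isT isT).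
have -> : t + dl - t = dl by ring.
have -> : t - (t - e) = e by ring.
by lra.
Qed.

Let slope_ne t : [set (Theta (t + dl) - Theta t) / dl | dl in [set dl | 0 < dl]] !=set0.
Proof. by exists ((Theta (t + 1) - Theta t) / 1), 1 => //=. Qed.

Lemma right_slope_bounds t dl : 0 < dl ->
  Theta t - Theta (t - dl) <= dl * right_slope t <= Theta (t + dl) - Theta t.
Proof.
move=> dl0; apply/andP; split.
  by rewrite mulrC -ler_pdivrMr//; apply: lb_le_inf; [exact: slope_ne|exact: slope_lb].
rewrite mulrC -ler_pdivlMr//; apply: ge_inf; last by exists dl.
by exists ((Theta t - Theta (t - 1)) / 1); exact: slope_lb.
Qed.

Lemma right_slope_homo : {homo right_slope : s t / s <= t}.
Proof.
move=> s t; rewrite le_eqVlt => /predU1P[->//|st].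
have e0 : 0 < t - s by rewrite subr_gt0.
have /andP[_ h1] := right_slope_bounds s e0; have /andP[h2 _] := right_slope_bounds t e0.
rewrite subKr in h2; rewrite (_ : s + (t - s) = t) in h1; last by ring.
by rewrite -(ler_pM2l e0); lra.
Qed.

(** An infimum of continuous functions is upper semicontinuous, and a nondecreasing upper
    semicontinuous function is right-continuous. *)
Lemma right_slope_rcont t : right_slope s @[s --> t^'+] --> right_slope t.
Proof.
apply/cvgrPdist_le => e e0.
have e20 : 0 < e / 2 by rewrite divr_gt0.
have [_ [dl /= dl0 <-] hd] := inf_adherent e20 (conj (slope_ne t) (ex_intro _ _ (@slope_lb t 1 ltr01))).
near=> s.
have ts : t < s by near: s; exact: nbhs_right_gt.
have sd : s <= t + dl * e / 4.
  near: s; apply: nbhs_right_le; rewrite ltrDl divr_gt0// mulr_gt0//.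
have h1 := right_slope_homo (ltW ts).
have /andP[_ h2] := right_slope_bounds s dl0.
have tsd : t + dl <= s + dl by rewrite lerD2r ltW.
have /andP[_ h3] := Theta_lip tsd.
have /andP[h4 _] := Theta_lip (ltW ts).
rewrite -/(right_slope t) ltr_pdivrMr// in hd.
rewrite distrC ger0_norm ?subr_ge0// -(ler_pM2l dl0).
nra.
Unshelve. all: by end_near. Qed.

Lemma right_slope_neg t : t < 0 -> right_slope t = 0.
Proof.
move=> t0; have n0 : 0 < - t by rewrite oppr_gt0.
have := right_slope_bounds t n0; rewrite subrr !Theta_neg ?(ltW t0)//; last lra.
rewrite !subrr => /andP[h1 h2]; apply/eqP; rewrite eq_le.
by rewrite -(ler_pM2l n0) mulr0 h2 -(ler_pM2l n0) mulr0.
Qed.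

Lemma right_slope_le1 t : right_slope t <= 1.
Proof.
have /andP[_ h] := right_slope_bounds t ltr01.
have := @Theta_lip t (t + 1); rewrite lerDl ler01 => /(_ isT) /andP[_ h2].
by rewrite mul1r in h; lra.
Qed.

(** By convexity the slope at t > 0 is at least Theta t / t, which tightness brings close to 1. *)
Lemma right_slope_cvgy : right_slope t @[t --> +oo%R] --> (1 : R).
Proof.
apply/cvgrPdist_le => e e0.
have e20 : 0 < e / 2 by rewrite divr_gt0.
have [u u0 hu] := tight e20.
near=> t.
have tu : u <= t by near: t; apply: nbhs_pinfty_ge; rewrite num_real.
have tu2 : 2 * u / e <= t by near: t; apply: nbhs_pinfty_ge; rewrite num_real.
have t0 : 0 < t by exact: lt_le_trans tu.
have h1 := right_slope_le1 t.
have /andP[h2 _] := right_slope_bounds t t0.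
rewrite subrr (Theta_neg (lexx 0)) subr0 in h2.
have h3 := hu t tu.
rewrite ger0_norm ?subr_ge0// -(ler_pM2l t0).
rewrite ler_pdivrMr// in tu2; nra.
Unshelve. all: by end_near. Qed.

Lemma limit_law : exists mu0 : probability R R, forall t, mu0 `]-oo, t]%classic = (right_slope t)%:E.
Proof.
apply: cdf_probability.
- exact: right_slope_homo.
- exact: right_slope_rcont.
- apply: cvg_near_cst; near=> t.
  have t0 : t < 0 by near: t; apply: nbhs_ninfty_lt; rewrite num_real.
  exact: right_slope_neg.
- exact: right_slope_cvgy.
Unshelve. all: by end_near. Qed.

(** The distribution function of [nu h] at t lies between the quotients of the mean ramp to the left
    and to the right of t. The limits of these quotients bracket the slope as well, and the
    hypothesis on second differences makes the bracket small. *)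
Lemma cdf_cvg_at t :
  (forall e, 0 < e -> exists2 dl, 0 < dl & Theta (t + dl) - 2 * Theta t + Theta (t - dl) <= e * dl) ->
  fine (nu h `]-oo, t]%classic) @[h --> 0^'+] --> right_slope t.
Proof.
move=> J.
have [t0|t0] := ltP t 0.
  rewrite right_slope_neg//; apply: cvg_near_cst; near=> h.
  by rewrite nu_neg//; near: h; exact: nbhs_right_gt.
apply/cvgrPdist_le => e e0.
have e40 : 0 < e / 4 by rewrite divr_gt0.
have [dl dl0 Jd] := J _ e40.
have e4d : 0 < e / 4 * dl by exact: mulr_gt0.
have /cvgrPdist_le /(_ _ e4d) Hu := ThetaP (v := t + dl).
have /cvgrPdist_le /(_ _ e4d) Hm := ThetaP (v := t).
have /cvgrPdist_le /(_ _ e4d) Hl := ThetaP (v := t - dl).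
near=> h.
have hu : `|Theta (t + dl) - Ex (nu h) (ramp (t + dl))| <= e / 4 * dl by near: h; exact: Hu.
have hm : `|Theta t - Ex (nu h) (ramp t)| <= e / 4 * dl by near: h; exact: Hm.
have hl : `|Theta (t - dl) - Ex (nu h) (ramp (t - dl))| <= e / 4 * dl by near: h; exact: Hl.
have mI : measurable (`]-oo, t]%classic : set R) by exact: measurable_itv.
have bI : bmf (\1_(`]-oo, t]%classic) : R -> R) by exact: bmf_indic.
have up : dl * fine (nu h `]-oo, t]%classic) <= Ex (nu h) (ramp (t + dl)) - Ex (nu h) (ramp t).
  rewrite -Ex_indic// -ExZ// -ExB//; apply: le_Ex => [||y]; [exact: bmfZ|exact: bmfB|].
  rewrite indicE mem_setE in_itv/= /ramp.
  have [yt|yt] := leP y t.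
    have zt : Num.max y 0 <= t by rewrite ge_max yt.
    by move: zt; set z := Num.max y 0 => zt; rewrite mulr1 !max_l; lra.
  by rewrite mulr0 subr_ge0; apply: max0_homo; lra.
have lo : Ex (nu h) (ramp t) - Ex (nu h) (ramp (t - dl)) <= dl * fine (nu h `]-oo, t]%classic).
  rewrite -Ex_indic// -ExZ// -ExB//; apply: le_Ex => [||y]; [exact: bmfB|exact: bmfZ|].
  rewrite indicE mem_setE in_itv/= /ramp.
  have [yt|yt] := leP y t.
    have := max0_lip (t - Num.max y 0) (t - dl - Num.max y 0).
    rewrite (_ : t - _ - (t - dl - _) = dl); last by ring.
    by rewrite mulr1 (gtr0_norm dl0) => /(le_trans (ler_norm _)).
  have zt : t < Num.max y 0 by rewrite lt_max yt.
  by move: zt; set z := Num.max y 0 => zt; rewrite !max_r ?subrr ?mulr0//; lra.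
have /andP[b1 b2] := right_slope_bounds t dl0.
rewrite -(ler_pM2l dl0) -{1}(gtr0_norm dl0) -normrM mulrBr.
set F := dl * fine _ in up lo *; set S := dl * right_slope t in b1 b2 *.
move: hu hm hl; rewrite !ler_norml => /andP[hu1 hu2] /andP[hm1 hm2] /andP[hl1 hl2].
by apply/andP; split; lra.
Unshelve. all: by end_near. Qed.

End limit_law.

(** * The limit law has no atoms *)

Section second_difference.
Context (R : realType).
Implicit Types (f : R -> R) (z dl : R).

Definition diff2 f z dl := f (z + dl) - 2 * f z + f (z - dl).

Variable rho : R.
Hypothesis rho01 : 0 < rho < 1.
Let rho0 : 0 < rho. Proof. by case/andP: rho01. Qed.
Let rho1 : rho < 1. Proof. by case/andP: rho01. Qed.

Lemma midpoint_convex_powR (r a b : R) : 1 <= r -> 0 <= a -> 0 <= b ->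
  ((a + b) / 2) `^ r <= (a `^ r + b `^ r) / 2.
Proof.
move=> r1 a0 b0.
have h1 : (0 : R) <= 2^-1 by [].
have h2 : (2^-1 : R) <= 1 by lra.
have : (2^-1 * a + (1 - 2^-1) * b) `^ r <= 2^-1 * a `^ r + (1 - 2^-1) * b `^ r.
  by apply: (convex_powR r1 (Itv01 h1 h2)); rewrite inE /= in_itv /= andbT.
rewrite (_ : 1 - 2^-1 = 2^-1 :> R); last by field.
by rewrite -!mulrDr ![2^-1 * _]mulrC.
Qed.

(** Convexity of the power 1 / rho, applied to a^rho and b^rho, then raised to the power rho. *)
Lemma midpoint_concave_powR a b : 0 <= a -> 0 <= b ->
  a `^ rho + b `^ rho <= 2 * ((a + b) / 2) `^ rho.
Proof.
move=> a0 b0.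
have r1 : 1 <= rho^-1 by rewrite invf_ge1// ltW.
have := midpoint_convex_powR r1 (powR_ge0 a rho) (powR_ge0 b rho).
rewrite -!powRrM mulfV ?gt_eqF// !powRr1// => h.
have := ler_powRl (ltW rho0) (powR_ge0 _ _) h.
rewrite -powRrM mulVf ?gt_eqF// powRr1; first lra.
by rewrite divr_ge0// addr_ge0// powR_ge0.
Qed.

(** Subadditivity of the power rho, which holds because a ratio in [0, 1] is at most its power
    rho. *)
Lemma powp_holder a b : b <= a -> powp rho a - powp rho b <= (a - b) `^ rho.
Proof.
move=> ba.
have mm : Num.max a 0 <= Num.max b 0 + (a - b).
  have h : b <= Num.max b 0 by rewrite le_max lexx.
  by have h0 := max0_ge0 b; rewrite ge_max; apply/andP; split; lra.
have sub u v : 0 <= u -> 0 <= v -> (u + v) `^ rho <= u `^ rho + v `^ rho.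
  move=> u0 v0; have [s0|s0] := leP (u + v) 0.
    have -> : u = 0 by lra.
    have -> : v = 0 by lra.
    by rewrite addr0 lerDl powR_ge0.
  have one z : 0 <= z -> z <= u + v -> z / (u + v) * (u + v) `^ rho <= z `^ rho.
    rewrite le_eqVlt => /predU1P[<- _|z0 zs]; first by rewrite !mul0r powR_ge0.
    have -> : z `^ rho = (z / (u + v)) `^ rho * (u + v) `^ rho.
      by rewrite -powRM ?divr_ge0 ?(ltW z0) ?(ltW s0)// divfK// gt_eqF.
    rewrite ler_pM2r ?powR_gt0//; apply: ger1_powR; last exact: ltW.
    by rewrite divr_gt0//= ler_pdivrMr// mul1r.
  have h1 := one u u0 (_ : u <= u + v); have h2 := one v v0 (_ : v <= u + v).
  have {}h1 := h1 ltac:(lra); have {}h2 := h2 ltac:(lra).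
  have <- : u / (u + v) * (u + v) `^ rho + v / (u + v) * (u + v) `^ rho = (u + v) `^ rho.
    by rewrite -!mulrDl mulfV ?mul1r// gt_eqF.
  exact: lerD.
rewrite lerBlDl /powp.
apply: le_trans (ler_powRl (ltW rho0) (max0_ge0 a) mm) _.
by apply: sub; [exact: max0_ge0|rewrite subr_ge0].
Qed.

Lemma diff2_powp_neg z dl : 0 <= dl -> dl <= z -> diff2 (powp rho) z dl <= 0.
Proof.
move=> dl0 dz; have z0 : 0 <= z by exact: le_trans dz.
rewrite /diff2 /powp !max_l//; [|lra|lra].
have := @midpoint_concave_powR (z + dl) (z - dl).
rewrite (_ : (z + dl + (z - dl)) / 2 = z); last by field.
by move=> h; have := h ltac:(lra) ltac:(lra); lra.
Qed.

Lemma powp1_decomp z : powp (1 + rho) z = z * powp rho z.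
Proof.
have [z0|z0] := ltP 0 z; first by rewrite !powp_gt0// powRDp// powRr1// ltW.
by rewrite !powp_le0 ?gt_eqF// ?mulr0// addr_gt0.
Qed.

Lemma diff2_powp1_ge0 z dl : 0 <= dl -> 0 <= diff2 (powp (1 + rho)) z dl.
Proof.
move=> dl0; rewrite /diff2.
have r1 : 1 <= 1 + rho by rewrite lerDl ltW.
have := midpoint_convex_powR r1 (max0_ge0 (z + dl)) (max0_ge0 (z - dl)).
have h : Num.max z 0 <= (Num.max (z + dl) 0 + Num.max (z - dl) 0) / 2.
  have h1 : z + dl <= Num.max (z + dl) 0 by rewrite le_max lexx.
  have h2 : z - dl <= Num.max (z - dl) 0 by rewrite le_max lexx.
  by have h3 := max0_ge0 (z + dl); have h4 := max0_ge0 (z - dl); rewrite ge_max; apply/andP; split; lra.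
have := ler_powRl (_ : 0 <= 1 + rho) (max0_ge0 z) h.
rewrite -/(powp (1 + rho) z) -/(powp (1 + rho) (z + dl)) -/(powp (1 + rho) (z - dl)).
by move=> /(_ ltac:(lra)); set q := (_ / 2) `^ _; lra.
Qed.

(** In z^(1 + rho) = z z^rho the second difference splits into z times that of z^rho, nonpositive by
    concavity when z >= dl, and dl times an increment of z^rho, of order dl^rho. For z < dl only the
    value at z + dl has to be bounded. *)
Lemma diff2_powp1_le z dl : 0 < dl -> diff2 (powp (1 + rho)) z dl <= dl * (2 * (2 * dl) `^ rho).
Proof.
move=> dl0; rewrite /diff2 !powp1_decomp.
have d2 : 0 <= (2 * dl) `^ rho by exact: powR_ge0.
have hol := @powp_holder (z + dl) (z - dl).
rewrite (_ : z + dl - (z - dl) = 2 * dl) in hol; last by ring.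
have {}hol := hol ltac:(lra).
have [zd|zd] := leP dl z.
  have := diff2_powp_neg (ltW dl0) zd; rewrite /diff2 => h.
  have z0 : 0 <= z by exact: le_trans (ltW dl0) zd.
  have e : (z + dl) * powp rho (z + dl) - 2 * (z * powp rho z) + (z - dl) * powp rho (z - dl) =
    z * (powp rho (z + dl) - 2 * powp rho z + powp rho (z - dl)) +
    dl * (powp rho (z + dl) - powp rho (z - dl)) by ring.
  rewrite e; have h1 : z * (powp rho (z + dl) - 2 * powp rho z + powp rho (z - dl)) <= 0.
    by rewrite mulr_ge0_le0.
  have h2 := ler_wpM2l (ltW dl0) hol.
  have h3 := mulr_ge0 (ltW dl0) d2; lra.
rewrite [powp rho (z - dl)]powp_le0 ?gt_eqF//; last lra.
rewrite [powp rho (z - dl)]powp_le0 ?gt_eqF// in hol; last lra.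
rewrite mulr0 addr0.
have zz : 0 <= z * powp rho z.
  rewrite -powp1_decomp; exact: powp_ge0.
have p0 := powp_ge0 rho (z + dl).
have : (z + dl) * powp rho (z + dl) <= (2 * dl) * (2 * dl) `^ rho.
  have [h|h] := leP (z + dl) 0.
    by apply: (@le_trans _ _ 0); [rewrite mulr_le0_ge0|rewrite mulr_ge0//; lra].
  by apply: ler_pM => //; lra.
lra.
Qed.

Lemma powR_quotient_dnbhs (r x : R) : 0 < x ->
  h^-1 * ((x + h) `^ r - x `^ r) @[h --> 0^'] --> r * x `^ (r - 1).
Proof.
move=> x0; have [df dE] := is_derive1_powR r x0.
have : h^-1 *: ((fun y : R => y `^ r) (h *: 1 + x) - x `^ r) @[h --> 0^'] --> r * x `^ (r - 1).
  by rewrite -dE; exact: df.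
apply: cvg_trans; apply: near_eq_cvg; apply: nearW => h.
by rewrite /= /GRing.scale /= mulr1 [h + x]addrC.
Qed.

Lemma diff2_powR_small (s0 e : R) : 0 < s0 -> 0 < e ->
  \forall dl \near 0^'+, - diff2 (powp rho) s0 dl <= e * dl.
Proof.
move=> s00 e0; have e20 : 0 < e / 2 by rewrite divr_gt0.
have /cvgrPdist_le /(_ _ e20) [d /= d0 H] := @powR_quotient_dnbhs rho s0 s00.
near=> dl.
have dl0 : 0 < dl by near: dl; exact: nbhs_right_gt.
have dld : dl < d by near: dl; exact: nbhs_right_lt.
have dls : dl < s0 by near: dl; exact: nbhs_right_lt.
have h1 := H dl; have h2 := H (- dl).
rewrite /= sub0r normrN gtr0_norm// in h1; rewrite /= sub0r opprK gtr0_norm// in h2.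
have {}h1 := h1 dld (lt0r_neq0 dl0).
have {}h2 := h2 dld _.
rewrite oppr_eq0 gt_eqF// in h2; have {}h2 := h2 isT.
rewrite /diff2 !powp_gt0//; [|lra|lra].
move: h1 h2; rewrite !ler_norml => /andP[_ h1] /andP[h2 _].
rewrite invrN mulNr opprK in h2.
set q := rho * _ in h1 h2; set A := (s0 + dl) `^ rho in h1 *; set B := (s0 - dl) `^ rho in h2 *; set S := s0 `^ rho in h1 h2 *.
have a1 : dl^-1 * (A - S) >= q - e / 2 by lra.
have a2 : dl^-1 * (B - S) >= - q - e / 2 by lra.
have : dl * (dl^-1 * (A - S) + dl^-1 * (B - S)) >= dl * (- e) by rewrite ler_pM2l//; lra.
rewrite mulrDr !mulrA mulfV ?gt_eqF// !mul1r; lra.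
Unshelve. all: by end_near. Qed.

End second_difference.

Lemma atom_enumeration (R : realType) (mu0 : probability R R) :
  exists b : nat -> R, forall s, (forall j, s != b j) -> forall e, 0 < e -> exists2 dl, 0 < dl &
    fine (mu0 `]-oo, (s + dl)]%classic) - fine (mu0 `]-oo, (s - dl)]%classic) <= e.
Proof.
pose A := [set r : R | 0 < fine (mu0 [set r])].
have : countable A.
  pose Z : {RV mu0 >-> R} := HB.pack (fun y : R => y)
    (isMeasurableFun.Build _ _ R R (fun y : R => y) (@measurable_id _ R setT)).
  exact: (pmf_gt0_countable Z).
move=> /countable_injP[f finj].
pose b j := xget 0 [set r | A r /\ f r = j].
exists b => s sb e e0.
have s0 : fine (mu0 [set s]) = 0.
  apply/eqP; rewrite eq_le fine_ge0// andbT leNgt; apply/negP => As.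
  have : s = b (f s).
    rewrite /b; case: xgetP => [r _ [Ar fr]|/(_ s)]; last by case; split.
    by apply: finj; rewrite ?inE.
  by move=> E; have := sb (f s); rewrite -E eqxx.
pose g n (y : R) : R := (y <= s + n.+1%:R^-1)%R%:R - (y <= s - n.+1%:R^-1)%R%:R.
have ble c : bmf (fun y : R => (y <= c)%R%:R : R).
  by apply: (@bmf_indicator_le R _ _ (fun y : R => y) c); exact: measurable_id.
have Ecdf c : Ex mu0 (fun y => (y <= c)%R%:R) = fine (mu0 `]-oo, c]%classic).
  rewrite -Ex_indic//; apply: Ex_eq => y; rewrite indicE.
  by congr (_ %:R); congr nat_of_bool; apply/idP/idP; rewrite inE /= in_itv.
have : Ex mu0 (g n) @[n --> \oo] --> Ex mu0 \1_[set s].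
  apply: (@Ex_cvg _ _ _ _ _ _ 2).
  - by move=> n; have [] := bmfB (ble (s + n.+1%:R^-1)) (ble (s - n.+1%:R^-1)).
  - by have [] := bmf_indic R (measurable_set1 s).
  - move=> n y; rewrite /g; apply: (le_trans (ler_normB _ _)).
    by rewrite !ger0_norm ?ler0n//; case: (y <= s + _); case: (y <= s - _); rewrite /=; lra.
  - apply: aeW => y /=; apply: (cvg_near_cst).
    have [->|ys] := eqVneq y s.
      apply: nearW => n; rewrite /g indicE mem_set//=.
      by rewrite lerDl invr_ge0 ler0n lerBrDr gerDl leNgt invr_gt0 ltr0n/= subr0.
    have d0 : 0 < `|y - s| by rewrite normr_gt0 subr_eq0.
    near=> n.
    have : n.+1%:R^-1 < `|y - s|.
      near: n; exact: near_infty_natSinv_lt (PosNum d0).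
    rewrite /g indicE memNset; last by move=> E; rewrite E eqxx in ys.
    rewrite ltr_normr => /orP[h|h].
      have [h1 h2] : (y <= s + n.+1%:R^-1) = false /\ (y <= s - n.+1%:R^-1) = false.
        have h3 : 0 <= n.+1%:R^-1 :> R by rewrite invr_ge0 ler0n.
        by split; apply/negbTE; rewrite -ltNge; move: h h3; set q := _^-1; lra.
      by rewrite h1 h2 subrr.
    have h3 : 0 <= n.+1%:R^-1 :> R by rewrite invr_ge0 ler0n.
    have [h1 h2] : (y <= s + n.+1%:R^-1) = true /\ (y <= s - n.+1%:R^-1) = true.
      by move: h h3; set q := _^-1; split; lra.
    by rewrite h1 h2 subrr.
rewrite Ex_indic// s0 => /cvgrPdist_le /(_ _ e0)[N _ /(_ N (leqnn N))] /=.
rewrite sub0r normrN ExB// !Ecdf => h; exists N.+1%:R^-1; first by rewrite invr_gt0 ltr0n.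
exact: le_trans (ler_norm _) h.
Unshelve. all: by end_near. Qed.

(** * Subgradients and second differences *)

Section slopes.
Context (R : realType).
Implicit Types (V M : R -> R) (c : R).

(** M t is a subgradient at t of the function c V; at a kink any value between the two one-sided
    derivatives is allowed. *)
Definition has_slope V M c := forall t dl, 0 < dl ->
  c * (V t - V (t - dl)) <= dl * M t <= c * (V (t + dl) - V t).

Lemma has_slope_homo V M c : has_slope V M c -> {homo M : s t / s <= t}.
Proof.
move=> HM s t; rewrite le_eqVlt => /predU1P[->//|st].
have ts : 0 < t - s by rewrite subr_gt0.
have /andP[_] := HM s _ ts; have /andP[+ _] := HM t _ ts.
rewrite [s + _]addrC subrK subKr => h1 h2.
by rewrite -(ler_pM2l ts); exact: le_trans h2 h1.
Qed.

Lemma has_slope_diff2 V M c s dl : has_slope V M c -> 0 < c -> 0 < dl ->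
  0 <= c * diff2 V s dl <= dl * (M (s + dl) - M (s - dl)).
Proof.
move=> HM c0 dl0; have /andP[h1 h2] := HM s _ dl0.
have /andP[h3 _] := HM (s + dl) _ dl0; have /andP[_ h4] := HM (s - dl) _ dl0.
rewrite addrK in h3; rewrite subrK in h4.
have -> : c * diff2 V s dl = c * (V (s + dl) - V s) - c * (V s - V (s - dl)).
  by rewrite /diff2; ring.
by apply/andP; split; [lra|rewrite mulrBr; lra].
Qed.

Lemma has_slope_incr V M c z d1 d2 : has_slope V M c -> 0 < c -> 0 < d1 -> 0 < d2 ->
  d2 * (V z - V (z - d1)) <= d1 * (V (z + d2) - V z).
Proof.
move=> HM c0 d10 d20; have /andP[h1 _] := HM z _ d10; have /andP[_ h2] := HM z _ d20.
rewrite -(ler_pM2l c0) mulrCA [leRHS]mulrCA.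
apply: (@le_trans _ _ (d2 * (d1 * M z))); first by rewrite ler_pM2l.
by rewrite [leLHS]mulrCA ler_pM2l.
Qed.

Lemma has_slope_scale V M c k r : 0 < k -> 0 < r -> has_slope V M c ->
  has_slope (fun v => k * V (v / r)) (fun v => M (v / r)) (c * r / k).
Proof.
move=> k0 r0 HM t dl dl0; have := HM (t / r) _ (divr_gt0 dl0 r0).
rewrite -!mulrBr -mulrBl -mulrDl.
have E q : c * r / k * (k * q) = r * (c * q) by field; exact: lt0r_neq0.
have -> : dl * M (t / r) = r * (dl / r * M (t / r)) by field; exact: lt0r_neq0.
by rewrite !E !ler_pM2l.
Qed.

Lemma has_slope_diff2_bounds V M c s dl C : has_slope V M c -> 0 < c -> 0 < dl -> dl <= 1 ->
  {homo V : a b / a <= b} -> (forall v, 0 <= V v) -> V (s + 2) <= C ->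
  0 <= diff2 V s dl <= dl * C.
Proof.
move=> HM c0 dl0 dl1 Vh V0 VC; have /andP[h1 _] := has_slope_diff2 s HM c0 dl0.
rewrite pmulr_rge0// in h1; rewrite h1 /=.
have := has_slope_incr (s + dl) HM c0 dl0 ltr01; rewrite addrK mul1r => h2.
have h3 : V (s - dl) <= V s by apply: Vh; lra.
have h4 : V (s + dl + 1) <= V (s + 2) by apply: Vh; lra.
have h5 := V0 (s + dl).
have : dl * (V (s + dl + 1) - V (s + dl)) <= dl * C by rewrite ler_pM2l//; lra.
by rewrite /diff2; lra.
Qed.

Lemma has_slope_diff2_small V M c s : has_slope V M c -> 0 < c ->
  (forall e, 0 < e -> exists2 dl, 0 < dl & M (s + dl) - M (s - dl) <= e) ->
  forall e, 0 < e -> \forall dl \near 0^'+, diff2 V s dl <= e * dl.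
Proof.
move=> HM c0 H e e0; have [d1 d10 h] := H _ (mulr_gt0 c0 e0).
near=> dl.
have dl0 : 0 < dl by near: dl; exact: nbhs_right_gt.
have dl1 : dl <= d1 by near: dl; exact: nbhs_right_le.
have /andP[_ h1] := has_slope_diff2 s HM c0 dl0.
have h2 : M (s + dl) <= M (s + d1) by apply: (has_slope_homo HM); lra.
have h3 : M (s - d1) <= M (s - dl) by apply: (has_slope_homo HM); lra.
rewrite -(ler_pM2l c0); apply: le_trans h1 _.
by rewrite mulrA [leRHS]mulrC ler_pM2l//; lra.
Unshelve. all: by end_near. Qed.

End slopes.

(** * Second differences by restarting at a fixed time *)

Section no_atom.
Context (R : realType) d (Omega : measurableType d) (P : probability Omega R)
  (X : R -> Omega -> R) (alpha rho : R).
Hypothesis alpha_gt1 : 1 < alpha.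
Hypothesis SX : stable_levy_process P alpha X.
Hypothesis ae_hit : forall y, 0 < y -> {ae P, forall w, hit (X ^~ w) y !=set0}.
Hypothesis rho01 : 0 < rho < 1.
Let a0 : 0 < alpha := alpha_gt0 alpha_gt1.
Let rho0 : 0 < rho. Proof. by case/andP: rho01. Qed.
Let r10 : 0 < 1 + rho. Proof. by rewrite addr_gt0. Qed.
Let mT y : measurable_fun setT (tau X y) := measurable_tau SX y.
Let T0 y w : 0 <= tau X y w. Proof. exact: tau_ge0. Qed.

(* Vfun x is the limit of E ((v - tau x)_+ | ovs x <= h) up to a constant. *)
Definition Vfun y v := Ex P (fun w => tau X y w * powp rho (v - tau X y w)).
Definition Ufun y v := Ex P (fun w => powp rho (v - tau X y w)).
Definition Gfun y v := Ex P (fun w => powp (1 + rho) (v - tau X y w)).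

Let bU y v : bmf (fun w => powp rho (v - tau X y w)).
Proof. by apply: bmf_powp => //; exact: ltW. Qed.

Let bG y v : bmf (fun w => powp (1 + rho) (v - tau X y w)).
Proof. by apply: bmf_powp => //; exact: ltW. Qed.

Let tpow_bound v s : 0 <= s -> 0 <= s * powp rho (v - s) <= powp (1 + rho) v.
Proof.
move=> s0; rewrite mulr_ge0 ?powp_ge0//=.
have [sv|vs] := ltP s v.
  have v0 : 0 < v by exact: le_lt_trans sv.
  rewrite powp1_decomp//; apply: ler_pM => //; first exact: powp_ge0; first exact: ltW.
  by apply: powp_homo; [exact: ltW|rewrite gerBl].
rewrite [powp rho _]powp_le0 ?gt_eqF// ?subr_le0// mulr0; exact: powp_ge0.
Qed.

Let bV y v : bmf (fun w => tau X y w * powp rho (v - tau X y w)).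
Proof.
split; first by apply: measurable_funM => //; have [] := bU y v.
exists (powp (1 + rho) v) => w; have /andP[h1 h2] := tpow_bound v (T0 y w).
by rewrite ger0_norm.
Qed.

Lemma Vfun_ge0 y v : 0 <= Vfun y v.
Proof. by apply: Ex_ge0 => w; rewrite mulr_ge0// powp_ge0. Qed.

Lemma Vfun_le y v : Vfun y v <= powp (1 + rho) v.
Proof.
rewrite -[leRHS](Ex_cst P); apply: le_Ex; [exact: bV|exact: bmf_cst|] => w.
by have /andP[] := tpow_bound v (T0 y w).
Qed.

Lemma Vfun_homo y : {homo Vfun y : u v / u <= v}.
Proof.
move=> u v uv; apply: le_Ex; [exact: bV|exact: bV|] => w.
by rewrite ler_wpM2l//; apply: powp_homo; [exact: ltW|rewrite lerD2r].
Qed.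

(** Writing tau = v - (v - tau) removes the factor tau, which a restart at a fixed time would split,
    and leaves functions of v - tau only. *)
Lemma VfunE y v : Vfun y v = v * Ufun y v - Gfun y v.
Proof.
rewrite /Vfun /Ufun /Gfun -ExZ// -ExB//; last exact: bmfZ.
by apply: Ex_eq => w; rewrite powp1_decomp//; ring.
Qed.

Lemma Ex_diff2 (r : R) y z dl : 0 <= r ->
  diff2 (fun v => Ex P (fun w => powp r (v - tau X y w))) z dl =
    Ex P (fun w => diff2 (powp r) (z - tau X y w) dl) /\
  bmf (fun w => diff2 (powp r) (z - tau X y w) dl).
Proof.
move=> r0; have b v : bmf (fun w => powp r (v - tau X y w)) by exact: bmf_powp.
have E w : diff2 (powp r) (z - tau X y w) dl =
    powp r (z + dl - tau X y w) - 2 * powp r (z - tau X y w) + powp r (z - dl - tau X y w).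
  by rewrite /diff2; congr (powp _ _ - _ + powp _ _); ring.
have bb := bmfB (b (z + dl)) (bmfZ 2 (b z)).
have /funext -> := E; split; last exact: (bmfD bb (b (z - dl))).
by rewrite (ExD P bb (b (z - dl))) (ExB P (b (z + dl)) (bmfZ 2 (b z))) (ExZ P 2 (b z)).
Qed.

Lemma Gfun_diff2 y z dl : 0 < dl -> 0 <= diff2 (Gfun y) z dl <= dl * (2 * (2 * dl) `^ rho).
Proof.
move=> dl0; have [E b] := Ex_diff2 y z dl (ltW r10).
rewrite /Gfun E; apply/andP; split.
  by apply: Ex_ge0 => w; apply: diff2_powp1_ge0 => //; exact: ltW.
rewrite -[leRHS](Ex_cst P); apply: le_Ex => //; first exact: bmf_cst.
by move=> w; exact: diff2_powp1_le.
Qed.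

Lemma Ufun_incr y z dl : 0 < dl -> 0 <= Ufun y (z + dl) - Ufun y (z - dl) <= (2 * dl) `^ rho.
Proof.
move=> dl0; rewrite /Ufun -ExB//; apply/andP; split.
  apply: Ex_ge0 => w; rewrite subr_ge0; apply: powp_homo; [exact: ltW|lra].
rewrite -[leRHS](Ex_cst P); apply: le_Ex => //; [exact: bmfB|exact: bmf_cst|] => w.
apply: le_trans (powp_holder _ _) _ => //; first lra.
by rewrite (_ : z + dl - _ - _ = 2 * dl)//; ring.
Qed.

(** At z the second differences of V and of z U differ by O(dl^(1 + rho)), so that smallness
    relative to dl can be proved for either: scaling and convexity are available for V, the restart
    for U. *)
Lemma diff2_VU y z dl : 0 < dl ->
  diff2 (Vfun y) z dl <= z * diff2 (Ufun y) z dl + dl * (2 * dl) `^ rho /\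
  z * diff2 (Ufun y) z dl <= diff2 (Vfun y) z dl + dl * (2 * (2 * dl) `^ rho) /\
  diff2 (Vfun y) z dl - dl * (2 * dl) `^ rho <= z * diff2 (Ufun y) z dl.
Proof.
move=> dl0; have /andP[g1 g2] := Gfun_diff2 y z dl0.
have /andP[u1 u2] := Ufun_incr y z dl0.
have E : diff2 (Vfun y) z dl = z * diff2 (Ufun y) z dl +
   dl * (Ufun y (z + dl) - Ufun y (z - dl)) - diff2 (Gfun y) z dl.
  rewrite /diff2 !VfunE.
  move: (Ufun y (z + dl)) (Ufun y z) (Ufun y (z - dl)) (Gfun y (z + dl)) (Gfun y z) (Gfun y (z - dl)).
  by move=> *; ring.
have h1 := ler_wpM2l (ltW dl0) u2; have h2 := mulr_ge0 (ltW dl0) u1.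
move: h1 h2 g1 g2; rewrite E mulrCA.
clear u1 u2 E; move: (dl * _) (diff2 (Gfun y) z dl) (dl * _) (z * _) => *.
by split; [|split]; lra.
Qed.

Lemma Vfun_scale x y v : 0 < x -> 0 < y -> let r := (y / x) `^ alpha in
  Vfun y v = r `^ (1 + rho) * Vfun x (v / r).
Proof.
move=> x0 y0 r.
have r0 : 0 < r by rewrite powR_gt0// divr_gt0.
pose phi v s := Num.max s 0 * powp rho (v - Num.max s 0) : R.
have cphi u : continuous (phi u).
  move=> s; apply: cvgM; first exact: (@continuous_max0 R s).
  apply: (@continuous_comp _ _ _ (fun s : R => u - Num.max s 0) (powp rho)).
    exact: (@continuous_subl _ _ u _ (@continuous_max0 R)).
  exact: powp_continuous.
have Bphi u s : `|phi u s| <= powp (1 + rho) u.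
  by have /andP[h1 h2] := tpow_bound u (max0_ge0 s); rewrite ger0_norm.
have E z u : 0 < z -> Vfun z u = Ex P (fun w => phi u (z `^ alpha * tau X 1 w)).
  move=> z0; rewrite -(scale_tau alpha_gt1 SX ae_hit z0 (cphi u) (Bphi u)).
  by apply: Ex_eq => w; rewrite /phi max_l.
rewrite !E// -ExZ; last first.
  apply: (bmf_comp (T' := measurableTypeR R) (g := tau X 1) (f := fun s => phi (v / r) (x `^ alpha * s))); first exact: mT.
  split; last by exists (powp (1 + rho) (v / r)).
  apply: measurableT_comp; first exact: continuous_measurable_fun.
  exact: mulrl_measurable.
apply: Ex_eq => w; set s := tau X 1 w.
have s0 : 0 <= s by exact: T0.
have -> : y `^ alpha = r * x `^ alpha.
  by rewrite -powRM ?divr_ge0 ?(ltW x0) ?(ltW y0)// divfK// gt_eqF.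
rewrite /phi !max_l ?mulr_ge0 ?powR_ge0//.
rewrite powRDp// powRr1 ?(ltW r0)//.
have -> : v - r * x `^ alpha * s = r * (v / r - x `^ alpha * s).
  by rewrite mulrBr mulrCA mulfV ?gt_eqF// mulr1 mulrA.
have -> : powp rho (r * (v / r - x `^ alpha * s)) = r `^ rho * powp rho (v / r - x `^ alpha * s).
  rewrite /powp -powRM ?max0_ge0 ?(ltW r0)//; congr (_ `^ _).
  by rewrite maxr_pMr ?mulr0// ltW.
by ring.
Qed.

Opaque Vfun Ufun Gfun.

Variables (x c : R) (M : R -> R) (b : nat -> R).
Hypothesis x0 : 0 < x.
Hypothesis c0 : 0 < c.
Hypothesis HM : has_slope (Vfun x) M c.
Hypothesis Hb : forall s, (forall j, s != b j) -> forall e, 0 < e ->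
  exists2 dl, 0 < dl & M (s + dl) - M (s - dl) <= e.

Let ratio_gt0 y : 0 < y -> 0 < (y / x) `^ alpha.
Proof. by move=> y0; rewrite powR_gt0// divr_gt0. Qed.

Let Vfun_slope y : 0 < y -> let r := (y / x) `^ alpha in
  has_slope (Vfun y) (fun v => M (v / r)) (c * r / r `^ (1 + rho)) /\ 0 < c * r / r `^ (1 + rho).
Proof.
move=> y0 r; have r0 : 0 < r by exact: ratio_gt0.
have k0 : 0 < r `^ (1 + rho) by rewrite powR_gt0.
split; last by rewrite divr_gt0// mulr_gt0.
have -> : Vfun y = fun v => r `^ (1 + rho) * Vfun x (v / r).
  by apply/funext => v; exact: Vfun_scale.
exact: has_slope_scale.
Qed.

(** The bound does not depend on the level y, so it can dominate an average over the levels x - X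
    t. *)
Lemma diff2_Vfun_bounds y s dl : 0 < y -> 0 < s -> 0 < dl -> dl <= 1 ->
  0 <= diff2 (Vfun y) s dl <= dl * (s + 2) `^ (1 + rho).
Proof.
move=> y0 s0 dl0 dl1; have [H cy] := Vfun_slope y0.
apply: (has_slope_diff2_bounds H) => //; [exact: Vfun_homo|exact: Vfun_ge0|].
by apply: le_trans (Vfun_le y _) _; rewrite powp_gt0// addr_gt0.
Qed.

Lemma diff2_Vfun_small y s e : 0 < y -> (forall j, s / (y / x) `^ alpha != b j) -> 0 < e ->
  \forall dl \near 0^'+, diff2 (Vfun y) s dl <= e * dl.
Proof.
move=> y0 sb e0; have [H cy] := Vfun_slope y0; have r0 := ratio_gt0 y0.
apply: (has_slope_diff2_small H) => // e1 e10; have [dl dl0 h] := Hb sb e10.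
exists (dl * (y / x) `^ alpha); first by rewrite mulr_gt0.
by rewrite mulrDl mulrBl mulfK ?gt_eqF.
Qed.

Lemma dyadic_between t0 : 0 < t0 -> exists i n : nat,
  0 < (i%:R * (1 / 2 ^+ n) : R) /\ (i%:R * (1 / 2 ^+ n) : R) < t0.
Proof.
move=> t00; exists 1%N.
have /cvgrPdist_lt /(_ _ t00)[n _ H] : (2^-1 : R) ^+ n @[n --> \oo] --> 0.
  by apply: cvg_expr; rewrite gtr0_norm// invf_lt1// ltr1n.
exists n; rewrite mul1r; split; first by rewrite divr_gt0// exprn_gt0.
have := H n (leqnn n); rewrite /= sub0r normrN gtr0_norm ?exprn_gt0//.
by rewrite exprVn mul1r.
Qed.

Section at_positive_time.
Variables (t0 t s0 : R) (a : Omega -> R).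
Hypothesis t_gt0 : 0 < t.
Hypothesis s_gt0 : 0 < s0.
Hypothesis t0E : t0 = t + s0.
Hypothesis ba : bmf a.
Hypothesis a01 : forall w, 0 <= a w <= 1.
Hypothesis a_lev : forall w, a w != 0 -> X t w <= x.
Hypothesis a_one : forall w, hit (X ^~ w) x !=set0 -> t < tau X x w -> a w = 1.
Hypothesis a_markov : forall f C, continuous (fun p : R * R => f p.1 p.2) ->
  (forall s z, `|f s z| <= C) -> 0 < x ->
  Ex P (fun w => a w * f (tau X x w - t) (ovs X x w)) = Ex P (fun w => a w * EFp P X f (x - X t w))
  /\ bmf (fun w => EFp P X f (x - X t w)).

(** The second difference at s0 of v |-> (v - s)_+^rho, as a function of the time s left until the
    passage; it is held constant for s <= 0, which keeps it bounded. *)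
Let kap (dl s : R) : R := diff2 (powp rho) (s0 - Num.max s 0) dl.

Let kap_cont dl : continuous (kap dl : R -> R).
Proof.
move=> s; have cp := @powp_continuous R rho rho0.
have cm c1 : {for s, continuous (fun s : R => powp rho (s0 - Num.max s 0 + c1))}.
  apply: (@continuous_comp _ _ _ (fun s : R => s0 - Num.max s 0 + c1) (powp rho)); last exact: cp.
  apply: cvgD; last exact: cvg_cst.
  exact: (@continuous_subl _ _ s0 _ (@continuous_max0 R)).
have c00 : {for s, continuous (fun s : R => powp rho (s0 - Num.max s 0))}.
  apply: (@continuous_comp _ _ _ (fun s : R => s0 - Num.max s 0) (powp rho)); last exact: cp.
  exact: (@continuous_subl _ _ s0 _ (@continuous_max0 R)).
rewrite /kap /diff2; apply: cvgD; last exact: (cm (- dl)).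
apply: cvgB; first exact: (cm dl).
by apply: cvgM; [exact: cvg_cst|exact: c00].
Qed.

Let kap_bound dl s : 0 < dl -> `|kap dl s| <= 4 * powp rho (s0 + dl).
Proof.
move=> dl0; have h := max0_ge0 s.
have pb z : z <= s0 + dl -> 0 <= powp rho z <= powp rho (s0 + dl).
  by move=> zs; rewrite powp_ge0 powp_homo// ltW.
rewrite /kap /diff2; set z := s0 - _.
have z1 : z <= s0 by rewrite /z; lra.
have /andP[p1 q1] := pb (z + dl) ltac:(lra).
have /andP[p2 q2] := pb z ltac:(lra).
have /andP[p3 q3] := pb (z - dl) ltac:(lra).
by rewrite ler_norml; apply/andP; split; lra.
Qed.

Let F dl w := EFp P X (fun s _ => kap dl s) (x - X t w).

Let F_markov dl : 0 < dl ->
  Ex P (fun w => a w * kap dl (tau X x w - t)) = Ex P (fun w => a w * F dl w) /\ bmf (F dl).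
Proof.
move=> dl0; apply: (@a_markov (fun s _ => kap dl s) (4 * powp rho (s0 + dl))) => //.
  exact: (@continuous_fst_comp R (kap dl) (@kap_cont dl)).
by move=> s _; exact: kap_bound.
Qed.

Let bkap dl : 0 < dl -> bmf (fun w => kap dl (tau X x w - t)).
Proof.
move=> dl0; apply: (bmf_comp (T' := measurableTypeR R) (g := fun w => tau X x w - t) (f := kap dl)).
  exact: measurable_funB.
split; first exact: (continuous_measurable_fun (@kap_cont dl)).
by exists (4 * powp rho (s0 + dl)) => s; exact: kap_bound.
Qed.

(* The paths that passed x before t contribute a nonpositive second difference,
   powp rho being concave on the positive half-line. *)
Lemma Ufun_restart dl : 0 < dl -> dl <= s0 ->
  diff2 (Ufun x) t0 dl <= Ex P (fun w => a w * F dl w) - diff2 (powp rho) s0 dl.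
Proof.
move=> dl0 dls; have [<- bF] := F_markov dl0; have bk := bkap dl0.
have [-> b2] := Ex_diff2 x t0 dl (ltW rho0).
rewrite -(Ex_cst P (diff2 (powp rho) s0 dl)) -(ExB P (bmfM ba bk) (bmf_cst _ _)).
apply: le_Ex => //; first exact: bmfB (bmfM ba bk) (bmf_cst _ _).
move=> w; have neg := diff2_powp_neg rho01 (ltW dl0) dls.
have [Tt|tT] := leP (tau X x w) t.
  rewrite /kap (max0_le0 (v := _ - t)) ?subr_le0// subr0.
  have h1 : diff2 (powp rho) (t0 - tau X x w) dl <= 0.
    by apply: diff2_powp_neg => //; [exact: ltW|rewrite t0E; lra].
  have /andP[_ a1] := a01 w; apply: le_trans h1 _.
  by rewrite subr_ge0 ler_niMl.
rewrite a_one//; last first.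
  by apply: contrapT => /tau_nohit[E _]; rewrite E ltNge (ltW t_gt0) in tT.
rewrite mul1r /kap max_l ?subr_ge0 ?(ltW tT)//.
have -> : s0 - (tau X x w - t) = t0 - tau X x w by rewrite t0E; ring.
by rewrite lerDl oppr_ge0.
Qed.

Let F_diff2 dl w : 0 < dl -> X t w < x -> F dl w = diff2 (Ufun (x - X t w)) s0 dl.
Proof.
move=> dl0 Xx; rewrite /F (EFp_tau SX (C := 4 * powp rho (s0 + dl))).
- by rewrite (Ex_diff2 (x - X t w) s0 dl (ltW rho0)).1; apply: Ex_eq => w'; rewrite /kap max_l.
- by apply: ae_hit; rewrite subr_gt0.
- exact: (@continuous_fst_comp R (kap dl) (@kap_cont dl)).
- by move=> s _; exact: kap_bound.
Qed.

Let F_bound dl w : 0 < dl -> dl <= 1 -> X t w < x ->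
  `|s0 * F dl w| <= dl * ((s0 + 2) `^ (1 + rho) + 2 * 2 `^ rho).
Proof.
move=> dl0 dl1 Xx; rewrite F_diff2//.
have [_ [h1 h2]] := diff2_VU (x - X t w) s0 dl0.
have /andP[h3 h4] := diff2_Vfun_bounds (y := x - X t w) ltac:(by rewrite subr_gt0) s_gt0 dl0 dl1.
have h5 : (2 * dl) `^ rho <= 2 `^ rho.
  by apply: ler_powRl; rewrite ?mulr_ge0 ?(ltW rho0) ?(ltW dl0)// ger_pMr.
have h6 := ler_wpM2l (ltW dl0) h5.
have h7 : 0 <= dl * 2 `^ rho by rewrite mulr_ge0 ?powR_ge0// ltW.
rewrite ler_norml (_ : dl * (_ + _) = dl * (s0 + 2) `^ (1 + rho) + 2 * (dl * 2 `^ rho)); last by ring.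
rewrite (_ : dl * (2 * _) = 2 * (dl * (2 * dl) `^ rho)) in h1; last by ring.
move: h1 h2 h3 h4 h6 h7; clear h5.
move: (dl * _ `^ _) (dl * _ `^ _) (dl * _ `^ _) (diff2 _ _ _) (s0 * _) => *.
by apply/andP; split; lra.
Qed.

Let F_small w : X t w < x -> (forall j, s0 / ((x - X t w) / x) `^ alpha != b j) ->
  forall e, 0 < e -> \forall dl \near 0^'+, `|s0 * F dl w| <= e * dl.
Proof.
move=> Xx Hj e e0; have e20 : 0 < e / 2 by rewrite divr_gt0.
have [d1 d10 hd] : exists2 d1, 0 < d1 & 2 * (2 * d1) `^ rho <= e / 2.
  exists ((e / 4) `^ rho^-1 / 2); first by rewrite divr_gt0// powR_gt0// divr_gt0.
  rewrite mulrCA mulfV ?mulr1// -powRrM mulVf ?gt_eqF// powRr1; lra.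
have y0 : 0 < x - X t w by rewrite subr_gt0.
near=> dl.
have dl0 : 0 < dl by near: dl; exact: nbhs_right_gt.
have dl1 : dl <= d1 by near: dl; exact: nbhs_right_le.
have h0 : diff2 (Vfun (x - X t w)) s0 dl <= e / 2 * dl.
  by near: dl; exact: (diff2_Vfun_small y0 Hj e20).
have dlm : dl <= 1 by near: dl; exact: nbhs_right_le.
rewrite F_diff2//; have [_ [h1 h2]] := diff2_VU (x - X t w) s0 dl0.
have /andP[h3 _] := diff2_Vfun_bounds y0 s_gt0 dl0 dlm.
have h5 : (2 * dl) `^ rho <= (2 * d1) `^ rho.
  by apply: ler_powRl; rewrite ?mulr_ge0 ?(ltW rho0) ?(ltW dl0)// ler_pM2l.
have h6 : dl * (2 * (2 * dl) `^ rho) <= dl * (e / 2) by rewrite ler_pM2l//; lra.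
have h7 : 0 <= dl * (2 * dl) `^ rho by rewrite mulr_ge0 ?powR_ge0// ltW.
rewrite (_ : dl * (2 * _) = 2 * (dl * (2 * dl) `^ rho)) in h1 h6; last by ring.
rewrite ler_norml; move: h1 h2 h3 h0 h6 h7; clear h5 dl1.
move: (dl * _ `^ _) (diff2 _ _ _) (s0 * _) => *.
by apply/andP; split; lra.
Unshelve. all: by end_near. Qed.

Let seq_near (Q : R -> Prop) q : 0 < q -> (\forall dl \near 0^'+, Q dl) ->
  \forall n \near \oo, Q (q / n.+1%:R).
Proof.
move=> q0 [e /= e0 H].
have /cvgrPdist_lt /(_ _ e0)[N _ HN] : q * (n.+1%:R : R)^-1 @[n --> \oo] --> q * 0.
  by apply: cvgM; [exact: cvg_cst|exact: cvg_harmonic].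
exists N => // n /= Nn; apply: H; last by rewrite divr_gt0.
by have := HN _ Nn; rewrite mulr0.
Qed.

(** For each j the equality s0 / ((x - X t) / x)^alpha = b j with X t < x allows one value of X t at
    most, and X t has no atoms. *)
Let generic : {ae P, forall w, X t w != x /\
  forall j, X t w < x -> s0 / ((x - X t w) / x) `^ alpha != b j}.
Proof.
have mX : measurable_fun setT (X t).
  by case: SX => LX _ _; apply: (levy_measurable LX); exact: ltW.
have atom r : {ae P, forall w, X t w <> r}.
  apply: ae_of_fine0; last exact: (atomless_X alpha_gt1 SX).
  by have := mX measurableT _ (measurable_set1 r); rewrite setTI.
have : {ae P, forall w, forall j, X t w <> x - x * (s0 / b j) `^ alpha^-1}.
  by apply/ae_foralln => j; exact: atom.
apply: filterS2 (atom x) => w h1 h2; split; first exact/eqP.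
move=> j Xx; apply/eqP => E; apply: (h2 j).
have y0 : 0 < (x - X t w) / x by rewrite divr_gt0// subr_gt0.
have r0 : 0 < ((x - X t w) / x) `^ alpha by rewrite powR_gt0.
rewrite -E invf_div mulrCA mulfV ?gt_eqF// mulr1.
rewrite -powRrM mulfV ?gt_eqF// powRr1 ?(ltW y0)//.
by rewrite mulrCA mulfV ?gt_eqF// mulr1 subKr.
Qed.

(** Steps at most s0 for the concavity argument of [Ufun_restart], and at most 1 for the uniform
    bound [F_bound]. *)
Let q := Num.min s0 1.
Let q0 : 0 < q. Proof. by rewrite lt_min s_gt0 ltr01. Qed.
Let dln n := q / n.+1%:R : R.
Let dln0 n : 0 < dln n. Proof. by rewrite divr_gt0. Qed.
Let dlnq n : dln n <= q.
Proof. by rewrite /dln ler_pdivrMr// ler_pMr// ler1n. Qed.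

(** Dominated convergence over the paths: [F_bound] dominates, and [F_small] gives the limit off the
    null set of [generic]. Where X t > x the weight [a] vanishes. *)
Let restart_small :
  (dln n)^-1 * (s0 * Ex P (fun w => a w * F (dln n) w)) @[n --> \oo] --> (0 : R).
Proof.
have mX : measurable_fun setT (X t).
  by case: SX => LX _ _; apply: (levy_measurable LX); exact: ltW.
have blt : bmf (fun w => (X t w < x)%R%:R : R).
  split; last by exists 1 => w; case: (_ < _); rewrite ?normr1 ?normr0.
  apply: (measurableT_comp (f := fun b : bool => b%:R : R)) => //.
  exact: (measurable_fun_ltr mX).
pose g n w := a w * (X t w < x)%R%:R * ((dln n)^-1 * (s0 * F (dln n) w)).
have bF n : bmf (F (dln n)) := (F_markov (dln0 n)).2.
have bg n : bmf (g n) := bmfM (bmfM ba blt) (bmfZ _ (bmfZ _ (bF n))).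
have E n : (dln n)^-1 * (s0 * Ex P (fun w => a w * F (dln n) w)) = Ex P (g n).
  rewrite -(ExZ P s0 (bmfM ba (bF n))) -(ExZ P _ (bmfZ s0 (bmfM ba (bF n)))).
  apply: Ex_ae_eq; [exact: (bmfZ _ (bmfZ s0 (bmfM ba (bF n))))|exact: bg|].
  apply: filterS generic => w [Xx _]; rewrite /g.
  have [Xlt|Xge|Xeq] := ltgtP (X t w) x; [by rewrite /=; ring| |by rewrite Xeq eqxx in Xx].
  have -> : a w = 0.
    by apply/eqP; apply: contraT => /a_lev; rewrite leNgt Xge.
  by rewrite !mul0r !mulr0.
apply: (cvg_ext _ (fun n => esym (E n)) erefl).
rewrite -(Ex_cst P 0).
apply: (@Ex_cvg _ _ _ _ _ _ ((s0 + 2) `^ (1 + rho) + 2 * 2 `^ rho)).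
- by move=> n; have [] := bg n.
- exact: measurable_cst.
- move=> n w; rewrite /g.
  have C0 : 0 <= (s0 + 2) `^ (1 + rho) + 2 * 2 `^ rho by rewrite addr_ge0// ?mulr_ge0// powR_ge0.
  have /andP[h0 h1] := a01 w.
  have [Xlt|Xge] := ltP (X t w) x; last by rewrite mulr0 mul0r normr0.
  rewrite mulr1 !normrM (ger0_norm h0) -normrM normfV (gtr0_norm (dln0 n)).
  have dq : dln n <= 1 by apply: le_trans (dlnq n) _; rewrite ge_min lexx orbT.
  have h2 := F_bound (dln0 n) dq Xlt.
  apply: le_trans (ler_piMl _ h1) _; first by rewrite mulr_ge0// invr_ge0 ltW.
  by rewrite ler_pdivrMl.
- apply: filterS generic => w [_ Hj].
  apply/cvgrPdist_le => e e0.
  rewrite /g; have [Xlt|Xge] := ltP (X t w) x; last first.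
    by apply: nearW => n; rewrite mulr0 mul0r subrr normr0 ltW.
  have := seq_near q0 (F_small Xlt (fun j => Hj j Xlt) e0).
  apply: filterS => n h; rewrite sub0r normrN mulr1 normrM.
  have /andP[h0 h1] := a01 w; rewrite (ger0_norm h0).
  apply: le_trans (ler_piMl _ h1) _; first by rewrite normr_ge0.
  by rewrite normrM normfV (gtr0_norm (dln0 n)) ler_pdivrMl// [leRHS]mulrC.
Qed.

Lemma diff2_Vfun_restart e : 0 < e -> exists2 dl, 0 < dl & diff2 (Vfun x) t0 dl <= e * dl.
Proof.
move=> e0; have t00 : 0 < t0 by rewrite t0E addr_gt0.
(* Three thirds of e: the restarted part, multiplied by t0 / s0, the concave term, multiplied by t0,
   and the discrepancy between V and t0 U. *)
pose e1 := e * s0 / t0 / 3; have e10 : 0 < e1 by rewrite !divr_gt0// mulr_gt0.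
pose e2 := e / t0 / 3; have e20 : 0 < e2 by rewrite !divr_gt0.
have e30 : 0 < e / 3 by rewrite divr_gt0.
have N1 : \forall n \near \oo, (dln n)^-1 * (s0 * Ex P (fun w => a w * F (dln n) w)) <= e1.
  have /cvgrPdist_le /(_ _ e10) := restart_small.
  by apply: filterS => n; rewrite sub0r normrN; exact: le_trans (ler_norm _).
have N2 := seq_near q0 (diff2_powR_small rho s_gt0 e20).
have N3 : \forall n \near \oo, (2 * dln n) `^ rho <= e / 3.
  apply: (@seq_near (fun dl => (2 * dl) `^ rho <= e / 3) _ q0).
  near=> dl; have dl0 : 0 < dl by near: dl; exact: nbhs_right_gt.
  have h : dl <= (e / 3) `^ rho^-1 / 2.
    by near: dl; apply: nbhs_right_le; rewrite divr_gt0// powR_gt0.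
  have := ler_powRl (ltW rho0) (_ : 0 <= 2 * dl) (_ : 2 * dl <= (e / 3) `^ rho^-1).
  rewrite -powRrM mulVf ?gt_eqF// powRr1 ?(ltW e30)//; apply; lra.
have [n [[h1 h2] h3]] : exists n, ((dln n)^-1 * (s0 * Ex P (fun w => a w * F (dln n) w)) <= e1 /\
    - diff2 (powp rho) s0 (dln n) <= e2 * dln n) /\ (2 * dln n) `^ rho <= e / 3.
  near \oo => n; exists n; split; first by split; near: n.
  by near: n.
exists (dln n) => //; set dl := dln n in h1 h2 h3 *; have dl0 : 0 < dl by exact: dln0.
have dls : dl <= s0 by apply: le_trans (dlnq n) _; rewrite ge_min lexx.
have [h4 _] := diff2_VU x t0 dl0; apply: le_trans h4 _.
have h5 := Ufun_restart dl0 dls.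
rewrite ler_pdivrMl// in h1.
have h6 : Ex P (fun w => a w * F dl w) <= s0^-1 * (dl * e1) by rewrite ler_pdivlMl.
have h7 : dl * (2 * dl) `^ rho <= dl * (e / 3) by rewrite ler_pM2l.
have h8 : diff2 (Ufun x) t0 dl <= s0^-1 * (dl * e1) + e2 * dl by lra.
have h9 : t0 * diff2 (Ufun x) t0 dl <= t0 * (s0^-1 * (dl * e1) + e2 * dl) by rewrite ler_pM2l.
have E : t0 * (s0^-1 * (dl * e1) + e2 * dl) = e * dl * (2 / 3).
  by rewrite /e1 /e2; field; rewrite !gt_eqF.
rewrite E in h9; lra.
Unshelve. all: by end_near. Qed.

End at_positive_time.

Lemma diff2_Vfun_vanish t0 e : 0 <= t0 -> 0 < e ->
  exists2 dl, 0 < dl & diff2 (Vfun x) t0 dl <= e * dl.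
Proof.
rewrite le_eqVlt => /predU1P[<-|t00] e0.
  (* At time 0 the bound V v <= v^(1 + rho) is enough. *)
  exists (e `^ rho^-1); first by rewrite powR_gt0.
  set dl := e `^ _; have dl0 : 0 < dl by rewrite powR_gt0.
  have V0 v : v <= 0 -> Vfun x v = 0.
    move=> v0; apply/eqP; rewrite eq_le Vfun_ge0 andbT.
    by apply: le_trans (Vfun_le x v) _; rewrite powp_le0// gt_eqF.
  have -> : diff2 (Vfun x) 0 dl = Vfun x dl.
    rewrite /diff2 add0r sub0r (V0 0 (lexx _)) (V0 (- dl)) ?oppr_le0 ?ltW//; ring.
  apply: le_trans (Vfun_le x dl) _; rewrite powp_gt0// powRDp// powRr1 ?(ltW dl0)//.
  by rewrite mulrC ler_pM2r// /dl -powRrM mulVf ?gt_eqF// powRr1// ltW.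
have [i [n [t_gt0 t_lt]]] := dyadic_between t00.
have [a [ba a01 a_lev a_one a_markov]] := fixed_time_markov SX ae_hit x i n.
apply: (@diff2_Vfun_restart t0 _ (t0 - i%:R * (1 / 2 ^+ n)) a t_gt0) => //.
- by rewrite subr_gt0.
- by rewrite addrC subrK.
Qed.

End no_atom.

(** * The distribution function of the limit law *)

Section density.
Context (R : realType) d (Omega : measurableType d) (P : probability Omega R).
Variables (T : Omega -> R) (M : R -> R) (rho c t : R).
Hypothesis mT : measurable_fun setT T.
Hypothesis T0 : forall w, 0 <= T w.
Hypothesis rho01 : 0 < rho < 1.
Hypothesis c0 : 0 < c.
Hypothesis t0 : 0 < t.
Let V v := Ex P (fun w => T w * powp rho (v - T w)).
Hypothesis HM : has_slope V M c.
Hypothesis Hd : forall e, 0 < e -> exists2 dl, 0 < dl & diff2 V t dl <= e * dl.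
Let rho0 : 0 < rho. Proof. by case/andP: rho01. Qed.

(** From r <= r^rho for the ratio r = (z - dl) / z; the constant 1 in place of rho is enough for
    domination. *)
Lemma powp_left_increment z dl : 0 < dl -> 0 < z -> 0 <= powp rho z - powp rho (z - dl) <= dl * z `^ (rho - 1).
Proof.
move=> dl0 z0; apply/andP; split.
  by rewrite subr_ge0; apply: powp_homo; [exact: ltW|rewrite gerBl ltW].
have zE : z `^ rho = z * z `^ (rho - 1).
  by rewrite -[X in X * _]powRr1 ?(ltW z0)// -powRDp//; congr (_ `^ _); ring.
have q0 : 0 < z `^ (rho - 1) by rewrite powR_gt0.
rewrite powp_gt0//; have [dz|zd] := ltP dl z; last first.
  by rewrite powp_le0 ?gt_eqF ?subr_le0// subr0 zE ler_pM2r.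
rewrite powp_gt0 ?subr_gt0//.
have h : (z - dl) / z <= ((z - dl) / z) `^ rho.
  apply: ger1_powR; last by case/andP: rho01 => _ /ltW.
  by rewrite divr_gt0 ?subr_gt0//= ler_pdivrMr// mul1r gerBl ltW.
have : (z - dl) / z * z `^ rho <= (z - dl) `^ rho.
  apply: (@le_trans _ _ (((z - dl) / z) `^ rho * z `^ rho)); first by rewrite ler_pM2r// powR_gt0.
  by rewrite -powRM ?divr_ge0 ?subr_ge0 ?(ltW z0) ?(ltW dz)// divfK// gt_eqF.
rewrite zE mulrA divfK ?gt_eqF// mulrBl; lra.
Qed.

Let bV v : bmf (fun w => T w * powp rho (v - T w)).
Proof.
split; first by apply: measurable_funM => //; have [] := bmf_powp mT T0 v (ltW rho0).
exists (Num.max v 0 * powp rho v) => w; have h := powp_ge0 rho (v - T w).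
rewrite ger0_norm ?mulr_ge0//; have [vT|Tv] := leP v (T w).
  rewrite [powp rho _]powp_le0 ?gt_eqF ?subr_le0// mulr0 mulr_ge0 ?powp_ge0// max0_ge0//.
apply: ler_pM => //; first by rewrite le_max (ltW Tv).
by apply: powp_homo; [exact: ltW|rewrite gerBl].
Qed.

(** Quotients from the left: at T = t they vanish, whereas quotients from the right would blow up
    there. *)
Let q n w : R := n.+1%:R * (T w * powp rho (t - T w) - T w * powp rho (t - n.+1%:R^-1 - T w)).
Let f w : R := T w * ((T w < t)%R%:R * (t - T w) `^ (rho - 1)).

Let bq n : bmf (q n).
Proof. exact: (bmfZ _ (bmfB (bV t) (bV (t - n.+1%:R^-1)))). Qed.

Let inv_gt0 n : 0 < (n.+1%:R : R)^-1. Proof. by rewrite invr_gt0. Qed.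

Let qf n w : 0 <= q n w <= f w.
Proof.
rewrite /q /f; have [Tt|tT] := ltP (T w) t; last first.
  rewrite !powp_le0 ?gt_eqF// ?subr_le0//; last by rewrite lerBlDr (le_trans tT)// lerDl ltW.
  by rewrite !mulr0 subrr mulr0 mul0r mulr0 lexx.
have z0 : 0 < t - T w by rewrite subr_gt0.
rewrite mul1r -mulrBr mulrCA addrAC.
have /andP[h1 h2] := powp_left_increment (inv_gt0 n) z0.
rewrite mulr_ge0 ?mulr_ge0//= ler_wpM2l//.
by rewrite -ler_pdivlMl.
Qed.

Let q_cvg w : q n w @[n --> \oo] --> rho * f w.
Proof.
rewrite /f; have [Tt|tT] := ltP (T w) t; last first.
  rewrite mul0r mulr0 mulr0; apply: cvg_near_cst; apply: nearW => n.
  rewrite /q !powp_le0 ?gt_eqF// ?subr_le0//; last by rewrite lerBlDr (le_trans tT)// lerDl ltW.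
  by rewrite !mulr0 subrr mulr0.
have z0 : 0 < t - T w by rewrite subr_gt0.
have /cvgrPdist_le H := @powR_quotient_dnbhs R rho _ z0.
rewrite mul1r mulrCA; apply/cvgrPdist_le => e e0.
have e1 : 0 < e / (T w + 1) by rewrite divr_gt0// ltr_wpDl.
have [d1 /= d10 {}H] := H _ e1.
near=> n.
have nd : n.+1%:R^-1 < d1 by near: n; exact: (near_infty_natSinv_lt (PosNum d10)).
have nz : n.+1%:R^-1 < t - T w by near: n; exact: (near_infty_natSinv_lt (PosNum z0)).
have := H (- n.+1%:R^-1); rewrite /= sub0r opprK gtr0_norm// => /(_ nd).
rewrite oppr_eq0 invr_eq0 pnatr_eq0 => /(_ isT).
rewrite invrN invrK => h.
have -> : q n w = T w * (- n.+1%:R * ((t - T w - n.+1%:R^-1) `^ rho - (t - T w) `^ rho)).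
  rewrite /q -mulrBr [t - n.+1%:R^-1 - T w]addrAC !powp_gt0 ?subr_gt0//; ring.
rewrite -mulrBr normrM ger0_norm//.
apply: (@le_trans _ _ (T w * (e / (T w + 1)))); first by rewrite ler_wpM2l.
have T1 : 0 < T w + 1 by rewrite ltr_wpDl.
by rewrite mulrA ler_pdivrMr// mulrC ler_wpM2l ?(ltW e0)// lerDl.
Unshelve. all: by end_near. Qed.

(** M t / c lies between the quotients from the left and from the right, which [Hd] brings together
    at one step [dl]. By convexity the left quotients increase as the step shrinks, so this one step
    controls all smaller ones. *)
Let q_lim : Ex P (q n) @[n --> \oo] --> M t / c.
Proof.
have E n : Ex P (q n) = n.+1%:R * (V t - V (t - n.+1%:R^-1)).
  by rewrite /q (ExZ P _ (bmfB (bV t) (bV (t - n.+1%:R^-1)))) (ExB P (bV t) (bV (t - n.+1%:R^-1))).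
apply/cvgrPdist_le => e e0; have [dl dl0 h] := Hd e0.
near=> n.
have nd : n.+1%:R^-1 < dl by near: n; exact: (near_infty_natSinv_lt (PosNum dl0)).
rewrite E; set u := n.+1%:R^-1 in nd *; have u0 : 0 < u by exact: inv_gt0.
have -> : (n.+1%:R : R) = u^-1 by rewrite /u invrK.
have /andP[h1 _] := HM t u0; have /andP[_ h2] := HM t dl0.
have du0 : 0 < dl - u by rewrite subr_gt0.
have := has_slope_incr (t - u) HM c0 du0 u0.
rewrite subrK (_ : t - u - (dl - u) = t - dl); last by ring.
move: h h1 h2; rewrite /diff2; move: (V (t + dl)) (V t) (V (t - dl)) (V (t - u)) (M t) => a1 a2 a3 a4 m.
move=> h h1 h2 h3.
have k1 : u^-1 * (a2 - a4) <= m / c.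
  by rewrite ler_pdivlMr// mulrC mulrCA ler_pdivrMl//.
have k2 : dl * (a2 - a4) >= u * (a2 - a3) by lra.
have k3 : m / c <= (a1 - a2) / dl by rewrite ler_pdivrMr// mulrAC ler_pdivlMr// [m * _]mulrC [_ * c]mulrC.
have k4 : (a1 - a2) / dl <= e + (a2 - a3) / dl by rewrite ler_pdivrMr// mulrDl divfK ?gt_eqF//; lra.
have k5 : (a2 - a3) / dl <= u^-1 * (a2 - a4).
  by rewrite ler_pdivrMr// -mulrA ler_pdivlMl// [_ * dl]mulrC.
by rewrite ler_norml; apply/andP; split; lra.
Unshelve. all: by end_near. Qed.

Let mf : measurable_fun setT f.
Proof.
apply: measurable_funM => //; apply: measurable_funM.
  apply: (measurableT_comp (f := fun b : bool => b%:R : R)) => //.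
  exact: (measurable_fun_ltr mT).
apply: (measurableT_comp (f := fun z : R => z `^ (rho - 1))); first exact: measurable_powR.
exact: measurable_funB.
Qed.

(** The singularity of f at T = t is not known to be integrable beforehand: Fatou's lemma proves
    that it is, after which f dominates the quotients. *)
Lemma density_formula : (\int[P]_w (f w)%:E = (M t / (c * rho))%:E)%E.
Proof.
have f0 w : 0 <= f w by rewrite mulr_ge0// mulr_ge0// powR_ge0.
have lim2 : (\int[P]_w (q n w)%:E @[n --> \oo] --> (M t / c)%:E)%E.
  by under eq_fun do rewrite -(ExE P (bq _)); apply: cvg_EFin; [exact: nearW|exact: q_lim].
have fat : (\int[P]_w (rho * f w)%:E <= (M t / c)%:E)%E.
  have -> : (\int[P]_w (rho * f w)%:E = \int[P]_w limn_einf (fun n => (q n w)%:E))%E.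
    apply: eq_integral => w _.
    have h : ((q n w)%:E @[n --> \oo] --> (rho * f w)%:E)%E.
      by apply: cvg_EFin; [exact: nearW|exact: q_cvg].
    by have [-> _] := cvg_limn_einf_sup h.
  apply: (@le_trans _ _ (limn_einf (fun n => \int[P]_w (q n w)%:E)%E)).
    apply: fatou => //; first by move=> n; apply/measurable_EFinP; have [] := bq n.
    by move=> n w _; rewrite lee_fin; case/andP: (qf n w).
  by have [-> _] := cvg_limn_einf_sup lim2.
have intf : P.-integrable setT (EFin \o (fun w => rho * f w)).
  apply/integrableP; split; first by apply/measurable_EFinP; exact: measurable_funM.
  rewrite (eq_integral (fun w => (rho * f w)%:E)); last first.
    by move=> w _; rewrite /= ger0_norm// mulr_ge0// ltW.
  by apply: le_lt_trans fat _; rewrite ltry.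
have intf1 : P.-integrable setT (EFin \o f).
  have := integrableZl measurableT rho^-1 intf.
  have <- : (fun w => (rho^-1%:E * (EFin \o (fun w => (rho * f w)%R)) w)%E) = EFin \o f => //.
  by apply/funext => w; rewrite /= -EFinM mulrA mulVf ?gt_eqF// mul1r.
have lim : (\int[P]_w (q n w)%:E @[n --> \oo] --> \int[P]_w (rho * f w)%:E)%E.
  apply: (@dominated_cvg _ _ _ P setT measurableT (fun n w => (q n w)%:E) _ (EFin \o f)) => //.
  - by move=> n; apply/measurable_EFinP; have [] := bq n.
  - by move=> w _; apply: cvg_EFin; [exact: nearW|exact: q_cvg].
  - by move=> n w _ /=; case/andP: (qf n w) => h1 h2; rewrite lee_fin ger0_norm.
have E : (\int[P]_w (rho * f w)%:E = (M t / c)%:E)%E.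
  exact: (cvg_unique _ lim lim2).
have : (\int[P]_w (rho * f w)%:E = rho%:E * \int[P]_w (f w)%:E)%E.
  by under eq_integral do rewrite EFinM; rewrite integralZl.
rewrite E => /(congr1 (fun z => (rho^-1)%:E * z)%E).
rewrite muleA -!EFinM mulVf ?gt_eqF// mul1e => <-.
by congr EFin; rewrite invfM; ring.
Qed.

End density.

(** * The reflection formula *)

Section cosine_integrals.
Context (R : realType).
Notation mu := (@lebesgue_measure R).
Let I0 : set R := `[0, pi / 2]%classic.

(* betaI (n - x) (n + x) and cosI n x both satisfy a recurrence in n, and the ratio of
   the two factors does not depend on x. *)
Definition cosI n (x : R) := \int[mu]_(t in I0) (cos t ^+ (2 * n) * cos (2 * x * t)).

Let pi20 : 0 < pi / 2 :> R. Proof. by rewrite divr_gt0// pi_gt0. Qed.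

Lemma derive_linear (a t : R) : is_derive t (1 : R) (fun t : R => a * t) a.
Proof.
have /is_derive_eq := is_deriveZ a (@is_derive_id R R t 1).
by apply; rewrite /GRing.scale /= mulr1.
Qed.

Lemma derive_sin_linear (a t : R) : is_derive t (1 : R) (fun t : R => sin (a * t)) (a * cos (a * t)).
Proof.
have /is_derive_eq := is_derive1_comp (is_derive_sin (a * t)) (derive_linear a t).
by apply; rewrite mulrC.
Qed.

Lemma derive_cos_linear (a t : R) : is_derive t (1 : R) (fun t : R => cos (a * t)) (- (a * sin (a * t))).
Proof.
have /is_derive_eq := is_derive1_comp (is_derive_cos (a * t)) (derive_linear a t).
by apply; rewrite mulNr mulrC.
Qed.

Lemma cosI_integrand_continuous n x : continuous (fun t : R => cos t ^+ (2 * n) * cos (2 * x * t)).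
Proof.
move=> t; apply: cvgM.
  apply: (@continuous_comp _ _ _ (@cos R) (fun y => y ^+ (2 * n))); first exact: continuous_cos.
  exact: exprn_continuous.
apply: (@continuous_comp _ _ _ (fun y : R => 2 * x * y) (@cos R)); last exact: continuous_cos.
by apply: cvgM; [exact: cvg_cst|exact: cvg_id].
Qed.

Let ici (f : R -> R) : continuous f -> mu.-integrable I0 (EFin \o f).
Proof.
move=> cf; apply: continuous_compact_integrable; first exact: segment_compact.
exact: continuous_subspaceT.
Qed.

Let icos n x := ici (@cosI_integrand_continuous n x).
Let mI : measurable (I0 : set (measurableTypeR R)). Proof. exact: measurable_itv. Qed.

Lemma cosI_rec n x :
  (2 * n%:R + 2) * (2 * n%:R + 1) * cosI n x = 4 * ((n%:R + 1) ^+ 2 - x ^+ 2) * cosI n.+1 x.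
Proof.
pose N : nat := 2 * n.
have NE : (N%:R : R) = 2 * n%:R by rewrite /N natrM.
pose c1 : R := (2 * n%:R + 2) * (2 * n%:R + 1).
pose c2 : R := 4 * ((n%:R + 1) ^+ 2 - x ^+ 2).
pose f t := c1 * (cos t ^+ (2 * n) * cos (2 * x * t)) - c2 * (cos t ^+ (2 * n.+1) * cos (2 * x * t)).
(* An antiderivative of the difference of the two integrands, which vanishes at 0 and at pi / 2. *)
pose F t := - (N.+2%:R) * (cos t ^+ N.+1 * sin t * cos (2 * x * t)) +
  2 * x * (cos t ^+ N.+2 * sin (2 * x * t)).
have dF (t : R) : is_derive t (1 : R) F (f t).
  have dA := is_deriveM (is_deriveM (is_deriveX N.+1 (is_derive_cos t)) (is_derive_sin t)) (derive_cos_linear (2 * x) t).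
  have dB := is_deriveM (is_deriveX N.+2 (is_derive_cos t)) (derive_sin_linear (2 * x) t).
  have -> : F = (- N.+2%:R) \*: (@cos R ^+ N.+1 * @sin R * (fun t : R => cos (2 * x * t))) +
      (2 * x) \*: (@cos R ^+ N.+2 * (fun t : R => sin (2 * x * t))).
    by apply/funext => u; rewrite /F !fctE.
  apply: (is_derive_eq (is_deriveD (is_deriveZ (- N.+2%:R) dA) (is_deriveZ (2 * x) dB))).
  rewrite /GRing.scale /= !fctE.
  rewrite /f /c1 /c2 (_ : 2 * n.+1 = N.+2)%N; last by rewrite /N mulnS.
  rewrite -/N !exprS -[in N.+2%:R]natr1 -![in N.+1%:R]natr1 NE.
  have s2 : sin t * sin t = 1 - cos t * cos t by have := cos2Dsin2 t; rewrite !expr2; lra.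
  move: (cos (2 * x * t)) (sin (2 * x * t)) (cos t ^+ N) => C S Q.
  have E : (1 - cos t * cos t) - sin t * sin t = 0 by rewrite s2 subrr.
  apply/eqP; rewrite -subr_eq0; apply/eqP.
  transitivity ((2 * n%:R + 2) * (2 * n%:R + 1) * Q * C * - ((1 - cos t * cos t) - sin t * sin t)); last by rewrite E oppr0 mulr0.
  ring.
have cf : continuous f.
  move=> t; apply: cvgB; apply: cvgM; try exact: cvg_cst; exact: cosI_integrand_continuous.
have cF : continuous F by move=> t; apply: differentiable_continuous; apply/derivable1_diffP; have [] := dF t.
have := @continuous_FTC2 R f F 0 (pi / 2) pi20 (continuous_subspaceT cf) _ _.
have -> : F 0 = 0 by rewrite /F !mulr0 sin0 !mulr0 mul0r mulr0 addr0.
have -> : F (pi / 2) = 0 by rewrite /F cos_pihalf !exprS !mul0r !mulr0 addr0.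
rewrite subee// => H.
have {}H : (\int[mu]_(t in I0) (f t)%:E = 0)%E.
  apply: H; last by move=> t _; rewrite derive1E; have [_ ->] := dF t.
  split; first by move=> t _; have [] := dF t.
    exact: cvg_at_right_filter (cF 0).
  exact: cvg_at_left_filter (cF (pi / 2)).
have : \int[mu]_(t in I0) f t = 0 by rewrite /Rintegral H.
rewrite /f RintegralB//; last 2 first.
- exact: (ici (f := fun t => c1 * _) (fun t => cvgM (@cvg_cst _ _ _ _ _) (@cosI_integrand_continuous n x t))).
- exact: (ici (f := fun t => c2 * _) (fun t => cvgM (@cvg_cst _ _ _ _ _) (@cosI_integrand_continuous n.+1 x t))).
rewrite (RintegralZl c1 mI (icos n x)) (RintegralZl c2 mI (icos n.+1 x)) => /eqP.
by rewrite subr_eq0 => /eqP.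
Qed.

Lemma cosI0x x : 0 < x -> cosI 0 x = sin (pi * x) / (2 * x).
Proof.
move=> x0; pose F t := sin (2 * x * t) / (2 * x).
have x2 : 2 * x != 0 by rewrite mulf_neq0// gt_eqF.
have dF (t : R) : is_derive t (1 : R) F (cos (2 * x * t)).
  have /is_derive_eq := is_deriveM (derive_sin_linear (2 * x) t) (is_derive_cst (2 * x)^-1 t 1).
  by apply; rewrite /GRing.scale /= mulr0 add0r mulrA mulVf// mul1r.
have cF : continuous F by move=> t; apply: differentiable_continuous; apply/derivable1_diffP; have [] := dF t.
have E : (fun t : R => cos t ^+ (2 * 0) * cos (2 * x * t)) = fun t => cos (2 * x * t).
  by apply/funext => t; rewrite muln0 expr0 mul1r.
have cf : continuous (fun t : R => cos (2 * x * t)) by rewrite -E; exact: cosI_integrand_continuous.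
rewrite /cosI E /Rintegral (@continuous_FTC2 R _ F 0 (pi / 2) pi20 (continuous_subspaceT cf)).
- by rewrite /F mulr0 sin0 mul0r sube0 /=; congr (sin _ / _); field.
- split; first by move=> t _; have [] := dF t.
    exact: cvg_at_right_filter (cF 0).
  exact: cvg_at_left_filter (cF (pi / 2)).
- by move=> t _; rewrite derive1E; have [_ ->] := dF t.
Qed.

Lemma cosI00 : cosI 0 0 = pi / 2.
Proof.
rewrite /cosI (_ : (fun t => _) = fun=> 1); last first.
  by apply/funext => t; rewrite muln0 expr0 mul1r mulr0 mul0r cos0.
rewrite Rintegral_cst// mul1r.
rewrite (_ : (pi / 2 : R) = fine (pi / 2)%:E)//; congr fine; apply: etrans (lebesgue_measure_itv _) _; by rewrite /= lte_fin pi20 -EFinB subr0.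
Qed.

Lemma cosI_rec0 n : 2 * cosI n.+1 0 = (2 * n%:R + 1) / (n%:R + 1) * cosI n 0.
Proof.
have := cosI_rec n 0; rewrite expr0n subr0.
have n1 : (n%:R + 1 : R) != 0 by rewrite natr1 pnatr_eq0.
move=> h; apply: (mulfI (_ : 2 * (n%:R + 1) ^+ 2 != 0 :> R)).
  by rewrite mulf_neq0// expf_neq0.
have -> : 2 * (n%:R + 1) ^+ 2 * (2 * cosI n.+1 0) = 4 * (n%:R + 1) ^+ 2 * cosI n.+1 0 by ring.
by rewrite -h; field.
Qed.

Lemma cosI_gt0 n : 0 < cosI n 0.
Proof.
elim: n => [|n IH]; first by rewrite cosI00.
by rewrite -(@pmulr_rgt0 _ 2)// cosI_rec0 mulr_gt0// divr_gt0// ltr_wpDl// mulr_ge0.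
Qed.

(** For x in [0, 1] one has cos (2 t) <= cos (2 x t) <= 1 on [0, pi / 2]; with cos (2 t) = 2 cos^2 t
    - 1 the lower bound is 2 [cosI n.+1 0] - [cosI n 0], which the recurrence evaluates. *)
Lemma cosI_bounds n x : 0 <= x <= 1 -> n%:R / (n%:R + 1) * cosI n 0 <= cosI n x <= cosI n 0.
Proof.
case/andP=> x0 x1.
have c0 t : I0 t -> 0 <= cos t ^+ (2 * n).
  by move=> _; rewrite exprM exprn_ge0// sqr_ge0.
apply/andP; split; last first.
  apply: le_Rintegral => // t It; rewrite mulr0 mul0r cos0 ler_wpM2l ?c0//; exact: cos_le1.
have -> : n%:R / (n%:R + 1) * cosI n 0 = 2 * cosI n.+1 0 - cosI n 0.
  have n1 : (n%:R + 1 : R) != 0 by rewrite natr1 pnatr_eq0.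
  by rewrite cosI_rec0; field.
have iz : mu.-integrable I0 (EFin \o (fun t => 2 * (cos t ^+ (2 * n.+1) * cos (2 * 0 * t)))).
  exact: (ici (f := fun t => 2 * _) (fun t => cvgM (@cvg_cst _ _ _ _ _) (@cosI_integrand_continuous n.+1 0 t))).
rewrite /cosI -(RintegralZl 2 mI (icos n.+1 0)) -(RintegralB mI iz (icos n 0)).
apply: le_Rintegral => //.
  exact: (ici (f := fun t => 2 * _ - _) (fun t => cvgB (cvgM (@cvg_cst _ _ _ _ _) (@cosI_integrand_continuous n.+1 0 t)) (@cosI_integrand_continuous n 0 t))).
move=> t It; rewrite mulr0 !mul0r cos0 !mulr1 mulnS exprD mulrA mulrC -[X in _ - X]mulr1 -mulrBr.
apply: ler_wpM2l; first exact: c0.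
move: It; rewrite /I0 /= in_itv /= => /andP[t0 tp].
have -> : 2 * x * t = (x * t) *+ 2 by rewrite mulr2n; ring.
rewrite cos_mulr2n.
have s1 : sin (x * t) <= sin t.
  have xt : x * t <= t by rewrite ler_piMl.
  have xt0 : 0 <= x * t by rewrite mulr_ge0.
  have [->//|ne] := eqVneq (x * t) t.
  by apply/ltW; rewrite ltr_sin ?in_itv /= ?lt_neqAle ?ne//; apply/andP; split; lra.
have s0 : 0 <= sin (x * t).
  have xt : x * t <= t by rewrite ler_piMl.
  by apply: sin_ge0_pi; rewrite mulr_ge0//=; lra.
have h : sin (x * t) ^+ 2 <= sin t ^+ 2 by rewrite ler_sqr ?nnegrE// (le_trans s0).
have := cos2Dsin2 (x * t); have := cos2Dsin2 t; rewrite -mulr_natl; lra.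
Qed.

End cosine_integrals.

(** * Recurrences and asymptotics of Beta integrals *)

Section beta_integrals.
Context (R : realType).
Notation mu := (@lebesgue_measure R).
Notation betaI := (@betaI R).
Implicit Types a b : R.

Let mp a b : measurable_fun setT (fun u : R => (powp a (1 - u) * powp b u)%:E).
Proof. by have := @mbeta R a b 1 0; under eq_fun do rewrite subr0. Qed.

Let p0 a b (u : R) : (0 <= (powp a (1 - u) * powp b u)%:E)%E.
Proof. by rewrite lee_fin mulr_ge0// powp_ge0. Qed.

Lemma betaI_ge0 a b : (0 <= betaI a b)%E.
Proof. by apply: integral_ge0 => u _; exact: p0. Qed.

(** Integration by parts in the form of the two orders of integration of (1 - s)^a u^b over the
    triangle 0 < u < s < 1, which singular end points do not disturb. *)
Lemma betaI_shift a b : -1 < a -> a != 0 -> -1 < b -> b != 0 ->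
  ((b + 1)%:E * betaI (a + 1) b = (a + 1)%:E * betaI a (b + 1))%E.
Proof.
move=> a1 na b1 nb.
have a10 : 0 < a + 1 by rewrite -ltrBlDr sub0r.
have b10 : 0 < b + 1 by rewrite -ltrBlDr sub0r.
pose F (q : R * R) : \bar R := (powp b q.1 * (powp a (1 - q.2) * (q.1 < q.2)%R%:R))%:E.
have mlt : measurable_fun setT (fun q : R * R => (q.1 < q.2)%R%:R : R).
  rewrite (_ : (fun _ => _) = \1_[set q : R * R | q.1 < q.2]).
    by apply: measurable_indic; apply: measurable_lt_set; [exact: measurable_fst|exact: measurable_snd].
  by apply/funext => u; rewrite indicE mem_setE.
have mF : measurable_fun setT F.
  apply/measurable_EFinP; apply: measurable_funM.
    by apply: (measurableT_comp (measurable_powp b)); exact: measurable_fst.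
  apply: (measurable_funM _ mlt); apply: (measurableT_comp (measurable_powp a)).
  by apply: measurable_funB => //; exact: measurable_snd.
have F0 q : (0 <= F q)%E by rewrite lee_fin !mulr_ge0 ?powp_ge0.
have := @fubini_tonelli _ _ _ _ R mu mu F mF F0.
have mk v : measurable_fun setT (fun s : R => (powp a (v - s))).
  by apply: (measurableT_comp (measurable_powp a)); exact: measurable_funB.
have -> : (\int[mu]_u \int[mu]_s F (u, s) = (a + 1)^-1%:E * betaI (a + 1) b)%E.
  rewrite /betaI -(ge0_integralZl_EFin mu measurableT _ (mp _ _)) ?invr_ge0 ?(ltW a10)//.
  apply: eq_integral => u _; rewrite /F /=.
  under eq_integral do rewrite EFinM.
  rewrite (ge0_integralZl_EFin mu measurableT _ _ (powp_ge0 b u)); last 2 first.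
  - by move=> s _; rewrite lee_fin mulr_ge0 ?powp_ge0.
  - by apply/measurable_EFinP; apply: measurable_funM; [exact: mk|exact: measurable_gt_nat].
  have [u1|u1] := leP u 1.
    rewrite integral_powp// -!EFinM; congr EFin.
    have -> : powp (a + 1) (1 - u) = (1 - u) `^ (a + 1) by rewrite /powp max_l ?subr_ge0.
    by ring.
  have s1 : 1 - u <= 0 by rewrite subr_le0 ltW.
  rewrite (powp_le0 (lt0r_neq0 a10) s1) mul0r mule0.
  rewrite integral0_eq ?mule0// => s _; congr EFin.
  have [us|us] := ltP u s; last by rewrite mulr0.
  by rewrite powp_le0 ?mul0r// subr_le0 (le_trans (ltW u1))// ltW.
have -> : (\int[mu]_s \int[mu]_u F (u, s) = (b + 1)^-1%:E * betaI a (b + 1))%E.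
  rewrite /betaI -(ge0_integralZl_EFin mu measurableT _ (mp _ _)) ?invr_ge0 ?(ltW b10)//.
  apply: eq_integral => s _; rewrite /F /=.
  under eq_integral do rewrite mulrCA EFinM.
  rewrite (ge0_integralZl_EFin mu measurableT _ _ (powp_ge0 a (1 - s))); last 2 first.
  - by move=> u _; rewrite lee_fin mulr_ge0 ?powp_ge0.
  - apply/measurable_EFinP; apply: measurable_funM; first exact: measurable_powp.
    by apply: (measurableT_comp mlt (g := fun u => (u, s))); exact: measurable_fun_pair.
  pose f (u : R) : \bar R := (powp b u * (u < s)%R%:R)%:E.
  have mf : measurable_fun setT f.
    apply/measurable_EFinP; apply: measurable_funM; first exact: measurable_powp.
    by apply: (measurableT_comp mlt (g := fun u => (u, s))); exact: measurable_fun_pair.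
  have f0 u : (0 <= f u)%E by rewrite lee_fin mulr_ge0 ?powp_ge0.
  rewrite -[X in (_ * X)%E](ge0_integral_reflect s mf f0).
  have -> : (\int[mu]_u f (s - u)%R = \int[mu]_u (powp b (s - u) * (0 < u)%R%:R)%:E)%E.
    by apply: eq_integral => u _; rewrite /f gtrBl.
  have [s0|s0] := leP 0 s.
    rewrite integral_powp// subr0 -!EFinM; congr EFin.
    have -> : powp (b + 1) s = s `^ (b + 1) by rewrite /powp max_l.
    by ring.
  rewrite [powp (b + 1) s]powp_le0 ?gt_eqF ?(ltW s0)// mulr0 mule0.
  rewrite integral0_eq ?mule0// => u _; congr EFin.
  have [us|us] := ltP 0 u; last by rewrite mulr0.
  by rewrite powp_le0 ?mul0r// subr_le0 (le_trans (ltW s0))// ltW.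
move=> /(congr1 (fun z => ((b + 1)%:E * ((a + 1)%:E * z))%E)).
rewrite [((a + 1)%:E * (_ * betaI (a + 1) b))%E]muleA -EFinM mulfV ?gt_eqF// mul1e => ->.
by rewrite muleCA [((b + 1)%:E * (_ * _))%E]muleA -EFinM mulfV ?gt_eqF// mul1e.
Qed.

(** The two integrands add up because (1 - u) + u = 1. *)
Lemma betaI_split a b : -1 < a -> a != 0 -> -1 < b -> b != 0 ->
  (betaI (a + 1) b + betaI a (b + 1) = betaI a b)%E.
Proof.
move=> a1 na b1 nb.
have a10 : 0 < a + 1 by rewrite -ltrBlDr sub0r.
have b10 : 0 < b + 1 by rewrite -ltrBlDr sub0r.
rewrite /betaI -(ge0_integralD mu measurableT (fun u _ => p0 _ _ u) (mp _ _) (fun u _ => p0 _ _ u) (mp _ _)).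
apply: eq_integral => u _; rewrite -EFinD; congr EFin.
have E (c z : R) : c != 0 -> 0 < c + 1 -> powp (c + 1) z = z * powp c z.
  move=> nc c10; have [z0|z0] := ltP 0 z; last by rewrite (powp_le0 (lt0r_neq0 c10) z0) (powp_le0 nc z0) mulr0.
  by rewrite !powp_gt0// powRDp// powRr1 ?(ltW z0)// mulrC.
by rewrite !E//; ring.
Qed.

Lemma betaI_up a b (B : R) : -1 < a -> a != 0 -> -1 < b -> b != 0 -> betaI a b = B%:E ->
  betaI (a + 1) b = (B * (a + 1) / (a + b + 2))%:E /\
  betaI a (b + 1) = (B * (b + 1) / (a + b + 2))%:E.
Proof.
move=> a1 na b1 nb E; have := betaI_split a1 na b1 nb; have := betaI_shift a1 na b1 nb.
rewrite E; have := betaI_ge0 (a + 1) b; have := betaI_ge0 a (b + 1).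
have ab : 0 < a + b + 2 by rewrite (_ : a + b + 2 = (a + 1) + (b + 1)); [lra|ring].
case: (betaI a (b + 1)) => [y| |]// y0; case: (betaI (a + 1) b) => [x| |]// x0.
rewrite -!EFinM -EFinD => -[h1] [h2]; split; congr EFin.
  by apply: (mulIf (lt0r_neq0 ab)); rewrite divfK ?gt_eqF// -h2; lra.
by apply: (mulIf (lt0r_neq0 ab)); rewrite divfK ?gt_eqF// -h2; lra.
Qed.

Lemma betaI_step a b (B : R) : -1 < a -> a != 0 -> -1 < b -> b != 0 -> betaI a b = B%:E ->
  betaI (a + 1) (b + 1) = (B * ((a + 1) * (b + 1)) / ((a + b + 2) * (a + b + 3)))%:E.
Proof.
move=> a1 na b1 nb /(betaI_up a1 na b1 nb)[_ E].
have b10 : 0 < b + 1 by rewrite -ltrBlDr sub0r.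
have [-> _] := betaI_up a1 na (lt_trans (ltrN10 R) b10) (lt0r_neq0 b10) E.
have a10 : 0 < a + 1 by rewrite -ltrBlDr sub0r.
congr EFin; field; apply/andP; split; apply: lt0r_neq0; lra.
Qed.

Lemma betaI11 : betaI 1 1 = (6^-1)%:E.
Proof.
pose D : set R := `]0, 1]%classic.
pose f (u : R) : \bar R := (u `^ (3 - 1))%:E.
have E : (betaI 1 1 + \int[mu]_(u in D) f u = \int[mu]_(u in D) (u `^ (2 - 1))%:E)%E.
  have -> : betaI 1 1 = (\int[mu]_(u in D) (powp 1 (1 - u) * powp 1 u)%:E)%E.
    rewrite [RHS]integral_mkcond; apply: eq_integral => u _; rewrite /patch.
    case: ifPn => //; rewrite /D mem_setE in_itv /= negb_and -leNgt -ltNge.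
    move=> /orP[u0|u1]; last by rewrite powp_le0 ?mul0r// subr_le0 ltW.
    by rewrite [powp 1 u]powp_le0 ?mulr0.
  rewrite -ge0_integralD//.
  - apply: eq_integral => u; rewrite /D mem_setE in_itv /= => /andP[u0 u1].
    rewrite -EFinD; congr EFin; rewrite (_ : 3 - 1 = 1 + 1 :> R); last by ring.
    rewrite (_ : 2 - 1 = 1 :> R); last by ring.
    rewrite /powp !max_l ?subr_ge0 ?(ltW u0)// powRDp// !powRr1 ?subr_ge0 ?(ltW u0)//.
    by ring.
  - exact: measurable_itv.
  - by apply: measurable_funTS; exact: mp.
  - by move=> u _; rewrite lee_fin powR_ge0.
  - by apply/measurable_EFinP/measurable_funTS; exact: measurable_powR.
move: E; rewrite /f !integral_powR// !powR1.
have := betaI_ge0 1 1; case: (betaI 1 1) => [y| |]// _ [h]; congr EFin; lra.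
Qed.

Lemma powR_le_tangent (y x : R) : 0 < y -> 0 <= x -> x <= 1 -> y `^ x <= 1 + x * (y - 1).
Proof.
move=> y0 x0 x1; have h : 0 < 1 + x * (y - 1).
  have [->|xn] := eqVneq x 0; first by rewrite mul0r addr0.
  have xp : 0 < x by rewrite lt_neqAle eq_sym xn.
  have : 0 < x * y by rewrite mulr_gt0.
  by rewrite mulrBr mulr1; lra.
have : x * ln y + (1 - x) * ln 1 <= ln (x * y + (1 - x) * 1).
  by apply: (concave_ln (Itv01 x0 x1)).
rewrite ln1 mulr0 addr0 mulr1 => hl.
rewrite /powR gt_eqF// -[leRHS]lnK ?posrE// ler_expR; apply: le_trans hl _.
by rewrite le_eqVlt; apply/orP; left; apply/eqP; congr ln; ring.
Qed.

Lemma powR_ge_tangent (y x : R) : 0 < y -> 0 <= x -> 1 + x <= y `^ x + x * y^-1.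
Proof.
move=> y0 x0; have h1 : 1 - y^-1 <= ln y.
  have := expR_ge1Dx (- ln y); rewrite expRN lnK ?posrE//; lra.
have h2 := expR_ge1Dx (x * ln y).
rewrite /powR gt_eqF//; apply: (@le_trans _ _ (1 + x * ln y + x * y^-1)); last by rewrite lerD2r.
by have := ler_wpM2l x0 h1; rewrite mulrBr mulr1; lra.
Qed.

Let comb (a b a' b' c : R) : 0 <= c ->
  (\int[mu]_u (powp a (1 - u) * powp b u + c * (powp a' (1 - u) * powp b' u))%:E =
   betaI a b + c%:E * betaI a' b')%E.
Proof.
move=> c0; rewrite /betaI -(ge0_integralZl_EFin mu measurableT (fun u _ => p0 _ _ u) (mp _ _) c0).
rewrite -ge0_integralD//; first exact: mp.
- by move=> u _; apply: mule_ge0; [rewrite lee_fin|exact: p0].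
- by apply: measurable_funeM; exact: mp.
Qed.

Let mcomb (a b a' b' c : R) :
  measurable_fun setT (fun u : R => (powp a (1 - u) * powp b u + c * (powp a' (1 - u) * powp b' u))%:E).
Proof.
apply/measurable_EFinP; apply: measurable_funD; first by apply/measurable_EFinP; exact: mp.
by apply: measurable_funM => //; apply/measurable_EFinP; exact: mp.
Qed.

(** With y = u / (1 - u) the integrand at (n - x, n + x) is ((1 - u) u)^n y^x, and 1 + x (1 - 1/y)
    <= y^x <= 1 + x (y - 1). The factors y and 1/y shift the exponents by one, and the shifted Beta
    integrals are (n + 1) / n times B. *)
Lemma betaI_near (n x B Bx : R) : 1 < n -> 0 < x < 1 -> betaI n n = B%:E ->
  betaI (n - x) (n + x) = Bx%:E -> B * (1 - x / n) <= Bx <= B * (1 + x / n).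
Proof.
move=> n1 /andP[x0 x1] EB Ex.
have n0 : 0 < n by exact: lt_trans n1.
have np : 0 < n - 1 by rewrite subr_gt0.
have ge : (n + 1) / n * n = n + 1 by rewrite divfK ?gt_eqF.
have Ep : betaI (n - 1) (n + 1) = (B * ((n + 1) / n))%:E.
  have := @betaI_shift (n - 1) n (lt_trans (ltrN10 R) np) (lt0r_neq0 np) (lt_trans (ltrN10 R) n0) (lt0r_neq0 n0).
  rewrite subrK EB; have := betaI_ge0 (n - 1) (n + 1).
  case: (betaI (n - 1) (n + 1)) => [y| |]// _; last by rewrite gt0_muley.
  by move=> [h]; congr EFin; apply: (mulfI (lt0r_neq0 n0)); rewrite -h; field; exact: lt0r_neq0.
have Em : betaI (n + 1) (n - 1) = (B * ((n + 1) / n))%:E.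
  have := @betaI_shift n (n - 1) (lt_trans (ltrN10 R) n0) (lt0r_neq0 n0) (lt_trans (ltrN10 R) np) (lt0r_neq0 np).
  rewrite subrK EB; have := betaI_ge0 (n + 1) (n - 1).
  case: (betaI (n + 1) (n - 1)) => [y| |]// _; last by rewrite gt0_muley.
  by move=> [h]; congr EFin; apply: (mulfI (lt0r_neq0 n0)); rewrite h; field; exact: lt0r_neq0.
have ptw u : powp (n - x) (1 - u) * powp (n + x) u + x * (powp n (1 - u) * powp n u) <=
      powp n (1 - u) * powp n u + x * (powp (n - 1) (1 - u) * powp (n + 1) u) /\
    powp n (1 - u) * powp n u + x * (powp n (1 - u) * powp n u) <=
      powp (n - x) (1 - u) * powp (n + x) u + x * (powp (n + 1) (1 - u) * powp (n - 1) u).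
  have nx : n - x != 0 by rewrite gt_eqF// subr_gt0 (lt_trans x1).
  have nx' : n + x != 0 by rewrite gt_eqF// addr_gt0.
  have n1' : n + 1 != 0 by rewrite gt_eqF// addr_gt0.
  have [u0|u0] := leP u 0.
    rewrite (powp_le0 nx' u0) (powp_le0 n1' u0) (powp_le0 (lt0r_neq0 n0) u0).
    by rewrite (powp_le0 (lt0r_neq0 np) u0) !mulr0 !addr0 lexx.
  have [u1|u1] := leP (1 - u) 0.
    rewrite (powp_le0 nx u1) (powp_le0 n1' u1) (powp_le0 (lt0r_neq0 n0) u1).
    by rewrite (powp_le0 (lt0r_neq0 np) u1) !mul0r !mulr0 !addr0 lexx.
  rewrite !powp_gt0//; set v := 1 - u in u1 *.
  have y0 : 0 < u / v by rewrite divr_gt0.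
  have E (s : R) : v `^ (n - s) * u `^ (n + s) = v `^ n * u `^ n * (u / v) `^ s.
    rewrite !powRDp// powRM ?invr_ge0 ?ltW// -powR_inv1 ?ltW// -powRrM mulN1r.
    ring.
  have w0 : 0 <= v `^ n * u `^ n by rewrite mulr_ge0// powR_ge0.
  have E1 := E 1; rewrite powRr1 ?(ltW y0)// in E1.
  have E2 := E (-1); rewrite opprK powR_inv1 ?(ltW y0)// in E2.
  rewrite E E1 E2; set w := v `^ n * u `^ n in w0 *.
  have h1 := ler_wpM2l w0 (powR_le_tangent y0 (ltW x0) (ltW x1)).
  have h2 := ler_wpM2l w0 (powR_ge_tangent y0 (ltW x0)).
  move: h1 h2; move: (u / v) => y; set z := y `^ x.
  rewrite (_ : w * (1 + x * (y - 1)) = w + x * (w * y) - x * w); last by ring.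
  rewrite (_ : w * (z + x / y) = w * z + x * (w / y)); last by ring.
  by rewrite mulrDr mulr1 [w * x]mulrC; split; lra.
have pp a b a' b' u : [set: R] u -> (0 <= (powp a (1 - u) * powp b u + x * (powp a' (1 - u) * powp b' u))%:E)%E.
  by move=> _; rewrite lee_fin addr_ge0 ?mulr_ge0 ?powp_ge0// ltW.
have h1 := ge0_le_integral mu measurableT (pp _ _ _ _) (mcomb (n - x) (n + x) n n x) (mcomb n n (n - 1) (n + 1) x) (fun u _ => (ptw u).1).
have h2 := ge0_le_integral mu measurableT (pp _ _ _ _) (mcomb n n n n x) (mcomb (n - x) (n + x) (n + 1) (n - 1) x) (fun u _ => (ptw u).2).
rewrite !comb ?(ltW x0)// EB Ex ?Ep ?Em -!EFinM -!EFinD !lee_fin in h1 h2.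
have e : x * (B * ((n + 1) / n)) = x * B + B * (x / n) by field; exact: lt0r_neq0.
by rewrite e in h1 h2; rewrite mulrBr mulrDr mulr1; lra.
Qed.

Lemma betaI_reflection x : 0 < x < 1 -> betaI (- x) x = (pi * x / sin (pi * x))%:E.
Proof.
move=> x01; have /andP[x0 x1] := x01; have xn0 : x != 0 by rewrite gt_eqF.
have [B0 B00 EB0] := betaI_fin x01 x0.
have nx1 : -1 < - x by rewrite ltrN2.
have x1' : -1 < x by rewrite (lt_trans (ltrN10 R)).
have nxn : - x != 0 by rewrite oppr_eq0.
(* The values at n = 1 of the product of [betaI (n - x) (n + x)] and [cosI n x], for the given x and
   for 0. The ratio of the two products does not depend on n and tends to 1. The start is n = 1
   because [powp 0] is the constant 1, so that [betaI 0 0] is not a Beta integral. *)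
pose L : R := B0 * cosI 0 x / 12; pose L0 : R := pi / 24.
have L00 : 0 < L0 by rewrite divr_gt0// pi_gt0.
have claim (n : nat) : exists b b0, [/\ betaI (n.+1%:R - x) (n.+1%:R + x) = b%:E,
    betaI n.+1%:R n.+1%:R = b0%:E, 0 < b0 & L0 * (b * cosI n.+1 x) = L * (b0 * cosI n.+1 0)].
  elim: n => [|n [b [b0 [Eb Eb0 b00 IH]]]].
    exists (B0 * ((- x + 1) * (x + 1)) / ((- x + x + 2) * (- x + x + 3))), 6^-1.
    rewrite [1 - x]addrC [1 + x]addrC (betaI_step nx1 nxn x1' xn0 EB0); split => //; first exact: betaI11.
    have h0 := cosI_rec0 R 0; rewrite cosI00 mulr0 !add0r divr1 mul1r in h0.
    have h1 := cosI_rec 0 x; rewrite mulr0 !add0r expr1n mulr1 in h1.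
    rewrite /L0 /L (_ : cosI 1 0 = pi / 4 :> R); last by lra.
    have -> : cosI 0 x = 2 * (1 - x ^+ 2) * cosI 1 x by lra.
    by rewrite addNr !add0r; field.
  have n0 : 0 < (n.+1%:R : R) by rewrite ltr0n.
  have n1 : -1 < (n.+1%:R : R) by rewrite (lt_trans (ltrN10 R)).
  have nx0 : 0 < n.+1%:R - x by rewrite subr_gt0 (lt_le_trans x1)// ler1n.
  have px0 : 0 < n.+1%:R + x by rewrite addr_gt0.
  have := betaI_step (lt_trans (ltrN10 R) nx0) (lt0r_neq0 nx0) (lt_trans (ltrN10 R) px0) (lt0r_neq0 px0) Eb.
  have := betaI_step n1 (lt0r_neq0 n0) n1 (lt0r_neq0 n0) Eb0.
  have := cosI_rec n.+1 x; have := cosI_rec0 R n.+1.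
  have -> : (n.+1%:R - x + 1 : R) = n.+2%:R - x by rewrite -[n.+2%:R]natr1; ring.
  have -> : (n.+1%:R + x + 1 : R) = n.+2%:R + x by rewrite -[n.+2%:R]natr1; ring.
  rewrite natr1 => h1 h2 Eb0' Eb'; eexists; eexists; split; [exact: Eb'|exact: Eb0'| |].
    by rewrite divr_gt0 ?mulr_gt0// ?addr_gt0// ltr0n.
  have nn : n.+2%:R = n.+1%:R + 1 :> R by rewrite natr1.
  move: h1 h2 IH n0; rewrite !nn; clear; move: (n.+1%:R) => N h1 h2 IH n0.
  have N1 : N + 1 != 0 by rewrite gt_eqF// addr_gt0.
  have -> : b * ((N + 1 - x) * (N + 1 + x)) / ((N - x + (N + x) + 2) * (N - x + (N + x) + 3)) * cosI n.+2 x
     = (2 * N + 1) / (4 * (2 * N + 3)) * (b * cosI n.+1 x).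
    transitivity (b * (4 * ((N + 1) ^+ 2 - x ^+ 2) * cosI n.+2 x) / (4 * ((2 * N + 2) * (2 * N + 3)))).
      by field; apply/andP; split; apply: lt0r_neq0; lra.
    by rewrite -h2; field; apply/andP; split; apply: lt0r_neq0; lra.
  have -> : b0 * ((N + 1) * (N + 1)) / ((N + N + 2) * (N + N + 3)) * cosI n.+2 0
     = (2 * N + 1) / (4 * (2 * N + 3)) * (b0 * cosI n.+1 0).
    transitivity (b0 * ((N + 1) * (N + 1)) / ((N + N + 2) * (N + N + 3)) / 2 * (2 * cosI n.+2 0)).
      by field; apply/andP; split; apply: lt0r_neq0; lra.
    by rewrite h1; field; rewrite N1 /=; apply/andP; split; apply: lt0r_neq0; lra.
  by rewrite mulrCA IH mulrCA.
have sx : 0 < sin (pi * x).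
  apply: sin_gt0_pi; rewrite mulr_gt0 ?pi_gt0//=.
  by rewrite gtr_pMr ?pi_gt0.
have bnd (n : nat) : L0 * (1 - 2 / n.+2%:R) <= L <= L0 * (1 + 2 / n.+2%:R).
  have [b [b0 [Eb Eb0 b00 E]]] := claim n.+1.
  have m1 : 1 < (n.+2%:R : R) by rewrite ltr1n.
  have /andP[h1 h2] := betaI_near m1 x01 Eb0 Eb.
  have /andP[h3 h4] := cosI_bounds n.+2 (introT andP (conj (ltW x0) (ltW x1))).
  have c0 := cosI_gt0 R n.+2.
  move: E m1 h1 h2 h3 h4 c0 b00; move: (cosI n.+2 x) (cosI n.+2 0) (n.+2%:R : R) => J J0 m E m1 h1 h2 h3 h4 c0 b00.
  have m0 : 0 < m by exact: lt_trans m1.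
  have bJ0 : 0 < b0 * J0 by rewrite mulr_gt0.
  have xm : x / m <= 2 / m by rewrite ler_pM2r ?invr_gt0//; lra.
  have xm1 : x / m <= 1 by rewrite ler_pdivrMr// mul1r; lra.
  have J0' : 0 <= J by apply: le_trans h3; rewrite mulr_ge0 ?divr_ge0//; lra.
  have b' : 0 <= b by apply: le_trans h1; rewrite mulr_ge0 ?subr_ge0// ltW.
  have up : b * J <= b0 * J0 * (1 + 2 / m).
    rewrite mulrAC; apply: ler_pM => //; apply: le_trans h2 _.
    by rewrite ler_pM2l//; lra.
  have lo : b0 * J0 * (1 - 2 / m) <= b * J.
    apply: (@le_trans _ _ (b0 * (1 - x / m) * (m / (m + 1) * J0))); last first.
      by apply: ler_pM => //; [rewrite mulr_ge0 ?subr_ge0// ltW|rewrite mulr_ge0 ?divr_ge0//; lra].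
    have -> : b0 * (1 - x / m) * (m / (m + 1) * J0) = b0 * J0 * ((1 - x / m) * (m / (m + 1))) by ring.
    have mn : m != 0 by rewrite gt_eqF.
    have m1n : m + 1 != 0 by rewrite gt_eqF// addr_gt0.
    rewrite ler_pM2l// (_ : (1 - x / m) * (m / (m + 1)) = (m - x) / (m + 1)); last by field; rewrite ?mn ?m1n.
    rewrite ler_pdivlMr ?addr_gt0// (_ : (1 - 2 / m) * (m + 1) = m - 1 - 2 / m); last by field.
    have : 0 <= 2 / m by rewrite divr_ge0// ltW.
    lra.
  have k1 : L * (b0 * J0) <= (L0 * (1 + 2 / m)) * (b0 * J0).
    by rewrite -E -mulrA [(1 + 2 / m) * _]mulrC ler_pM2l.
  have k2 : (L0 * (1 - 2 / m)) * (b0 * J0) <= L * (b0 * J0).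
    by rewrite -E -mulrA [(1 - 2 / m) * _]mulrC ler_pM2l.
  by rewrite !ler_pM2r// in k1 k2; rewrite k1 k2.
have LL : L = L0.
  apply/eqP; rewrite -subr_eq0 -normr_le0; apply/ler_addgt0Pr => e e0; rewrite add0r.
  have q0 : 0 < e / (2 * L0) by rewrite divr_gt0// mulr_gt0.
  near \oo => n.
  have hn : n.+1%:R^-1 < e / (2 * L0) by near: n; exact: (near_infty_natSinv_lt (PosNum q0)).
  have hn2 : n.+2%:R^-1 <= n.+1%:R^-1 :> R by rewrite lef_pV2 ?posrE ?ltr0n// ler_nat.
  have h : L0 * (2 / n.+2%:R) <= e.
    have L2 : 0 < 2 * L0 by rewrite mulr_gt0.
    have := ltW (le_lt_trans hn2 hn); rewrite ler_pdivlMr// => h.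
    by rewrite mulrCA mulrA mulrC.
  have /andP[h1 h2] := bnd n.
  move: h h1 h2; rewrite mulrBr mulrDr !mulr1; move: (L0 * (2 / _)) => q h h1 h2.
  by rewrite ler_distl; apply/andP; split; [apply: le_trans h1; rewrite lerB|apply: le_trans h2 _; rewrite lerD2l].
rewrite EB0; congr EFin; move: LL; rewrite /L /L0 cosI0x// => h.
have : B0 * sin (pi * x) = pi * x.
  have -> : B0 * sin (pi * x) = B0 * (sin (pi * x) / (2 * x)) / 12 * (24 * x) by field.
  by rewrite h; field.
by move=> h3; rewrite -[LHS](mulfK (lt0r_neq0 sx)) h3.
Unshelve. all: by end_near.
Qed.

End beta_integrals.

(** * Conditional laws and truncated times *)

Lemma conditional_law d (T : measurableType d) (R : realType) (P : probability T R)
    (Y : T -> R) (D : set T) : measurable_fun setT Y -> measurable D -> 0 < fine (P D) ->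
  exists nu : probability R R, forall A, measurable A ->
    nu A = (fine (P (Y @^-1` A `&` D)) / fine (P D))%:E.
Proof.
move=> mY mD D0.
pose m : {measure set T -> \bar R} := mrestr P mD.
have [nu [nuE _]] := image_probability (mnormalize m P) mY.
have ET : m [set: T] = P D by rewrite /m /= /mrestr setTI.
exists nu => A mA.
transitivity ((mnormalize m P : set T -> \bar R) (Y @^-1` A)); first exact: nuE.
rewrite /mnormalize ET.
have fD : P D \is a fin_num by exact: fin_num_measure.
have mYA : measurable (Y @^-1` A) by rewrite -[_ @^-1` _]setTI; exact: mY.
rewrite ifF; last first.
  apply/negbTE; rewrite negb_or; apply/andP; split.
    by apply/eqP => E; move: D0; rewrite E ltxx.
  by apply/eqP => E; move: fD; rewrite E.
have EA : m (Y @^-1` A) = P (Y @^-1` A `&` D) by [].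
rewrite EA.
rewrite -[X in (X * _)%E]fineK; first by rewrite EFinM.
by apply: fin_num_measure; exact: measurableI.
Qed.

Lemma ramp_layer_cake d (T : measurableType d) (R : realType) (P : probability T R)
    (Z Y : T -> R) v : bmf Z -> (forall w, 0 <= Z w) -> measurable_fun setT Y ->
  (Ex P (fun w => Z w * Num.max (v - Num.max (Y w) 0) 0))%:E =
  (\int[@lebesgue_measure R]_(s in `]0%R, v]) (Ex P (fun w => Z w * (Y w <= s)%R%:R))%:E)%E.
Proof.
move=> bZ Z0 mY.
have mle : measurable_fun setT (fun q : T * R => (Y q.1 <= q.2)%R%:R : R).
  rewrite (_ : (fun _ => _) = \1_[set q : T * R | Y q.1 <= q.2]).
    apply: measurable_indic; apply: measurable_le_set; last exact: measurable_snd.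
    by apply: (measurableT_comp mY); exact: measurable_fst.
  by apply/funext => u; rewrite indicE mem_setE.
have mZ : measurable_fun setT (fun q : T * R => Z q.1).
  by apply: (measurableT_comp bZ.1); exact: measurable_fst.
have bF s : bmf (fun w => Z w * (Y w <= s)%R%:R) := bmfM bZ (bmf_indicator_le s mY).
have bR : bmf (fun w => Z w * Num.max (v - Num.max (Y w) 0) 0).
  apply: bmfM => //; split.
    apply: measurable_maxr => //; apply: measurable_funB => //; exact: measurable_maxr.
  by exists (Num.max v 0) => w; apply: norm_max0_sub_le; exact: max0_ge0.
rewrite -(@tonelli_Ex _ _ _ P `]0%R, v]%classic (fun w s => Z w * (Y w <= s)%R%:R)) //.
- rewrite (ExE P bR); apply: eq_integral => w _.
  have mY1 : measurable_fun setT (fun s : R => ((Y w <= s)%R%:R : R)%:E).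
    apply/measurable_EFinP.
    by apply: (measurableT_comp mle (g := fun s => (w, s))); exact: measurable_fun_pair.
  under eq_integral do rewrite EFinM.
  rewrite (ge0_integralZl_EFin (@lebesgue_measure R) _ _ (measurable_funTS mY1) (Z0 w)); last 2 first.
  - exact: measurable_itv.
  - by move=> s _; rewrite lee_fin.
  rewrite EFinM; congr (_ * _)%E.
  pose D := [set` Interval (if Y w <= 0 then BRight 0 else BLeft (Y w)) (BRight v)].
  transitivity (\int[@lebesgue_measure R]_(s in `]0%R, v]) (\1_D s)%:E)%E; last first.
    apply: eq_integral => s; rewrite inE /= in_itv /= => /andP[s0 sv].
    rewrite indicE mem_setE /D; case: (leP (Y w) 0) => Yw; rewrite /= in_itv /= sv ?s0 ?andbT//.
    by rewrite (le_trans Yw (ltW s0)).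
  rewrite integral_indic//; last exact: measurable_itv.
  have -> : D `&` `]0%R, v]%classic = D.
    apply/seteqP; split=> s; [by case|move=> h; split => //; move: h].
    rewrite /D /=; case: (leP (Y w) 0) => Yw; rewrite !in_itv //= => /andP[h ->]; rewrite andbT.
    exact: lt_le_trans h.
  apply/esym; apply: etrans (lebesgue_measure_itv _) _ => /=.
  have [Yw|Yw] := leP (Y w) 0; rewrite /= lte_fin.
    by rewrite subr0; case: ltP => v0; rewrite -?EFinB ?subr0.
  by case: ltP => Yv; rewrite -?EFinB ?subr_ge0 ?subr_le0//; [rewrite max_l ?subr_ge0 ?(ltW Yv)|rewrite max_r ?subr_le0].
- exact: (measurable_funM mZ mle).
- by move=> w s; rewrite mulr_ge0.
Qed.

(** [nu] is known on sets only, so the ramp is written on both sides as an integral of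
    indicators. *)
Lemma conditional_ramp d (T : measurableType d) (R : realType) (P : probability T R)
    (Y : T -> R) (D : set T) (nu : probability R R) v :
  measurable_fun setT Y -> (forall w, 0 <= Y w) -> measurable D ->
  (forall A, measurable A -> nu A = (fine (P (Y @^-1` A `&` D)) / fine (P D))%:E) ->
  Ex nu (fun y => Num.max (v - Num.max y 0) 0) =
  Ex P (fun w => \1_D w * Num.max (v - Y w) 0) / fine (P D).
Proof.
move=> mY Y0 mD nuE; apply: EFin_inj.
have E1 : Ex nu (fun y => Num.max (v - Num.max y 0) 0) = Ex nu (fun y => 1 * Num.max (v - Num.max y 0) 0).
  by apply: Ex_eq => y; rewrite mul1r.
have E2 : Ex P (fun w => \1_D w * Num.max (v - Y w) 0) = Ex P (fun w => \1_D w * Num.max (v - Num.max (Y w) 0) 0).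
  by apply: Ex_eq => w; rewrite [Num.max (Y w) 0]max_l.
have D0 w : 0 <= \1_D w :> R by rewrite indicE.
have mid : measurable_fun setT (fun y : R => y) by exact: measurable_id.
rewrite E1 (ramp_layer_cake nu v (bmf_cst _ 1) (fun=> ler01) mid) E2 mulrC EFinM.
rewrite (ramp_layer_cake P v (bmf_indic R mD) D0 mY).
have mI (Q : R -> R) : {homo Q : s t / s <= t} -> measurable_fun `]0, v]%classic (fun s => (Q s)%:E).
  move=> Qh; apply/measurable_EFinP/measurable_funTS; exact: nondecreasing_measurable.
rewrite -ge0_integralZl_EFin//; last 3 first.
- by move=> s _; rewrite lee_fin Ex_ge0// => w; rewrite mulr_ge0.
- apply: mI => s t st; apply: le_Ex; [exact: (bmfM (bmf_indic R mD) (bmf_indicator_le _ mY))|exact: (bmfM (bmf_indic R mD) (bmf_indicator_le _ mY))|].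
  move=> w; rewrite ler_wpM2l// ler_nat; case: (leP (Y w) s) => //= h.
  by rewrite (le_trans h st).
- by rewrite invr_ge0 fine_ge0.
apply: eq_integral => s _; rewrite -EFinM; congr EFin.
have mle : measurable (Y @^-1` `]-oo, s]%classic) by rewrite -[_ @^-1` _]setTI; exact: mY.
transitivity (fine (nu `]-oo, s]%classic)).
  by rewrite -Ex_indic//; apply: Ex_eq => y; rewrite mul1r indicE mem_setE in_itv.
rewrite nuE//= mulrC; congr (_ * _).
rewrite -Ex_indic; last exact: measurableI.
apply: Ex_eq => w; rewrite indicI /= mulrC; congr (_ * _).
by rewrite indicE; congr (_%:R); congr nat_of_bool; apply/idP/idP; rewrite inE /= in_itv.
Qed.

Lemma bmf_truncated d (T : measurableType d) (R : realType) (Z : T -> R) u :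
  measurable_fun setT Z -> (forall w, 0 <= Z w) -> bmf (fun w => Z w * (Z w < u)%R%:R).
Proof.
move=> mZ Z0.
have := bmf_truncated_time mZ Z0 u (@measurable_cst _ _ _ _ setT (1 : R)) (fun=> introT andP (conj ler01 (lexx 1))).
by under eq_fun do rewrite mulr1.
Qed.

(** * The limit law *)

Section limit.
Context (R : realType) d (Omega : measurableType d) (P : probability Omega R)
  (X : R -> Omega -> R) (alpha rho k : R).
Hypothesis alpha_gt1 : 1 < alpha.
Hypothesis SX : stable_levy_process P alpha X.
Hypothesis ae_hit : forall y, 0 < y -> {ae P, forall w, hit (X ^~ w) y !=set0}.
Hypothesis k_gt0 : 0 < k.
Hypothesis rho01 : 0 < rho < 1.
Hypothesis FsupP : forall e, 0 < e -> \forall y \near 0^'+,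
  `|Fsup P X y - k * y `^ (alpha * rho)| <= e * (k * y `^ (alpha * rho)).
Let a0 : 0 < alpha := alpha_gt0 alpha_gt1.
Let rho0 : 0 < rho. Proof. by case/andP: rho01. Qed.
Let rho1 : rho < 1. Proof. by case/andP: rho01. Qed.
Let p := 1 - rho.
Let p0 : 0 < p. Proof. by rewrite subr_gt0. Qed.
Let p01 : 0 < p < 1. Proof. by rewrite p0 gtrBl. Qed.
Let beta := alpha * rho.
Let beta0 : 0 < beta. Proof. by rewrite mulr_gt0. Qed.
Let Y := tau X 1.
Let mY : measurable_fun setT Y := measurable_tau SX 1.
Let Y0 w : 0 <= Y w. Proof. exact: tau_ge0. Qed.

(** For x = h = 1 the overshoot moment is 2^beta - 1, and it is the mean of a variable at most 1. *)
Lemma exponent_le1 : beta <= 1.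
Proof.
have mK : measurable_fun setT (ovs X 1) := measurable_ovs SX 1.
have K0 w : 0 <= ovs X 1 w := ovs_ge0 SX 1 w.
have := overshoot_moment alpha_gt1 SX ae_hit k_gt0 rho01 FsupP ltr01 ler01.
rewrite powR1 => E.
have le1 : Ex P (fun w => powp beta (1 - ovs X 1 w)) <= 1.
  rewrite -[leRHS](Ex_cst P); apply: le_Ex; [by apply: bmf_powp => //; exact: ltW|exact: bmf_cst|].
  have one : 1 `^ beta = 1 :> R by rewrite powR1.
  move=> w; rewrite -[leRHS]one; apply: ler_powRl; [exact: ltW|exact: max0_ge0|].
  by rewrite ge_max ler01 gerBl K0.
have h : (2 : R) `^ beta <= 2 `^ 1 by rewrite powRr1//; rewrite -/beta in E; move: E le1; rewrite (_ : 1 + 1 = 2 :> R)//; lra.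
rewrite leNgt; apply/negP => b1; move: h; apply/negP; rewrite -ltNge.
have r0 : 0 < beta - 1 by rewrite subr_gt0.
have := gt0_ltr_powR r0 (_ : 1 \in Num.nneg) (_ : (2 : R) \in Num.nneg) (_ : 1 < 2).
rewrite powR1 !nnegrE => /(_ ler01 (ler0n _ 2) (ltr1n _ 2)) => h.
have -> : beta = 1 + (beta - 1) by ring.
by rewrite powRDp// powRr1// ltr_pMr.
Qed.

Let trunc_mean u : bmf (fun w => Y w * (Y w < u)%R%:R) := bmf_truncated u mY Y0.

(** E[Y; Y < s] is [m1 s] - s P(Y >= s), of order (k / p - k) s^p = (k rho / p) s^p. The upper tail
    bound concerns a strict inequality, so it is taken at (1 - e2) s. *)
Lemma truncated_mean_lower e : 0 < e < 1 -> exists2 A, 0 < A & forall s, A <= s ->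
  (1 - e) * (k * rho / p) * s `^ p <= Ex P (fun w => Y w * (Y w < s)%R%:R).
Proof.
case/andP=> e0 e1.
(* The losses in the two terms add up to k e2 (1 / p + 4) s^p, which must not exceed e k (rho / p)
   s^p. *)
pose e2 := Num.min (2^-1) (e * (rho / p) / (p^-1 + 4)).
have q0 : 0 < p^-1 + 4 by rewrite addr_gt0// invr_gt0.
have e20 : 0 < e2 by rewrite lt_min invr_gt0 ltr0n/= divr_gt0// mulr_gt0// divr_gt0.
have e2h : e2 <= 2^-1 by rewrite ge_min lexx.
have e2q : e2 * (p^-1 + 4) <= e * (rho / p) by rewrite -ler_pdivlMr// ge_min lexx orbT.
have e21 : 0 < e2 < 1 by rewrite e20/=; lra.
have [A1 A10 H1] := m1_bounds alpha_gt1 SX ae_hit k_gt0 rho01 FsupP e21.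
have [s0 s00 H2] := tail_bounds alpha_gt1 SX ae_hit FsupP e20.
exists (Num.max A1 (s0 / (1 - e2))); first by rewrite lt_max A10.
move=> s; rewrite ge_max => /andP[sA sB].
have s_gt0 : 0 < s by exact: lt_le_trans sA.
have f0 : 0 < 1 - e2 by lra.
have /andP[h1 _] := H1 s sA.
pose s' := (1 - e2) * s; have s'0 : 0 < s' by rewrite mulr_gt0.
have [h2 _] := H2 s' ltac:(by rewrite /s' mulrC -ler_pdivrMr).
have mle : measurable [set w | s <= Y w] by apply: measurable_le_set.
have mlt : measurable [set w | s' < Y w] by apply: measurable_lt_set.
have tail : fine (P [set w | s <= Y w]) <= (1 + 4 * e2) * k * s `^ (- rho).
  apply: (@le_trans _ _ (fine (P [set w | s' < Y w]))).
    apply: fine_probability_mono => // w /=; apply: lt_le_trans.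
    by rewrite /s' gtr_pMl//; lra.
  apply: le_trans h2 _; rewrite /s' powRM ?(ltW f0) ?(ltW s_gt0)//.
  rewrite mulrA ler_pM2r ?powR_gt0// mulrAC ler_pM2r//.
  have : (1 - e2) `^ (- rho) <= (1 - e2)^-1.
    rewrite powRN lef_pV2 ?posrE ?powR_gt0//; apply: ger1_powR; last exact: ltW.
    by rewrite f0/=; lra.
  have : (1 + e2) * (1 - e2)^-1 <= 1 + 4 * e2.
    rewrite ler_pdivrMr//; have := mulr_ge0 (ltW e20) (ltW e20); have : e2 * e2 <= e2 * 2^-1 by rewrite ler_pM2l.
    by rewrite (_ : (1 + 4 * e2) * (1 - e2) = 1 + 3 * e2 - 4 * (e2 * e2)); [lra|ring].
  by move=> h3 h4; apply: le_trans h3; rewrite ler_pM2l// addr_gt0.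
have E : Ex P (fun w => Y w * (Y w < s)%R%:R) = m1 P X s - s * fine (P [set w | s <= Y w]).
  rewrite -Ex_indic// -(ExZ P s (bmf_indic R mle)) /m1 -ExB//; last exact: (bmfZ _ (bmf_indic R mle)).
    apply: Ex_eq => w; rewrite indicE -/Y; have [h|h] := leP s (Y w).
      by rewrite mem_set//= mulr0 mulr1 subrr.
    rewrite memNset ?mulr1 ?mulr0 ?subr0//=.
    by apply/negP; rewrite -ltNge.
  split; first by apply: measurable_minr.
  by exists s => w; rewrite ger0_norm ?ge_min ?lexx ?orbT// le_min Y0 ltW.
rewrite E; have sE : s * s `^ (- rho) = s `^ p.
  by rewrite -[X in X * _]powRr1 ?(ltW s_gt0)// -powRDp.
have h3 : s * fine (P [set w | s <= Y w]) <= (1 + 4 * e2) * k * s `^ p.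
  by rewrite -sE mulrCA ler_pM2l.
have z0 : 0 < s `^ p by rewrite powR_gt0.
apply: (@le_trans _ _ ((1 - e2) * (k / p) * s `^ p - (1 + 4 * e2) * k * s `^ p)); last by lra.
rewrite -mulrBl ler_pM2r//.
have -> : (1 - e2) * (k / p) - (1 + 4 * e2) * k = k * (rho / p - e2 * (p^-1 + 4)).
  by rewrite (_ : rho / p = p^-1 - 1); [ring|rewrite /p; field; rewrite -/p gt_eqF].
have -> : (1 - e) * (k * rho / p) = k * (rho / p - e * (rho / p)) by ring.
by rewrite ler_pM2l// lerD2l lerN2.
Qed.

Section level.
Variable x : R.
Hypothesis x0 : 0 < x.
Let T := tau X x.
Let K := ovs X x.
Let mT : measurable_fun setT T := measurable_tau SX x.
Let mK : measurable_fun setT K := measurable_ovs SX x.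
Let T0 w : 0 <= T w. Proof. exact: tau_ge0. Qed.
Let K0 w : 0 <= K w. Proof. exact: (ovs_ge0 SX). Qed.
Let beta01 : 0 < beta <= 1. Proof. by rewrite beta0 exponent_le1. Qed.

Lemma truncated_mean_scale u : 0 < u ->
  Ex P (fun w => T w * (T w < u)%R%:R) =
  x `^ alpha * Ex P (fun w => Y w * (Y w < u * x `^ (- alpha))%R%:R).
Proof.
move=> u0; have xa0 : 0 < x `^ alpha by rewrite powR_gt0.
pose phi n (s : R) := Num.max s 0 * Num.min 1 (Num.max (n.+1%:R * (u - s)) 0).
have cphi n : continuous (phi n).
  move=> s; apply: cvgM; first exact: (@continuous_max0 R s).
  apply: (@continuous_minr R R (fun=> 1) (fun s => Num.max (n.+1%:R * (u - s)) 0)); first exact: cst_continuous.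
  apply: continuous_maxr; last exact: cst_continuous.
  move=> z; apply: cvgM; first exact: cvg_cst.
  by apply: cvgB; [exact: cvg_cst|exact: cvg_id].
have bphi n s : `|phi n s| <= u.
  rewrite /phi; have m0 := max0_ge0 s.
  have r0 : 0 <= Num.min 1 (Num.max (n.+1%:R * (u - s)) 0) by rewrite le_min ler01 max0_ge0.
  rewrite ger0_norm ?mulr_ge0//; have [us|su] := leP u s.
    have -> : Num.max (n.+1%:R * (u - s)) 0 = 0.
      by apply: max0_le0; rewrite mulr_ge0_le0// subr_le0.
    by rewrite min_r// mulr0 ltW.
  apply: (@le_trans _ _ (Num.max s 0)); last by rewrite ge_max !ltW.
  by rewrite ler_piMr// ge_min lexx.
have lim (Z : Omega -> R) : measurable_fun setT Z -> (forall w, 0 <= Z w) ->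
    Ex P (fun w => phi n (Z w)) @[n --> \oo] --> Ex P (fun w => Z w * (Z w < u)%R%:R).
  move=> mZ Z0.
  apply: (@Ex_cvg _ _ _ _ _ _ u).
  - by move=> n; apply: (measurableT_comp _ mZ); exact: continuous_measurable_fun.
  - by have [] := bmf_truncated u mZ Z0.
  - by move=> n w; exact: bphi.
  - apply: aeW => w /=; rewrite /phi max_l//.
    have [us|su] := ltP (Z w) u; last first.
      rewrite mulr0; apply: cvg_near_cst; apply: nearW => n.
      by rewrite max0_le0 ?min_r ?mulr0// mulr_ge0_le0// subr_le0.
    have d0 : 0 < u - Z w by rewrite subr_gt0.
    apply: cvg_near_cst; near=> n.
    have h : n.+1%:R^-1 < u - Z w by near: n; exact: (near_infty_natSinv_lt (PosNum d0)).
    have h1 : 1 <= n.+1%:R * (u - Z w) by rewrite -ler_pdivrMl// mulr1 ltW.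
    by rewrite min_l// le_max h1.
have l1 := lim T mT T0.
have mxY : measurable_fun setT (fun w => x `^ alpha * Y w) by exact: measurable_funM.
have xY0 w : 0 <= x `^ alpha * Y w by rewrite mulr_ge0// ltW.
have l2 := lim (fun w => x `^ alpha * Y w) mxY xY0.
have E n : Ex P (fun w => phi n (T w)) = Ex P (fun w => phi n (x `^ alpha * Y w)).
  exact: (scale_tau alpha_gt1 SX ae_hit x0 (cphi n) (bphi n)).
have {}l2 := cvg_ext l2 (fun n => esym (E n)) erefl.
have -> := cvg_unique _ l1 l2 => //.
rewrite -(ExZ P _ (trunc_mean _)); apply: Ex_eq => w.
rewrite mulrA; congr (_ * (_ : bool)%:R).
by rewrite powRN ltr_pdivlMr// mulrC.
Unshelve. all: by end_near. Qed.

Let B := pi * p / sin (pi * p).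
Let B0 : 0 < B.
Proof.
apply: divr_gt0; first by rewrite mulr_gt0// pi_gt0.
by apply: sin_gt0_pi; rewrite mulr_gt0 ?pi_gt0//= gtr_pMr ?pi_gt0//; case/andP: p01.
Qed.
Let b := beta * x `^ (beta - 1).
Let b0 : 0 < b. Proof. by rewrite mulr_gt0// powR_gt0. Qed.
Let c := alpha / (k / p * x).
Let c0 : 0 < c. Proof. by rewrite divr_gt0// mulr_gt0// divr_gt0. Qed.
(** The product rho C is the constant of the theorem: the factor 1 / rho comes from the fractional
    integration, and differentiating the power rho removes it. *)
Let C := c / (rho * B) / b.
Let C0 : 0 < C. Proof. by rewrite /C divr_gt0// divr_gt0// mulr_gt0. Qed.
Let Hmom := overshoot_moment_quotient alpha_gt1 SX ae_hit k_gt0 rho01 FsupP x0.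
Let Hjoint u (u0 : 0 < u) := joint_quotient alpha_gt1 SX ae_hit k_gt0 rho01 FsupP x0 u0.

Let Pr h := Ex P (fun w => (K w <= h)%R%:R).
Let Theta v := C * Vfun P X rho x v.

(** The moment of [overshoot_moment] is positive and at most h^beta P(K <= h). *)
Lemma overshoot_prob_gt0 h : 0 < h -> 0 < Pr h.
Proof.
move=> h0; have := overshoot_moment alpha_gt1 SX ae_hit k_gt0 rho01 FsupP x0 (ltW h0).
rewrite -/beta -/K => E.
have pos : 0 < (x + h) `^ beta - x `^ beta.
  by rewrite subr_gt0 gt0_ltr_powR// ?nnegrE ?ltW// ?addr_gt0// ltrDl.
have bp : bmf (fun w => powp beta (h - K w)) by apply: bmf_powp => //; exact: ltW.
have : Ex P (fun w => powp beta (h - K w)) <= Ex P (fun w => h `^ beta * (K w <= h)%R%:R).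
  apply: le_Ex => //; first exact: (bmfZ _ (bmf_indicator_le h mK)).
  move=> w; have [Kh|Kh] := leP (K w) h.
    rewrite mulr1; apply: ler_powRl; [exact: ltW|exact: max0_ge0|].
    by rewrite ge_max gerBl K0 ltW.
  by rewrite mulr0 powp_le0 ?gt_eqF// subr_le0 ltW.
rewrite E (ExZ P _ (bmf_indicator_le h mK)) => le.
by have := lt_le_trans pos le; rewrite pmulr_rgt0// powR_gt0.
Qed.

Lemma conditional_ramp_limit v :
  Ex P (fun w => Num.max (v - T w) 0 * (K w <= h)%R%:R) / Pr h @[h --> 0^'+] --> Theta v.
Proof.
have bZ : bmf (fun w => Num.max (v - T w) 0).
  split; first by apply: measurable_maxr => //; exact: measurable_funB.
  by exists (Num.max v 0) => w; exact: norm_max0_sub_le.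
have Hq := time_quotient mT T0 mK K0 beta0 rho01 B0 (betaI_reflection p01) (ltW c0) Hmom Hjoint (v := v).
have := conditional_limit mK K0 beta01 bZ (fun w => max0_ge0 _) (lt0r_neq0 b0) Hmom Hq.
by rewrite -/B /Theta /C => h; apply: cvg_ext h _ _ => //; rewrite -/b mulrAC.
Qed.

Lemma conditional_power_limit u : 0 < u ->
  Ex P (fun w => powp p (u - T w) * (K w <= h)%R%:R) / Pr h @[h --> 0^'+] -->
  c / b * Ex P (fun w => T w * (T w < u)%R%:R).
Proof.
move=> u0; have bZ : bmf (fun w => powp p (u - T w)) by apply: bmf_powp => //; exact: ltW.
have Hq : h^-1 * Ex P (fun w => powp p (u - T w) * powp beta (h - K w)) @[h --> 0^'+] -->
    c * Ex P (fun w => T w * (T w < u)%R%:R).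
  have E h : h^-1 * Ex P (fun w => powp (alpha * rho) (h - ovs X x w) * powp (1 - rho) (u - tau X x w)) =
      h^-1 * Ex P (fun w => powp p (u - T w) * powp beta (h - K w)).
    by congr (_ * _); apply: Ex_eq => w; rewrite mulrC.
  exact: (cvg_ext (Hjoint u0) E erefl).
have := conditional_limit mK K0 beta01 bZ (fun w => powp_ge0 _ _) (lt0r_neq0 b0) Hmom Hq.
by move=> h; apply: cvg_ext h _ _ => //; rewrite -/b mulrAC.
Qed.

(** For v >= u one has (v - u) (u - T)_+^p <= u^p (v - T)_+ pointwise; under the conditioning the
    mean of (u - T)_+^p tends to a multiple of E[T; T < u], which is at least (1 - e) u^p for large
    u. *)
Lemma Theta_tight e : 0 < e -> exists2 u, 0 < u & forall v, u <= v -> (1 - e) * (v - u) <= Theta v.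
Proof.
move=> e0; have [e1|e1] := leP 1 e.
  exists 1 => // v v1; apply: (@le_trans _ _ 0); last by rewrite mulr_ge0 ?(ltW C0)// Vfun_ge0.
  by rewrite mulr_le0_ge0 ?subr_le0 ?subr_ge0.
have [A A0 H] := truncated_mean_lower (introT andP (conj e0 e1)).
have xa0 : 0 < x `^ alpha by rewrite powR_gt0.
pose u := A * x `^ alpha; have u0 : 0 < u by rewrite mulr_gt0.
have uA : u * x `^ (- alpha) = A by rewrite powRN mulfK// gt_eqF.
have up0 : 0 < u `^ p by rewrite powR_gt0.
have W : (1 - e) * u `^ p <= c / b * Ex P (fun w => T w * (T w < u)%R%:R).
  rewrite truncated_mean_scale// uA.
  apply: (@le_trans _ _ (c / b * (x `^ alpha * ((1 - e) * (k * rho / p) * A `^ p)))); last first.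
    apply: ler_wpM2l; first by rewrite divr_ge0// ltW.
    by apply: ler_wpM2l; [exact: ltW|exact: H].
  (* The constants cancel exactly: c / b is p x^(-beta) / (k rho), and alpha - beta = alpha p. *)
  rewrite le_eqVlt; apply/orP; left; apply/eqP.
  rewrite /u powRM ?(ltW A0) ?(ltW xa0)// -powRrM.
  have xE : x `^ alpha = x `^ (alpha * p) * x `^ beta by rewrite -powRDp// /beta /p; congr (_ `^ _); ring.
  have xB : x `^ beta = x * x `^ (beta - 1).
    by rewrite -[X in X * _]powRr1 ?(ltW x0)// -powRDp//; congr (_ `^ _); ring.
  rewrite xE xB /c /b /beta; have z0 : x `^ (alpha * rho - 1) != 0 by rewrite gt_eqF// powR_gt0.
  by move: z0; set z := x `^ _ => z0; field; rewrite z0 !gt_eqF.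
exists u => // v uv.
have le : (v - u) * (c / b * Ex P (fun w => T w * (T w < u)%R%:R)) <= u `^ p * Theta v.
  have l1 : (v - u) * (Ex P (fun w => powp p (u - T w) * (K w <= h)%R%:R) / Pr h) @[h --> 0^'+] -->
      (v - u) * (c / b * Ex P (fun w => T w * (T w < u)%R%:R)).
    by apply: cvgM; [exact: cvg_cst|exact: conditional_power_limit].
  have l2 : u `^ p * (Ex P (fun w => Num.max (v - T w) 0 * (K w <= h)%R%:R) / Pr h) @[h --> 0^'+] -->
      u `^ p * Theta v.
    by apply: cvgM; [exact: cvg_cst|exact: conditional_ramp_limit].
  apply: (ler_cvg_to l1 l2); near=> h.
  have h0 : 0 < h by near: h; exact: nbhs_right_gt.
  have P0 := overshoot_prob_gt0 h0.
  rewrite !mulrA ler_pM2r ?invr_gt0//.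
  have bi := bmf_indicator_le h mK.
  have b1 : bmf (fun w => powp p (u - T w) * (K w <= h)%R%:R).
    by apply: bmfM bi; apply: bmf_powp => //; exact: ltW.
  have b2 : bmf (fun w => Num.max (v - T w) 0 * (K w <= h)%R%:R).
    apply: bmfM bi; split; first by apply: measurable_maxr => //; exact: measurable_funB.
    by exists (Num.max v 0) => w; exact: norm_max0_sub_le.
  rewrite -(ExZ P _ b1) -(ExZ P _ b2); apply: le_Ex; [exact: bmfZ|exact: bmfZ|] => w.
  rewrite !mulrA ler_wpM2r//.
  have [Tu|uT] := ltP (T w) u; last first.
    by rewrite powp_le0 ?gt_eqF// ?subr_le0// mulr0 mulr_ge0 ?powR_ge0 ?max0_ge0.
  rewrite mulrC; apply: ler_pM; rewrite ?powp_ge0 ?subr_ge0//.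
    apply: ler_powRl; [exact: ltW|exact: max0_ge0|].
    by rewrite ge_max gerBl T0 ltW.
  by rewrite le_max lerD2l lerN2 (ltW Tu).
have : (v - u) * ((1 - e) * u `^ p) <= u `^ p * Theta v.
  by apply: le_trans le; rewrite ler_wpM2l// subr_ge0.
by rewrite mulrA mulrC ler_pM2l// mulrC.
Unshelve. all: by end_near. Qed.

Lemma conditional_limit_law (nu : R -> probability R R) :
  (forall h A, 0 < h -> measurable A -> nu h A =
    (fine (P (T @^-1` A `&` [set w | K w <= h])) / fine (P [set w | K w <= h]))%:E) ->
  exists mu0 : probability R R, cvg_in_law (0^'+) nu mu0 /\
    forall t, 0 < t -> mu0 `]-oo, t]%classic =
      ((sin (pi * rho) / (k * pi * rho) * x `^ (- beta))%:E *
       \int[P]_w (T w * ((T w < t)%R%:R * (t - T w) `^ (rho - 1)))%:E)%E.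
Proof.
move=> nuE.
have mKh h : measurable [set w | K w <= h] by apply: measurable_le_set.
have PrE h : Pr h = fine (P [set w | K w <= h]).
  by rewrite -Ex_indic//; apply: Ex_eq => w; rewrite indicE mem_setE.
have ThetaP v : Ex (nu h) (fun y => Num.max (v - Num.max y 0) 0) @[h --> 0^'+] --> Theta v.
  have E : \forall h \near 0^'+, Ex P (fun w => Num.max (v - T w) 0 * (K w <= h)%R%:R) / Pr h =
      Ex (nu h) (fun y => Num.max (v - Num.max y 0) 0); last first.
    exact: (cvg_ext_near _ (conditional_ramp_limit (v := v)) E erefl).
  near=> h; have h0 : 0 < h by near: h; exact: nbhs_right_gt.
  rewrite (conditional_ramp v mT T0 (mKh h) (fun A => nuE h A h0)) PrE; congr (_ / _).
  by apply: Ex_eq => w; rewrite indicE mem_setE mulrC.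
have nu_neg h t : 0 < h -> t < 0 -> nu h `]-oo, t]%classic = 0%E.
  move=> h0 t0; rewrite nuE// (_ : T @^-1` _ = set0) ?set0I ?measure0 ?mul0r//.
  by apply/seteqP; split => w //=; rewrite in_itv /= leNgt (lt_le_trans t0 (T0 w)).
have [mu0 mu0E] := limit_law ThetaP Theta_tight.
have HM : has_slope (Vfun P X rho x) (right_slope Theta) C.
  move=> t dl dl0; have := right_slope_bounds ThetaP t dl0.
  by rewrite /Theta -!mulrBr.
(* The atoms of the limit law at the level x suffice, other levels being reached from it by
   scaling. *)
have [bb Hb] := atom_enumeration mu0.
have {}Hb s : (forall j, s != bb j) -> forall e, 0 < e ->
    exists2 dl, 0 < dl & right_slope Theta (s + dl) - right_slope Theta (s - dl) <= e.
  by move=> h e e0; have [dl dl0] := Hb s h e e0; rewrite !mu0E /=; exists dl.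
have van t e (t0 : 0 <= t) (e0 : 0 < e) :=
  diff2_Vfun_vanish alpha_gt1 SX ae_hit rho01 x0 C0 HM Hb t0 e0.
exists mu0; split.
  apply: cvg_in_law_cdf => t; rewrite mu0E /=.
  have [t0|t0] := ltP t 0.
    rewrite (right_slope_neg ThetaP)//; apply: cvg_near_cst; near=> h.
    by rewrite nu_neg.
  apply: (cdf_cvg_at ThetaP nu_neg) => e e0.
  have [dl dl0 h] := van t (e / C) t0 (divr_gt0 e0 C0).
  exists dl => //; move: h; rewrite /diff2 /Theta -(ler_pM2l C0) => h.
  apply: le_trans (le_trans h _); first by rewrite !mulrDr mulrN mulrCA lexx.
  by rewrite mulrA [C * _]mulrC divfK ?gt_eqF.
move=> t t0; rewrite mu0E.
have -> := density_formula mT T0 rho01 C0 HM (fun e e0 => van t e (ltW t0) e0).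
rewrite -EFinM; congr EFin.
have sE : sin (pi * p) = sin (pi * rho).
  by rewrite /p mulrBr mulr1 sinB sinpi cospi mul0r sub0r mulN1r opprK.
have s0 : sin (pi * rho) != 0.
  rewrite gt_eqF//; apply: sin_gt0_pi; rewrite mulr_gt0 ?pi_gt0//=.
  by rewrite gtr_pMr ?pi_gt0.
have xB : x `^ (- beta) = (x * x `^ (beta - 1))^-1.
  rewrite powRN -[X in (X * _)^-1]powRr1 ?(ltW x0)// -powRDp//; congr (_ `^ _)^-1; ring.
rewrite xB /C /c /b /B sE /beta.
have z0 : x `^ (alpha * rho - 1) != 0 by rewrite gt_eqF// powR_gt0.
have pi0 : pi != 0 :> R by rewrite gt_eqF// pi_gt0.
move: (right_slope Theta t) (x `^ (alpha * rho - 1)) (sin (pi * rho)) z0 s0 => m z s z0 s0.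
move: (pi : R) pi0 => q q0.
by field; rewrite ?z0 ?s0 ?q0 ?gt_eqF.
Unshelve. all: by end_near. Qed.

End level.
End limit.

(** * Almost everywhere equal events under a complete measure *)

Section complete_measure.
Context d (T : measurableType d) (R : realType) (mu : {measure set T -> \bar R}).
Hypothesis complete_mu : measure_is_complete mu.

Lemma measurable_ae_iff (A B : set T) : measurable A ->
  {ae mu, forall w, A w <-> B w} -> measurable B.
Proof.
move=> mA [N [mN N0 AB]].
have mDA : measurable (A `\` B).
  by apply: complete_mu; exists N; split => // w [Aw Bw]; apply: AB => /=; tauto.
have mDB : measurable (B `\` A).
  by apply: complete_mu; exists N; split => // w [Bw Aw]; apply: AB => /=; tauto.
rewrite (_ : B = (A `\` (A `\` B)) `|` (B `\` A)).
  by apply: measurableU => //; exact: measurableD.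
by apply/seteqP; split => w /=; have := EM (A w); have := EM (B w); tauto.
Qed.

Lemma measure_ae_iff (A B : set T) : measurable A ->
  {ae mu, forall w, A w <-> B w} -> mu B = mu A.
Proof.
move=> mA AB; have mB := measurable_ae_iff mA AB.
rewrite -[B in LHS]setIT -[A in RHS]setIT -!integral_indic//; apply: ae_eq_integral => //.
- by apply/measurable_EFinP; exact: measurable_indic.
- by apply/measurable_EFinP; exact: measurable_indic.
- by apply: filterS AB => w h _; congr EFin; rewrite !indicE; congr (_%:R); congr nat_of_bool; apply/idP/idP; rewrite !inE => ?; apply/h.
Qed.

Lemma ae_integral_complete (f g : T -> R) : measurable_fun setT f ->
  {ae mu, forall w, f w = g w} -> (\int[mu]_w (g w)%:E = \int[mu]_w (f w)%:E)%E.
Proof.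
move=> mf fg; apply: ae_eq_integral => //.
- apply/measurable_EFinP => _ Y mY; rewrite setTI.
  apply: (@measurable_ae_iff (f @^-1` Y)); first by rewrite -[_ @^-1` _]setTI; exact: mf.
  by apply: filterS fg => w /= ->.
- exact/measurable_EFinP.
- by apply: filterS fg => w -> _.
Qed.

End complete_measure.

Transparent ovs tau.
Lemma ovs_hit (R : realType) d (Omega : measurableType d) (X : R -> Omega -> R) y w :
  hit (X ^~ w) y !=set0 -> ovs X y w = X (tau X y w) w - y.
Proof. by move=> h; rewrite /ovs Fp_hit. Qed.
Opaque ovs tau.

(** * From the asymptotics of the supremum to the theorem *)

Section assembly.
Context (R : realType) d (Omega : measurableType d) (P : probability Omega R)
  (X : R -> Omega -> R) (alpha rho k : R).
Hypothesis alpha_gt1 : 1 < alpha.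
Hypothesis k_gt0 : 0 < k.
Hypothesis rho_gt0 : 0 < rho.
Hypothesis equivP : (fun y : R => fine (P [set w | running_sup X 1 w <= y])) ~_ (0^'+)
  (fun y : R => k * y `^ (alpha * rho)).

Lemma Fsup_near e : 0 < e -> \forall y \near 0^'+,
  `|Fsup P X y - k * y `^ (alpha * rho)| <= e * (k * y `^ (alpha * rho)).
Proof.
move=> e0; have /eqaddoP/(_ e e0) := equivP.
by apply: filterS => y; rewrite /= [X in _ <= _ * X]ger0_norm// mulr_ge0 ?powR_ge0// ltW.
Qed.

Lemma Fsup_cvg0 : Fsup P X y @[y --> 0^'+] --> (0 : R).
Proof.
have b0 : 0 < alpha * rho by rewrite mulr_gt0// (lt_trans ltr01).
apply/cvgrPdist_le => e e0.
have d0 : 0 < e / (2 * k) by rewrite divr_gt0// mulr_gt0.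
have z0 : 0 < (e / (2 * k)) `^ (alpha * rho)^-1 by rewrite powR_gt0.
near=> y.
have y0 : 0 < y by near: y; exact: nbhs_right_gt.
have h : `|Fsup P X y - k * y `^ (alpha * rho)| <= 1 * (k * y `^ (alpha * rho)).
  by near: y; exact: Fsup_near.
have h2 : y `^ (alpha * rho) <= e / (2 * k).
  have -> : e / (2 * k) = ((e / (2 * k)) `^ (alpha * rho)^-1) `^ (alpha * rho).
    by rewrite -powRrM mulVf ?gt_eqF// powRr1// ltW.
  apply: ge0_ler_powR; rewrite ?nnegrE ?powR_ge0 ?(ltW y0) ?(ltW b0)//.
  by near: y; exact: nbhs_right_le.
rewrite sub0r normrN.
have : k * y `^ (alpha * rho) <= e / 2.
  have -> : e / 2 = k * (e / (2 * k)) by field; rewrite gt_eqF.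
  by rewrite ler_pM2l.
move: h; rewrite mul1r => h.
have kz : 0 <= k * y `^ (alpha * rho) by rewrite mulr_ge0 ?powR_ge0// ltW.
have := ler_normD (Fsup P X y - k * y `^ (alpha * rho)) (k * y `^ (alpha * rho)).
rewrite subrK (ger0_norm kz) => h3 h4; lra.
Unshelve. all: by end_near. Qed.

End assembly.

Theorem theorem12 (R : realType) (d : measure_display) (Omega : measurableType d)
    (P : probability Omega R) (alpha rho k : R) (X : R -> Omega -> R)
    (complete_P : measure_is_complete P)
    (alpha_gt1 : 1 < alpha) (alpha_le2 : alpha <= 2)
    (stable_X : stable_levy_process P alpha X)
    (rhoE : rho = fine (P [set w | 0 <= X 1 w]))
    (k_gt0 : 0 < k)
    (kP : (fun x : R => fine (P [set w | running_sup X 1 w <= x])) ~_ (0^'+)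
          (fun x : R => k * x `^ (alpha * rho)))
    (x : R) (x_gt0 : 0 < x) :
  exists (muh : R -> probability R R) (mu0 : probability R R),
    [/\ forall h : R, 0 < h -> forall A : set R, measurable A ->
          muh h A = (cond_prob P [set w | (EFin @` A) (first_passage X x w)]
                               [set w | (overshoot X x w <= h%:E)%E])%:E,
        cvg_in_law (0^'+) muh mu0 &
        forall t : R, 0 < t ->
          mu0 `]-oo, t]%classic =
          ((sin (pi * rho) / (k * pi * rho) * x `^ (- (alpha * rho)))%:E *
           'E_P[(fun w => fine (first_passage X x w)
                         * \1_[set w' | (first_passage X x w' <= t%:E)%E] w
                         / (t - fine (first_passage X x w)) `^ (1 - rho))%R])%E].
Proof.
have rho01 : 0 < rho < 1 by rewrite rhoE; exact: positivity_parameter alpha_gt1 stable_X.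
have rho0 : 0 < rho by case/andP: rho01.
have FsupP := @Fsup_near _ _ _ P X alpha rho k k_gt0 kP.
have ae_hit := ae_hit_of_Fsup alpha_gt1 stable_X (Fsup_cvg0 alpha_gt1 k_gt0 rho0 kP).
pose T := tau X x; pose K := ovs X x.
have mT : measurable_fun setT T by exact: (measurable_tau stable_X).
have mK : measurable_fun setT K by exact: (measurable_ovs stable_X).
have fpE : {ae P, forall w, first_passage X x w = (T w)%:E}.
  exact: first_passageE alpha_gt1 stable_X ae_hit x x_gt0.
have ovE : {ae P, forall w, overshoot X x w = (K w)%:E}.
  apply: filterS2 (ae_hit x x_gt0) fpE => w hw fw.
  by rewrite /overshoot fw; congr EFin; exact/esym/ovs_hit.
have mKh h : measurable [set w | K w <= h] by apply: measurable_le_set.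
have Pr_gt0 h : 0 < h -> 0 < fine (P [set w | K w <= h]).
  move=> h0; have := overshoot_prob_gt0 alpha_gt1 stable_X ae_hit k_gt0 rho01 FsupP x_gt0 h0.
  congr (_ < _); rewrite /= -Ex_indic//; apply: Ex_eq => w; rewrite indicE mem_setE//.
(* For h <= 0 any law will do; the one for h = 1 is taken. *)
have /choice[nu nuE] h : exists m : probability R R, 0 < h -> forall A, measurable A ->
    m A = (fine (P (T @^-1` A `&` [set w | K w <= h])) / fine (P [set w | K w <= h]))%:E.
  have [h0|h0] := ltP 0 h; first by have [m mE] := conditional_law mT (mKh h) (Pr_gt0 h h0); exists m.
  by have [m _] := conditional_law mT (mKh 1) (Pr_gt0 1 ltr01); exists m.
have [mu0 [cv mu0E]] := conditional_limit_law alpha_gt1 stable_X ae_hit k_gt0 rho01 FsupP x_gt0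
  (fun h A h0 mA => nuE h h0 A mA).
exists nu, mu0; split=> //.
  move=> h h0 A mA; rewrite nuE// /cond_prob; congr ((_ / _)%:E); congr fine.
    symmetry; apply: measure_ae_iff => //.
      by apply: measurableI => //; rewrite -[_ @^-1` _]setTI; exact: mT.
    apply: filterS2 fpE ovE => w fw ow /=; rewrite fw ow lee_fin.
    split=> [[Aw Kw]|[[a Aa [aT]] Kw]]; first by split=> //; exists (T w).
    by split=> //; rewrite /= -aT.
  symmetry; apply: measure_ae_iff => //.
  by apply: filterS ovE => w ow /=; rewrite ow lee_fin.
move=> t t0; rewrite mu0E// expectation.unlock; congr (_ * _)%E; symmetry.
apply: ae_integral_complete => //.
  apply: measurable_funM => //; apply: measurable_funM.
    have mlt : measurable [set w | T w < t] by apply: measurable_lt_set.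
    rewrite (_ : (fun _ => _) = \1_[set w | T w < t]); first exact: measurable_indic.
    by apply/funext => w; rewrite indicE mem_setE.
  by apply: (measurableT_comp (measurable_powR _)); exact: measurable_funB.
apply: filterS fpE => w fw; rewrite indicE.
have -> : (w \in [set w' | (first_passage X x w' <= t%:E)%E]) = (T w <= t).
  by apply/idP/idP; rewrite inE /= fw lee_fin.
rewrite fw /= -mulrA -/T; congr (_ * _).
have [Tt|tT|Tt] := ltgtP (T w) t.
- by rewrite !mul1r -powRN opprB.
- by rewrite !mul0r.
(* On T = t the formula divides by 0 to the power 1 - rho, that is by 0, and so takes the value 0,
   as the strict indicator does. *)
have p0 : 1 - rho != 0 by rewrite subr_eq0 eq_sym lt_eqF//; case/andP: rho01.
by rewrite Tt subrr (powR0 p0) invr0 mulr0 mul0r.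
Qed.
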